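(* (a) Let $\mathcal{C}$ be a finite sequence of $n$ points in the open unit disk $\mathbb{D}$. Then every maximal function for $\mathcal{C}$ is a finite Blaschke product of degree $m=n+1$. (b) If $\mathcal{C}$ is a Blaschke sequence in $\mathbb{D}$, then every maximal function for $\mathcal{C}$ is an indestructible Blaschke product which has a finite angular derivative at almost every point of $\partial\mathbb{D}$.
   Context: $\mathbb{D}=\{z\in\mathbb{C}:|z|<1\}$. A conformal pseudometric $\lambda(z)\,|dz|$ on a domain $G\subseteq\mathbb{C}$ is given by a continuous function $\lambda:G\to[0,+\infty)$, $\lambda\not\equiv0$ (its density); it is regular if $\lambda$ is of class $C^2$ on $\{z\in G:\lambda(z)>0\}$. For a continuous function $u$ the generalized lower Laplacian is $\Delta u(z)=\liminf_{r\to0}\frac{4}{r^2}\left(\frac1{2\pi}\int_0^{2\pi}u(z+re^{it})\,dt-u(z)\right)$, which is the usual Laplacian if $u$ is $C^2$. The (Gauss) curvature is $\kappa_\lambda(z)=-\Delta(\log\lambda)(z)/\lambda(z)^2$ at points with $\lambda(z)>0$. An SK-metric on $G$ is a conformal pseudometric with $\kappa_\lambda(z)\le-4$ for all $z\in G$ with $\lambda(z)>0$. Constant curvature $-4$ means regular with $\kappa_\lambda(z)=-4$ wherever $\lambda(z)>0$. A sequence $\mathcal{C}$ of points in $G$ (repetitions allowed), in which the distinct points $z_j$ occur with multiplicity $m_j\in\mathbb{N}$, is the zero set of $\lambda(z)\,|dz|$ if $\lambda>0$ off $\mathcal{C}$ and for every $j$ the limit $\lim_{z\to z_j}\lambda(z)/|z-z_j|^{m_j}$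 exists and is $\neq0$. Let $\Phi_{\mathcal{C}}$ be the family of all densities $\lambda$ of SK-metrics on $\mathbb{D}$ with $\limsup_{z\to z_j}\lambda(z)/|z-z_j|^{m_j}<+\infty$ for all $j$. If $\Phi_{\mathcal{C}}\neq\emptyset$, then $\lambda_{max}(z):=\sup_{\lambda\in\Phi_{\mathcal{C}}}\lambda(z)$, $z\in\mathbb{D}$, induces a regular conformal pseudometric of constant curvature $-4$ on $\mathbb{D}$ with zero set $\mathcal{C}$, called the maximal conformal pseudometric on $\mathbb{D}$ with constant curvature $-4$ and zero set $\mathcal{C}$. A maximal function for $\mathcal{C}$ is an analytic function $F:\mathbb{D}\to\mathbb{D}$ with $\lambda_{max}(z)=\frac{|F'(z)|}{1-|F(z)|^2}$ for all $z\in\mathbb{D}$. A Blaschke sequence is a sequence $(a_j)$ in $\mathbb{D}$ with $\sum_j(1-|a_j|)<\infty$. A Blaschke product is a function $B(z)=\eta\prod_{j}\frac{\overline{a_j}}{|a_j|}\frac{a_j-z}{1-\overline{a_j}z}$ with $|\eta|=1$ and $(a_j)$ a finite or infinite Blaschke sequence (the factor is $z$ when $a_j=0$); if there are exactly $m$ factors, $B$ is a finite Blaschke product of degree $m$. It is indestructible if $T\circ B$ is a Blaschke product for every unit disk automorphism $T$. An analytic $f:\mathbb{D}\to\mathbb{D}$ has a finite angular derivative at $\zeta\in\partial\mathbb{D}$ if for some $\omega\in\partial\mathbb{D}$ the nontangential limit of $\frac{f(z)-\omega}{z-\zeta}$ as $z\to\zeta$ exists and is finite. *)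

(* Defs.v *)
From HB Require Import structures.
From mathcomp Require Import all_boot all_order all_algebra.
From mathcomp Require Import all_classical all_reals all_analysis.
From mathcomp Require Import complex.

Set Implicit Arguments.
Unset Strict Implicit.
Unset Printing Implicit Defensive.

Import Order.TTheory GRing.Theory Num.Theory numFieldNormedType.Exports.

Local Open Scope classical_set_scope.
Local Open Scope ring_scope.

(* [R[i]] packed as a [numClosedFieldType]: on the bare type [R[i]] the topology
   and normed-module structure that a [numFieldType] carries over itself are not
   found by unification. Consequently [derivable F z 1] and [F^`() z], for
   [F : cplx R -> cplx R], are complex differentiability and the complex
   derivative. *)
Definition cplx (R : realType) : numClosedFieldType := R[i].

(* The modulus as an element of [R]; the norm [`|z|] lives in [R[i]]. *)
Definition cmod (R : realType) (z : cplx R) : R :=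
  ComplexField.Normc.normc (z : R[i]).

Definition expi (R : realType) (t : R) : cplx R := (cos t +i* sin t)%C.

Definition unit_disk (R : realType) : set (cplx R) := [set z | cmod z < 1].

Definition analytic_on (R : realType) (G : set (cplx R))
    (F : cplx R -> cplx R) : Prop :=
  forall z, G z -> derivable F z 1.

Section Metrics.
Variable R : realType.
Local Notation C := (cplx R).

Definition circle_mean (u : C -> R) (z : C) (r : R) : R :=
  (2 * pi)^-1 *
  \int[@lebesgue_measure R]_(t in `[0, 2 * pi]) u (z + ((r%:C)%C : C) * expi t).

Definition lower_laplacian (u : C -> R) (z : C) : \bar R :=
  limf_einf (fun r : R => (4 / r ^+ 2 * (circle_mean u z r - u z))%:E) 0^'+.

(* Only meaningful where [lam z > 0]. *)
Definition curvature (lam : C -> R) (z : C) : \bar R :=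
  (- lower_laplacian (fun w => ln (lam w)) z * ((lam z ^+ 2)^-1)%:E)%E.

Definition conformal_pseudometric (G : set C) (lam : C -> R) : Prop :=
  [/\ {within G, continuous lam},
      forall z, G z -> 0 <= lam z &
      exists2 z, G z & lam z != 0].

Definition SK_metric (G : set C) (lam : C -> R) : Prop :=
  conformal_pseudometric G lam /\
  forall z, G z -> 0 < lam z -> (curvature lam z <= (- 4)%:E)%E.

End Metrics.

Inductive point_seq (R : realType) : Type :=
| FinSeq of seq (cplx R)
| InfSeq of (nat -> cplx R).

Section PointSequences.
Variable R : realType.
Local Notation C := (cplx R).

Definition has_index (s : point_seq R) : pred nat :=
  match s with FinSeq c => fun j => (j < size c)%N | InfSeq _ => xpredT end.

Definition seq_point (s : point_seq R) (j : nat) : C :=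
  match s with FinSeq c => nth 0 c j | InfSeq a => a j end.

Definition occurs_with_multiplicity (s : point_seq R) (z : C) (m : nat) : Prop :=
  (0 < m)%N /\ ([set j | has_index s j /\ seq_point s j = z] #= `I_m)%card.

Definition Blaschke_sequence (s : point_seq R) : Prop :=
  (forall j, has_index s j -> unit_disk (seq_point s j)) /\
  (\sum_(0 <= j <oo | has_index s j) (1 - cmod (seq_point s j))%:E < +oo)%E.

Definition SK_family (s : point_seq R) : set (C -> R) :=
  [set lam | SK_metric (@unit_disk R) lam /\
     forall z m, occurs_with_multiplicity s z m ->
       (limf_esup (fun w => (lam w / cmod (w - z) ^+ m)%:E) z^' < +oo)%E].

(* The supremum is taken in [\bar R]: it is [-oo] if the family is empty, so the
   equation in [maximal_function] forces the family to be nonempty. *)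
Definition lambda_max (s : point_seq R) (z : C) : \bar R :=
  ereal_sup [set (lam z)%:E | lam in SK_family s].

Definition maximal_function (s : point_seq R) (F : C -> C) : Prop :=
  [/\ analytic_on (@unit_disk R) F,
      forall z, unit_disk z -> unit_disk (F z) &
      forall z, unit_disk z ->
        lambda_max s z = (cmod (F^`()%classic z) / (1 - cmod (F z) ^+ 2))%:E].

End PointSequences.

Section BlaschkeProducts.
Variable R : realType.
Local Notation C := (cplx R).

Definition Blaschke_factor (a z : C) : C :=
  if a == 0 then z
  else a^* / `|a| * ((a - z) / (1 - a^* * z)).

Definition finite_Blaschke_product (m : nat) (B : C -> C) : Prop :=
  exists (eta : C) (a : m.-tuple C),
    [/\ cmod eta = 1,
        forall i, unit_disk (tnth a i) &
        forall z, unit_disk z ->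
          B z = eta * \prod_(i < m) Blaschke_factor (tnth a i) z].

Definition Blaschke_product (B : C -> C) : Prop :=
  exists (eta : C) (s : point_seq R),
    [/\ cmod eta = 1,
        Blaschke_sequence s &
        forall z, unit_disk z ->
          (fun k : nat => eta *
             \prod_(0 <= j < k | has_index s j) Blaschke_factor (seq_point s j) z)
          @ \oo --> B z].

Definition disk_automorphism (T : C -> C) : Prop :=
  exists S : C -> C,
    [/\ analytic_on (@unit_disk R) T, analytic_on (@unit_disk R) S,
        forall z, unit_disk z -> unit_disk (T z),
        forall z, unit_disk z -> unit_disk (S z) &
        forall z, unit_disk z -> S (T z) = z /\ T (S z) = z].

Definition indestructible_Blaschke_product (B : C -> C) : Prop :=
  Blaschke_product B /\
  forall T, disk_automorphism T -> Blaschke_product (T \o B).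

Definition Stolz_region (K : R) (zeta : C) : set C :=
  [set z | unit_disk z /\ cmod (z - zeta) < K * (1 - cmod z)].

Definition nontangential_limit (g : C -> C) (zeta l : C) : Prop :=
  forall K : R, 1 < K -> g z @[z --> within (Stolz_region K zeta) (nbhs zeta)] --> l.

Definition finite_angular_derivative (F : C -> C) (zeta : C) : Prop :=
  exists omega l : C,
    cmod omega = 1 /\
    nontangential_limit (fun z => (F z - omega) / (z - zeta)) zeta l.

(* Almost everywhere on the unit circle with respect to arc length. *)
Definition ae_unit_circle (P : C -> Prop) : Prop :=
  {ae @lebesgue_measure R, forall t, `[0, 2 * pi]%classic t -> P (expi t)}.

End BlaschkeProducts.

(* Main.v *)
(* Let [B] be the Blaschke product of the critical set. Since [|B| / (1 - |z|^2)] is an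
   SK-metric with the prescribed zeros, maximality gives
     [|B| (1 - |F|^2) <= (1 - |z|^2) |F'|]    (1)
   and a sub-mean-value argument shows that [F'] vanishes on the critical set.

   (b) Splitting off the zeros of [F] one by one, [F = B_N S_N] with [S_N] zero-free on
   discs exhausting [D]. Writing [S_N = Q^2] and applying Schwarz-Pick to [B_N Q] and [Q],
   (1) yields [|B| (1 + s) <= 2 sqrt s + o(1)] for [s = |S_N|]; as the mean of [ln |B|]
   over [|z| = r] tends to [0], [|S_N 0|] tends to [1] and [F] is a Blaschke product.
   The hypothesis (1) is invariant under disk automorphisms, hence [F] is
   indestructible. Also by (1), the means of [ln ((1 - |F|^2) / (1 - |z|^2))] are bounded,
   so by Fatou its liminf along almost every radius is finite, and the Julia-Caratheodory
   theorem provides the angular derivative.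

   (a) With [d = prod (z - c_j)] and [q = prod (1 - conj c_j z)], the bounded function
   [F d q / F'] is real almost everywhere on the circle after division by
   [z^(n+1)], hence is a polynomial; so [F] has finitely many zeros. A second
   function of this kind, bounded together with its inverse, forces the degree of [F]
   to be [n + 1]. *)
Require Import Defs.
From HB Require Import structures.
From mathcomp Require Import all_boot all_order all_algebra.
From mathcomp Require Import all_classical all_reals all_analysis.
From mathcomp Require Import complex.
From mathcomp Require Import ring lra.
Set Implicit Arguments.
Unset Strict Implicit.
Unset Printing Implicit Defensive.
Import Order.TTheory GRing.Theory Num.Theory numFieldNormedType.Exports.
Local Open Scope classical_set_scope.
Local Open Scope ring_scope.

(** * The modulus with real values, coordinates and topology of the complex plane *)

Section ComplexBasics.
Variable R : realType.
Local Notation C := (cplx R).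
Local Notation Re := (@complex.Re R).
Local Notation Im := (@complex.Im R).
Implicit Types z w a b : C.

(** In (1) the modulus [|B|] is the infimum of the moduli of the finite partial products, with the
    tail of the Blaschke sum as explicit error. The arguments then work with a finite product and a
    holomorphic quotient that is zero-free on the disc in question, so that the averaged logarithms
    are harmonic; the radii avoid the finitely many moduli at which a logarithm is singular.

    The square root [S = Q^2] produces the factor [2 sqrt s / (1 + s)], which is below 1 unless
    [s = 1]. In the mean, [ln s] gives [ln |S_N 0|] and [ln (1 + s)] at least [ln (1 + |S_N 0|)], so
    [(1 + |S_N 0|)^2 <= 4 |S_N 0| (1 + o(1))], which forces [|S_N 0|] towards 1.

    The boundary values in (a) come from the angular derivatives: at almost every [zeta], [F] tends
    to some [omega] and [F'] to [omega * conj zeta / k] with [|omega| = 1] and [k > 0], so [F / F']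
    tends to [k * zeta]. Since [d q] is a real multiple of [zeta^n] on the circle, this is the
    origin of the exponent [n + 1]. *)

Definition rc (x : R) : C := (x%:C)%C.

Lemma normC_cmod z : `|z| = rc (cmod z). Proof. by []. Qed.

Lemma cmod_ge0 z : 0 <= cmod z.
Proof. by case: z => a b; exact: sqrtr_ge0. Qed.

Lemma cmod_sqr z : cmod z ^+ 2 = Re z ^+ 2 + Im z ^+ 2.
Proof. by case: z => a b; rewrite sqr_sqrtr ?addr_ge0 ?sqr_ge0. Qed.

Lemma cmodM z w : cmod (z * w) = cmod z * cmod w.
Proof. exact: ComplexField.Normc.normcM. Qed.

Lemma cmodD z w : cmod (z + w) <= cmod z + cmod w.
Proof. exact: le_normcD. Qed.

Lemma cmodN z : cmod (- z) = cmod z.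
Proof. exact: normcN. Qed.

Lemma cmod0 : cmod (0 : C) = 0.
Proof. exact: ComplexField.Normc.normc0. Qed.

Lemma cmod1 : cmod (1 : C) = 1.
Proof. exact: ComplexField.Normc.normc1. Qed.

Lemma cmodV z : cmod z^-1 = (cmod z)^-1.
Proof. exact: ComplexField.Normc.normcV. Qed.

Lemma cmod_div z w : cmod (z / w) = cmod z / cmod w.
Proof. by rewrite cmodM cmodV. Qed.

Lemma cmodX z n : cmod (z ^+ n) = cmod z ^+ n.
Proof. by elim: n => [|n IH]; rewrite ?cmod1 // !exprS cmodM IH. Qed.

Lemma cmod_eq0 z : (cmod z == 0) = (z == 0).
Proof.
apply/eqP/eqP => [|->]; last exact: cmod0.
exact: ComplexField.Normc.eq0_normc.
Qed.

Lemma cmod_gt0 z : (0 < cmod z) = (z != 0).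
Proof. by rewrite lt_neqAle cmod_ge0 andbT eq_sym cmod_eq0. Qed.

Lemma cmodB z w : cmod (z - w) = cmod (w - z).
Proof. by rewrite -cmodN opprB. Qed.

Lemma cmod_leB z w : cmod (z - w) <= cmod z + cmod w.
Proof. by rewrite (le_trans (cmodD _ _))// cmodN. Qed.

Lemma cmod_subl z w : cmod z - cmod w <= cmod (z - w).
Proof. by rewrite lerBlDr -{1}(subrK w z) cmodD. Qed.

Lemma cmod_trian a z w : cmod (z - w) <= cmod (z - a) + cmod (a - w).
Proof. by have := cmodD (z - a) (a - w); rewrite addrA subrK. Qed.

Lemma cmod_rc x : cmod (rc x) = `|x|.
Proof. by rewrite /cmod /rc /= expr0n addr0 sqrtr_sqr. Qed.

Lemma cmod_rc_ge0 x : 0 <= x -> cmod (rc x) = x.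
Proof. by move=> x0; rewrite cmod_rc ger0_norm. Qed.

Lemma cmod_conj z : cmod z^* = cmod z.
Proof. by case: z => a b; rewrite /cmod /= sqrrN. Qed.

Lemma conj_pair (a b : R) : (((a +i* b)%C : C)^*) = ((a -i* b)%C : C).
Proof. by []. Qed.

Lemma mul_conj z : z * z^* = rc (cmod z ^+ 2).
Proof.
case: z => a b; rewrite cmod_sqr /rc; apply/eqP; rewrite eq_complex /=.
by apply/andP; split; apply/eqP; rewrite /=; ring.
Qed.

Lemma Re_le z : Re z <= cmod z.
Proof.
have [r0|r0] := leP 0 (Re z); last by rewrite (le_trans (ltW r0)) ?cmod_ge0.
by rewrite -(@ler_pXn2r _ 2) ?nnegrE ?cmod_ge0// cmod_sqr lerDl sqr_ge0.
Qed.

Lemma normRe_le z : `|Re z| <= cmod z.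
Proof.
rewrite ler_norml Re_le andbT lerNl.
by have := Re_le (- z); rewrite cmodN; case: z.
Qed.

Lemma normIm_le z : `|Im z| <= cmod z.
Proof.
rewrite -(@ler_pXn2r _ 2) ?nnegrE ?cmod_ge0//.
by rewrite cmod_sqr real_normK ?num_real// lerDr sqr_ge0.
Qed.

Lemma cmod_le_ReIm z : cmod z <= `|Re z| + `|Im z|.
Proof.
rewrite -(@ler_pXn2r _ 2) ?nnegrE ?cmod_ge0 ?addr_ge0//.
rewrite cmod_sqr sqrrD !real_normK ?num_real//.
by rewrite -addrA lerD2l lerDr mulrn_wge0// mulr_ge0.
Qed.

Lemma rcM x y : rc (x * y) = rc x * rc y.
Proof. by rewrite /rc rmorphM. Qed.
Lemma rcD x y : rc (x + y) = rc x + rc y.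
Proof. by rewrite /rc rmorphD. Qed.
Lemma rcB x y : rc (x - y) = rc x - rc y.
Proof. by rewrite /rc rmorphB. Qed.
Lemma rcN x : rc (- x) = - rc x.
Proof. by rewrite /rc rmorphN. Qed.
Lemma rcV x : rc (x^-1) = (rc x)^-1.
Proof. by rewrite /rc fmorphV. Qed.
Lemma rcX x n : rc (x ^+ n) = rc x ^+ n.
Proof. by rewrite /rc rmorphXn. Qed.
Lemma rc_nat n : rc n%:R = n%:R.
Proof. by rewrite /rc rmorph_nat. Qed.
Lemma conj_rc x : (rc x)^* = rc x.
Proof. by rewrite /rc; apply/eqP; rewrite eq_complex /= oppr0 !eqxx. Qed.
Lemma conjM z w : (z * w)^* = z^* * w^*.
Proof. by rewrite rmorphM. Qed.
Lemma rc1 : rc 1 = 1. Proof. by []. Qed.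
Lemma rc_eq0 x : (rc x == 0) = (x == 0).
Proof. by rewrite -cmod_eq0 cmod_rc normr_eq0. Qed.

Lemma cReD z w : Re (z + w) = Re z + Re w. Proof. by case: z; case: w. Qed.
Lemma cImD z w : Im (z + w) = Im z + Im w. Proof. by case: z; case: w. Qed.
Lemma cReN z : Re (- z) = - Re z. Proof. by case: z. Qed.
Lemma cImN z : Im (- z) = - Im z. Proof. by case: z. Qed.
Lemma cReB z w : Re (z - w) = Re z - Re w. Proof. by rewrite cReD cReN. Qed.
Lemma cImB z w : Im (z - w) = Im z - Im w. Proof. by rewrite cImD cImN. Qed.
Lemma cReM z w : Re (z * w) = Re z * Re w - Im z * Im w.
Proof. by case: z; case: w. Qed.
Lemma cImM z w : Im (z * w) = Re z * Im w + Im z * Re w.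
Proof. by case: z => a b; case: w => c d /=. Qed.
Lemma Im_rc x : Im (rc x) = 0. Proof. by []. Qed.
Lemma complexP z w : Re z = Re w -> Im z = Im w -> z = w.
Proof. by case: z => a b; case: w => c d /= -> ->. Qed.

Lemma cmod_sum (I : Type) (r : seq I) (P : pred I) (F : I -> C) :
  cmod (\sum_(i <- r | P i) F i) <= \sum_(i <- r | P i) cmod (F i).
Proof.
elim/big_ind2: _ => [|x1 x2 y1 y2 h1 h2|//]; first by rewrite cmod0.
by rewrite (le_trans (cmodD _ _))// lerD.
Qed.

Lemma cmod_prod (I : Type) (r : seq I) (P : pred I) (F : I -> C) :
  cmod (\prod_(i <- r | P i) F i) = \prod_(i <- r | P i) cmod (F i).
Proof. by elim/big_ind2: _ => [|x1 x2 y1 y2 <- <-|//]; rewrite ?cmod1 ?cmodM. Qed.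

Lemma cmod_expi (t : R) : cmod (expi t) = 1.
Proof. by rewrite /cmod /= cos2Dsin2 sqrtr1. Qed.

Lemma expi_neq0 (t : R) : expi t != 0 :> C.
Proof. by rewrite -cmod_gt0 cmod_expi. Qed.

Lemma expiD (s t : R) : expi (s + t) = expi s * expi t :> C.
Proof. by apply: complexP; rewrite /= ?cosD ?sinD//; ring. Qed.

Lemma expi0 : expi 0 = 1 :> C.
Proof. by apply: complexP; rewrite /= ?cos0 ?sin0. Qed.

Lemma expi_inv (t : R) : expi (- t) = (expi t)^-1 :> C.
Proof.
apply: (mulfI (expi_neq0 t)).
by rewrite -expiD subrr expi0 divff ?expi_neq0.
Qed.

Lemma expi_2pi (t : R) : expi (t + 2 * pi) = expi t :> C.
Proof.
by rewrite mulrC mulr_natr; apply: complexP; rewrite /= ?cosD2pi ?sinD2pi.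
Qed.

(** Balls of [cplx R] have radii in [R[i]], where positivity forces the imaginary part to vanish;
    neighbourhoods can therefore be described by real radii and [cmod], as is done throughout. *)
Lemma nbhsCP z (A : set C) :
  nbhs z A <-> exists2 e : R, 0 < e & forall w, cmod (w - z) < e -> A w.
Proof.
split=> [/nbhs_ballP[e /= e0 zeA]|[e e0 zeA]].
  case: e e0 zeA => a b; rewrite ltcE /= => /andP[/eqP -> a0] zeA.
  exists a => // w wa; apply: zeA; rewrite -ball_normE /= normC_cmod.
  by rewrite cmodB /rc ltcR.
apply/nbhs_ballP; exists (rc e); first by rewrite /= /rc ltcR.
move=> w; rewrite -ball_normE /= normC_cmod /rc ltcR => wz.
by apply: zeA; rewrite cmodB.
Qed.

Lemma cvgCP (T : Type) (F : set_system T) (FF : Filter F) (f : T -> C) l :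
  f @ F --> l <-> forall e : R, 0 < e -> \forall x \near F, cmod (f x - l) < e.
Proof.
split=> [fl e e0|fl A /nbhsCP[e e0 eA]].
  by apply: (fl [set w | cmod (w - l) < e]); apply/nbhsCP; exists e.
by near=> x; apply: eA; near: x; exact: fl.
Unshelve. all: by end_near. Qed.

Lemma cvgCRP (f : C -> R) z (l : R) :
  f @ z --> l <-> forall e : R, 0 < e ->
    exists2 d : R, 0 < d & forall w, cmod (w - z) < d -> `|f w - l| < e.
Proof.
split=> [fl e e0|fl].
  move: (fl [set y | `|y - l| < e]) => /(_ _)/nbhsCP; apply.
  by apply/nbhs_ballP; exists e => //= y; rewrite -ball_normE /= distrC.
move=> A /nbhs_ballP[e /= e0 eA]; have [d d0 dP] := fl e e0.
apply/nbhsCP; exists d => // w /dP wd; apply: eA.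
by rewrite -ball_normE /= distrC.
Qed.

Lemma cvgCCP (f : C -> C) z (l : C) :
  f @ z --> l <-> forall e : R, 0 < e ->
    exists2 d : R, 0 < d & forall w, cmod (w - z) < d -> cmod (f w - l) < e.
Proof.
split=> [fl e e0|fl].
  move: (fl [set y | cmod (y - l) < e]) => /(_ _)/nbhsCP; apply.
  by apply/nbhsCP; exists e.
move=> A /nbhsCP[e /= e0 eA]; have [d d0 dP] := fl e e0.
by apply/nbhsCP; exists d => // w /dP wd; apply: eA.
Qed.

Lemma cont_cmod : continuous (@cmod R).
Proof.
move=> z; apply/cvgCRP => e e0; exists e => // w wz.
rewrite (le_lt_trans _ wz)// ler_norml; apply/andP; split.
  by rewrite lerNl opprB cmodB cmod_subl.
by rewrite cmod_subl.
Qed.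

Lemma cont_Re : continuous (Re : C -> R).
Proof.
move=> z; apply/cvgCRP => e e0; exists e => // w wz.
by rewrite (le_lt_trans _ wz)// -cReB (le_trans (normRe_le _)).
Qed.

Lemma cont_Im : continuous (Im : C -> R).
Proof.
move=> z; apply/cvgCRP => e e0; exists e => // w wz.
by rewrite (le_lt_trans _ wz)// -cImB (le_trans (normIm_le _)).
Qed.

Lemma cvg_ReIm (T : Type) (F : set_system T) (FF : Filter F) (f : T -> C) (l : C) :
  (fun x => Re (f x)) @ F --> Re l -> (fun x => Im (f x)) @ F --> Im l ->
  f @ F --> l.
Proof.
move=> fr fi; apply/cvgCP => e e0.
have e2 : 0 < e / 2 by rewrite divr_gt0.
move/cvgrPdist_lt: fr => /(_ _ e2) fr; move/cvgrPdist_lt: fi => /(_ _ e2) fi.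
near=> x; rewrite (le_lt_trans (cmod_le_ReIm _))// cReB cImB (splitr e) ltrD//;
  by rewrite distrC; near: x.
Unshelve. all: by end_near. Qed.

Lemma cont_expi : continuous (@expi R).
Proof.
move=> t; apply: cvg_ReIm => /=; [exact: continuous_cos | exact: continuous_sin].
Qed.

Lemma cont_conj : continuous (fun z => z^*).
Proof.
move=> z; apply/cvgCCP => e e0; exists e => // w.
by rewrite -rmorphB cmod_conj.
Qed.

End ComplexBasics.

(** * Complex differentiability *)

Section Derivative.
Variable R : realType.
Local Notation C := (cplx R).
Implicit Types (f g : C -> C) (z w a d : C).

Definition hasD f z d := derivable f z 1 /\ f^`()%classic z = d.

(** Differentiability as a first-order error bound. Free of quotients, it holds at [h = 0] as well,
    which suits the chain rule, Goursat's lemma and power series. *)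
Lemma hasDP f z d : hasD f z d <-> forall e : R, 0 < e ->
  exists2 r : R, 0 < r &
    forall h, cmod h < r -> cmod (f (z + h) - f z - d * h) <= e * cmod h.
Proof.
have cvgE d' : (fun h : C => h^-1 *: (f (h *: (1 : C) + z) - f z)) @ 0^' --> d' <->
    forall e : R, 0 < e -> exists2 r : R, 0 < r &
    forall h, cmod h < r -> cmod (f (z + h) - f z - d' * h) <= e * cmod h.
  split=> [fd e e0|fd].
    move: (fd [set y | cmod (y - d') < e]) => /(_ _)/nbhsCP[].
      by apply/nbhsCP; exists e.
    move=> r r0 rP; exists r => // h hr.
    have [->|h0] := eqVneq h 0.
      by rewrite addr0 mulr0 subrr subr0 cmod0 mulr0.
    have := rP h; rewrite subr0 => /(_ hr h0) /= /ltW.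
    rewrite scaler1 /GRing.scale /= [h + z]addrC => hle.
    have -> : f (z + h) - f z - d' * h = (h^-1 * (f (z + h) - f z) - d') * h.
      by field.
    by rewrite cmodM ler_wpM2r ?cmod_ge0.
  move=> A /nbhsCP[e e0 eA].
  have [r r0 rP] := fd (e / 2) (divr_gt0 e0 (ltr0n _ 2)).
  apply/nbhsCP; exists r => // h hr h0; apply: eA.
  rewrite subr0 in hr; rewrite scaler1 /GRing.scale /= [h + z]addrC.
  have -> : h^-1 * (f (z + h) - f z) - d' = (f (z + h) - f z - d' * h) / h.
    by field.
  rewrite cmod_div ltr_pdivrMr ?cmod_gt0//.
  rewrite (le_lt_trans (rP h hr))// ltr_pM2r ?cmod_gt0//.
  by rewrite gtr_pMr// invf_lt1// ltr1n.
split=> [[df <-]|/cvgE fd].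
  by apply/cvgE; rewrite derive1E; exact: df.
split; first by apply/cvg_ex; exists d.
by rewrite derive1E; apply/cvg_lim.
Qed.

Lemma derivable_hasD f z : derivable f z 1 -> hasD f z (f^`()%classic z).
Proof. by []. Qed.

Lemma hasD_is f z d : hasD f z d -> is_derive z 1 f d.
Proof. by case=> df <-; rewrite derive1E; exact/derivableP. Qed.

Lemma is_hasD f z d : is_derive z 1 f d -> hasD f z d.
Proof. by case=> df fd; split; [exact: df | rewrite derive1E; exact: fd]. Qed.

Lemma hasD_uniq f z d d' : hasD f z d -> hasD f z d' -> d = d'.
Proof. by move=> [_ <-] [_ <-]. Qed.

Lemma hasD_near f g z d (r : R) : 0 < r ->
  (forall w, cmod (w - z) < r -> f w = g w) -> hasD f z d -> hasD g z d.
Proof.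
move=> r0 fg /hasDP fd; apply/hasDP => e e0; have [s s0 sP] := fd e e0.
exists (Num.min r s); first by rewrite lt_min r0.
move=> h; rewrite lt_min => /andP[hr hs]; rewrite -!fg ?sP//.
  by rewrite subrr cmod0.
by rewrite addrC addKr.
Qed.

Lemma hasD_ext f g z d : f =1 g -> hasD f z d -> hasD g z d.
Proof. by move=> fg; apply: (@hasD_near _ _ _ _ 1) => // w _. Qed.

Lemma hasD_eq f z d d' : hasD f z d -> d = d' -> hasD f z d'.
Proof. by move=> ? <-. Qed.

Lemma hasD_cst a z : hasD (fun=> a) z 0.
Proof. by apply: is_hasD; exact: is_derive_cst. Qed.

Lemma hasD_id z : hasD (fun w => w) z 1.
Proof. by apply: is_hasD; exact: is_derive_id. Qed.

Lemma hasD_add f g z d d' : hasD f z d -> hasD g z d' ->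
  hasD (fun w => f w + g w) z (d + d').
Proof.
by move=> /hasD_is fd /hasD_is gd; apply: is_hasD; exact: is_deriveD.
Qed.

Lemma hasD_opp f z d : hasD f z d -> hasD (fun w => - f w) z (- d).
Proof. by move=> /hasD_is fd; apply: is_hasD; exact: is_deriveN. Qed.

Lemma hasD_sub f g z d d' : hasD f z d -> hasD g z d' ->
  hasD (fun w => f w - g w) z (d - d').
Proof. by move=> fd gd; exact: hasD_add fd (hasD_opp gd). Qed.

Lemma hasD_mul f g z d d' : hasD f z d -> hasD g z d' ->
  hasD (fun w => f w * g w) z (d * g z + f z * d').
Proof.
move=> /hasD_is fd /hasD_is gd; apply: is_hasD.
have H := is_deriveM fd gd; apply: is_derive_eq H _.
by rewrite /GRing.scale /= addrC [g z * d]mulrC.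
Qed.

Lemma hasD_cmul f a z d : hasD f z d -> hasD (fun w => a * f w) z (a * d).
Proof.
move=> fd; apply: hasD_eq (hasD_mul (hasD_cst a z) fd) _.
by rewrite mul0r add0r.
Qed.

Lemma hasD_inv f z d : hasD f z d -> f z != 0 ->
  hasD (fun w => (f w)^-1) z (- d / f z ^+ 2).
Proof.
move=> [df <-] f0; split; first exact: derivableV.
rewrite !derive1E deriveV// /GRing.scale /=.
by rewrite !mulNr mulrC.
Qed.

Lemma hasD_div f g z d d' : hasD f z d -> hasD g z d' -> g z != 0 ->
  hasD (fun w => f w / g w) z ((d * g z - f z * d') / g z ^+ 2).
Proof.
move=> fd gd g0; apply: hasD_eq (hasD_mul fd (hasD_inv gd g0)) _.
by field.
Qed.

Lemma hasD_exp f z d n : hasD f z d ->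
  hasD (fun w => f w ^+ n) z (n%:R * f z ^+ n.-1 * d).
Proof.
move=> fd; elim: n => [|n IH].
  by apply: hasD_eq (hasD_cst _ _) _; rewrite !mul0r.
apply: (@hasD_ext (fun w => f w * f w ^+ n)) => [w|]; first by rewrite exprS.
apply: hasD_eq (hasD_mul fd IH) _; rewrite /=.
case: n {IH} => [|n]; first by rewrite expr0 !mul0r mulr0 addr0 mulr1 !mul1r.
by rewrite /= exprS -!natr1; ring.
Qed.

Lemma hasD_comp f g z d d' : hasD g z d -> hasD f (g z) d' ->
  hasD (fun w => f (g w)) z (d' * d).
Proof.
move=> /hasDP gd /hasDP fd; apply/hasDP => e e0.
have K0 : 0 < cmod d + 1 by rewrite ltr_wpDl ?cmod_ge0.
have L0 : 0 < cmod d' + 1 by rewrite ltr_wpDl ?cmod_ge0.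
have e1 : 0 < e / 2 / (cmod d + 1) by rewrite !divr_gt0.
have [s s0 sP] := fd _ e1.
(* The bound 1 makes the increment [k] of [g] at most [(cmod d + 1) * cmod h]; the other bound pays
   for the error that is multiplied by [d']. *)
have e2 : 0 < Num.min 1 (e / 2 / (cmod d' + 1)) by rewrite lt_min ltr01 !divr_gt0.
have [r r0 rP] := gd _ e2.
exists (Num.min r (s / (cmod d + 1))); first by rewrite lt_min r0 divr_gt0.
move=> h; rewrite lt_min => /andP[hr hs].
have e20 : 0 <= e / 2 by rewrite divr_ge0// ltW.
have {}rP := rP h hr; set k := g (z + h) - g z.
have rP1 : cmod (k - d * h) <= cmod h.
  by rewrite (le_trans rP)// ler_piMl ?cmod_ge0// ge_min lexx.
have rP2 : cmod (k - d * h) <= e / 2 / (cmod d' + 1) * cmod h.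
  by rewrite (le_trans rP)// ler_wpM2r ?cmod_ge0// ge_min lexx orbT.
have kle : cmod k <= (cmod d + 1) * cmod h.
  rewrite -[k](subrK (d * h)) (le_trans (cmodD _ _))// cmodM.
  by rewrite mulrDl mul1r addrC lerD2l.
have ks : cmod k < s.
  by rewrite (le_lt_trans kle)// mulrC -ltr_pdivlMr.
have -> : g (z + h) = g z + k by rewrite /k [RHS]addrC subrK.
have -> : f (g z + k) - f (g z) - d' * d * h =
    (f (g z + k) - f (g z) - d' * k) + d' * (k - d * h) by ring.
rewrite (le_trans (cmodD _ _))// (splitr e) mulrDl lerD//.
  rewrite (le_trans (sP k ks))// -mulrA ler_wpM2l//.
  by rewrite mulrC ler_pdivrMr// mulrC.
rewrite cmodM (le_trans (ler_wpM2l (cmod_ge0 _) rP2))//.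
rewrite -[X in _ * X <= _]mulrA mulrCA ler_wpM2l// mulrA ler_piMl ?cmod_ge0//.
by rewrite mulrC ler_pdivrMl// mulr1 lerDl.
Qed.

Lemma hasD_cvg f z d : hasD f z d -> {for z, continuous f}.
Proof.
move=> [df _]; apply: differentiable_continuous.
exact/derivable1_diffP.
Qed.

Lemma contC_cst a z : {for z, continuous (fun=> a : C)}.
Proof. exact: hasD_cvg (hasD_cst a z). Qed.

Lemma contC_D f g z : {for z, continuous f} -> {for z, continuous g} ->
  {for z, continuous (fun w => f w + g w)}.
Proof. by move=> fc gc; exact: cvgD fc gc. Qed.

Lemma contC_B f g z : {for z, continuous f} -> {for z, continuous g} ->
  {for z, continuous (fun w => f w - g w)}.
Proof. by move=> fc gc; exact: cvgB fc gc. Qed.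

Lemma contC_M f g z : {for z, continuous f} -> {for z, continuous g} ->
  {for z, continuous (fun w => f w * g w)}.
Proof. by move=> fc gc; exact: cvgM fc gc. Qed.

Lemma contC_V f z : f z != 0 -> {for z, continuous f} ->
  {for z, continuous (fun w => (f w)^-1)}.
Proof. by move=> f0 fc; exact: (cvg_comp _ _ fc (inv_continuous f0)). Qed.

Lemma contC_comp f g z : {for z, continuous f} -> {for f z, continuous g} ->
  {for z, continuous (fun w => g (f w))}.
Proof. by move=> fc gc; exact: (@continuous_comp _ _ _ f g z fc gc). Qed.

Lemma contC_cmod f z : {for z, continuous f} ->
  {for z, continuous (fun w => cmod (f w))}.
Proof.
by move=> fc; exact: (@continuous_comp _ _ _ f (@cmod R) z fc (@cont_cmod R _)).
Qed.

End Derivative.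

(** * Real and complex integrals over segments *)

Section Integrals.
Variable R : realType.
Local Notation C := (cplx R).
Local Notation Re := (@complex.Re R).
Local Notation Im := (@complex.Im R).
Local Notation mu := (@lebesgue_measure R).
Local Notation rc := (@rc R).
Implicit Types (a b m : R).

Definition rint (a b : R) (g : R -> R) : R := \int[mu]_(t in `[a, b]) g t.

(** Two-sided continuity at every point of the segment, end points included, so that the pointwise
    rules for continuity apply without a subspace topology. *)
Definition ctsR a b (g : R -> R) :=
  forall t : R, a <= t -> t <= b -> {for t, continuous g}.
Definition ctsC a b (g : R -> C) :=
  forall t : R, a <= t -> t <= b -> {for t, continuous g}.

Lemma ctsR_integrable a b (g : R -> R) : ctsR a b g ->
  mu.-integrable `[a, b] (EFin \o g).
Proof.
move=> gc; apply: continuous_compact_integrable; first exact: segment_compact.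
apply: continuous_subspace_itv => t; rewrite in_itv /= => /andP[]; exact: gc.
Qed.

Lemma ctsRT a b (f : R -> R) : continuous f -> ctsR a b f.
Proof. by move=> fc t _ _; exact: fc. Qed.
Lemma ctsR_N a b (f : R -> R) : ctsR a b f -> ctsR a b (fun t => - f t).
Proof. by move=> fc t ta tb; apply: cvgN; exact: fc. Qed.
Lemma ctsR_M a b (f g : R -> R) : ctsR a b f -> ctsR a b g ->
  ctsR a b (fun t => f t * g t).
Proof. by move=> fc gc t ta tb; apply: cvgM; [exact: fc|exact: gc]. Qed.
Lemma ctsR_cst a b (k : R) : ctsR a b (fun=> k).
Proof. by move=> t _ _; exact: cvg_cst. Qed.
Lemma ctsCT a b (f : R -> C) : continuous f -> ctsC a b f.
Proof. by move=> fc t _ _; exact: fc. Qed.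
Lemma ctsC_cst a b (k : C) : ctsC a b (fun=> k).
Proof. by move=> t _ _; exact: cvg_cst. Qed.
Lemma ctsC_N a b (f : R -> C) : ctsC a b f -> ctsC a b (fun t => - f t).
Proof. by move=> fc t ta tb; apply: cvgN; exact: fc. Qed.
Lemma ctsC_M a b (f g : R -> C) : ctsC a b f -> ctsC a b g ->
  ctsC a b (fun t => f t * g t).
Proof. by move=> fc gc t ta tb; apply: cvgM; [exact: fc|exact: gc]. Qed.
Lemma ctsC_comp a b (f : R -> C) (h : C -> C) :
  ctsC a b f -> (forall t, a <= t -> t <= b -> {for f t, continuous h}) ->
  ctsC a b (fun t => h (f t)).
Proof.
move=> fc hc t ta tb.
exact: (@continuous_comp _ _ _ f h t (fc t ta tb) (hc t ta tb)).
Qed.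
Lemma ctsC_compR a b (f : R -> C) (h : C -> R) :
  ctsC a b f -> (forall t, a <= t -> t <= b -> {for f t, continuous h}) ->
  ctsR a b (fun t => h (f t)).
Proof.
move=> fc hc t ta tb.
exact: (@continuous_comp _ _ _ f h t (fc t ta tb) (hc t ta tb)).
Qed.
Lemma ctsC_Re a b (f : R -> C) : ctsC a b f -> ctsR a b (fun t => Re (f t)).
Proof. by move=> fc; apply: (ctsC_compR fc) => t _ _; exact: cont_Re. Qed.
Lemma ctsC_Im a b (f : R -> C) : ctsC a b f -> ctsR a b (fun t => Im (f t)).
Proof. by move=> fc; apply: (ctsC_compR fc) => t _ _; exact: cont_Im. Qed.
Lemma ctsC_cmod a b (f : R -> C) :
  ctsC a b f -> ctsR a b (fun t => cmod (f t)).
Proof. by move=> fc; apply: (ctsC_compR fc) => t _ _; exact: cont_cmod. Qed.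

Lemma rint_eq a b (f g : R -> R) : (forall t, a <= t -> t <= b -> f t = g t) ->
  rint a b f = rint a b g.
Proof.
move=> fg; apply: eq_Rintegral => t; rewrite inE /= in_itv /= => /andP[].
exact: fg.
Qed.

Lemma rintD a b (f g : R -> R) : ctsR a b f -> ctsR a b g ->
  rint a b (fun t => f t + g t) = rint a b f + rint a b g.
Proof.
by move=> fc gc; rewrite /rint RintegralD//; exact: ctsR_integrable.
Qed.

Lemma rintZ a b (k : R) (f : R -> R) : ctsR a b f ->
  rint a b (fun t => k * f t) = k * rint a b f.
Proof. by move=> fc; rewrite /rint RintegralZl//; exact: ctsR_integrable. Qed.

Lemma rintN a b (f : R -> R) : ctsR a b f -> rint a b (fun t => - f t) = - rint a b f.
Proof.
by move=> fc; rewrite -mulN1r -rintZ//; apply: rint_eq => t _ _; rewrite mulN1r.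
Qed.

Lemma rintB a b (f g : R -> R) : ctsR a b f -> ctsR a b g ->
  rint a b (fun t => f t - g t) = rint a b f - rint a b g.
Proof. by move=> fc gc; rewrite rintD ?rintN//; exact: ctsR_N. Qed.

Lemma rint_cst a b (k : R) : a <= b -> rint a b (fun=> k) = k * (b - a).
Proof.
move=> ab; rewrite /rint Rintegral_cst//; congr (_ * _).
rewrite [X in fine (X _)](_ : _ = mu)// lebesgue_measure_itv /= lte_fin.
by case: ltgtP ab => // -> _; rewrite subrr.
Qed.

Lemma rint_le a b (f g : R -> R) : ctsR a b f -> ctsR a b g ->
  (forall t, a <= t -> t <= b -> f t <= g t) -> rint a b f <= rint a b g.
Proof.
move=> fc gc fg; apply: le_Rintegral => //; try exact: ctsR_integrable.
by move=> t /=; rewrite in_itv /= => /andP[]; exact: fg.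
Qed.

Lemma rint_split a m b (f : R -> R) : a <= m -> m <= b -> ctsR a b f ->
  rint a b f = rint a m f + rint m b f.
Proof.
move=> am mb fc; rewrite /rint.
have fi := ctsR_integrable fc.
apply/eqP; rewrite addrC -subr_eq (@Rintegral_itvB _ f (BLeft a) (BRight b) m)//.
apply/eqP; apply: Rintegral_itv_obnd_cbnd.
apply: integrableS fi => //= t /=; rewrite !in_itv /= => /andP[/ltW mt ->].
by rewrite andbT (le_trans am mt).
Qed.

Lemma rint_FTC (F f : R -> R) a b : a <= b -> continuous f ->
  (forall t : R, is_derive t (1 : R) F (f t)) -> rint a b f = F b - F a.
Proof.
rewrite le_eqVlt => /orP[/eqP <-|ab] fc Fd.
  by rewrite /rint set_itv1 Rintegral_set1 subrr.
rewrite /rint /Rintegral (@continuous_FTC2 _ f F)//.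
- exact: continuous_subspaceT.
- have Fcont : continuous F.
    move=> t; apply/differentiable_continuous/derivable1_diffP.
    by have [] := Fd t.
  split; [by move=> t _; have [] := Fd t| |].
  + by apply: cvg_at_right_filter; exact: Fcont.
  + by apply: cvg_at_left_filter; exact: Fcont.
- by move=> t _; rewrite derive1E; have [] := Fd t.
Qed.

Lemma rint_id a b : a <= b -> rint a b id = (b ^+ 2 - a ^+ 2) / 2.
Proof.
move=> ab; have H : forall t : R, is_derive t (1 : R) (fun t => t ^+ 2 / 2) t.
  move=> t; rewrite (_ : (fun t0 : R => t0 ^+ 2 / 2) = 2^-1 *: (id ^+ 2)).
    apply: is_derive_eq; rewrite /GRing.scale /= mulr1 expr1.
    by rewrite -mulr_natl mulrA mulVf ?mul1r.
  by apply/funext => s; rewrite /GRing.scale /= mulrC.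
rewrite (@rint_FTC _ id a b ab _ H); first by rewrite mulrBl.
by move=> t; exact: cvg_id.
Qed.

Definition cint (a b : R) (h : R -> C) : C :=
  (rint a b (fun t => Re (h t)) +i* rint a b (fun t => Im (h t)))%C.

Lemma cint_eq a b (f g : R -> C) : (forall t, a <= t -> t <= b -> f t = g t) ->
  cint a b f = cint a b g.
Proof.
by move=> fg; apply: complexP => /=; apply: rint_eq => t ta tb; rewrite fg.
Qed.

Lemma cintD a b (f g : R -> C) : ctsC a b f -> ctsC a b g ->
  cint a b (fun t => f t + g t) = cint a b f + cint a b g.
Proof.
move=> fc gc; apply: complexP => /=; rewrite -rintD; do ?exact: ctsC_Re;
  do ?exact: ctsC_Im; apply: rint_eq => t _ _; [exact: cReD|exact: cImD].
Qed.

Lemma cintZ a b (k : C) (f : R -> C) : ctsC a b f ->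
  cint a b (fun t => k * f t) = k * cint a b f.
Proof.
move=> fc; have fr := ctsC_Re fc; have fi := ctsC_Im fc.
have cM x (g : R -> R) : ctsR a b g -> ctsR a b (fun t => x * g t).
  by apply: ctsR_M; exact: ctsR_cst.
apply: complexP.
  rewrite cReM; transitivity (rint a b (fun t => Re k * Re (f t) - Im k * Im (f t))).
    by apply: rint_eq => t _ _; rewrite cReM.
  by rewrite rintB ?rintZ//; exact: cM.
rewrite cImM; transitivity (rint a b (fun t => Re k * Im (f t) + Im k * Re (f t))).
  by apply: rint_eq => t _ _; rewrite cImM.
by rewrite rintD ?rintZ//; exact: cM.
Qed.

Lemma cintB a b (f g : R -> C) : ctsC a b f -> ctsC a b g ->
  cint a b (fun t => f t - g t) = cint a b f - cint a b g.
Proof.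
move=> fc gc; rewrite (cintD fc (ctsC_N gc)).
congr (_ + _); rewrite -mulN1r -cintZ//.
by apply: cint_eq => t _ _; rewrite mulN1r.
Qed.

Lemma cint_cst a b (k : C) : a <= b -> cint a b (fun=> k) = k * rc (b - a).
Proof.
move=> ab; apply: complexP; rewrite /= ?cReM ?cImM !rint_cst//.
  by rewrite mulr0 subr0.
by rewrite mulr0 add0r.
Qed.

Lemma cint_split a m b (f : R -> C) : a <= m -> m <= b -> ctsC a b f ->
  cint a b f = cint a m f + cint m b f.
Proof.
move=> am mb fc; have fr := ctsC_Re fc; have fi := ctsC_Im fc.
by apply: complexP => /=; apply: rint_split.
Qed.

(** Multiplying by the conjugate of the integral [I] turns its value into [|I|^2]; the real
    inequality [Re <= cmod] then applies under the integral sign. *)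
Lemma cint_le a b (f : R -> C) : ctsC a b f ->
  cmod (cint a b f) <= rint a b (fun t => cmod (f t)).
Proof.
move=> fc; set I := cint a b f.
have [I0|I0] := eqVneq I 0.
  rewrite I0 cmod0; apply: Rintegral_ge0 => t _; exact: cmod_ge0.
have cI : 0 < cmod I by rewrite cmod_gt0.
suff : cmod I ^+ 2 <= cmod I * rint a b (fun t => cmod (f t)).
  by rewrite expr2 ler_pM2l.
have -> : cmod I ^+ 2 = Re (I^* * I).
  by rewrite mulrC mul_conj.
have -> : I^* * I = cint a b (fun t => I^* * f t) by rewrite cintZ.
rewrite -rintZ; last exact: ctsC_cmod.
apply: rint_le => [||t _ _].
- exact/ctsC_Re/(ctsC_M _ fc)/ctsC_cst.
- by apply: ctsR_M; [exact: ctsR_cst | exact: ctsC_cmod].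
- by rewrite (le_trans (Re_le _))// cmodM cmod_conj.
Qed.

Lemma cint_bound a b (f : R -> C) M : a <= b -> ctsC a b f ->
  (forall t, a <= t -> t <= b -> cmod (f t) <= M) ->
  cmod (cint a b f) <= M * (b - a).
Proof.
move=> ab fc fM; rewrite (le_trans (cint_le fc))// -rint_cst//.
by apply: rint_le => //; [exact: ctsC_cmod|exact: ctsR_cst].
Qed.

End Integrals.
Lemma geometric_small (R : realType) (L q r : R) : 0 <= L -> 0 <= q -> q < 1 ->
  0 < r -> exists N : nat, forall n, (N <= n)%N -> L * q ^+ n < r.
Proof.
move=> L0 q0 q1 r0.
have /cvgrPdist_lt/(_ _ r0)[N _ NP] : geometric L q @ \oo --> (0 : R).
  by apply: cvg_geometric; rewrite ger0_norm.
exists N => n /NP; rewrite sub0r normrN ger0_norm//.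
by rewrite /geometric /= mulr_ge0// exprn_ge0.
Qed.

(** * Cauchy theory *)

Section Goursat.
Variable R : realType.
Local Notation C := (cplx R).
Local Notation Re := (@complex.Re R).
Local Notation Im := (@complex.Im R).
Local Notation rc := (@rc R).
Implicit Types (a b c d x y m : R) (f g : C -> C).

Definition pt (x y : R) : C := (x +i* y)%C.

Definition cont_rect g a b c d := forall x y,
  a <= x -> x <= b -> c <= y -> y <= d -> {for pt x y, continuous g}.

Lemma cont_rectW g a b c d a' b' c' d' :
  a <= a' -> b' <= b -> c <= c' -> d' <= d ->
  cont_rect g a b c d -> cont_rect g a' b' c' d'.
Proof.
move=> aa bb cc dd gc x y ax xb cy yd.
by apply: gc; [exact: le_trans ax|exact: le_trans bb|exact: le_trans cy|
  exact: le_trans dd].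
Qed.

Lemma ctsC_ptx a b y : ctsC a b (fun x => pt x y).
Proof.
by move=> x _ _; apply: cvg_ReIm => /=; [exact: cvg_id|exact: cvg_cst].
Qed.

Lemma ctsC_pty a b x : ctsC a b (fun y => pt x y).
Proof.
by move=> y _ _; apply: cvg_ReIm => /=; [exact: cvg_cst|exact: cvg_id].
Qed.

Lemma cont_rectx g a b c d y : cont_rect g a b c d -> c <= y -> y <= d ->
  ctsC a b (fun x => g (pt x y)).
Proof.
move=> gc cy yd; apply: ctsC_comp; first exact: ctsC_ptx.
by move=> x ax xb; exact: gc.
Qed.

Lemma cont_recty g a b c d x : cont_rect g a b c d -> a <= x -> x <= b ->
  ctsC c d (fun y => g (pt x y)).
Proof.
move=> gc ax xb; apply: ctsC_comp; first exact: ctsC_pty.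
by move=> y cy yd; exact: gc.
Qed.

(** The contour integral of [g dz] around the rectangle, counterclockwise; ['i] is [dz/dy] on the
    vertical sides. *)
Definition rect_int g a b c d : C :=
  cint a b (fun x => g (pt x c)) - cint a b (fun x => g (pt x d)) +
  'i * (cint c d (fun y => g (pt b y)) - cint c d (fun y => g (pt a y))).

Lemma rect_int_splitx g a m b c d : a <= m -> m <= b -> c <= d ->
  cont_rect g a b c d ->
  rect_int g a b c d = rect_int g a m c d + rect_int g m b c d.
Proof.
move=> am mb cd gc; rewrite /rect_int.
rewrite (cint_split am mb (cont_rectx gc (lexx c) cd)).
rewrite (cint_split am mb (cont_rectx gc cd (lexx d))).
ring.
Qed.

Lemma rect_int_splity g a b c m d : a <= b -> c <= m -> m <= d ->
  cont_rect g a b c d ->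
  rect_int g a b c d = rect_int g a b c m + rect_int g a b m d.
Proof.
move=> ab cm md gc; rewrite /rect_int.
rewrite (cint_split cm md (cont_recty gc (lexx a) ab)).
rewrite (cint_split cm md (cont_recty gc ab (lexx b))).
ring.
Qed.

Lemma rect_intD f g a b c d : a <= b -> c <= d ->
  cont_rect f a b c d -> cont_rect g a b c d ->
  rect_int (fun z => f z + g z) a b c d =
  rect_int f a b c d + rect_int g a b c d.
Proof.
move=> ab cd fc gc; rewrite /rect_int.
rewrite (cintD (cont_rectx fc (lexx c) cd) (cont_rectx gc (lexx c) cd)).
rewrite (cintD (cont_rectx fc cd (lexx d)) (cont_rectx gc cd (lexx d))).
rewrite (cintD (cont_recty fc (lexx a) ab) (cont_recty gc (lexx a) ab)).
rewrite (cintD (cont_recty fc ab (lexx b)) (cont_recty gc ab (lexx b))).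
ring.
Qed.

Lemma rect_int_bound g a b c d M : a <= b -> c <= d ->
  cont_rect g a b c d ->
  (forall x y, a <= x -> x <= b -> c <= y -> y <= d -> cmod (g (pt x y)) <= M) ->
  cmod (rect_int g a b c d) <= 2 * M * ((b - a) + (d - c)).
Proof.
move=> ab cd gc gM; rewrite /rect_int (le_trans (cmodD _ _))// cmodM.
have -> : cmod ('i : C) = 1.
  by rewrite -complexiE /cmod /= expr0n expr1n add0r sqrtr1.
rewrite mul1r mulrDr mulr_natl mulr2n; apply: lerD;
  rewrite (le_trans (cmod_leB _ _))// mulrDl; apply: lerD;
  apply: cint_bound => //; try (by move=> *; exact: gM).
- exact: cont_rectx gc (lexx _) cd.
- exact: cont_rectx gc cd (lexx _).
- exact: cont_recty gc ab (lexx _).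
- exact: cont_recty gc (lexx _) ab.
Qed.

(** Disposes of the first-order Taylor polynomial in Goursat's lemma; the four sides are computed
    explicitly. *)
Lemma rect_int_affine (p q : C) a b c d : a <= b -> c <= d ->
  rect_int (fun z => p * z + q) a b c d = 0.
Proof.
move=> ab cd; rewrite /rect_int.
have cx y : cint a b (fun x => p * pt x y + q) =
    p * pt ((b ^+ 2 - a ^+ 2) / 2) (y * (b - a)) + q * rc (b - a).
  rewrite cintD; [|by apply: (ctsC_M (f := fun=> p)); [exact: ctsC_cst|exact: ctsC_ptx]|exact: ctsC_cst].
  rewrite cintZ; last exact: ctsC_ptx.
  rewrite cint_cst//; congr (_ * _ + _).
  by apply: complexP => /=; [exact: rint_id|exact: rint_cst].
have cy x : cint c d (fun y => p * pt x y + q) =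
    p * pt (x * (d - c)) ((d ^+ 2 - c ^+ 2) / 2) + q * rc (d - c).
  rewrite cintD; [|by apply: (ctsC_M (f := fun=> p)); [exact: ctsC_cst|exact: ctsC_pty]|exact: ctsC_cst].
  rewrite cintZ; last exact: ctsC_pty.
  rewrite cint_cst//; congr (_ * _ + _).
  by apply: complexP => /=; [exact: rint_cst|exact: rint_id].
rewrite !cx !cy; have I2 : ('i : C) ^+ 2 = -1 by exact: sqrCi.
have -> : p * pt ((b ^+ 2 - a ^+ 2) / 2) (c * (b - a)) + q * rc (b - a) -
  (p * pt ((b ^+ 2 - a ^+ 2) / 2) (d * (b - a)) + q * rc (b - a)) =
  p * (pt ((b ^+ 2 - a ^+ 2) / 2) (c * (b - a)) -
       pt ((b ^+ 2 - a ^+ 2) / 2) (d * (b - a))) by ring.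
have -> : p * pt (b * (d - c)) ((d ^+ 2 - c ^+ 2) / 2) + q * rc (d - c) -
  (p * pt (a * (d - c)) ((d ^+ 2 - c ^+ 2) / 2) + q * rc (d - c)) =
  p * (pt (b * (d - c)) ((d ^+ 2 - c ^+ 2) / 2) -
       pt (a * (d - c)) ((d ^+ 2 - c ^+ 2) / 2)) by ring.
rewrite mulrCA -mulrDr; set X := (X in p * X).
suff -> : X = 0 by rewrite mulr0.
rewrite /X -complexiE; apply: complexP; rewrite cReD cReM cReB cImB /= || 
  rewrite cImD cImM cReB cImB /=; ring.
Qed.

(* The halving step keeps a half on which the integral is at least half as
   large in modulus. *)
Definition halfx g (q : R * R * R * R) :=
  let: (a, b, c, d) := q in let m := (a + b) / 2 in
  if cmod (rect_int g a b c d) <= 2 * cmod (rect_int g a m c d)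
  then (a, m, c, d) else (m, b, c, d).
Definition halfy g (q : R * R * R * R) :=
  let: (a, b, c, d) := q in let m := (c + d) / 2 in
  if cmod (rect_int g a b c d) <= 2 * cmod (rect_int g a b c m)
  then (a, b, c, m) else (a, b, m, d).
Lemma mid_ge a b : a <= b -> a <= (a + b) / 2.
Proof. by move=> ab; rewrite ler_pdivlMr// mulr_natr mulr2n lerD2l. Qed.
Lemma mid_le a b : a <= b -> (a + b) / 2 <= b.
Proof. by move=> ab; rewrite ler_pdivrMr// mulr_natr mulr2n lerD2r. Qed.

Lemma halfxP g a b c d : a <= b -> c <= d -> cont_rect g a b c d ->
  exists a' b', [/\ halfx g (a, b, c, d) = (a', b', c, d),
    [/\ a <= a', a' <= b' & b' <= b], b' - a' = (b - a) / 2 &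
    cmod (rect_int g a b c d) <= 2 * cmod (rect_int g a' b' c d)].
Proof.
move=> ab cd gc; rewrite /halfx; have ma := mid_ge ab; have mb := mid_le ab.
case: ifPn => [h|]; first by exists a, ((a + b) / 2); split => //; field.
rewrite -ltNge => h; exists ((a + b) / 2), b; split => //; first by field.
have := cmodD (rect_int g a ((a + b) / 2) c d) (rect_int g ((a + b) / 2) b c d).
rewrite -rect_int_splitx// => h2.
by move: h h2; move: (cmod _) (cmod _) (cmod _) => X Y Z; lra.
Qed.

Lemma halfyP g a b c d : a <= b -> c <= d -> cont_rect g a b c d ->
  exists c' d', [/\ halfy g (a, b, c, d) = (a, b, c', d'),
    [/\ c <= c', c' <= d' & d' <= d], d' - c' = (d - c) / 2 &
    cmod (rect_int g a b c d) <= 2 * cmod (rect_int g a b c' d')].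
Proof.
move=> ab cd gc; rewrite /halfy; have mc := mid_ge cd; have md := mid_le cd.
case: ifPn => [h|]; first by exists c, ((c + d) / 2); split => //; field.
rewrite -ltNge => h; exists ((c + d) / 2), d; split => //; first by field.
have := cmodD (rect_int g a b c ((c + d) / 2)) (rect_int g a b ((c + d) / 2) d).
rewrite -rect_int_splity// => h2.
by move: h h2; move: (cmod _) (cmod _) (cmod _) => X Y Z; lra.
Qed.

Lemma nested_limit (u v : nat -> R) :
  (forall n, u n <= u n.+1) -> (forall n, v n.+1 <= v n) ->
  (forall n, u n <= v n) -> exists l, forall n, u n <= l /\ l <= v n.
Proof.
move=> ui vd uv.
have um n k : u n <= u (n + k)%N.
  by elim: k => [|k IH]; rewrite ?addn0// addnS (le_trans IH).
have vm n k : v (n + k)%N <= v n.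
  by elim: k => [|k IH]; rewrite ?addn0// addnS (le_trans _ IH).
have uvnm n k : u n <= v k.
  rewrite (le_trans (um n k))// (le_trans (uv _))// addnC; exact: vm.
exists (sup (range u)) => n; split.
  apply: sup_upper_bound; last by exists n.
  by split; [exists (u 0), 0%N|exists (v 0) => _ [k _ <-]].
by apply: ge_sup; [exists (u 0), 0%N|move=> _ [k _ <-]].
Qed.

Lemma itv_dist (A B x x0 : R) :
  A <= x -> x <= B -> A <= x0 -> x0 <= B -> `|x - x0| <= B - A.
Proof. by move=> *; rewrite ler_norml; apply/andP; split; lra. Qed.

Theorem Goursat g a b c d : a <= b -> c <= d ->
  (forall x y, a <= x -> x <= b -> c <= y -> y <= d ->
     exists k : C, hasD g (pt x y) k) ->
  rect_int g a b c d = 0.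
Proof.
move=> ab cd gD.
have gc : cont_rect g a b c d.
  by move=> x y ax xb cy yd; have [k /hasD_cvg] := gD x y ax xb cy yd.
(* One round bisects horizontally and vertically: both sides are halved at the cost of a factor 4 in
   the integral. The square of the perimeter shrinks by the same factor 4. *)
pose q n := iter n (fun q => halfy g (halfx g q)) (a, b, c, d).
have qP n : exists a' b' c' d', [/\ q n = (a', b', c', d'),
    [/\ a <= a', a' <= b' & b' <= b], [/\ c <= c', c' <= d' & d' <= d],
    b' - a' = (b - a) / 2 ^+ n /\ d' - c' = (d - c) / 2 ^+ n &
    cmod (rect_int g a b c d) <= 4 ^+ n * cmod (rect_int g a' b' c' d')] /\
    exists a'' b'' c'' d'', q n.+1 = (a'', b'', c'', d'') /\
    [/\ a' <= a'', b'' <= b', c' <= c'' & d'' <= d'].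
  have step n' a' b' c' d' : q n' = (a', b', c', d') ->
    [/\ a <= a', a' <= b' & b' <= b] -> [/\ c <= c', c' <= d' & d' <= d] ->
    exists a'' b'' c'' d'', [/\ q n'.+1 = (a'', b'', c'', d''),
      [/\ a' <= a'', a'' <= b'' & b'' <= b'], [/\ c' <= c'', c'' <= d'' & d'' <= d'],
      b'' - a'' = (b' - a') / 2 /\ d'' - c'' = (d' - c') / 2 &
      cmod (rect_int g a' b' c' d') <= 4 * cmod (rect_int g a'' b'' c'' d'')].
    move=> qn [aa' ab' bb'] [cc' cd' dd'].
    have gc' := cont_rectW aa' bb' cc' dd' gc.
    have [a'' [b'' [qx [xa xab xb] xe xi]]] := halfxP ab' cd' gc'.
    have gc'' := cont_rectW xa xb (lexx _) (lexx _) gc'.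
    have [c'' [d'' [qy [yc ycd yd] ye yi]]] := halfyP xab cd' gc''.
    exists a'', b'', c'', d''; split => //.
      by rewrite /q iterS -/(q n') qn qx.
    by move: xi yi; lra.
  elim: n => [|n [a' [b' [c' [d' [[qn [aa ab' bb] [cc cd' dd] [e1 e2] qi] [a'' [b'' [c'' [d'' [qn1 _]]]]]]]]]]].
    exists a, b, c, d; split.
      by split; rewrite ?expr0 ?divr1 ?mul1r.
    have [] := @step 0 a b c d; rewrite /q//= => a' [b' [c' [d' [qn []]]]].
    by move=> ? ? ? [? ? ?] _ _; exists a', b', c', d'.
  have [a1 [b1 [c1 [d1 [q1 [A1 A2 A3] [C1 C2 C3] [E1 E2] I1]]]]] :=
    step n a' b' c' d' qn (And3 aa ab' bb) (And3 cc cd' dd).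
  have A := And3 (le_trans aa A1) A2 (le_trans A3 bb).
  have Cc := And3 (le_trans cc C1) C2 (le_trans C3 dd).
  exists a1, b1, c1, d1; split.
    split => //.
      by rewrite E1 E2 e1 e2 exprSr !invfM !mulrA.
    by rewrite (le_trans qi)// exprSr -mulrA ler_wpM2l ?exprn_ge0.
  have [a2 [b2 [c2 [d2 [q2 [? ? ?] [? ? ?] _ _]]]]] := step n.+1 a1 b1 c1 d1 q1 A Cc.
  by exists a2, b2, c2, d2.
pose qa n := let: (x, _, _, _) := q n in x.
pose qb n := let: (_, x, _, _) := q n in x.
pose qc n := let: (_, _, x, _) := q n in x.
pose qd n := let: (_, _, _, x) := q n in x.
have {}qP n : [/\ [/\ a <= qa n, qa n <= qb n & qb n <= b],
    [/\ c <= qc n, qc n <= qd n & qd n <= d],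
    qb n - qa n = (b - a) / 2 ^+ n /\ qd n - qc n = (d - c) / 2 ^+ n,
    cmod (rect_int g a b c d) <=
      4 ^+ n * cmod (rect_int g (qa n) (qb n) (qc n) (qd n)) &
    [/\ qa n <= qa n.+1, qb n.+1 <= qb n, qc n <= qc n.+1 & qd n.+1 <= qd n]].
  have [a' [b' [c' [d' [[qn A B E I] [a'' [b'' [c'' [d'' [qn1 D]]]]]]]]]] := qP n.
  by rewrite /qa /qb /qc /qd qn qn1; split.
have [x0 xP] := @nested_limit qa qb
  (fun n => let: And5 _ _ _ _ (And4 h _ _ _) := qP n in h)
  (fun n => let: And5 _ _ _ _ (And4 _ h _ _) := qP n in h)
  (fun n => let: And5 (And3 _ h _) _ _ _ _ := qP n in h).
have [y0 yP] := @nested_limit qc qd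
  (fun n => let: And5 _ _ _ _ (And4 _ _ h _) := qP n in h)
  (fun n => let: And5 _ _ _ _ (And4 _ _ _ h) := qP n in h)
  (fun n => let: And5 _ (And3 _ h _) _ _ _ := qP n in h).
have [k gp] : exists k : C, hasD g (pt x0 y0) k.
  have [x1 x2] := xP 0%N; have [y1 y2] := yP 0%N.
  by apply: gD; rewrite ?(le_trans _ x1) ?(le_trans x2) ?(le_trans _ y1) ?(le_trans y2)//;
    have [[? ? ?] [? ? ?] _ _ _] := qP 0%N.
move/hasDP: gp => gp.
pose L := (b - a) + (d - c).
have L0 : 0 <= L by rewrite addr_ge0// subr_ge0.
(* The affine part integrates to zero and the remainder is at most [e * (L / 2 ^+ n)] on a rectangle
   of half-perimeter [L / 2 ^+ n]; the factor [4 ^+ n] cancels exactly, so the bound does not depend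
   on [n]. *)
have small e : 0 < e -> cmod (rect_int g a b c d) <= 2 * e * L ^+ 2.
  move=> e0; have [r r0 rP] := gp e e0.
  have [n nr] : exists n, L / 2 ^+ n < r.
    have [||N NP] := @geometric_small R L (2^-1) r L0 _ _ r0.
    - by rewrite invr_ge0.
    - by rewrite invf_lt1// ltr1n.
    by exists N; have := NP _ (leqnn N); rewrite exprVn.
  have [[aa ab' bb] [cc cd' dd] [e1 e2] I _] := qP n.
  have gc' := cont_rectW aa bb cc dd gc.
  rewrite (le_trans I)//.
  set A := qa n in aa ab' e1 gc' I *; set B := qb n in ab' bb e1 gc' I *.
  set A' := qc n in cc cd' e2 gc' I *; set B' := qd n in cd' dd e2 gc' I *.
  pose h z := g z - (k * z + (g (pt x0 y0) - k * pt x0 y0)).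
  have lc : cont_rect (fun z => k * z + (g (pt x0 y0) - k * pt x0 y0)) A B A' B'.
    move=> x y _ _ _ _; apply: contC_D; last exact: contC_cst.
    by apply: contC_M; [exact: contC_cst|exact: cvg_id].
  have hc : cont_rect h A B A' B'.
    by move=> x y ? ? ? ?; apply: contC_B; [exact: gc'|exact: lc].
  have -> : rect_int g A B A' B' = rect_int h A B A' B'.
    rewrite -[RHS]addr0 -(rect_int_affine k (g (pt x0 y0) - k * pt x0 y0) ab' cd').
    rewrite -(rect_intD ab' cd' hc lc); congr (rect_int _ A B A' B').
    by apply/funext => z; rewrite /h subrK.
  have EL : (B - A) + (B' - A') = L / 2 ^+ n by rewrite e1 e2 -mulrDl.
  have hb : cmod (rect_int h A B A' B') <=
      2 * (e * (L / 2 ^+ n)) * ((B - A) + (B' - A')).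
    apply: rect_int_bound => // x y Ax xB A'y yB'.
    have le : cmod (pt x y - pt x0 y0) <= L / 2 ^+ n.
      rewrite (le_trans (cmod_le_ReIm _))// -EL.
      have [x1 x2] := xP n; have [y1 y2] := yP n.
      rewrite /A /B /A' /B' in Ax xB A'y yB' *.
      by rewrite cReB cImB /=; apply: lerD; exact: itv_dist.
    have := rP (pt x y - pt x0 y0) (le_lt_trans le nr).
    rewrite [pt x0 y0 + _]addrC subrK => hle; rewrite /h.
    have -> : g (pt x y) - (k * pt x y + (g (pt x0 y0) - k * pt x0 y0)) =
      g (pt x y) - g (pt x0 y0) - k * (pt x y - pt x0 y0) by ring.
    by rewrite (le_trans hle)// ler_wpM2l// ltW.
  have p4 : 0 <= (4 : R) ^+ n by rewrite exprn_ge0.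
  rewrite (le_trans (ler_wpM2l p4 hb))// EL.
  have -> : (4 : R) ^+ n = 2 ^+ n * 2 ^+ n by rewrite -exprMn -natrM.
  have p2 : (2 : R) ^+ n != 0 by rewrite expf_neq0.
  by rewrite le_eqVlt; apply/orP; left; apply/eqP; field.
apply/eqP; rewrite -cmod_eq0 eq_le cmod_ge0 andbT; apply/ler_addgt0Pl => e e0.
rewrite addr0.
have K0 : 0 < 2 * (L ^+ 2 + 1) by rewrite mulr_gt0// ltr_wpDl ?sqr_ge0.
rewrite (le_trans (small (e / (2 * (L ^+ 2 + 1))) (divr_gt0 e0 K0)))//.
have -> : 2 * (e / (2 * (L ^+ 2 + 1))) * L ^+ 2 = e * (L ^+ 2 / (L ^+ 2 + 1)).
  by field; lra.
rewrite ler_piMr ?(ltW e0)// ler_pdivrMr; last by rewrite ltr_wpDl ?sqr_ge0.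
by rewrite mul1r lerDl.
Qed.

End Goursat.

(** * The complex exponential and polar form *)

Section Exponential.
Variable R : realType.
Local Notation C := (cplx R).
Local Notation Re := (@complex.Re R).
Local Notation Im := (@complex.Im R).
Local Notation rc := (@rc R).
Local Notation pt := (@pt R).

Lemma is_derive_small (f : R -> R) (x d : R) : is_derive x (1 : R) f d ->
  forall e, 0 < e -> exists2 r : R, 0 < r &
    forall h, `|h| < r -> `|f (x + h) - f x - d * h| <= e * `|h|.
Proof.
move=> [df fd] e e0; have := df; rewrite /derivable => /cvg_ex[l fl].
have ld : l = d by rewrite -fd; apply/esym/cvg_lim.
move: fl => /cvgrPdist_le/(_ _ e0)/nbhs_ballP[r /= r0 rP].
exists r => // h hr; have [->|h0] := eqVneq h 0.
  by rewrite addr0 mulr0 subrr subr0 normr0 mulr0.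
have := rP h; rewrite -ball_normE /= sub0r normrN => /(_ hr h0).
rewrite ld /GRing.scale /= mulr1 [h + x]addrC => hle.
have -> : f (x + h) - f x - d * h = - (d - h^-1 * (f (x + h) - f x)) * h.
  by field.
by rewrite normrM normrN ler_wpM2r.
Qed.

Definition cexp (z : C) : C := rc (expR (Re z)) * expi (Im z).

Lemma cexpD z w : cexp (z + w) = cexp z * cexp w.
Proof. by rewrite /cexp cReD cImD expRD expiD rcM; ring. Qed.

Lemma cmod_cexp z : cmod (cexp z) = expR (Re z).
Proof. by rewrite /cexp cmodM cmod_expi mulr1 cmod_rc_ge0// expR_ge0. Qed.

Lemma cexp_neq0 z : cexp z != 0.
Proof. by rewrite -cmod_gt0 cmod_cexp expR_gt0. Qed.

Lemma cexp0 : cexp 0 = 1.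
Proof. by rewrite /cexp /= expR0 expi0 mulr1. Qed.

Lemma hasD_cexp0 : hasD cexp 0 1.
Proof.
apply/hasDP => e e0.
(* [8 = 3 + 5] adds up the errors of the real part ([A1]) and of the imaginary part ([A2]). *)
have [k [k0 k1 ke]] : exists k : R, [/\ 0 < k, k <= 1 & 8 * k <= e].
  exists (Num.min 1 (e / 8)); split; first by rewrite lt_min ltr01 divr_gt0.
    by rewrite ge_min lexx.
  by rewrite mulrC -ler_pdivlMr// ge_min lexx orbT.
have [r1 r10 P1] := is_derive_small (is_derive_expR 0) k0.
have [r2 r20 P2] := is_derive_small (is_derive_cos 0) k0.
have [r3 r30 P3] := is_derive_small (is_derive_sin 0) k0.
exists (Num.min k (Num.min r1 (Num.min r2 r3))); first by rewrite !lt_min k0 r10 r20.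
case=> x y; rewrite !lt_min => /and4P[hk h1 h2 h3].
rewrite add0r cexp0 mul1r.
have ax : `|x| <= cmod ((x +i* y)%C : C) := normRe_le ((x +i* y)%C : C).
have ay : `|y| <= cmod ((x +i* y)%C : C) := normIm_le ((x +i* y)%C : C).
have ax0 := normr_ge0 x; have ay0 := normr_ge0 y.
set H := cmod _ in hk h1 h2 h3 ax ay *.
have {}P1 : `|expR x - 1 - x| <= k * `|x|.
  by have := P1 x (le_lt_trans ax h1); rewrite add0r expR0 mul1r.
have {}P2 : `|cos y - 1| <= k * `|y|.
  by have := P2 y (le_lt_trans ay h2); rewrite add0r cos0 sin0 oppr0 mul0r subr0.
have {}P3 : `|sin y - y| <= k * `|y|.
  by have := P3 y (le_lt_trans ay h3); rewrite add0r cos0 sin0 mul1r subr0.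
have Hk : `|x| <= k by rewrite (le_trans ax)// ltW.
rewrite (le_trans (cmod_le_ReIm _))// !cReB !cImB /cexp cReM cImM /= !mul0r subr0 addr0 subr0.
set E := expR x in P1 *; set c := cos y in P2 *; set s := sin y in P3 *.
have c1 : `|c| <= 1 by rewrite ler_norml cos_geN1 cos_le1.
have A1 : `|E * c - 1 - x| <= 3 * k * H.
  have -> : E * c - 1 - x = (E - 1 - x) * c + (1 + x) * (c - 1) by ring.
  rewrite (le_trans (ler_normD _ _))// !normrM.
  have B1 : `|E - 1 - x| * `|c| <= k * H.
    rewrite -[leRHS]mulr1 ler_pM// (le_trans P1)//.
    by rewrite ler_wpM2l// ltW.
  have B2 : `|1 + x| * `|c - 1| <= 2 * (k * H).
    apply: ler_pM => //; last by rewrite (le_trans P2)// ler_wpM2l// ltW.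
    by rewrite (le_trans (ler_normD _ _))// normr1; lra.
  by lra.
have A2 : `|E * s - y| <= 5 * k * H.
  have -> : E * s - y = (E - 1 - x + x) * s + (s - y) by ring.
  rewrite (le_trans (ler_normD _ _))// normrM.
  have kH : k * `|x| <= k * H by rewrite ler_wpM2l// ltW.
  have B1 : `|E - 1 - x + x| <= 2 * H * 1.
    rewrite (le_trans (ler_normD _ _))//.
    have : k * `|x| <= 1 * `|x| by rewrite ler_wpM2r.
    by move: P1; lra.
  have kx : `|E - 1 - x + x| <= 2 * k.
    rewrite (le_trans (ler_normD _ _))//.
    have : k * `|x| <= k * 1 by rewrite ler_wpM2l ?(ltW k0)// (le_trans Hk).
    by move: P1; lra.
  have sy : `|s| <= 2 * H * 1.
    have := ler_normD (s - y) y; rewrite subrK.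
    have : k * `|y| <= 1 * `|y| by rewrite ler_wpM2r.
    by move: P3; lra.
  have B2 : `|E - 1 - x + x| * `|s| <= 2 * k * (2 * H).
    by apply: ler_pM => //; move: sy; lra.
  have kHy : k * `|y| <= k * H by rewrite ler_wpM2l// ltW.
  by move: B2 P3; lra.
have : 8 * k * H <= e * H by rewrite ler_wpM2r ?cmod_ge0.
by move: A1 A2; lra.
Qed.

Lemma hasD_cexp z : hasD cexp z (cexp z).
Proof.
have /hasDP H := hasD_cexp0; apply/hasDP => e e0.
have ez : 0 < cmod (cexp z) by rewrite cmod_gt0 cexp_neq0.
have [r r0 rP] := H (e / cmod (cexp z)) (divr_gt0 e0 ez).
exists r => // h hr; have := rP h hr; rewrite add0r cexp0 mul1r cexpD => hle.
have -> : cexp z * cexp h - cexp z - cexp z * h = cexp z * (cexp h - 1 - h) by ring.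
rewrite cmodM (le_trans (ler_wpM2l (cmod_ge0 _) hle))//.
by rewrite mulrA mulrCA divff ?mulr1// gt_eqF.
Qed.

Lemma cexp_pt (r t : R) : 0 < r -> cexp (pt (ln r) t) = rc r * expi t.
Proof. by move=> r0; rewrite /cexp /= lnK. Qed.

Lemma expi_eq1 (u : R) : `|u| <= pi -> expi u = 1 :> C -> u = 0.
Proof.
move=> upi [/= cu _]; apply/normr0_eq0; apply: cos_inj.
- by rewrite in_itv /= normr_ge0.
- by rewrite in_itv /= lexx pi_ge0.
- by rewrite cos_norm cu cos0.
Qed.

(** The argument is shifted to be at least [pi], so that the window [[t - pi, t + pi]] used for the
    annulus starts at a nonnegative angle, as [rint_period] requires. *)
Lemma polar z : z != 0 -> exists2 t : R, pi <= t & z = rc (cmod z) * expi t.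
Proof.
move=> z0; have cz : 0 < cmod z by rewrite cmod_gt0.
set x := Re z / cmod z; set y := Im z / cmod z.
have xy : x ^+ 2 + y ^+ 2 = 1.
  rewrite /x /y !expr_div_n -mulrDl -cmod_sqr divff// expf_neq0// gt_eqF//.
have x1 : -1 <= x <= 1.
  rewrite -ler_norml -(@ler_pXn2r _ 2) ?nnegrE// real_normK ?num_real// expr1n.
  by rewrite -xy lerDl sqr_ge0.
have [/andP[a0 api] ca] := acos_def x1.
have sa : sin (acos x) = `|y|.
  rewrite sin_acos// -xy addrAC subrr add0r sqrtr_sqr//.
have zE : z = rc (cmod z) * (x +i* y)%C.
  by apply: complexP; rewrite ?cReM ?cImM /= mul0r ?subr0 ?addr0 mulrC divfK// gt_eqF.
have pp := pi_gt0 R.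
have [y0|y0] := leP 0 y.
  exists (acos x + 2 * pi); first by lra.
  rewrite expi_2pi {1}zE; congr (_ * _); apply: complexP => //=.
  by rewrite sa ger0_norm.
exists (- acos x + 2 * pi); first by lra.
rewrite expi_2pi {1}zE; congr (_ * _); apply: complexP => /=.
  by rewrite cosN.
by rewrite sinN sa ltr0_norm// opprK.
Qed.

End Exponential.

(** * Means over circles *)

Section Means.
Variable R : realType.
Local Notation C := (cplx R).
Local Notation Re := (@complex.Re R).
Local Notation Im := (@complex.Im R).
Local Notation rc := (@rc R).
Local Notation pt := (@pt R).

Lemma pi2_gt0 : 0 < 2 * pi :> R.
Proof. by rewrite mulr_gt0// pi_gt0. Qed.

Lemma rint_trans (a b c : R) (g : R -> R) : a <= b -> continuous g ->
  rint (a + c) (b + c) g = rint a b (fun t => g (t + c)).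
Proof.
move=> ab gc; rewrite /rint /Rintegral; congr fine.
have dF (t : R) : is_derive t (1 : R) (fun t => t + c) 1.
  by apply: is_derive_eq; rewrite addr0.
have F1 : (fun t => t + c)^`()%classic = (fun=> 1 : R).
  by apply/funext => t; rewrite derive1E; have [] := dF t.
have cF : continuous (fun t : R => t + c).
  by move=> t; apply: cvgD; [exact: cvg_id|exact: cvg_cst].
rewrite (@integration_by_substitution_increasing _ (fun t => t + c) g a b ab).
- by apply: eq_integral => t _; rewrite F1 /= fctE /= mulr1.
- by move=> x y _ _; rewrite ltrD2r.
- by rewrite F1 => t _; exact: cvg_cst.
- by rewrite F1; apply/cvg_ex; exists (1 : R); exact: cvg_cst.
- by rewrite F1; apply/cvg_ex; exists (1 : R); exact: cvg_cst.
- split; [by move=> t _; have [] := dF t| |].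
  + by apply: cvg_at_right_filter; exact: cF.
  + by apply: cvg_at_left_filter; exact: cF.
- exact: continuous_subspaceT.
Qed.

(** Cutting [[0, s + 2 * pi]] at [s] and at [2 * pi] leaves, besides the two integrals to be
    compared, pieces over [[0, s]] and [[2 * pi, s + 2 * pi]] that agree by periodicity. *)
Lemma rint_period (s : R) (g : R -> R) : 0 <= s -> continuous g ->
  (forall t, g (t + 2 * pi) = g t) ->
  rint s (s + 2 * pi) g = rint 0 (2 * pi) g.
Proof.
move=> s0 gc gp; have pp := pi2_gt0.
have gcR a b : ctsR a b g by exact: ctsRT.
have H : rint (2 * pi) (s + 2 * pi) g = rint 0 s g.
  by rewrite -{1}[2 * pi]add0r rint_trans//; apply: rint_eq.
have := @rint_split R 0 s (s + 2 * pi) g s0.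
rewrite lerDl (ltW pp) => /(_ isT (gcR _ _)).
rewrite (@rint_split R 0 (2 * pi) (s + 2 * pi) g (ltW pp))// ?lerDr// H.
by rewrite addrC => /addrI.
Qed.

Definition tmean (g : R -> R) : R := (2 * pi)^-1 * rint 0 (2 * pi) g.
Definition cmean (h : R -> C) : C := rc (2 * pi)^-1 * cint 0 (2 * pi) h.

Lemma circle_meanE (u : C -> R) z r :
  circle_mean u z r = tmean (fun t => u (z + rc r * expi t)).
Proof. by []. Qed.

Lemma inv2pi_ge0 : 0 <= (2 * pi)^-1 :> R.
Proof. by rewrite invr_ge0 ltW// pi2_gt0. Qed.

Lemma tmean_eq f g : f =1 g -> tmean f = tmean g.
Proof. by move=> fg; congr (_ * _); apply: rint_eq. Qed.

Lemma tmeanD (f g : R -> R) : continuous f -> continuous g ->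
  tmean (fun t => f t + g t) = tmean f + tmean g.
Proof. by move=> fc gc; rewrite /tmean rintD ?mulrDr//; exact: ctsRT. Qed.

Lemma tmeanB (f g : R -> R) : continuous f -> continuous g ->
  tmean (fun t => f t - g t) = tmean f - tmean g.
Proof. by move=> fc gc; rewrite /tmean rintB ?mulrBr//; exact: ctsRT. Qed.

Lemma tmeanN (f : R -> R) : continuous f ->
  tmean (fun t => - f t) = - tmean f.
Proof. by move=> fc; rewrite /tmean rintN ?mulrN//; exact: ctsRT. Qed.

Lemma tmeanZ k (f : R -> R) : continuous f ->
  tmean (fun t => k * f t) = k * tmean f.
Proof. by move=> fc; rewrite /tmean rintZ 1?mulrCA//; exact: ctsRT. Qed.

Lemma tmean_cst k : tmean (fun=> k) = k.
Proof.
have pp := pi2_gt0; rewrite /tmean rint_cst ?ltW// subr0 mulrCA mulVf ?mulr1//.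
by rewrite gt_eqF.
Qed.

Lemma tmean_le (f g : R -> R) : continuous f -> continuous g ->
  (forall t, f t <= g t) -> tmean f <= tmean g.
Proof.
move=> fc gc fg; rewrite ler_wpM2l ?inv2pi_ge0//.
by apply: rint_le => //; exact: ctsRT.
Qed.

Lemma cmean_eq f g : f =1 g -> cmean f = cmean g.
Proof. by move=> fg; congr (_ * _); apply: cint_eq. Qed.

Lemma cmeanB (f g : R -> C) : continuous f -> continuous g ->
  cmean (fun t => f t - g t) = cmean f - cmean g.
Proof. by move=> fc gc; rewrite /cmean cintB ?mulrBr//; exact: ctsCT. Qed.

Lemma cmeanZ k (f : R -> C) : continuous f ->
  cmean (fun t => k * f t) = k * cmean f.
Proof. by move=> fc; rewrite /cmean cintZ 1?mulrCA//; exact: ctsCT. Qed.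

Lemma cmean_cst k : cmean (fun=> k) = k.
Proof.
have pp := pi2_gt0; rewrite /cmean cint_cst ?ltW// subr0 mulrCA -rcM mulVf.
  by rewrite rc1 mulr1.
by rewrite gt_eqF.
Qed.

Lemma cmean_le (f : R -> C) : continuous f ->
  cmod (cmean f) <= tmean (fun t => cmod (f t)).
Proof.
move=> fc; rewrite /cmean cmodM cmod_rc_ge0 ?inv2pi_ge0// ler_wpM2l ?inv2pi_ge0//.
by apply: cint_le; exact: ctsCT.
Qed.

Lemma cmean_bound (f : R -> C) M : continuous f ->
  (forall t, cmod (f t) <= M) -> cmod (cmean f) <= M.
Proof.
move=> fc fM; rewrite (le_trans (cmean_le fc))// -[leRHS]tmean_cst.
apply: tmean_le => // t; last exact: cvg_cst.
by apply: (@continuous_comp _ _ _ f (@cmod R) t (fc t)); exact: cont_cmod.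
Qed.

Lemma Re_cmean (f : R -> C) : Re (cmean f) = tmean (fun t => Re (f t)).
Proof. by rewrite /cmean cReM /= mul0r subr0. Qed.

Lemma Im_cmean (f : R -> C) : Im (cmean f) = tmean (fun t => Im (f t)).
Proof. by rewrite /cmean cImM /= mul0r addr0. Qed.

Definition circ (p : C) (r t : R) : C := p + rc r * expi t.

Lemma cont_circ p r : continuous (circ p r).
Proof.
move=> t; apply: cvgD; first exact: cvg_cst.
by apply: cvgM; [exact: cvg_cst|exact: cont_expi].
Qed.

Lemma cmod_circ p r t : 0 <= r -> cmod (circ p r t - p) = r.
Proof.
by move=> r0; rewrite /circ addrC addKr cmodM cmod_expi mulr1 cmod_rc_ge0.
Qed.

Lemma circ_2pi p r t : circ p r (t + 2 * pi) = circ p r t.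
Proof. by rewrite /circ expi_2pi. Qed.

Lemma cmean_period (h : R -> C) (s : R) : 0 <= s -> continuous h ->
  (forall t, h (t + 2 * pi) = h t) ->
  cint s (s + 2 * pi) h = cint 0 (2 * pi) h.
Proof.
move=> s0 hc hp; apply: complexP => /=; apply: rint_period => //.
- by move=> t; apply: (@continuous_comp _ _ _ h Re t (hc t)); exact: cont_Re.
- by move=> t; rewrite hp.
- by move=> t; apply: (@continuous_comp _ _ _ h Im t (hc t)); exact: cont_Im.
- by move=> t; rewrite hp.
Qed.

End Means.

(** * Cauchy's theorem on annuli and the mean value property *)

Section Cauchy.
Variable R : realType.
Local Notation C := (cplx R).
Local Notation Re := (@complex.Re R).
Local Notation Im := (@complex.Im R).
Local Notation rc := (@rc R).
Local Notation pt := (@pt R).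

(** By continuity [g] is bounded by some [M] near the exceptional point. A square of side [2 * D]
    around it contributes at most [8 * M * D], and the four remaining rectangles contribute nothing
    by [Goursat]. *)
Lemma Goursat_except (g : C -> C) (a b c d x0 y0 : R) :
  a < x0 -> x0 < b -> c < y0 -> y0 < d -> cont_rect g a b c d ->
  (forall x y, a <= x -> x <= b -> c <= y -> y <= d -> (x, y) != (x0, y0) ->
     exists k : C, hasD g (pt x y) k) ->
  rect_int g a b c d = 0.
Proof.
move=> ax xb cy yd gc gD.
have [M M0 [d0 d00 gM]] : exists2 M, 0 < M & exists2 d0, 0 < d0 &
    forall w, cmod (w - pt x0 y0) < d0 -> cmod (g w) <= M.
  have := gc x0 y0 (ltW ax) (ltW xb) (ltW cy) (ltW yd).
  move/cvgCCP/(_ _ ltr01) => [d0 d00 dP].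
  exists (cmod (g (pt x0 y0)) + 1); first by rewrite ltr_wpDl ?cmod_ge0.
  exists d0 => // w /dP wd; rewrite addrC -lerBlDr (le_trans (cmod_subl _ _))//.
  exact: ltW.
apply/eqP; rewrite -cmod_eq0 eq_le cmod_ge0 andbT; apply/ler_addgt0Pl => e e0.
rewrite addr0.
have [D [D0 D1 [D2 D3] [D4 D5] D6]] : exists D : R, [/\ 0 < D, 2 * D < d0,
    D < x0 - a /\ D < b - x0, D < y0 - c /\ D < d - y0 & 8 * M * D <= e].
  pose D := Num.min (Num.min (d0 / 4) (e / (8 * M)))
    (Num.min (Num.min ((x0 - a) / 2) ((b - x0) / 2))
             (Num.min ((y0 - c) / 2) ((d - y0) / 2))).
  have DE : 0 < D by rewrite !lt_min !divr_gt0 ?subr_gt0 ?mulr_gt0.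
  have : D <= D := lexx D.
  rewrite {2}/D !le_min => /and3P[/andP[d1 d2] /andP[d3 d4] /andP[d5 d6]].
  exists D; split => //; [lra|split; lra|split; lra|].
  by rewrite mulrC -ler_pdivlMr// mulr_gt0.
have W (a' b' c' d' : R) : a <= a' -> b' <= b -> c <= c' -> d' <= d ->
    cont_rect g a' b' c' d' by move=> *; exact: cont_rectW gc.
have Z (a' b' c' d' : R) : a <= a' -> b' <= b -> c <= c' -> d' <= d ->
    a' <= b' -> c' <= d' ->
    (forall x y, a' <= x -> x <= b' -> c' <= y -> y <= d' -> (x, y) != (x0, y0)) ->
    rect_int g a' b' c' d' = 0.
  move=> aa bb cc dd ab cd ne; apply: Goursat => // x y a'x xb' c'y yd'.
  apply: gD; rewrite ?(le_trans aa) ?(le_trans xb') ?(le_trans cc) ?(le_trans yd')//.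
  exact: ne.
have neX (x y : R) : x != x0 -> (x, y) != (x0, y0).
  by move=> h; rewrite xpair_eqE negb_and h.
have neY (x y : R) : y != y0 -> (x, y) != (x0, y0).
  by move=> h; rewrite xpair_eqE negb_and h orbT.
rewrite (@rect_int_splitx R g a (x0 - D) b c d); [|lra|lra|lra|exact: W].
rewrite (@rect_int_splitx R g (x0 - D) (x0 + D) b c d); [|lra|lra|lra|by apply: W; lra].
rewrite (@Z a (x0 - D) c d); try lra; last first.
  by move=> x y *; apply: neX; apply/eqP; lra.
rewrite (@Z (x0 + D) b c d); try lra; last first.
  by move=> x y *; apply: neX; apply/eqP; lra.
rewrite add0r addr0.
rewrite (@rect_int_splity R g _ _ c (y0 - D) d); [|lra|lra|lra|by apply: W; lra].
rewrite (@rect_int_splity R g _ _ (y0 - D) (y0 + D) d); [|lra|lra|lra|by apply: W; lra].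
rewrite (@Z _ _ c (y0 - D)); try lra; last first.
  by move=> x y *; apply: neY; apply/eqP; lra.
rewrite (@Z _ _ (y0 + D) d); try lra; last first.
  by move=> x y *; apply: neY; apply/eqP; lra.
rewrite add0r addr0.
rewrite (le_trans (@rect_int_bound R g _ _ _ _ M _ _ _ _)); [by []|lra|lra| | |lra].
  by apply: W; lra.
move=> x y h1 h2 h3 h4; apply: gM; rewrite (le_lt_trans (cmod_le_ReIm _))//.
rewrite cReB cImB /= (le_lt_trans _ D1)// mulr2n mulrDl mul1r lerD// ler_norml;
  by apply/andP; split; lra.
Qed.

(** The exponential maps the rectangle [[ln r1, ln r2] x [th - pi, th + pi]] onto the annulus. The
    horizontal sides cancel by periodicity and the vertical ones are the two means. Centring the
    window at the argument [th] of [z - p] puts the exceptional point in the interior of the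
    rectangle. *)
Lemma annulus_mean (f : C -> C) (p z : C) (r1 r2 : R) :
  0 < r1 -> r1 < cmod (z - p) -> cmod (z - p) < r2 ->
  (forall w, r1 <= cmod (w - p) -> cmod (w - p) <= r2 -> {for w, continuous f}) ->
  (forall w, r1 <= cmod (w - p) -> cmod (w - p) <= r2 -> w != z ->
     exists k : C, hasD f w k) ->
  cmean (fun t => f (circ p r1 t)) = cmean (fun t => f (circ p r2 t)).
Proof.
move=> r10 r1z zr2 fc fD.
have z0 : 0 < cmod (z - p) by exact: lt_trans r1z.
have r20 : 0 < r2 by exact: lt_trans zr2.
have [th thpi zE] : exists2 t : R, pi <= t & z - p = rc (cmod (z - p)) * expi t.
  by apply: polar; rewrite -cmod_gt0.
have pp := pi_gt0 R.
have cE (x y : R) : cmod (p + cexp (pt x y) - p) = expR x.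
  by rewrite addrC addKr cmod_cexp.
have r12 (x : R) : ln r1 <= x -> x <= ln r2 -> r1 <= expR x /\ expR x <= r2.
  by move=> h1 h2; rewrite -ler_expR lnK// in h1; rewrite -ler_expR lnK// in h2.
have I0 : rect_int (fun u => f (p + cexp u)) (ln r1) (ln r2) (th - pi) (th + pi) = 0.
  apply: (@Goursat_except _ _ _ _ _ (ln (cmod (z - p))) th).
  - by rewrite ltr_ln.
  - by rewrite ltr_ln.
  - by lra.
  - by lra.
  - move=> x y h1 h2 _ _; have [h3 h4] := r12 x h1 h2.
    apply: (@contC_comp R (fun u => p + cexp u)).
      by apply: contC_D; [exact: contC_cst|exact: hasD_cvg (hasD_cexp _)].
    by apply: fc; rewrite cE.
  - move=> x y h1 h2 h3 h4 ne; have [h5 h6] := r12 x h1 h2.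
    have [k fk] : exists k : C, hasD f (p + cexp (pt x y)) k.
      apply: fD; rewrite ?cE//; apply: contra ne => /eqP /(congr1 (fun w => w - p)).
      rewrite addrC addKr => E0; have {E0}E := etrans E0 zE.
      have xE : x = ln (cmod (z - p)).
        move/(congr1 (@cmod R)): E.
        by rewrite cmod_cexp cmodM cmod_expi mulr1 cmod_rc_ge0 ?cmod_ge0// => <-; rewrite expRK.
      rewrite xpair_eqE -xE eqxx /=; move: E; rewrite xE cexp_pt// => E.
      have {}E : expi y = expi th :> C.
        by apply: mulfI E; rewrite rc_eq0 gt_eqF.
      have : y - th = 0.
        apply: (expi_eq1 (R := R)); first by rewrite ler_norml; apply/andP; split; lra.
        by rewrite expiD expi_inv E divff// expi_neq0.
      by move/eqP; rewrite subr_eq0.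
    exists (k * (0 + cexp (pt x y))).
    apply: (@hasD_comp R f (fun u => p + cexp u)); last exact: fk.
    by apply: hasD_add; [exact: hasD_cst|exact: hasD_cexp].
have cl (r : R) : 0 < r -> r1 <= r -> r <= r2 -> continuous (fun t => f (circ p r t)).
  move=> r0 rr1 rr2 t; apply: (@continuous_comp _ _ _ (circ p r) f).
    exact: cont_circ.
  by apply: fc; rewrite cmod_circ// ltW.
have r1r2 : r1 <= r2 by exact/ltW/(lt_trans r1z).
move: I0; rewrite /rect_int.
have -> : cint (ln r1) (ln r2) (fun x => f (p + cexp (pt x (th - pi)))) =
    cint (ln r1) (ln r2) (fun x => f (p + cexp (pt x (th + pi)))).
  apply: cint_eq => x _ _; congr (f (p + _)); rewrite /cexp /=; congr (_ * _).
  by rewrite -expi_2pi; congr expi; ring.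
rewrite subrr add0r => /eqP; rewrite mulf_eq0 (negbTE (neq0Ci _)) /= subr_eq0 => /eqP.
have sw (r : R) : 0 < r -> r1 <= r -> r <= r2 ->
   cint (th - pi) (th + pi) (fun y => f (p + cexp (pt (ln r) y))) =
   cint 0 (2 * pi) (fun t => f (circ p r t)).
  move=> r0 rr1 rr2.
  transitivity (cint (th - pi) (th + pi) (fun t => f (circ p r t))).
    by apply: cint_eq => y _ _; rewrite cexp_pt.
  have -> : th + pi = (th - pi) + 2 * pi by ring.
  apply: cmean_period; [lra|exact: cl|by move=> t; rewrite circ_2pi].
by rewrite !sw// => E; rewrite /cmean E.
Qed.

Lemma cont_fcirc (f : C -> C) (p : C) (r : R) : 0 <= r ->
  (forall w, cmod (w - p) = r -> {for w, continuous f}) ->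
  continuous (fun t => f (circ p r t)).
Proof.
move=> r0 fc t; apply: (@continuous_comp _ _ _ (circ p r) f).
  exact: cont_circ.
by apply: fc; rewrite cmod_circ.
Qed.

(* Means over concentric circles agree and tend to the value at the centre. *)
Lemma mean_value_except (f : C -> C) (p z : C) (r : R) :
  z != p -> cmod (z - p) < r ->
  (forall w, cmod (w - p) <= r -> {for w, continuous f}) ->
  (forall w, cmod (w - p) <= r -> w != p -> w != z -> exists k : C, hasD f w k) ->
  cmean (fun t => f (circ p r t)) = f p.
Proof.
move=> zp zr fc fD.
have z0 : 0 < cmod (z - p) by rewrite cmod_gt0 subr_eq0.
have r0 : 0 < r by exact: lt_trans zr.
apply/eqP; rewrite -subr_eq0 -cmod_eq0 eq_le cmod_ge0 andbT.
apply/ler_addgt0Pl => e e0; rewrite addr0.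
have /cvgCCP/(_ _ e0)[d d0 dP] : {for p, continuous f}.
  by apply: fc; rewrite subrr cmod0 ltW.
pose s := Num.min (d / 2) (cmod (z - p) / 2).
have s0 : 0 < s by rewrite lt_min !divr_gt0.
have sd : s < d.
  by rewrite (@le_lt_trans _ _ (d / 2)) ?ge_min ?lexx// gtr_pMr// invf_lt1// ltr1n.
have sz : s < cmod (z - p).
  rewrite (@le_lt_trans _ _ (cmod (z - p) / 2)) ?ge_min ?lexx ?orbT//.
  by rewrite gtr_pMr// invf_lt1// ltr1n.
rewrite -(@annulus_mean f p z s r)//; last first.
- move=> w sw wr wz; apply: fD => //.
  by apply: contraTneq sw => ->; rewrite subrr cmod0 -ltNge.
- by move=> w _; exact: fc.
have cl : continuous (fun t => f (circ p s t)).
  apply: cont_fcirc; first exact: ltW.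
  by move=> w ws; apply: fc; rewrite ws; exact/ltW/(lt_trans sz).
have ccst : continuous (fun _ : R => f p) by move=> t; exact: cvg_cst.
rewrite -[X in cmod (_ - X)](cmean_cst (f p)) -(cmeanB cl ccst).
apply: cmean_bound; first by move=> t; exact: cvgB (cl t) (ccst t).
by move=> t; apply/ltW/dP; rewrite cmod_circ// ltW.
Qed.

Lemma mean_value (f : C -> C) (p : C) (r : R) : 0 < r ->
  (forall w, cmod (w - p) <= r -> exists k : C, hasD f w k) ->
  cmean (fun t => f (circ p r t)) = f p.
Proof.
(* Any point strictly between the centre and the circle can play the exceptional point. *)
move=> r0 fD; apply: (@mean_value_except f p (p + rc (r / 2))).
- rewrite -subr_eq0 addrC addKr rc_eq0 gt_eqF// divr_gt0//.
- rewrite addrC addKr cmod_rc_ge0 ?divr_ge0 ?ltW//.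
  by rewrite gtr_pMr// invf_lt1// ltr1n.
- by move=> w /fD[k /hasD_cvg].
- by move=> w /fD.
Qed.

End Cauchy.

(** * Power series and termwise differentiation *)

Section PowerSeries.
Variable R : realType.
Local Notation C := (cplx R).
Local Notation Re := (@complex.Re R).
Local Notation Im := (@complex.Im R).
Local Notation rc := (@rc R).
Implicit Types (c : nat -> C) (rho r : R) (z h : C) (f g : C -> C).

(** Cauchy's estimates taken as a hypothesis: the power series with coefficients [c] has radius of
    convergence at least [rho]. *)
Definition growth rho c := forall r, 0 < r -> r < rho ->
  exists2 M : R, 0 <= M & forall k, cmod (c k) <= M / r ^+ k.

Definition dcoef c : nat -> C := fun k => k.+1%:R * c k.+1.

Definition psum c z : C :=
  (limn (series (fun k => Re (c k * z ^+ k))) +i*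
   limn (series (fun k => Im (c k * z ^+ k))))%C.

Lemma geometric_cvg_series (u : nat -> R) (M q : R) : 0 <= q -> q < 1 ->
  (forall k, `|u k| <= M * q ^+ k) -> cvgn (series u).
Proof.
move=> q0 q1 uM; apply: normed_cvg.
apply: (@series_le_cvg _ _ (geometric M q)) => [k|k|k|].
- exact: normr_ge0.
- by rewrite (le_trans _ (uM k)).
- exact: uM.
- by apply: is_cvg_geometric_series; rewrite ger0_norm.
Qed.

Lemma between (x y : R) : x < y -> exists2 r : R, x < r & r < y.
Proof. by move=> xy; exists ((x + y) / 2); lra. Qed.

Lemma growth_term rho c z : growth rho c -> cmod z < rho ->
  exists M q : R, [/\ 0 <= M, 0 <= q, q < 1 &
    forall k, cmod (c k * z ^+ k) <= M * q ^+ k].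
Proof.
move=> gc zr; have [r r1 r2] := between zr.
have r0 : 0 < r by rewrite (le_lt_trans (cmod_ge0 z)).
have [M M0 cM] := gc r r0 r2; exists M, (cmod z / r); split => //.
- by rewrite divr_ge0 ?cmod_ge0// ltW.
- by rewrite ltr_pdivrMr// mul1r.
- move=> k; rewrite cmodM cmodX expr_div_n mulrCA mulrC.
  by apply: ler_wpM2l => //; rewrite exprn_ge0// cmod_ge0.
Qed.

Lemma sum_Re (F : nat -> C) n : Re (\sum_(0 <= k < n) F k) = \sum_(0 <= k < n) Re (F k).
Proof.
by elim: n => [|n IH]; [rewrite !big_nil|rewrite !big_nat_recr//= cReD IH].
Qed.
Lemma sum_Im (F : nat -> C) n : Im (\sum_(0 <= k < n) F k) = \sum_(0 <= k < n) Im (F k).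
Proof.
by elim: n => [|n IH]; [rewrite !big_nil|rewrite !big_nat_recr//= cImD IH].
Qed.

Lemma psumP rho c z : growth rho c -> cmod z < rho ->
  forall e : R, 0 < e -> exists N, forall n, (N <= n)%N ->
    cmod (psum c z - \sum_(0 <= k < n) c k * z ^+ k) < e.
Proof.
move=> gc zr e e0; have [M [q [M0 q0 q1 cM]]] := growth_term gc zr.
have e2 : 0 < e / 2 by rewrite divr_gt0.
have cr : cvgn (series (fun k => Re (c k * z ^+ k))).
  apply: (geometric_cvg_series (M := M) q0 q1) => k.
  by rewrite (le_trans (normRe_le _)).
have ci : cvgn (series (fun k => Im (c k * z ^+ k))).
  apply: (geometric_cvg_series (M := M) q0 q1) => k.
  by rewrite (le_trans (normIm_le _)).
move/cvgrPdist_lt/(_ _ e2): cr => [N1 _ N1P].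
move/cvgrPdist_lt/(_ _ e2): ci => [N2 _ N2P].
exists (maxn N1 N2) => n; rewrite geq_max => /andP[/N1P h1 /N2P h2].
rewrite (le_lt_trans (cmod_le_ReIm _))// cReB cImB sum_Re sum_Im (splitr e).
by apply: ltrD.
Qed.

Lemma psum_uniq rho c z l : growth rho c -> cmod z < rho ->
  (forall e : R, 0 < e -> exists N, forall n, (N <= n)%N ->
    cmod (l - \sum_(0 <= k < n) c k * z ^+ k) < e) -> l = psum c z.
Proof.
move=> gc zr lP; apply/eqP; rewrite -subr_eq0 -cmod_eq0 eq_le cmod_ge0 andbT.
apply/ler_addgt0Pl => e e0; rewrite addr0; have e2 : 0 < e / 2 by rewrite divr_gt0.
have [N1 N1P] := lP _ e2; have [N2 N2P] := psumP gc zr e2.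
rewrite (le_trans (cmod_trian (\sum_(0 <= k < maxn N1 N2) c k * z ^+ k) _ _))//.
rewrite (splitr e) lerD//; first by rewrite ltW// N1P// leq_maxl.
by rewrite cmodB ltW// N2P// leq_maxr.
Qed.

Lemma bernoulli_le (x : R) n : 0 <= x -> n%:R * x <= (1 + x) ^+ n.
Proof.
move=> x0; elim: n => [|n IH]; first by rewrite mul0r expr0.
have h : 1 <= (1 + x) ^+ n by rewrite exprn_ege1// lerDl.
rewrite exprS -natr1 mulrDl mul1r mulrDl mul1r lerD//.
by rewrite ler_peMr.
Qed.

(** The factor [k.+1] is absorbed by passing from [r] to a larger [s < rho]: Bernoulli's inequality
    bounds it by a constant times [(s / r) ^+ k.+1]. *)
Lemma growth_dcoef rho c : growth rho c -> growth rho (dcoef c).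
Proof.
move=> gc r r0 rr; have [s s1 s2] := between rr.
have s0 : 0 < s by exact: lt_trans s1.
have [M M0 cM] := gc s s0 s2.
pose x := s / r - 1.
have x0 : 0 < x by rewrite subr_gt0 ltr_pdivlMr// mul1r.
exists (M / x / r); first by rewrite !divr_ge0// ltW.
move=> k; rewrite /dcoef cmodM -rc_nat cmod_rc_ge0//.
have bk := bernoulli_le k.+1 (ltW x0).
have E : 1 + x = s / r by rewrite /x addrC subrK.
rewrite E expr_div_n in bk.
rewrite (le_trans (ler_wpM2l _ (cM k.+1)))//.
have -> : M / x / r / r ^+ k = M / x / r ^+ k.+1.
  by rewrite exprS invfM mulrA.
have sk : 0 < s ^+ k.+1 by rewrite exprn_gt0.
have rk : 0 < r ^+ k.+1 by rewrite exprn_gt0.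
rewrite mulrCA -mulrA; apply: ler_wpM2l => //.
rewrite ler_pdivrMr// -(ler_pM2r x0) (le_trans bk)//.
have -> : x^-1 / r ^+ k.+1 * s ^+ k.+1 * x = s ^+ k.+1 / r ^+ k.+1 * (x^-1 * x).
  by ring.
by rewrite mulVf ?mulr1// gt_eqF.
Qed.

(** The factor [k * k.+1] is that of the twice differentiated series, so these remainders stay
    summable against the coefficients. *)
Lemma pow_taylor z h r k : cmod z <= r -> cmod (z + h) <= r ->
  cmod ((z + h) ^+ k.+1 - z ^+ k.+1 - k.+1%:R * z ^+ k * h) <=
    (k * k.+1)%:R * r ^+ k.-1 * cmod h ^+ 2.
Proof.
move=> zr zhr; have r0 : 0 <= r by exact: le_trans (cmod_ge0 z) zr.
elim: k => [|k IH].
  rewrite mul0n !mul0r !expr1 expr0 mulr1 mul1r.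
  by rewrite [z + h]addrC addrK subrr cmod0.
have -> : (z + h) ^+ k.+2 - z ^+ k.+2 - k.+2%:R * z ^+ k.+1 * h =
   (z + h) * ((z + h) ^+ k.+1 - z ^+ k.+1 - k.+1%:R * z ^+ k * h) +
   k.+1%:R * z ^+ k * h ^+ 2.
  by rewrite !exprS -[k.+2%:R]natr1; ring.
rewrite (le_trans (cmodD _ _))// !cmodM !cmodX -rc_nat cmod_rc_ge0//.
have h1 : cmod (z + h) * cmod ((z + h) ^+ k.+1 - z ^+ k.+1 - rc k.+1%:R * z ^+ k * h)
    <= (k * k.+1)%:R * r ^+ k * cmod h ^+ 2.
  rewrite rc_nat (le_trans (ler_pM (cmod_ge0 _) (cmod_ge0 _) zhr IH))//.
  case: k {IH} => [|k]; first by rewrite mul0n !mul0r mulr0.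
  rewrite -pred_Sn [r ^+ k.+1]exprS le_eqVlt; apply/orP; left; apply/eqP.
  by move: (_%:R) (r ^+ k) (cmod h ^+ 2) => *; ring.
have h2 : k.+1%:R * cmod z ^+ k * cmod h ^+ 2 <= k.+1%:R * r ^+ k * cmod h ^+ 2.
  apply: ler_wpM2r; first exact: sqr_ge0.
  by apply: ler_wpM2l => //; apply: lerXn2r; rewrite ?nnegrE ?cmod_ge0.
rewrite (le_trans (lerD h1 h2))// -!mulrDl -natrD /=.
apply: ler_wpM2r; first exact: sqr_ge0.
apply: ler_wpM2r; first exact: exprn_ge0.
by rewrite ler_nat -mulSnr leq_mul2l leqnSn orbT.
Qed.

Lemma geometric_sum_le (q : R) n : 0 <= q -> q < 1 ->
  \sum_(0 <= k < n) q ^+ k <= (1 - q)^-1.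
Proof.
move=> q0 q1; have q1' : 0 < 1 - q by rewrite subr_gt0.
have E : (1 - q) * \sum_(0 <= k < n) q ^+ k = 1 - q ^+ n.
  elim: n => [|n IH]; first by rewrite big_nil mulr0 expr0 subrr.
  by rewrite big_nat_recr//= mulrDr IH exprS; ring.
by rewrite -[leRHS]mul1r ler_pdivlMr// mulrC E lerBlDl lerDr exprn_ge0.
Qed.

(** The partial sums have first-order remainders bounded by [B * cmod h ^+ 2] with [B] independent
    of their length; the bound passes to the limit, and a quadratic remainder gives the
    derivative. *)
Lemma hasD_psum rho c z : growth rho c -> cmod z < rho ->
  hasD (psum c) z (psum (dcoef c) z).
Proof.
move=> gc zr; have gd := growth_dcoef gc; have gdd := growth_dcoef gd.
have [r r1 r2] := between zr; have [s s1 s2] := between r2.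
have r0 : 0 < r by rewrite (le_lt_trans (cmod_ge0 z)).
have s0 : 0 < s by exact: lt_trans s1.
have [M M0 cM] := gdd s s0 s2.
have q0 : 0 <= r / s by rewrite divr_ge0 ?ltW.
have q1 : r / s < 1 by rewrite ltr_pdivrMr// mul1r.
pose B := M / (1 - r / s) + 1.
have B0 : 0 < B by rewrite ltr_wpDl// divr_ge0// subr_ge0 ltW.
have key h : cmod h < r - cmod z ->
    cmod (psum c (z + h) - psum c z - psum (dcoef c) z * h) <= B * cmod h ^+ 2.
  move=> hr; have zhr : cmod (z + h) <= r.
    by rewrite (le_trans (cmodD _ _))// -lerBrDl ltW.
  have zhrho : cmod (z + h) < rho by exact: le_lt_trans r2.
  apply/ler_addgt0Pl => e e0.
  have e3 : 0 < e / (3 * (1 + cmod h)).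
    by rewrite divr_gt0// mulr_gt0// ltr_pwDl// cmod_ge0.
  have [N1 P1] := psumP gc zhrho e3.
  have [N2 P2] := psumP gc zr e3.
  have [N3 P3] := psumP gd zr e3.
  pose n := maxn N1 (maxn N2 N3).
  have {}P1 : cmod (psum c (z + h) - \sum_(0 <= k < n.+1) c k * (z + h) ^+ k) < e / (3 * (1 + cmod h)).
    by apply: P1; rewrite leqW// leq_maxl.
  have {}P2 : cmod (psum c z - \sum_(0 <= k < n.+1) c k * z ^+ k) < e / (3 * (1 + cmod h)).
    by apply: P2; rewrite leqW// /n maxnCA leq_maxl.
  have {}P3 : cmod (psum (dcoef c) z - \sum_(0 <= k < n) dcoef c k * z ^+ k) < e / (3 * (1 + cmod h)).
    by apply: P3; rewrite /n !leq_max leqnn !orbT.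
  have S : cmod (\sum_(0 <= k < n.+1) c k * (z + h) ^+ k -
      \sum_(0 <= k < n.+1) c k * z ^+ k - (\sum_(0 <= k < n) dcoef c k * z ^+ k) * h)
      <= B * cmod h ^+ 2.
    rewrite big_nat_recl// [X in _ - X - _]big_nat_recl// !expr0.
    have -> : c 0%N * 1 + \sum_(0 <= i < n) c i.+1 * (z + h) ^+ i.+1 -
       (c 0%N * 1 + \sum_(0 <= i < n) c i.+1 * z ^+ i.+1) -
       (\sum_(0 <= k < n) dcoef c k * z ^+ k) * h =
       \sum_(0 <= i < n) c i.+1 * ((z + h) ^+ i.+1 - z ^+ i.+1 - i.+1%:R * z ^+ i * h).
      rewrite mulr_suml opprD addrACA subrr add0r -!sumrB.
      by apply: eq_bigr => i _; rewrite /dcoef; ring.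
    rewrite (le_trans (cmod_sum _ _ _))//.
    apply: (@le_trans _ _ (\sum_(0 <= i < n) (M * cmod h ^+ 2) * (if i is j.+1 then (r / s) ^+ j else 0))).
      apply: ler_sum => i _; rewrite cmodM.
      rewrite (le_trans (ler_wpM2l (cmod_ge0 _) (pow_taylor i (ltW r1) zhr)))//.
      case: i => [|i]; first by rewrite mul0n !mul0r !mulr0.
      have := cM i; rewrite /dcoef !cmodM -!rc_nat !cmod_rc_ge0// => ci.
      rewrite /= expr_div_n natrM.
      have ri : 0 <= r ^+ i * cmod h ^+ 2 by rewrite mulr_ge0 ?sqr_ge0// exprn_ge0// ltW.
      have := ler_wpM2r ri ci.
      by congr (_ <= _); [ring|field; rewrite expf_neq0 ?gt_eqF].
    rewrite -mulr_sumr mulrAC; apply: ler_wpM2r; first exact: sqr_ge0.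
    apply: (@le_trans _ _ (M / (1 - r / s))); last by rewrite lerDl.
    apply: ler_wpM2l => //; case: (n) => [|m].
      by rewrite big_nil invr_ge0 subr_ge0 ltW.
    by rewrite big_nat_recl// add0r geometric_sum_le.
  set A1 := \sum_(0 <= k < n.+1) c k * (z + h) ^+ k in P1 S.
  set A2 := \sum_(0 <= k < n.+1) c k * z ^+ k in P2 S.
  set A3 := \sum_(0 <= k < n) dcoef c k * z ^+ k in P3 S.
  clearbody A1 A2 A3; move: (psum c (z + h)) (psum c z) (psum (dcoef c) z) P1 P2 P3 => U V W P1 P2 P3.
  have -> : U - V - W * h =
    (A1 - A2 - A3 * h) + ((U - A1) - (V - A2) - (W - A3) * h) by ring.
  rewrite (le_trans (cmodD _ _))// addrC lerD//.
  rewrite (le_trans (cmod_leB _ _))// cmodM.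
  have hh := cmod_ge0 h.
  have eE : 3 * (e / (3 * (1 + cmod h))) * (1 + cmod h) = e by field; lra.
  move: eE P1 P2 P3 e3; move: (e / (3 * (1 + cmod h))) => E eE P1 P2 P3 e3.
  have h1 : 0 <= E * cmod h by rewrite mulr_ge0// ltW.
  have h2 := ler_wpM2r hh (ltW P3).
  have h3 := cmod_leB (U - A1) (V - A2).
  rewrite -eE; move: h1 h2 h3 P1 P2 e3; clear; lra.
apply/hasDP => e e0; exists (Num.min (r - cmod z) (e / B)).
  by rewrite lt_min subr_gt0 r1 divr_gt0.
move=> h; rewrite lt_min => /andP[hr he]; rewrite (le_trans (key h hr))//.
rewrite expr2 mulrA; apply: ler_wpM2r; first exact: cmod_ge0.
by rewrite mulrC -ler_pdivlMr// ltW.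
Qed.

End PowerSeries.

(** * The Cauchy formula and Taylor expansions *)

Section Taylor.
Variable R : realType.
Local Notation C := (cplx R).
Local Notation Re := (@complex.Re R).
Local Notation Im := (@complex.Im R).
Local Notation rc := (@rc R).
Implicit Types (c : nat -> C) (rho r : R) (z w h : C) (f g : C -> C).

Definition hol rho f := forall w, cmod w < rho -> exists k : C, hasD f w k.

Lemma hol_cont rho f w : hol rho f -> cmod w < rho -> {for w, continuous f}.
Proof. by move=> fh /fh[k /hasD_cvg]. Qed.

Lemma cont_hol_circ rho f r : hol rho f -> 0 <= r -> r < rho ->
  continuous (fun t => f (circ 0 r t)).
Proof.
move=> fh r0 rr; apply: cont_fcirc => // w.
by rewrite subr0 => wr; apply: hol_cont fh _; rewrite wr.
Qed.

Lemma cmod_circ0 r t : 0 <= r -> cmod (circ 0 r t) = r.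
Proof. by move=> r0; rewrite -{2}(cmod_circ 0 t r0) subr0. Qed.

Lemma circ_neq0 r t : 0 < r -> circ 0 r t != 0.
Proof. by move=> r0; rewrite -cmod_gt0 cmod_circ0// ltW. Qed.

Lemma cmean_conj (h : R -> C) : continuous h ->
  cmean (fun t => (h t)^*) = (cmean h)^*.
Proof.
move=> hc; apply: complexP.
  transitivity (Re (cmean h)); last by case: (cmean h).
  by rewrite !Re_cmean; apply: tmean_eq => t; case: (h t).
transitivity (- Im (cmean h)); last by case: (cmean h).
rewrite !Im_cmean -tmeanN; first by apply: tmean_eq => t; case: (h t).
by move=> t; apply: (@continuous_comp _ _ _ h Im t (hc t)); exact: cont_Im.
Qed.

Lemma cont_comp_RC (h : R -> C) f : continuous h ->
  (forall t, {for h t, continuous f}) -> continuous (fun t => f (h t)).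
Proof. by move=> hc fc t; exact: (@continuous_comp _ _ _ h f t (hc t) (fc t)). Qed.

(** On [|w| = r] the kernel [w / (w - z)] is the conjugate of [1 / (1 - conj z * w / r^2)], which is
    holomorphic on the closed disc and equals 1 at the origin. *)
Lemma cauchy_kernel_mean z r : cmod z < r ->
  cmean (fun t => circ 0 r t / (circ 0 r t - z)) = 1.
Proof.
move=> zr; have r0 : 0 < r by exact: le_lt_trans (cmod_ge0 z) zr.
pose u w := (1 - rc (r ^- 2) * z^* * w)^-1.
have nz w : cmod w <= r -> 1 - rc (r ^- 2) * z^* * w != 0.
  move=> wr; rewrite subr_eq0; apply/eqP => /(congr1 (@cmod R)).
  rewrite cmod1 !cmodM cmod_conj cmod_rc_ge0 ?invr_ge0 ?exprn_ge0 ?ltW// => /esym/eqP.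
  apply/negP; rewrite lt_eqF// -mulrA mulrC ltr_pdivrMr ?exprn_gt0// mul1r.
  rewrite expr2 (le_lt_trans (ler_wpM2l (cmod_ge0 _) wr))//.
  by rewrite ltr_pM2r.
have uD w : cmod (w - 0) <= r -> exists k : C, hasD u w k.
  rewrite subr0 => wr; have D1 := hasD_cmul (rc (r ^- 2) * z^*) (hasD_id w).
  have D2 := hasD_sub (hasD_cst 1 w) D1.
  by eexists; exact: hasD_inv D2 (nz w wr).
have mu := mean_value r0 uD.
have cu : continuous (fun t => u (circ 0 r t)).
  apply: cont_fcirc; first exact: ltW.
  by move=> w wr; have [|k /hasD_cvg] := uD w; first by rewrite wr.
have := cmean_conj cu; rewrite mu /u mulr0 subr0 invr1 rmorph1 => <-.
apply: cmean_eq => t; rewrite rmorphV /=; last by rewrite unitfE nz// cmod_circ0// ltW.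
rewrite rmorphB rmorph1 !rmorphM /= conjCK.
set W := circ 0 r t; have W0 : W != 0 by exact: circ_neq0.
have -> : W^* = rc (r ^+ 2) / W.
  apply: (mulfI W0); rewrite mul_conj cmod_circ0 ?ltW// mulrCA divff ?mulr1//.
have -> : (rc (r ^- 2))^* = rc (r ^- 2) by apply: complexP; rewrite /= ?oppr0.
have -> : rc (r ^- 2) * z * (rc (r ^+ 2) / W) = z / W.
  have h : rc (r ^+ 2) != 0 by rewrite rc_eq0 expf_neq0// gt_eqF.
  transitivity ((rc (r ^+ 2))^-1 * rc (r ^+ 2) * (z / W)); last by rewrite mulVf ?mul1r.
  by rewrite rcV; ring.
have Wz : W - z != 0.
  rewrite subr_eq0; apply/eqP => Wz; move: zr.
  by rewrite -Wz cmod_circ0 ?ltxx// ltW.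
by field; rewrite W0 Wz.
Qed.

(** The difference quotient of [f] at [z], multiplied by [w], is continuous on the disc, holomorphic
    off [z] and zero at the origin. Its mean therefore vanishes, and what is left is [f z] times the
    mean of the kernel. *)
Lemma cauchy_formula rho f z r : hol rho f -> cmod z < r -> r < rho ->
  cmean (fun t => f (circ 0 r t) * (circ 0 r t / (circ 0 r t - z))) = f z.
Proof.
move=> fh zr rr; have r0 : 0 < r by exact: le_lt_trans (cmod_ge0 z) zr.
have cf := cont_hol_circ fh (ltW r0) rr.
have Wz t : circ 0 r t - z != 0.
  rewrite subr_eq0; apply/eqP => Wz; move: zr.
  by rewrite -Wz cmod_circ0 ?ltxx// ltW.
have [->|z0] := eqVneq z 0.
  transitivity (cmean (fun t => f (circ 0 r t))).
    by apply: cmean_eq => t; rewrite subr0 divff ?mulr1// circ_neq0.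
  apply: mean_value => // w; rewrite subr0 => wr.
  exact: fh (le_lt_trans wr rr).
have [k fk] := fh z (lt_trans zr rr).
pose K w := (if w == z then k else (f w - f z) / (w - z)) * w.
have KD w : cmod w < rho -> w != z -> exists l : C, hasD K w l.
  move=> wr wz; have [l fl] := fh w wr.
  have wz0 : w - z != 0 by rewrite subr_eq0.
  eexists; apply: (@hasD_near R (fun w => (f w - f z) / (w - z) * w) K w _ (cmod (w - z))).
  - by rewrite cmod_gt0.
  - move=> v vw; rewrite /K ifN//; apply: contraTneq vw => ->.
    by rewrite cmodB ltxx.
  - have D1 := hasD_sub fl (hasD_cst (f z) w).
    have D2 := hasD_sub (hasD_id w) (hasD_cst z w).
    exact: hasD_mul (hasD_div D1 D2 wz0) (hasD_id w).
have Kc w : cmod w < rho -> {for w, continuous K}.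
  move=> wr; have [->|wz] := eqVneq w z; last by have [l /hasD_cvg] := KD w wr wz.
  apply: contC_M; last exact: cvg_id.
  apply/cvgCCP => e e0; move/hasDP: fk => fk.
  have [d d0 dP] := fk (e / 2) (divr_gt0 e0 (ltr0n _ 2)).
  exists d => // v vd; rewrite eqxx; case: eqVneq => [_|vz].
    by rewrite subrr cmod0.
  have vz0 : v - z != 0 by rewrite subr_eq0.
  have := dP _ vd; rewrite [z + _]addrC subrK => h.
  have -> : (f v - f z) / (v - z) - k = (f v - f z - k * (v - z)) / (v - z) by field.
  rewrite cmod_div ltr_pdivrMr ?cmod_gt0// (le_lt_trans h)// ltr_pM2r ?cmod_gt0//.
  by rewrite gtr_pMr// invf_lt1// ltr1n.
have mK : cmean (fun t => K (circ 0 r t)) = K 0.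
  apply: (@mean_value_except _ K 0 z) => //; rewrite ?subr0//.
    by move=> w; rewrite subr0 => wr; apply: Kc; exact: le_lt_trans rr.
  by move=> w; rewrite subr0 => wr _; apply: KD; exact: le_lt_trans rr.
have c1 : continuous (fun t => circ 0 r t / (circ 0 r t - z)).
  apply: (@cont_comp_RC (circ 0 r) (fun w => w / (w - z))); first exact: cont_circ.
  move=> t; apply: contC_M; first exact: cvg_id.
  by apply: contC_V => //; apply: contC_B; [exact: cvg_id|exact: contC_cst].
have c2 : continuous (fun t => f (circ 0 r t) * (circ 0 r t / (circ 0 r t - z))).
  by move=> t; apply: cvgM; [exact: cf|exact: c1].
have c3 : continuous (fun t => f z * (circ 0 r t / (circ 0 r t - z))).
  by move=> t; apply: cvgM; [exact: cvg_cst|exact: c1].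
apply/eqP; rewrite -subr_eq0; apply/eqP; rewrite -[f z]mulr1.
rewrite -(cauchy_kernel_mean zr) -(cmeanZ (f z) c1) -(cmeanB c2 c3).
transitivity (cmean (fun t => K (circ 0 r t))); last by rewrite mK /K mulr0.
apply: cmean_eq => t; rewrite /K ifN; last by rewrite -subr_eq0.
by have := Wz t; move: (circ 0 r t) => W; move=> ?; field.
Qed.

(** Cauchy's integral for the [k]-th Taylor coefficient at the origin; by [coef_radius] it does not
    depend on [r]. *)
Definition coef f r (k : nat) : C :=
  cmean (fun t => f (circ 0 r t) * (circ 0 r t)^-1 ^+ k).

Lemma cont_circV r : 0 < r -> continuous (fun t => (circ 0 r t)^-1).
Proof.
move=> r0; apply: (@cont_comp_RC (circ 0 r) (fun w => w^-1)); first exact: cont_circ.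
by move=> t; apply: contC_V; [exact: circ_neq0|exact: cvg_id].
Qed.

Lemma cont_expC (h : R -> C) n : continuous h -> continuous (fun t => h t ^+ n).
Proof.
move=> hc; elim: n => [|n IH] t; first by rewrite /= ; exact: cvg_cst.
have -> : (fun t => h t ^+ n.+1) = (fun t => h t * h t ^+ n).
  by apply/funext => s; rewrite exprS.
by apply: cvgM; [exact: hc|exact: IH].
Qed.

Lemma cont_coef rho f r k : hol rho f -> 0 < r -> r < rho ->
  continuous (fun t => f (circ 0 r t) * (circ 0 r t)^-1 ^+ k).
Proof.
move=> fh r0 rr; have c1 := cont_hol_circ fh (ltW r0) rr.
have c2 := @cont_expC (fun t => (circ 0 r t)^-1) k (cont_circV r0).
by move=> t; apply: cvgM; [exact: c1|exact: c2].
Qed.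

Lemma coef_radius rho f r s k : hol rho f -> 0 < r -> r < s -> s < rho ->
  coef f r k = coef f s k.
Proof.
move=> fh r0 rs sr; have [m rm ms] := between rs.
have m0 := lt_trans r0 rm.
have zE : cmod (rc m - 0) = m by rewrite subr0 cmod_rc_ge0// ltW.
have D w : r <= cmod (w - 0) -> cmod (w - 0) <= s ->
    exists l : C, hasD (fun w => f w * w^-1 ^+ k) w l.
  rewrite subr0 => rw ws; have [l fl] := fh w (le_lt_trans ws sr).
  have w0 : w != 0 by rewrite -cmod_gt0 (lt_le_trans r0).
  eexists; apply: hasD_mul; first exact: fl.
  by apply: hasD_exp; exact: hasD_inv (hasD_id w) w0.
apply: (@annulus_mean R (fun w => f w * w^-1 ^+ k) 0 (rc m)) => //; rewrite ?zE//.
- by move=> w rw ws; have [l /hasD_cvg] := D w rw ws.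
- by move=> w rw ws _; exact: D.
Qed.

Lemma coef_bound rho f r k : hol rho f -> 0 < r -> r < rho ->
  cmod (coef f r k) <= tmean (fun t => cmod (f (circ 0 r t))) / r ^+ k.
Proof.
move=> fh r0 rr; rewrite (le_trans (cmean_le (@cont_coef rho f r k fh r0 rr)))//.
rewrite mulrC -tmeanZ; last first.
  move=> t; apply: (@continuous_comp _ _ _ (fun t => f (circ 0 r t)) (@cmod R)).
    exact: cont_hol_circ fh (ltW r0) rr t.
  exact: cont_cmod.
rewrite le_eqVlt; apply/orP; left; apply/eqP; apply: tmean_eq => t.
by rewrite cmodM cmodX cmodV cmod_circ0 ?ltW// mulrC exprVn.
Qed.

Lemma coef_growth rho f r0 : hol rho f -> 0 < r0 -> r0 < rho ->
  growth rho (coef f r0).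
Proof.
move=> fh r00 r0r r rgt0 rr.
exists (tmean (fun t => cmod (f (circ 0 r t)))).
  rewrite -(tmean_cst 0); apply: tmean_le => [t|t|t]; [exact: cvg_cst| |exact: cmod_ge0].
  apply: (@continuous_comp _ _ _ (fun t => f (circ 0 r t)) (@cmod R)).
    exact: cont_hol_circ fh (ltW rgt0) rr t.
  exact: cont_cmod.
move=> k; have [h|h|->] := ltgtP r r0; last exact: coef_bound fh _ _.
  by rewrite -(coef_radius k fh rgt0 h r0r); exact: coef_bound fh _ _.
by rewrite (coef_radius k fh r00 h rr); exact: coef_bound fh _ _.
Qed.

(** Subtracting one Taylor term multiplies the Cauchy kernel by [z / w]; after [n] terms the
    remainder is a mean that contains [(z / w)^n]. *)
Lemma taylor_remainder rho f z r n : hol rho f -> cmod z < r -> r < rho ->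
  cmod (f z - \sum_(0 <= k < n) coef f r k * z ^+ k) <=
  tmean (fun t => cmod (f (circ 0 r t))) * (r / (r - cmod z)) * (cmod z / r) ^+ n.
Proof.
move=> fh zr rr; have r0 : 0 < r by exact: le_lt_trans (cmod_ge0 z) zr.
have cf := cont_hol_circ fh (ltW r0) rr.
have W0 t : circ 0 r t != 0 by exact: circ_neq0.
have Wz t : circ 0 r t - z != 0.
  rewrite subr_eq0; apply/eqP => Wz; move: zr.
  by rewrite -Wz cmod_circ0 ?ltxx// ltW.
have ck : continuous (fun t => circ 0 r t / (circ 0 r t - z)).
  apply: (@cont_comp_RC (circ 0 r) (fun w => w / (w - z))); first exact: cont_circ.
  move=> t; apply: contC_M; first exact: cvg_id.
  by apply: contC_V => //; apply: contC_B; [exact: cvg_id|exact: contC_cst].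
have cg m : continuous (fun t => f (circ 0 r t) * ((z / circ 0 r t) ^+ m * (circ 0 r t / (circ 0 r t - z)))).
  move=> t; apply: cvgM; first exact: cf.
  apply: cvgM; last exact: ck.
  apply: (@cont_expC (fun t => z / circ 0 r t) m) => {}t.
  by apply: cvgM; [exact: cvg_cst|exact: (cont_circV r0)].
have E m : f z - \sum_(0 <= k < m) coef f r k * z ^+ k =
    cmean (fun t => f (circ 0 r t) * ((z / circ 0 r t) ^+ m * (circ 0 r t / (circ 0 r t - z)))).
  elim: m => [|m IH].
    rewrite big_nil subr0 -(cauchy_formula fh zr rr); apply: cmean_eq => t.
    by rewrite expr0 mul1r.
  rewrite big_nat_recr//= opprD addrA IH.
  have cc := @cont_coef rho f r m fh r0 rr.
  have ccz : continuous (fun t => z ^+ m * (f (circ 0 r t) * (circ 0 r t)^-1 ^+ m)).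
    by move=> t; apply: cvgM; [exact: cvg_cst|exact: cc].
  rewrite [_ * z ^+ m]mulrC -(cmeanZ (z ^+ m) cc) -(cmeanB (cg m) ccz).
  apply: cmean_eq => t; rewrite exprS expr_div_n exprVn.
  have := Wz t; have := W0 t; move: (circ 0 r t) => W W0' Wz'.
  by field; rewrite ?expf_neq0 ?W0' ?Wz'.
have rz : 0 < r - cmod z by rewrite subr_gt0.
rewrite E (le_trans (cmean_le (cg n)))//.
have ca : continuous (fun t => cmod (f (circ 0 r t))).
  move=> t; apply: (@continuous_comp _ _ _ (fun t => f (circ 0 r t)) (@cmod R)).
    exact: cf.
  exact: cont_cmod.
rewrite -mulrA mulrC -(tmeanZ _ ca); apply: tmean_le.
- move=> t; apply: (@continuous_comp _ _ _ (fun t => f (circ 0 r t) * _) (@cmod R)).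
    exact: cg.
  exact: cont_cmod.
- by move=> t; apply: cvgM; [exact: cvg_cst|exact: ca].
move=> t; have hz : cmod (z / circ 0 r t) = cmod z / r.
  by rewrite cmod_div cmod_circ0// ltW.
have hw : cmod (circ 0 r t / (circ 0 r t - z)) <= r / (r - cmod z).
  rewrite cmod_div (cmod_circ0 _ (ltW r0)); apply: ler_wpM2l; first exact: ltW.
  rewrite lef_pV2 ?posrE ?cmod_gt0//.
  by rewrite -[r in r - _](cmod_circ0 t (ltW r0)) cmod_subl.
rewrite cmodM [X in _ * X]cmodM cmodX hz [leLHS]mulrC.
apply: ler_wpM2r; first exact: cmod_ge0.
rewrite mulrC; apply: ler_wpM2r => //.
by rewrite exprn_ge0// divr_ge0 ?cmod_ge0// ltW.
Qed.

(* A fixed radius [r0] serves to compute all the Taylor coefficients. *)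
Theorem taylor rho f r0 z : hol rho f -> 0 < r0 -> r0 < rho -> cmod z < rho ->
  f z = psum (coef f r0) z.
Proof.
move=> fh r00 r0r zr; apply: (psum_uniq (coef_growth fh r00 r0r) zr) => e e0.
have [r1 zr1 r1r] := between zr.
have [r [zr' r0r' rr]] : exists r, [/\ cmod z < r, r0 < r & r < rho].
  have [|r] := @between R (Num.max r1 r0) rho; first by rewrite gt_max r1r.
  by rewrite gt_max => /andP[h1 h2] h3; exists r; split => //; exact: lt_trans h1.
have rgt0 := lt_trans r00 r0r'.
have q0 : 0 <= cmod z / r by rewrite divr_ge0 ?cmod_ge0// ltW.
have q1 : cmod z / r < 1 by rewrite ltr_pdivrMr// mul1r.
have L0 : 0 <= tmean (fun t => cmod (f (circ 0 r t))) * (r / (r - cmod z)).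
  rewrite mulr_ge0//; last by rewrite divr_ge0 ?subr_ge0 ?ltW.
  rewrite -(tmean_cst 0); apply: tmean_le => [t|t|t]; [exact: cvg_cst| |exact: cmod_ge0].
  apply: (@continuous_comp _ _ _ (fun t => f (circ 0 r t)) (@cmod R)).
    exact: cont_hol_circ fh (ltW rgt0) rr t.
  exact: cont_cmod.
have [N NP] := geometric_small L0 q0 q1 e0.
exists N => n /NP; apply: le_lt_trans.
have TR := @taylor_remainder rho f z r n fh zr' rr; apply: le_trans TR.
have -> : coef f r0 = coef f r.
  by apply/funext => k; exact: (@coef_radius rho f r0 r k fh r00 r0r' rr).
exact: lexx.
Qed.

Lemma hol_psum rho c : growth rho c -> hol rho (psum c).
Proof. by move=> gc w wr; eexists; exact: hasD_psum gc wr. Qed.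

Lemma hasD_taylor rho f r0 z : hol rho f -> 0 < r0 -> r0 < rho -> cmod z < rho ->
  hasD f z (psum (dcoef (coef f r0)) z).
Proof.
move=> fh r00 r0r zr; have gc := coef_growth fh r00 r0r.
have := hasD_psum gc zr; apply: (@hasD_near R _ _ _ _ (rho - cmod z)).
  by rewrite subr_gt0.
move=> w wz; apply/esym/(taylor fh r00 r0r).
rewrite -[w](subrK z) (le_lt_trans (cmodD _ _))//.
by rewrite -ltrBrDr.
Qed.

Lemma hol_derive rho f g : 0 < rho -> hol rho f ->
  (forall w, cmod w < rho -> hasD f w (g w)) -> hol rho g.
Proof.
move=> rho0 fh fg w wr; have [r0 r00 r0r] := between rho0.
have gc := growth_dcoef (coef_growth fh r00 r0r).
exists (psum (dcoef (dcoef (coef f r0))) w).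
have := hasD_psum gc wr; apply: (@hasD_near R _ _ _ _ (rho - cmod w)).
  by rewrite subr_gt0.
move=> v vw; have vr : cmod v < rho.
  by rewrite -[v](subrK w) (le_lt_trans (cmodD _ _))// -ltrBrDr.
exact: hasD_uniq (hasD_taylor fh r00 r0r vr) (fg v vr).
Qed.

Lemma hol_primitive rho f : 0 < rho -> hol rho f -> exists2 F : C -> C,
  F 0 = 0 & forall w, cmod w < rho -> hasD F w (f w).
Proof.
move=> rho0 fh; have [r0 r00 r0r] := between rho0.
have gc := coef_growth fh r00 r0r.
pose c (k : nat) : C := if k is j.+1 then coef f r0 j / j.+1%:R else 0.
have dc : dcoef c = coef f r0.
  apply/funext => k; rewrite /dcoef /c mulrCA -rc_nat -mulrA divff ?mulr1//.
  by rewrite rc_eq0 pnatr_eq0.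
have gC : growth rho c.
  move=> r rgt0 rr; have [M M0 MP] := gc r rgt0 rr.
  exists (M * r); first by rewrite mulr_ge0// ltW.
  case=> [|k]; first by rewrite cmod0 divr_ge0 ?exprn_ge0 ?mulr_ge0// ltW.
  rewrite /c cmod_div -rc_nat cmod_rc_ge0// exprS invfM mulrA mulfK ?gt_eqF//.
  rewrite (le_trans _ (MP k))// ler_piMr ?cmod_ge0// invf_le1 ?ltr0n//.
  by rewrite ler1n.
exists (psum c) => [|w wr]; last by rewrite (taylor fh r00 r0r wr) -dc; exact: hasD_psum gC wr.
apply/esym/(psum_uniq gC); first by rewrite cmod0.
move=> e e0; exists 0%N => n _; rewrite big1_seq ?subr0 ?cmod0// => k _.
by case: k => [|k]; rewrite ?mul0r// exprS mul0r mulr0.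
Qed.

End Taylor.

(** * Closure properties of holomorphic functions, maximum principle and Schwarz lemma *)

Section MaximumPrinciple.
Variable R : realType.
Local Notation C := (cplx R).
Local Notation Re := (@complex.Re R).
Local Notation Im := (@complex.Im R).
Local Notation rc := (@rc R).
Implicit Types (rho r : R) (z w a : C) (f g : C -> C).

Lemma hol_cst rho a : hol rho (fun=> a).
Proof. by move=> w _; eexists; exact: hasD_cst. Qed.
Lemma hol_id rho : hol rho (fun w : C => w).
Proof. by move=> w _; eexists; exact: hasD_id. Qed.
Lemma hol_add rho f g : hol rho f -> hol rho g -> hol rho (fun w => f w + g w).
Proof.
by move=> fh gh w wr; have [k fk] := fh w wr; have [l gl] := gh w wr;
  eexists; exact: hasD_add fk gl.
Qed.
Lemma hol_sub rho f g : hol rho f -> hol rho g -> hol rho (fun w => f w - g w).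
Proof.
by move=> fh gh w wr; have [k fk] := fh w wr; have [l gl] := gh w wr;
  eexists; exact: hasD_sub fk gl.
Qed.
Lemma hol_mul rho f g : hol rho f -> hol rho g -> hol rho (fun w => f w * g w).
Proof.
by move=> fh gh w wr; have [k fk] := fh w wr; have [l gl] := gh w wr;
  eexists; exact: hasD_mul fk gl.
Qed.
Lemma hol_exp rho f n : hol rho f -> hol rho (fun w => f w ^+ n).
Proof. by move=> fh w wr; have [k fk] := fh w wr; eexists; exact: hasD_exp fk. Qed.
Lemma hol_div rho f g : hol rho f -> hol rho g ->
  (forall w, cmod w < rho -> g w != 0) -> hol rho (fun w => f w / g w).
Proof.
by move=> fh gh g0 w wr; have [k fk] := fh w wr; have [l gl] := gh w wr;
  eexists; exact: hasD_div fk gl (g0 w wr).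
Qed.
Lemma hol_comp rho s f g : hol rho f -> hol s g ->
  (forall w, cmod w < rho -> cmod (f w) < s) -> hol rho (fun w => g (f w)).
Proof.
by move=> fh gh fs w wr; have [k fk] := fh w wr; have [l gl] := gh _ (fs w wr);
  eexists; exact: hasD_comp fk gl.
Qed.
Lemma hol_eq rho f g : (forall w, cmod w < rho -> f w = g w) -> hol rho f -> hol rho g.
Proof.
move=> fg fh w wr; have [k fk] := fh w wr; exists k; move: fk.
apply: (@hasD_near R f g w k (rho - cmod w)); first by rewrite subr_gt0.
move=> v vw; apply: fg; rewrite -[v](subrK w) (le_lt_trans (cmodD _ _))//.
by rewrite -ltrBrDr.
Qed.
Lemma hol_sub_radius rho s f : s <= rho -> hol rho f -> hol s f.
Proof. by move=> sr fh w ws; apply: fh; exact: lt_le_trans sr. Qed.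
Lemma hol_scale rho r f : 0 < r -> hol (r * rho) f -> hol rho (fun w => f (rc r * w)).
Proof.
move=> r0 fh w wr; have [|k fk] := fh (rc r * w).
  by rewrite cmodM cmod_rc_ge0 ?ltW// ltr_pM2l.
have D := hasD_cmul (rc r) (hasD_id w).
by eexists; exact: hasD_comp D fk.
Qed.

Lemma pow_bounded_le1 (x K : R) : 0 <= x -> (forall n, x ^+ n <= K) -> x <= 1.
Proof.
move=> x0 xK; rewrite leNgt; apply/negP => x1.
have d0 : 0 < x - 1 by rewrite subr_gt0.
have K0 : 0 <= K by rewrite (le_trans _ (xK 0%N))// expr0 ler01.
have [n Kn] : exists n : nat, K / (x - 1) < n%:R.
  exists (Num.bound (K / (x - 1))); apply: archi_boundP.
  by rewrite divr_ge0// ltW.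
rewrite ltr_pdivrMr// in Kn.
have := xK n; have := bernoulli_le n (ltW d0); rewrite [1 + _]addrC subrK.
by move=> h1 h2; have := lt_le_trans Kn (le_trans h1 h2); rewrite ltxx.
Qed.

(* Landau's trick: apply the Cauchy formula to the powers of [f]. *)
Lemma max_principle rho f r M z : hol rho f -> r < rho -> cmod z < r -> 0 <= M ->
  (forall w, cmod w = r -> cmod (f w) <= M) -> cmod (f z) <= M.
Proof.
move=> fh rr zr M0 fM; have r0 : 0 < r by exact: le_lt_trans (cmod_ge0 z) zr.
have Kc : continuous (fun t => circ 0 r t / (circ 0 r t - z)).
  apply: (@cont_comp_RC R (circ 0 r) (fun w => w / (w - z))); first exact: cont_circ.
  move=> t; apply: contC_M; first exact: cvg_id.
  apply: contC_V; last by apply: contC_B; [exact: cvg_id|exact: contC_cst].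
  rewrite subr_eq0; apply/eqP => Wz; move: zr.
  by rewrite -Wz (cmod_circ0 _ (ltW r0)) ltxx.
have key (M' : R) : M <= M' -> 0 < M' -> cmod (f z) <= M'.
  move=> MM' M'0; suff : cmod (f z) / M' <= 1 by rewrite ler_pdivrMr// mul1r.
  apply: (@pow_bounded_le1 _ (r / (r - cmod z))) => [|n].
    by rewrite divr_ge0 ?cmod_ge0// ltW.
  have fnh := hol_exp n fh.
  rewrite expr_div_n ler_pdivrMr ?exprn_gt0// -cmodX -(cauchy_formula fnh zr rr).
  apply: cmean_bound.
    have c1 := cont_hol_circ fnh (ltW r0) rr.
    by move=> t; apply: cvgM; [exact: c1|exact: Kc].
  move=> t; rewrite cmodM mulrC; apply: ler_pM; [exact: cmod_ge0|exact: cmod_ge0| |].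
    rewrite cmod_div (cmod_circ0 _ (ltW r0)); apply: ler_wpM2l; first exact: ltW.
    have h : 0 < r - cmod z by rewrite subr_gt0.
    have h2 : r - cmod z <= cmod (circ 0 r t - z).
      by rewrite -[r in r - _](cmod_circ0 t (ltW r0)) cmod_subl.
    by rewrite lef_pV2 ?posrE// (lt_le_trans h).
  rewrite cmodX; apply: lerXn2r; rewrite ?nnegrE ?cmod_ge0 ?(ltW M'0)//.
  by apply: le_trans MM'; apply: fM; rewrite cmod_circ0// ltW.
apply/ler_addgt0Pl => e e0; apply: key; first by rewrite lerDr ltW.
by rewrite ltr_pwDl.
Qed.

Lemma hol_factor0 rho f : 0 < rho -> hol rho f -> f 0 = 0 ->
  exists2 g, hol rho g & forall w, cmod w < rho -> f w = w * g w.
Proof.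
move=> rho0 fh f0; have [r0 r00 r0r] := between rho0.
have gc := coef_growth fh r00 r0r; set c := coef f r0 in gc.
have c0 : c 0%N = 0.
  rewrite -f0 -(@mean_value R f 0 r0 r00); last first.
    by move=> w; rewrite subr0 => wr; apply: fh; exact: le_lt_trans r0r.
  by apply: cmean_eq => t; rewrite expr0 mulr1.
pose d (k : nat) := c k.+1.
have gd : growth rho d.
  move=> r rgt0 rr; have [M M0 MP] := gc r rgt0 rr.
  exists (M / r) => [|k]; first by rewrite divr_ge0// ltW.
  by rewrite /d (le_trans (MP _))// exprS invfM mulrA.
exists (psum d); first exact: hol_psum.
move=> w wr; rewrite (taylor fh r00 r0r wr); apply/esym/(psum_uniq gc wr) => e e0.
have w1 : 0 < 1 + cmod w by rewrite ltr_pwDl// cmod_ge0.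
have [N NP] := psumP gd wr (divr_gt0 e0 w1).
exists N.+1; case=> // n; rewrite ltnS => /NP h.
rewrite big_nat_recl// -/c c0 mul0r add0r.
have -> : w * psum d w - \sum_(0 <= i < n) c i.+1 * w ^+ i.+1 =
    w * (psum d w - \sum_(0 <= i < n) d i * w ^+ i).
  rewrite mulrBr mulr_sumr; congr (_ - _); apply: eq_bigr => i _.
  by rewrite exprS mulrCA.
rewrite cmodM (@le_lt_trans _ _ ((1 + cmod w) * cmod (psum d w - \sum_(0 <= i < n) d i * w ^+ i)))//.
  by apply: ler_wpM2r; [exact: cmod_ge0|rewrite lerDr].
by rewrite mulrC -ltr_pdivlMr.
Qed.

(** The quotient by [w] is at most [1 / r] on [|w| = r], hence inside; then [r] tends to 1. The
    bounds are not strict, so that the quotient satisfies the same hypothesis as [f] and zeros can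
    be removed repeatedly. *)
Lemma schwarz_factor f : hol 1 f -> f 0 = 0 ->
  (forall w, cmod w < 1 -> cmod (f w) <= 1) ->
  exists g, [/\ hol 1 g, forall w, cmod w < 1 -> f w = w * g w &
    forall w, cmod w < 1 -> cmod (g w) <= 1].
Proof.
move=> fh f0 f1; have [g gh gE] := hol_factor0 ltr01 fh f0.
exists g; split => // z z1; apply/ler_addgt0Pl => e e0.
have [r1 zr1 r11] := between z1.
have e1 : 0 < 1 + e by rewrite ltr_wpDl.
have [r [zr rr er]] : exists r, [/\ cmod z < r, r < 1 & r^-1 <= 1 + e].
  have h : (1 + e)^-1 < 1 by rewrite invf_lt1// ltrDl.
  have [|r] := @between R (Num.max r1 (1 + e)^-1) 1; first by rewrite gt_max r11 h.
  rewrite gt_max => /andP[h1 h2] h3; exists r; split => //; first exact: lt_trans h1.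
  have r0 : 0 < r by apply: lt_trans h2; rewrite invr_gt0.
  by rewrite -[1 + e]invrK lef_pV2 ?posrE ?invr_gt0// ltW.
have r0 : 0 < r by exact: le_lt_trans (cmod_ge0 z) zr.
rewrite addrC; apply: le_trans er; apply: (@max_principle 1 g r) => //.
  by rewrite invr_ge0 ltW.
move=> w wr; have w1 : cmod w < 1 by rewrite wr.
have := f1 w w1; rewrite (gE w w1) cmodM wr => h.
by rewrite -[r^-1]mul1r ler_pdivlMr// mulrC.
Qed.

End MaximumPrinciple.

(** * Blaschke factors and the Schwarz-Pick lemma *)

Section Mobius.
Variable R : realType.
Local Notation C := (cplx R).
Local Notation Re := (@complex.Re R).
Local Notation Im := (@complex.Im R).
Local Notation rc := (@rc R).
Implicit Types (rho r : R) (z w a : C) (f g : C -> C).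

(** The involution of the disk that exchanges [a] and [0]. It differs from [Blaschke_factor a] by a
    unimodular constant and needs no special case at [a = 0]. *)
Definition mob a z := (a - z) / (1 - a^* * z).

Lemma mob_den_gt0 a z : cmod a < 1 -> cmod z <= 1 -> 0 < cmod (1 - a^* * z).
Proof.
move=> a1 z1; rewrite cmod_gt0 subr_eq0; apply/eqP => /(congr1 (@cmod R)).
rewrite cmod1 cmodM cmod_conj => /esym/eqP; apply/negP; rewrite lt_eqF//.
by rewrite (le_lt_trans _ a1)// ler_piMr// cmod_ge0.
Qed.

Lemma mob_den a z : cmod a < 1 -> cmod z <= 1 -> 1 - a^* * z != 0.
Proof. by move=> a1 z1; rewrite -cmod_gt0 mob_den_gt0. Qed.

Lemma mob_id a z : cmod (1 - a^* * z) ^+ 2 - cmod (a - z) ^+ 2 =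
  (1 - cmod a ^+ 2) * (1 - cmod z ^+ 2).
Proof.
rewrite !cmod_sqr cReB cImB cReB cImB cReM cImM; case: a => a b; case: z => x y /=.
ring.
Qed.

Lemma one_sub_mob a z : cmod a < 1 -> cmod z <= 1 ->
  1 - cmod (mob a z) ^+ 2 =
  (1 - cmod a ^+ 2) * (1 - cmod z ^+ 2) / cmod (1 - a^* * z) ^+ 2.
Proof.
move=> a1 z1; have d0 := mob_den_gt0 a1 z1.
rewrite /mob cmod_div -mob_id expr_div_n mulrBl divff ?expf_neq0 ?gt_eqF//.
Qed.

Lemma sqr_lt1 (x : R) : 0 <= x -> (x ^+ 2 < 1) = (x < 1).
Proof. by move=> x0; rewrite expr_lt1. Qed.

Lemma cmod_sqr_lt1 z : cmod z < 1 -> cmod z ^+ 2 < 1.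
Proof. by move=> z1; rewrite sqr_lt1 ?cmod_ge0. Qed.

Lemma cmod_mob_lt1 a z : cmod a < 1 -> cmod z < 1 -> cmod (mob a z) < 1.
Proof.
move=> a1 z1; rewrite -sqr_lt1 ?cmod_ge0// -subr_gt0 one_sub_mob ?ltW//.
rewrite divr_gt0 ?exprn_gt0 ?mob_den_gt0 ?ltW// mulr_gt0// subr_gt0 cmod_sqr_lt1//.
Qed.

Lemma mob_le1 a z : cmod a < 1 -> cmod z <= 1 -> cmod (mob a z) <= 1.
Proof.
move=> a1 z1; rewrite -(@expr_le1 _ 2)// ?cmod_ge0// -subr_ge0 one_sub_mob//.
by rewrite divr_ge0 ?sqr_ge0// mulr_ge0// subr_ge0 expr_le1// ?cmod_ge0// ltW.
Qed.

Lemma mobK a z : cmod a < 1 -> cmod z <= 1 -> mob a (mob a z) = z.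
Proof.
move=> a1 z1; have d0 := mob_den a1 z1.
have h : 1 - a^* * a != 0.
  by rewrite mob_den// ltW.
rewrite /mob; move: d0 h; move: (a^*) => b d0 h.
have h2 : 1 - b * ((a - z) / (1 - b * z)) != 0.
  have -> : 1 - b * ((a - z) / (1 - b * z)) = (1 - b * a) / (1 - b * z) by field.
  by rewrite mulf_neq0 ?invr_eq0.
have -> : 1 - b * ((a - z) / (1 - b * z)) = (1 - b * a) / (1 - b * z) by field.
by field; rewrite d0 h.
Qed.

Lemma mob0 a : mob a 0 = a.
Proof. by rewrite /mob mulr0 !subr0 divr1. Qed.
Lemma mobb a : mob a a = 0.
Proof. by rewrite /mob subrr mul0r. Qed.

Lemma hasD_mob a z : cmod a < 1 -> cmod z <= 1 ->
  hasD (mob a) z ((a^* * a - 1) / (1 - a^* * z) ^+ 2).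
Proof.
move=> a1 z1; have D1 := hasD_sub (hasD_cst a z) (hasD_id z).
have D2 := hasD_sub (hasD_cst 1 z) (hasD_cmul a^* (hasD_id z)).
apply: hasD_eq (hasD_div D1 D2 (mob_den a1 z1)) _.
by congr (_ / _); ring.
Qed.

Lemma hol_mob a : cmod a < 1 -> hol 1 (mob a).
Proof. by move=> a1 w w1; eexists; exact: hasD_mob a1 (ltW w1). Qed.

(** Composition with [mob a] moves the zero to the origin, where the Schwarz lemma divides it out; a
    second composition returns. *)
Lemma peel_zero f a : hol 1 f -> (forall w, cmod w < 1 -> cmod (f w) <= 1) ->
  cmod a < 1 -> f a = 0 ->
  exists g, [/\ hol 1 g, forall w, cmod w < 1 -> cmod (g w) <= 1 &
    forall w, cmod w < 1 -> f w = mob a w * g w].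
Proof.
move=> fh f1 a1 fa; have mh := hol_mob a1.
have [] := @schwarz_factor R (fun w => f (mob a w)).
- by apply: hol_comp mh fh _ => w w1; exact: cmod_mob_lt1.
- by rewrite mob0.
- by move=> w w1; apply: f1; exact: cmod_mob_lt1.
move=> g [gh gE g1]; exists (fun w => g (mob a w)); split.
- by apply: hol_comp mh gh _ => w w1; exact: cmod_mob_lt1.
- by move=> w w1; apply: g1; exact: cmod_mob_lt1.
- by move=> w w1; rewrite -gE ?cmod_mob_lt1// mobK// ltW.
Qed.

Lemma schwarz_pick_strict f z w : hol 1 f -> (forall v, cmod v < 1 -> cmod (f v) <= 1) ->
  cmod (f w) < 1 -> cmod z < 1 -> cmod w < 1 ->
  cmod (f w - f z) * cmod (1 - w^* * z) <= cmod (w - z) * cmod (1 - (f w)^* * f z).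
Proof.
move=> fh f1 fw z1 w1; have mh := hol_mob w1.
have [] := @schwarz_factor R (fun u => mob (f w) (f (mob w u))).
- move=> u u1; have m1 := cmod_mob_lt1 w1 u1.
  have [k fk] := fh _ m1; have D := hasD_mob w1 (ltW u1).
  have D2 := hasD_comp D fk.
  by eexists; exact: hasD_comp D2 (hasD_mob fw (f1 _ m1)).
- by rewrite mob0 mobb.
- by move=> u u1; apply: mob_le1 => //; apply: f1; exact: cmod_mob_lt1.
move=> g [_ gE g1]; have m1 := cmod_mob_lt1 w1 z1.
have : cmod (mob (f w) (f z)) <= cmod (mob w z).
  have := gE _ m1; rewrite (mobK w1 (ltW z1)) => ->.
  by rewrite cmodM ler_piMr ?cmod_ge0// g1.
rewrite /mob !cmod_div ler_pdivrMr; last by rewrite mob_den_gt0// f1.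
by rewrite mulrAC ler_pdivlMr// mob_den_gt0// ltW.
Qed.

(** The case [|f w| = 1] is reached by applying the strict version to [t * f] and letting [t]
    increase to 1. *)
Lemma schwarz_pick f z w : hol 1 f -> (forall v, cmod v < 1 -> cmod (f v) <= 1) ->
  cmod z < 1 -> cmod w < 1 ->
  cmod (f w - f z) * cmod (1 - w^* * z) <= cmod (w - z) * cmod (1 - (f w)^* * f z).
Proof.
move=> fh f1 z1 w1; apply/ler_addgt0Pl => e e0.
set L := cmod (f w - f z) * _; set Rr := cmod (w - z) * _.
have L0 : 0 <= L by rewrite mulr_ge0 ?cmod_ge0.
(* The factor [t] costs [(1 - t) * L] on the left and at most [2 * (1 - t ^+ 2) <= 4 * (1 - t)] on
   the right. *)
have [t t0 [t1 te]] : exists2 t : R, 0 < t & t < 1 /\ (1 - t) * (L + 4) <= e.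
  have L4 : 0 < L + 4 by rewrite ltr_wpDl.
  have d0 : 0 < Num.min (2^-1) (e / (L + 4)).
    by rewrite lt_min invr_gt0 divr_gt0//= ltr0n.
  exists (1 - Num.min (2^-1) (e / (L + 4))).
    rewrite subr_gt0 (@le_lt_trans _ _ (2^-1)) ?ge_min ?lexx//.
    by rewrite invf_lt1// ltr1n.
  split; first by rewrite ltrBlDr ltrDl.
  rewrite opprB addrC subrK -ler_pdivlMr//.
  by rewrite ge_min lexx orbT.
have fth : hol 1 (fun w => rc t * f w) := hol_mul (hol_cst _) fh.
have ctf v : cmod v < 1 -> cmod (rc t * f v) < 1.
  move=> v1; rewrite cmodM cmod_rc_ge0 ?ltW//.
  by rewrite (le_lt_trans _ t1)// ler_piMr ?f1// ltW.
have := @schwarz_pick_strict (fun w => rc t * f w) z w fth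
  (fun v v1 => ltW (ctf v v1)) (ctf w w1) z1 w1.
rewrite -mulrBr cmodM cmod_rc_ge0 ?(ltW t0)// -mulrA -/L => h.
have h2 : cmod (1 - (rc t * f w)^* * (rc t * f z)) <=
    cmod (1 - (f w)^* * f z) + (1 - t ^+ 2).
  have -> : 1 - (rc t * f w)^* * (rc t * f z) =
     (1 - (f w)^* * f z) + rc (1 - t ^+ 2) * ((f w)^* * f z).
    by rewrite conjM conj_rc rcB rc1 rcX; ring.
  rewrite (le_trans (cmodD _ _))// lerD2l cmodM cmod_rc_ge0; last first.
    by rewrite subr_ge0 expr_le1// ltW.
  apply: ler_piMr; first by rewrite subr_ge0 expr_le1// ltW.
  by rewrite cmodM cmod_conj mulr_ile1 ?cmod_ge0 ?f1.
have wz2 : cmod (w - z) <= 2.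
  by rewrite (le_trans (cmod_leB _ _))// (le_trans (lerD (ltW w1) (ltW z1))).
have h3 := ler_wpM2l (cmod_ge0 (w - z)) h2.
rewrite mulrDr -/Rr in h3.
have h4 : cmod (w - z) * (1 - t ^+ 2) <= 2 * (1 - t ^+ 2).
  by rewrite ler_wpM2r// subr_ge0 expr_le1// ltW.
have h5 : 1 - t ^+ 2 <= 2 * (1 - t) by rewrite -subr_ge0; nra.
move: (le_trans h h3); move: te h4 h5; lra.
Qed.

Lemma schwarz_pick_derive f z k : hol 1 f ->
  (forall v, cmod v < 1 -> cmod (f v) <= 1) ->
  cmod z < 1 -> hasD f z k -> (1 - cmod z ^+ 2) * cmod k <= 1 - cmod (f z) ^+ 2.
Proof.
move=> fh f1 z1 fk.
have fc := hasD_cvg fk.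
pose L h : C := 1 - (z + h)^* * z.
pose U h : C := 1 - (f (z + h))^* * f z.
have L0 : cmod (L 0) = 1 - cmod z ^+ 2.
  rewrite /L addr0 mulrC mul_conj -rc1 -rcB cmod_rc_ge0//.
  by rewrite subr_ge0 expr_le1// ?cmod_ge0// ltW.
have U0 : cmod (U 0) = 1 - cmod (f z) ^+ 2.
  rewrite /U addr0 mulrC mul_conj -rc1 -rcB cmod_rc_ge0//.
  by rewrite subr_ge0 expr_le1// ?cmod_ge0// f1.
apply/ler_addgt0Pl => e e0.
have k0 := cmod_ge0 k.
(* Replacing [L h], [U h] and the difference quotient by their limits costs at most
   [(3 + cmod k) * e1] in all. *)
pose e1 := e / (4 + cmod k).
have e10 : 0 < e1 by rewrite divr_gt0// ltr_pwDl.
have [d1 d10 P1] := (hasDP f z k).1 fk e1 e10.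
have [d2 d20 P2] := (cvgCCP f z (f z)).1 fc e1 e10.
pose d := Num.min (Num.min d1 d2) (Num.min e1 (1 - cmod z)).
have d0 : 0 < d by rewrite !lt_min d10 d20 e10 subr_gt0.
have hd : 0 < d / 2 by rewrite divr_gt0.
have hlt : cmod (rc (d / 2)) < d.
  by rewrite cmod_rc_ge0 ?ltW// gtr_pMr// invf_lt1// ltr1n.
move: hlt; set h := rc (d / 2); rewrite !lt_min => /andP[/andP[hd1 hd2] /andP[hd3 hd4]].
have h0 : 0 < cmod h by rewrite cmod_rc_ge0 ?ltW.
have zh1 : cmod (z + h) < 1.
  by rewrite (le_lt_trans (cmodD _ _))// -ltrBrDl.
have SP := schwarz_pick fh f1 z1 zh1.
rewrite [z + h - z]addrC addKr in SP.
have Q1 := P1 h hd1.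
have Q2 : cmod (f (z + h) - f z) < e1 by apply: P2; rewrite addrC addKr.
have B1 : cmod k * cmod h <= cmod (f (z + h) - f z) + e1 * cmod h.
  rewrite -cmodM -{1}[k * h](subrK (f (z + h) - f z)) addrC.
  by rewrite (le_trans (cmodD _ _))// lerD2l cmodB.
have B2 : cmod (U h) <= cmod (U 0) + e1.
  rewrite -{1}[U h](subrK (U 0)) addrC (le_trans (cmodD _ _))// lerD2l.
  have -> : U h - U 0 = (f z - f (z + h))^* * f z by rewrite /U addr0 rmorphB; ring.
  rewrite cmodM cmod_conj cmodB ltW// (le_lt_trans _ Q2)// ler_piMr ?cmod_ge0//.
  exact: f1.
have B3 : cmod (L 0) - e1 <= cmod (L h).
  rewrite lerBlDr -{1}[L 0](subrK (L h)) addrC (le_trans (cmodD _ _))// lerD2l.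
  have -> : L 0 - L h = h^* * z by rewrite /L addr0 rmorphD; ring.
  rewrite cmodM cmod_conj ltW// (le_lt_trans _ hd3)// ler_piMr ?cmod_ge0// ltW//.
rewrite -/(L h) -/(U h) in SP.
have L1 : cmod (L 0) <= 1 by rewrite L0 lerBlDr lerDl sqr_ge0.
rewrite -L0 -U0; move: SP B1 B2 B3 h0 L1 (cmod_ge0 (L 0)) (cmod_ge0 (L h)).
have Lh2 : cmod (L h) <= 2.
  rewrite /L (le_trans (cmod_leB _ _))// cmod1 cmodM cmod_conj.
  have : cmod (z + h) * cmod z <= 1 by rewrite mulr_ile1 ?cmod_ge0// ltW.
  by lra.
have -> : e = e1 * (4 + cmod k) by rewrite /e1 divfK// gt_eqF// ltr_pwDl.
move: (cmod (f (z + h) - f z)) (cmod (U h)) (cmod (U 0)) (cmod (L h)) (cmod (L 0)) (cmod h) (cmod k) k0 e10 Lh2.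
move=> X uh u0 lh l0 H K K0 e10 Lh2 SP B1 B2 B3 h0 L1 l00 lh0.
have S1 : (K - e1) * lh <= u0 + e1.
  rewrite -(ler_pM2r h0) (le_trans _ (le_trans SP _))//; last first.
    by rewrite mulrC ler_wpM2r// ltW.
  by rewrite mulrAC ler_wpM2r// mulrBl lerBlDr.
have S2 : K * (l0 - e1) <= K * lh by rewrite ler_wpM2l.
have S3 : e1 * lh <= e1 * 2 by rewrite ler_wpM2l// ltW.
move: S1 S2 S3; rewrite mulrBl mulrBr mulrDr; lra.
Qed.

End Mobius.

(** * Holomorphic logarithms, means of [ln |f|] and compactness of closed discs *)

Section LogAndCompact.
Variable R : realType.
Local Notation C := (cplx R).
Local Notation Re := (@complex.Re R).
Local Notation Im := (@complex.Im R).
Local Notation rc := (@rc R).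
Implicit Types (rho r : R) (z w a : C) (f g : C -> C).

Lemma is_derive_of_small (f : R -> R) (x d : R) :
  (forall e, 0 < e -> exists2 r : R, 0 < r &
    forall h, `|h| < r -> `|f (x + h) - f x - d * h| <= e * `|h|) ->
  is_derive x (1 : R) f d.
Proof.
move=> fd; have cv : (fun h : R => h^-1 *: (f (h *: (1 : R) + x) - f x)) @ 0^' --> d.
  apply/cvgrPdist_le => e e0; have [r r0 rP] := fd e e0.
  apply/nbhs_ballP; exists r => //= h; rewrite -ball_normE /= sub0r normrN => hr h0.
  rewrite /GRing.scale /= mulr1 [h + x]addrC.
  have -> : d - h^-1 * (f (x + h) - f x) = - (f (x + h) - f x - d * h) / h by field.
  rewrite normrM normfV normrN ler_pdivrMr ?normr_gt0//.
  exact: rP.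
by split; [apply/cvg_ex; exists d|apply/cvg_lim].
Qed.

Lemma hasD_Re_line g (t : R) (d : C) : hasD g (rc t) d ->
  is_derive t (1 : R) (fun s => Re (g (rc s))) (Re d).
Proof.
move=> /hasDP gd; apply: is_derive_of_small => e e0; have [r r0 rP] := gd e e0.
exists r => // h hr; have := rP (rc h); rewrite cmod_rc => /(_ hr).
rewrite -rcD; apply: le_trans; apply: le_trans (normRe_le _).
by rewrite !cReB cReM /= mulr0 subr0.
Qed.

Lemma hasD_Im_line g (t : R) (d : C) : hasD g (rc t) d ->
  is_derive t (1 : R) (fun s => Im (g (rc s))) (Im d).
Proof.
move=> /hasDP gd; apply: is_derive_of_small => e e0; have [r r0 rP] := gd e e0.
exists r => // h hr; have := rP (rc h); rewrite cmod_rc => /(_ hr).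
rewrite -rcD; apply: le_trans; apply: le_trans (normIm_le _).
by rewrite !cImB cImM /= mulr0 add0r.
Qed.

Lemma derive0_const_real (f : R -> R) :
  (forall t : R, 0 <= t -> t <= 1 -> is_derive t (1 : R) f 0) -> f 1 = f 0.
Proof.
move=> fd; have [||c _] := @MVT_segment R f (fun=> 0) 0 1 ler01.
- by move=> x; rewrite in_itv /= => /andP[/ltW h1 /ltW h2]; exact: fd.
- apply: continuous_subspace_itv => t; rewrite in_itv /= => /andP[h1 h2].
  have [dt _] := fd t h1 h2.
  exact/differentiable_continuous/derivable1_diffP.
by rewrite mul0r => /eqP; rewrite subr_eq0 => /eqP.
Qed.

Lemma derive0_const rho g z : (forall w, cmod w < rho -> hasD g w 0) ->
  cmod z < rho -> g z = g 0.
Proof.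
move=> gd zr; pose G w := g (w * z).
have GD (t : R) : 0 <= t -> t <= 1 -> hasD G (rc t) 0.
  move=> t0 t1; have D := hasD_mul (hasD_id (rc t)) (hasD_cst z (rc t)).
  have D2 : hasD g (rc t * z) 0.
    by apply: gd; rewrite cmodM cmod_rc_ge0// (le_lt_trans _ zr)// ler_piMl ?cmod_ge0.
  by have := hasD_comp D D2; rewrite mul0r.
have -> : g z = G (rc 1) by rewrite /G rc1 mul1r.
have -> : g 0 = G (rc 0) by rewrite /G mul0r.
apply: complexP.
  apply: (@derive0_const_real (fun s => Re (G (rc s)))) => t t0 t1.
  exact: hasD_Re_line (GD t t0 t1).
apply: (@derive0_const_real (fun s => Im (G (rc s)))) => t t0 t1.
exact: hasD_Im_line (GD t t0 t1).
Qed.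

(** [L] is the primitive of [f' / f], and [f / cexp L] has derivative zero. With [f 0] as a factor,
    [L] can be normalized by [L 0 = 0]. *)
Lemma hol_log rho f : 0 < rho -> hol rho f ->
  (forall w, cmod w < rho -> f w != 0) ->
  exists L, [/\ hol rho L, L 0 = 0 &
    forall w, cmod w < rho -> f w = f 0 * cexp (L w)].
Proof.
move=> rho0 fh f0.
have [f' fd] : exists f' : C -> C, forall w, cmod w < rho -> hasD f w (f' w).
  exists (fun w => (f^`())%classic w) => w wr; have [k [df _]] := fh w wr.
  by split.
have f'h := hol_derive rho0 fh fd.
have [L L0 LD] := hol_primitive rho0 (hol_div f'h fh f0).
have Lh : hol rho L by move=> w wr; eexists; exact: LD.
exists L; split => // w wr.
pose g w := f w / cexp (L w).
have gd v : cmod v < rho -> hasD g v 0.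
  move=> vr; have D1 := hasD_comp (LD v vr) (hasD_cexp (L v)).
  apply: hasD_eq (hasD_div (fd v vr) D1 (cexp_neq0 (L v))) _.
  have := f0 v vr; have := cexp_neq0 (L v); move: (cexp _) (f v) (f' v) => E F F' E0 F0.
  by field; rewrite E0 F0.
have := derive0_const gd wr; rewrite /g L0 cexp0 divr1 => <-.
by rewrite divfK// cexp_neq0.
Qed.

Lemma ln_cexp (x : C) z : x != 0 -> ln (cmod (x * cexp z)) = ln (cmod x) + Re z.
Proof.
by move=> x0; rewrite cmodM cmod_cexp lnM ?posrE ?cmod_gt0 ?expR_gt0// expRK.
Qed.

Lemma cont_Re_hol rho f r : hol rho f -> 0 <= r -> r < rho ->
  continuous (fun t => Re (f (circ 0 r t))).
Proof.
move=> fh r0 rr t; have c := cont_hol_circ fh r0 rr.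
by apply: (@continuous_comp _ _ _ (fun t => f (circ 0 r t)) Re t (c t)); exact: cont_Re.
Qed.

Lemma mean_Re_hol rho f r : hol rho f -> 0 < r -> r < rho ->
  tmean (fun t => Re (f (circ 0 r t))) = Re (f 0).
Proof.
move=> fh r0 rr; rewrite -(@mean_value R f 0 r r0) ?Re_cmean// => w.
by rewrite subr0 => wr; apply: fh; exact: le_lt_trans rr.
Qed.

Lemma cont_ln_hol rho f r : hol rho f -> 0 <= r -> r < rho ->
  (forall w, cmod w = r -> f w != 0) ->
  continuous (fun t => ln (cmod (f (circ 0 r t)))).
Proof.
move=> fh r0 rr f0 t; have c := cont_hol_circ fh r0 rr.
apply: (@continuous_comp _ _ _ (fun t => cmod (f (circ 0 r t))) (@ln R)).
  by apply: (@continuous_comp _ _ _ (fun t => f (circ 0 r t)) (@cmod R) t (c t)); exact: cont_cmod.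
by apply: continuous_ln; rewrite cmod_gt0 f0// cmod_circ0.
Qed.

(** Jensen's formula without zeros: [ln |f|] is, up to a constant, the real part of a holomorphic
    logarithm. *)
Lemma mean_ln_hol rho f r : hol rho f -> 0 < r -> r < rho ->
  (forall w, cmod w < rho -> f w != 0) ->
  tmean (fun t => ln (cmod (f (circ 0 r t)))) = ln (cmod (f 0)).
Proof.
move=> fh r0 rr f0; have rho0 := lt_trans r0 rr.
have [L [Lh L0 LE]] := hol_log rho0 fh f0.
have f00 : f 0 != 0 by apply: f0; rewrite cmod0.
transitivity (tmean (fun t => ln (cmod (f 0)) + Re (L (circ 0 r t)))).
  apply: tmean_eq => t; rewrite LE ?ln_cexp//.
  by rewrite cmod_circ0// ltW.
rewrite tmeanD; last exact: cont_Re_hol Lh (ltW r0) rr.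
  by rewrite tmean_cst (mean_Re_hol Lh r0 rr) L0 addr0.
by move=> t; exact: cvg_cst.
Qed.

Lemma hol_sqrt rho f : 0 < rho -> hol rho f ->
  (forall w, cmod w < rho -> f w != 0) ->
  exists2 Q, hol rho Q & forall w, cmod w < rho -> f w = Q w ^+ 2.
Proof.
move=> rho0 fh f0; have [L [Lh L0 LE]] := hol_log rho0 fh f0.
exists (fun w => sqrtC (f 0) * cexp (L w / 2)).
  apply: hol_mul; first exact: hol_cst.
  have h2 : hol rho (fun w => L w / 2) := hol_mul Lh (hol_cst _).
  by move=> w wr; have [k Lk] := h2 w wr; eexists; exact: hasD_comp Lk (hasD_cexp _).
move=> w wr; rewrite exprMn sqrtCK LE//; congr (_ * _).
by rewrite expr2 -cexpD -splitr.
Qed.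

Lemma closed_disc_compact r : compact [set w : C | cmod w <= r].
Proof.
pose K := [set p : R * R | (`[- r, r]%classic p.1) /\ (`[- r, r]%classic p.2)].
have Kc : compact ([set` `[- r, r]] `*` [set` `[- r, r]] : set (R * R)).
  by apply: compact_setX; exact: segment_compact.
have ptc : continuous (fun p : R * R => pt p.1 p.2).
  by move=> p; apply: cvg_ReIm => /=; [exact: cvg_fst|exact: cvg_snd].
have Ic := continuous_compact (continuous_subspaceT ptc) Kc.
apply: (@subclosed_compact _ _ _ _ Ic).
  have -> : [set w : C | cmod w <= r] = @cmod R @^-1` [set x : R | x <= r] by [].
  by apply: closed_comp => [w _|]; [exact: cont_cmod|exact: closed_le].
move=> [x y] /= h; exists (x, y) => //=.
have hx := le_trans (normRe_le ((x +i* y)%C : C)) h.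
have hy := le_trans (normIm_le ((x +i* y)%C : C)) h.
by split; rewrite /= in_itv /=; rewrite -ler_norml.
Qed.

Lemma disc_max r (u : C -> R) : 0 <= r ->
  (forall w, cmod w <= r -> {for w, continuous u}) ->
  exists2 p, cmod p <= r & forall w, cmod w <= r -> u w <= u p.
Proof.
move=> r0 uc.
have [||p] := @compact_EVT_max _ R u _ _ (closed_disc_compact (r := r)).
- by exists (0 : C); change (cmod (0 : C) <= r); rewrite cmod0.
- rewrite continuous_subspace_in => w; rewrite inE => wr.
  by apply: continuous_subspaceT_for; [exact: wr|exact: uc].
rewrite inE /= => pr pmax; exists p => // w wr.
by apply: pmax; rewrite inE.
Qed.

End LogAndCompact.

(** * Boundary behaviour *)

Section JuliaCaratheodory.
Variable R : realType.
Local Notation C := (cplx R).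
Local Notation Re := (@complex.Re R).
Local Notation Im := (@complex.Im R).
Local Notation rc := (@rc R).
Implicit Types (rho r : R) (z w a : C) (f g : C -> C).

(** Squaring and applying [mob_id] on both sides leaves an inequality between [|1 - conj a * b|^2]
    and products [(1 - |a|^2) (1 - |b|^2)]; in this form one point may approach the circle. *)
Lemma schwarz_pick_sqr f z w : hol 1 f -> (forall v, cmod v < 1 -> cmod (f v) <= 1) ->
  cmod z < 1 -> cmod w < 1 ->
  cmod (1 - (f w)^* * f z) ^+ 2 * ((1 - cmod w ^+ 2) * (1 - cmod z ^+ 2)) <=
  cmod (1 - w^* * z) ^+ 2 * ((1 - cmod (f w) ^+ 2) * (1 - cmod (f z) ^+ 2)).
Proof.
move=> fh f1 z1 w1; have SP := schwarz_pick fh f1 z1 w1.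
have : (cmod (f w - f z) * cmod (1 - w^* * z)) ^+ 2 <=
    (cmod (w - z) * cmod (1 - (f w)^* * f z)) ^+ 2.
  by apply: lerXn2r; rewrite ?nnegrE ?mulr_ge0 ?cmod_ge0.
rewrite !exprMn -!mob_id; lra.
Qed.

(** The intervals [[x k - e k, x k + e k]] meet pairwise, so the supremum of their left ends lies in
    all of them. *)
Lemma cauchy_point (x : nat -> R) (e : nat -> R) :
  (forall k l, `|x k - x l| <= e k + e l) ->
  exists l, forall k, `|x k - l| <= e k.
Proof.
move=> xe; have xe' k l : x k - e k <= x l + e l.
  by have := xe k l; rewrite ler_norml => /andP[_]; lra.
exists (sup (range (fun k => x k - e k))) => k; rewrite ler_norml; apply/andP; split.
  have : sup (range (fun k => x k - e k)) <= x k + e k.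
    by apply: ge_sup; [exists (x 0 - e 0), 0%N|move=> _ [l _ <-]; exact: xe'].
  lra.
have : x k - e k <= sup (range (fun k => x k - e k)).
  apply: sup_upper_bound; last by exists k.
  by split; [exists (x 0 - e 0), 0%N|exists (x 0 + e 0) => _ [l _ <-]; exact: xe'].
lra.
Qed.

Lemma cmod_unit_conj (zeta : C) : cmod zeta = 1 -> zeta * zeta^* = 1.
Proof. by move=> z1; rewrite mul_conj z1 expr1n. Qed.

Lemma cmod_one_conj (u v : C) : cmod u = 1 -> cmod (1 - u^* * v) = cmod (u - v).
Proof.
move=> u1; have -> : u - v = u * (1 - u^* * v).
  by rewrite mulrBr mulr1 mulrA cmod_unit_conj// mul1r.
by rewrite cmodM u1 mul1r.
Qed.

(** The Cayley transform [(f - 1) / (f + 1)] carries the right half-plane to the disk, where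
    [schwarz_pick_sqr] applies; the denominators cancel. *)
Lemma halfplane_schwarz_pick f z w : hol 1 f ->
  (forall v, cmod v < 1 -> 0 <= Re (f v)) -> cmod z < 1 -> cmod w < 1 ->
  cmod (f z + (f w)^*) ^+ 2 * ((1 - cmod w ^+ 2) * (1 - cmod z ^+ 2)) <=
  cmod (1 - w^* * z) ^+ 2 * (4 * (Re (f z) * Re (f w))).
Proof.
move=> fh fRe z1 w1; pose q v := (f v - 1) / (f v + 1).
have f10 v : cmod v < 1 -> f v + 1 != 0.
  move=> v1; apply/eqP => /(congr1 Re); rewrite cReD /=.
  by have := fRe v v1; lra.
have qh : hol 1 q.
  exact: hol_div (hol_sub fh (hol_cst 1)) (hol_add fh (hol_cst 1)) f10.
have E v : cmod v < 1 -> 1 - cmod (q v) ^+ 2 = 4 * Re (f v) / cmod (f v + 1) ^+ 2.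
  move=> v1; have c0 : cmod (f v + 1) ^+ 2 != 0 by rewrite expf_neq0// cmod_eq0 f10.
  rewrite /q cmod_div expr_div_n; apply: (mulIf c0).
  rewrite mulrBl !divfK// mul1r !cmod_sqr cReB cImB cReD cImD /=; ring.
have q1 v : cmod v < 1 -> cmod (q v) <= 1.
  move=> v1; rewrite -(@expr_le1 _ 2)// ?cmod_ge0// -subr_ge0 E//.
  by rewrite divr_ge0 ?sqr_ge0// mulr_ge0// fRe.
have := schwarz_pick_sqr qh q1 z1 w1; rewrite !E//.
have A0 := f10 z z1; have B0 := f10 w w1.
have B0' : (f w)^* + 1 != 0.
  have -> : (f w)^* + 1 = (f w + 1)^* by rewrite rmorphD rmorph1.
  by rewrite conjC_eq0.
have -> : 1 - (q w)^* * q z = 2 * (f z + (f w)^*) / (((f w)^* + 1) * (f z + 1)).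
  rewrite /q rmorphM fmorphV rmorphB rmorphD rmorph1.
  by field; rewrite A0 B0'.
have hB : cmod ((f w)^* + 1) = cmod (f w + 1).
  by rewrite -(cmod_conj (f w + 1)) rmorphD rmorph1.
rewrite cmod_div !cmodM hB expr_div_n !exprMn.
have -> : cmod (2 : C) = 2 by rewrite -(rc_nat R 2) cmod_rc_ge0.
have a0 : 0 < cmod (f z + 1) ^+ 2 by rewrite exprn_gt0// cmod_gt0.
have b0 : 0 < cmod (f w + 1) ^+ 2 by rewrite exprn_gt0// cmod_gt0.
move: (cmod (f z + 1) ^+ 2) (cmod (f w + 1) ^+ 2) a0 b0 => a b a0 b0.
move: (cmod (f z + (f w)^*) ^+ 2) (cmod (1 - w^* * z) ^+ 2) (1 - cmod w ^+ 2)
  (1 - cmod z ^+ 2) (Re (f w)) (Re (f z)) => X Y p p' u v h.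
have ab : 0 < b * a by rewrite mulr_gt0.
have := ler_wpM2r (ltW ab) h.
have -> : 2 ^+ 2 * X / (b * a) * (p * p') * (b * a) = 4 * (X * (p * p')).
  by field; rewrite !gt_eqF.
have -> : Y * (4 * u / b * (4 * v / a)) * (b * a) = 4 * (Y * (4 * (v * u))).
  by field; rewrite !gt_eqF.
by rewrite ler_pM2l.
Qed.

Section Boundary.
Variables (F : C -> C) (zeta : C) (rk : nat -> R) (alpha : R).
Hypothesis Fh : hol 1 F.
Hypothesis F1 : forall z, cmod z < 1 -> cmod (F z) < 1.
Hypothesis zeta1 : cmod zeta = 1.
Hypothesis rk01 : forall k, 0 < rk k /\ rk k < 1.
Hypothesis rk1 : forall e : R, 0 < e -> exists k, 1 - rk k < e.
Hypothesis Fk : forall k, 1 - cmod (F (rc (rk k) * zeta)) ^+ 2 <=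
  alpha * (1 - rk k ^+ 2).

Let zk k := rc (rk k) * zeta.

Let zkE k : cmod (zk k) = rk k.
Proof. by rewrite cmodM zeta1 mulr1 cmod_rc_ge0// ltW// (rk01 k).1. Qed.

Let zk1 k : cmod (zk k) < 1.
Proof. by rewrite zkE (rk01 k).2. Qed.

Let rk2 k : 0 < 1 - rk k ^+ 2.
Proof. by have [h1 h2] := rk01 k; rewrite subr_gt0 expr_lt1// ltW. Qed.

Let F1' z : cmod z < 1 -> cmod (F z) <= 1.
Proof. by move/F1/ltW. Qed.

Let F2 z : cmod z < 1 -> 0 < 1 - cmod (F z) ^+ 2.
Proof. by move=> z1; rewrite subr_gt0 cmod_sqr_lt1// F1. Qed.

Let alpha0 : 0 < alpha.
Proof.
have := lt_le_trans (F2 (zk1 0%N)) (Fk 0%N).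
by rewrite pmulr_lgt0.
Qed.

(** Schwarz-Pick between [z] and the point [zk k], with the hypothesis [Fk] inserted and
    [1 - rk k ^+ 2] divided out. Julia's inequality is its limit as the radii tend to 1. *)
Let julia_pre k z : cmod z < 1 ->
  cmod (1 - (F (zk k))^* * F z) ^+ 2 * (1 - cmod z ^+ 2) <=
  alpha * cmod (1 - (zk k)^* * z) ^+ 2 * (1 - cmod (F z) ^+ 2).
Proof.
move=> z1; have := schwarz_pick_sqr Fh F1' z1 (zk1 k); rewrite zkE => h.
rewrite -(ler_pM2l (rk2 k)).
rewrite mulrCA (le_trans h)// (mulrCA _ (1 - cmod (F (zk k)) ^+ 2)).
have := ler_wpM2r _ (Fk k) => /(_ (cmod (1 - (zk k)^* * z) ^+ 2 * (1 - cmod (F z) ^+ 2))).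
rewrite mulr_ge0 ?sqr_ge0 ?(ltW (F2 z1))// => /(_ isT).
by rewrite -/(zk k); lra.
Qed.

(** Taking [julia_pre] at another point of the same radius and using [Fk] there gives [|F z_k - F
    z_l| <= alpha * (1 - r_k * r_l)], at most [alpha * (1 - r_k) + alpha * (1 - r_l)]: the values
    determine a single [omega] with an explicit rate. *)
Let limit_value : exists omega : C,
  forall k, cmod (F (zk k) - omega) <= 2 * (alpha * (1 - rk k)).
Proof.
have key k l : cmod (F (zk k) - F (zk l)) <= alpha * (1 - rk k) + alpha * (1 - rk l).
  have h := julia_pre k (zk1 l).
  have h0 : cmod (F (zk k) - F (zk l)) ^+ 2 <= cmod (1 - (F (zk k))^* * F (zk l)) ^+ 2.
    rewrite -subr_ge0 mob_id mulr_ge0// subr_ge0 expr_le1// ?cmod_ge0//; exact: F1'.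
  have E : cmod (1 - (zk k)^* * zk l) = 1 - rk k * rk l.
    rewrite /zk conjM conj_rc.
    have -> : 1 - rc (rk k) * zeta^* * (rc (rk l) * zeta) =
      1 - rc (rk k) * rc (rk l) * (zeta * zeta^*) by ring.
    rewrite cmod_unit_conj// mulr1 -rcM -rc1 -rcB cmod_rc_ge0// subr_ge0.
    have [a1 a2] := rk01 k; have [b1 b2] := rk01 l.
    by rewrite mulr_ile1// ltW.
  have [a1 a2] := rk01 k; have [b1 b2] := rk01 l.
  have ab : rk k * rk l <= 1 by rewrite mulr_ile1// ltW.
  rewrite E zkE in h.
  have hl : 1 - cmod (F (zk l)) ^+ 2 <= alpha * (1 - rk l ^+ 2) := Fk l.
  have h2 : cmod (F (zk k) - F (zk l)) ^+ 2 <= (alpha * (1 - rk k * rk l)) ^+ 2.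
    rewrite -(ler_pM2r (rk2 l)).
    apply: le_trans (le_trans (ler_wpM2r (ltW (rk2 l)) h0) h) _.
    have -> : (alpha * (1 - rk k * rk l)) ^+ 2 * (1 - rk l ^+ 2) =
       alpha * (1 - rk k * rk l) ^+ 2 * (alpha * (1 - rk l ^+ 2)) by ring.
    by apply: ler_wpM2l => //; rewrite mulr_ge0 ?sqr_ge0// ltW.
  have h3 : cmod (F (zk k) - F (zk l)) <= alpha * (1 - rk k * rk l).
    rewrite -(@ler_pXn2r _ 2)// ?nnegrE ?cmod_ge0//.
    by rewrite mulr_ge0 ?subr_ge0// ltW.
  apply: le_trans h3 _; rewrite -mulrDr; apply: ler_wpM2l; first exact: ltW.
  by nra.
have [x xP] := @cauchy_point (fun k => Re (F (zk k))) (fun k => alpha * (1 - rk k))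
  (fun k l => ltac:(rewrite -cReB; exact: le_trans (normRe_le _) (key k l))).
have [y yP] := @cauchy_point (fun k => Im (F (zk k))) (fun k => alpha * (1 - rk k))
  (fun k l => ltac:(rewrite -cImB; exact: le_trans (normIm_le _) (key k l))).
exists (x +i* y)%C => k; apply: le_trans (cmod_le_ReIm _) _.
by rewrite cReB cImB /= mulr_natl mulr2n lerD.
Qed.

Let limit_unit (omega : C) :
  (forall k, cmod (F (zk k) - omega) <= 2 * (alpha * (1 - rk k))) ->
  cmod omega = 1.
Proof.
move=> oP; apply/eqP; rewrite eq_le; apply/andP; split; apply/ler_addgt0Pl => e e0.
  have [k ke] := rk1 (divr_gt0 e0 (mulr_gt0 (ltr0n _ 2) alpha0)).
  rewrite ltr_pdivlMr ?mulr_gt0// in ke.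
  have := cmod_subl omega (F (zk k)); rewrite cmodB => h.
  by have := oP k; have := F1 (zk1 k); move: h ke; lra.
have [k ke] := rk1 (divr_gt0 e0 (mulr_gt0 (ltr0n _ 4) alpha0)).
rewrite ltr_pdivlMr ?mulr_gt0// in ke.
have h := cmod_subl (F (zk k)) omega.
have h2 : 1 - cmod (F (zk k)) ^+ 2 <= alpha * (1 - rk k ^+ 2) := Fk k.
have h3 := F1 (zk1 k); have h4 := cmod_ge0 (F (zk k)).
have [h5 h6] := rk01 k.
have h7 : cmod (F (zk k)) ^+ 2 <= cmod (F (zk k)) by rewrite expr2 ler_piMl// ltW.
have h8 : alpha * (1 - rk k ^+ 2) <= alpha * (2 * (1 - rk k)).
  by apply: ler_wpM2l; [exact: ltW|nra].
by have := oP k; move: h h2 h7 h8 ke; lra.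
Qed.

Let julia (omega z : C) :
  (forall k, cmod (F (zk k) - omega) <= 2 * (alpha * (1 - rk k))) ->
  cmod z < 1 ->
  cmod (omega - F z) ^+ 2 * (1 - cmod z ^+ 2) <=
  alpha * cmod (zeta - z) ^+ 2 * (1 - cmod (F z) ^+ 2).
Proof.
move=> oP z1; have o1 := limit_unit oP.
apply/ler_addgt0Pl => e e0.
(* [8 * alpha + 4 * alpha ^+ 2] pays for replacing [F (zk k)] by [omega] ([S1]), and [5 * alpha] for
   replacing [zk k] by [zeta] ([S4]). *)
pose M := 8 * alpha + 4 * alpha ^+ 2 + 5 * alpha.
have a0 : 0 < alpha := alpha0.
have M0 : 0 < M by rewrite /M; have := sqr_ge0 alpha; lra.
have e1 : 0 < Num.min 1 (e / M) by rewrite lt_min ltr01 divr_gt0.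
have [k] := rk1 e1; rewrite lt_min => /andP[k1 ke].
rewrite ltr_pdivlMr// in ke.
have [h5 h6] := rk01 k.
have JP := julia_pre k z1.
have c1 : cmod (1 - omega^* * F z) = cmod (omega - F z) := cmod_one_conj (F z) o1.
have c2 : cmod (1 - zeta^* * z) = cmod (zeta - z) := cmod_one_conj z zeta1.
have X1 : cmod (omega - F z) <= cmod (1 - (F (zk k))^* * F z) + 2 * (alpha * (1 - rk k)).
  rewrite -c1.
  have -> : 1 - omega^* * F z = (1 - (F (zk k))^* * F z) + (F (zk k) - omega)^* * F z.
    by rewrite rmorphB; ring.
  apply: le_trans (cmodD _ _) _; rewrite lerD2l cmodM cmod_conj.
  by apply: le_trans (oP k); rewrite ler_piMr ?cmod_ge0// F1'.
have X2 : cmod (1 - (F (zk k))^* * F z) <= 2.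
  apply: le_trans (cmod_leB _ _) _; rewrite cmod1 cmodM cmod_conj.
  have : cmod (F (zk k)) * cmod (F z) <= 1 by rewrite mulr_ile1 ?cmod_ge0 ?F1'.
  by lra.
have Y1 : cmod (1 - (zk k)^* * z) <= cmod (zeta - z) + (1 - rk k).
  rewrite -c2 /zk conjM conj_rc.
  have -> : 1 - rc (rk k) * zeta^* * z = (1 - zeta^* * z) + rc (1 - rk k) * (zeta^* * z).
    by rewrite rcB rc1; ring.
  apply: le_trans (cmodD _ _) _; rewrite lerD2l cmodM cmod_rc_ge0 ?subr_ge0 ?(ltW h6)//.
  by rewrite ler_piMr ?subr_ge0 ?(ltW h6)// cmodM cmod_conj zeta1 mul1r ltW.
have Y2 : cmod (zeta - z) <= 2.
  by apply: le_trans (cmod_leB _ _) _; rewrite zeta1; move: z1; lra.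
have p0 : 0 <= 1 - cmod z ^+ 2 by rewrite subr_ge0 expr_le1 ?cmod_ge0// ltW.
have p1 : 1 - cmod z ^+ 2 <= 1 by rewrite lerBlDr lerDl sqr_ge0.
have P0 : 0 <= 1 - cmod (F z) ^+ 2 by rewrite ltW// F2.
have P1 : 1 - cmod (F z) ^+ 2 <= 1 by rewrite lerBlDr lerDl sqr_ge0.
move: JP X1 X2 Y1 Y2 p0 p1 P0 P1 (cmod_ge0 (omega - F z)) (cmod_ge0 (zeta - z))
  (cmod_ge0 (1 - (F (zk k))^* * F z)) (cmod_ge0 (1 - (zk k)^* * z)).
move: (cmod (omega - F z)) (cmod (zeta - z)) (cmod (1 - (F (zk k))^* * F z))
  (cmod (1 - (zk k)^* * z)) (1 - cmod z ^+ 2) (1 - cmod (F z) ^+ 2).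
move=> X Y Xk Yk p P JP X1 X2 Y1 Y2 p0 p1 P0 P1 X0 Y0 Xk0 Yk0.
set eta := 1 - rk k in k1 ke X1 Y1.
have eta0 : 0 < eta by rewrite subr_gt0.
clearbody eta.
have ae : 0 < alpha * eta by rewrite mulr_gt0.
have S1 : X ^+ 2 <= Xk ^+ 2 + (8 * alpha + 4 * alpha ^+ 2) * eta.
  have : X ^+ 2 <= (Xk + 2 * (alpha * eta)) ^+ 2.
    by apply: lerXn2r => //; rewrite nnegrE; lra.
  have : Xk * (alpha * eta) <= 2 * (alpha * eta) by rewrite ler_wpM2r// ltW.
  have : (alpha * eta) ^+ 2 <= alpha ^+ 2 * eta.
    by rewrite exprMn; apply: ler_wpM2l; [exact: sqr_ge0|nra].
  by rewrite sqrrD; nra.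
have S2 : Yk ^+ 2 <= Y ^+ 2 + 5 * eta.
  have : Yk ^+ 2 <= (Y + eta) ^+ 2 by apply: lerXn2r => //; rewrite nnegrE; lra.
  by rewrite sqrrD; nra.
have S3 : X ^+ 2 * p <= Xk ^+ 2 * p + (8 * alpha + 4 * alpha ^+ 2) * eta.
  have h := ler_wpM2r p0 S1.
  have : (8 * alpha + 4 * alpha ^+ 2) * eta * p <= (8 * alpha + 4 * alpha ^+ 2) * eta.
    rewrite ler_piMr// mulr_ge0 ?(ltW eta0)//; have := sqr_ge0 alpha; lra.
  by move: h; lra.
have S4 : alpha * Yk ^+ 2 * P <= alpha * Y ^+ 2 * P + 5 * alpha * eta.
  have aP : 0 <= alpha * P by rewrite mulr_ge0// ltW.
  have h := ler_wpM2r aP S2.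
  have : 5 * (alpha * eta) * P <= 5 * (alpha * eta) by rewrite ler_piMr// mulr_ge0// ltW.
  by move: h; lra.
have : eta * M = (8 * alpha + 4 * alpha ^+ 2) * eta + 5 * alpha * eta by rewrite /M; ring.
by move: S3 S4 JP ke; lra.
Qed.

(** In the half-plane the maps become [P = (omega + F) / (omega - F)] and
    [W = (zeta + z) / (zeta - z)], and Julia's inequality says [Re P >= Re W / alpha]. With the best
    constant [c] in place of [1 / alpha], the difference [P - c * W] keeps nonnegative real part,
    and [(zeta - z) * (P - c * W)] tends to zero in Stolz regions. *)
Theorem julia_caratheodory : exists (omega : C) (c : R),
  [/\ cmod omega = 1, 0 < c & forall K e : R, 0 < e ->
    exists2 d : R, 0 < d & forall z, cmod z < 1 ->
      cmod (z - zeta) < K * (1 - cmod z) -> cmod (z - zeta) < d ->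
      cmod ((F z - omega) / (z - zeta) - omega * zeta^* / rc c) < e].
Proof.
have [omega oP] := limit_value; have o1 := limit_unit oP.
have a0 : 0 < alpha := alpha0.
have zz z : cmod z < 1 -> zeta - z != 0.
  by move=> z1; rewrite subr_eq0; apply: contraTneq z1 => <-; rewrite zeta1 ltxx.
have oF z : cmod z < 1 -> omega - F z != 0.
  by move=> z1; rewrite subr_eq0; apply: contraTneq (F1 z1) => <-; rewrite o1 ltxx.
pose P z := (omega + F z) / (omega - F z).
pose W z := (zeta + z) / (zeta - z).
have cay (u v : C) : cmod u = 1 -> u - v != 0 ->
    Re ((u + v) / (u - v)) = (1 - cmod v ^+ 2) / cmod (u - v) ^+ 2.
  move=> u1 uv; have h : cmod (u - v) ^+ 2 != 0 by rewrite expf_neq0// cmod_eq0.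
  have -> : (u + v) / (u - v) = ((u + v) * (u - v)^*) * rc (cmod (u - v) ^- 2).
    have uv' : (u - v)^* != 0 by rewrite conjC_eq0.
    by rewrite rcV -mul_conj -mulrA; congr (_ * _); rewrite invfM mulrCA divff ?mulr1.
  rewrite cReM /= mulr0 subr0; congr (_ * _).
  have : cmod u ^+ 2 = 1 by rewrite u1 expr1n.
  rewrite !cmod_sqr; case: u {u1 uv h} => x y; case: v => x' y' /= h.
  by rewrite -h; ring.
have ReP z : cmod z < 1 -> Re (P z) = (1 - cmod (F z) ^+ 2) / cmod (omega - F z) ^+ 2.
  by move=> z1; apply: cay => //; exact: oF.
have ReW z : cmod z < 1 -> Re (W z) = (1 - cmod z ^+ 2) / cmod (zeta - z) ^+ 2.
  by move=> z1; apply: cay => //; exact: zz.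
have p0 z : cmod z < 1 -> 0 < 1 - cmod z ^+ 2 by move=> z1; rewrite subr_gt0 cmod_sqr_lt1.
have W0 z : cmod z < 1 -> 0 < Re (W z).
  by move=> z1; rewrite ReW// divr_gt0 ?p0// exprn_gt0// cmod_gt0 zz.
have PW z : cmod z < 1 -> Re (W z) / alpha <= Re (P z).
  move=> z1; have J := julia oP z1; rewrite ReP// ReW// ler_pdivrMr//.
  have h1 : 0 < cmod (omega - F z) ^+ 2 by rewrite exprn_gt0// cmod_gt0 oF.
  have h2 : 0 < cmod (zeta - z) ^+ 2 by rewrite exprn_gt0// cmod_gt0 zz.
  rewrite ler_pdivrMr// [leRHS]mulrAC -[leRHS]mulrA mulrC.
  by rewrite mulrA ler_pdivlMr//; move: J; lra.
pose E := [set Re (P z) / Re (W z) | z in [set z | cmod z < 1]].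
have E0 : E !=set0.
  by exists (Re (P 0) / Re (W 0)); exists (0 : C) => //; change (cmod (0 : C) < 1); rewrite cmod0.
have Elb : lbound E alpha^-1.
  move=> _ [z /= z1 <-]; rewrite ler_pdivlMr ?W0// mulrC.
  exact: PW.
have Einf : has_inf E by split => //; exists alpha^-1.
(* The reciprocal of [c] is the modulus of the angular derivative. *)
pose c := inf E.
have ca : alpha^-1 <= c by apply: lb_le_inf.
have c0 : 0 < c by apply: lt_le_trans ca; rewrite invr_gt0.
pose f z := P z - rc c * W z.
have Ph : hol 1 P.
  apply: hol_div; [exact: hol_add (hol_cst _) Fh|exact: hol_sub (hol_cst _) Fh|exact: oF].
have Wh : hol 1 W.
  apply: hol_div zz; [exact: hol_add (hol_cst _) (@hol_id R 1)|
    exact: hol_sub (hol_cst _) (@hol_id R 1)].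
have fh : hol 1 f := hol_sub Ph (hol_mul (hol_cst _) Wh).
have fRe z : cmod z < 1 -> 0 <= Re (f z).
  move=> z1; rewrite cReB cReM /= mul0r subr0 subr_ge0 -ler_pdivlMr ?W0//.
  by apply: ge_inf; [exists alpha^-1|exists z].
exists omega, c; split => // K e e0.
pose b := Num.min c (e * c ^+ 2 / 2).
have b0 : 0 < b by rewrite lt_min c0 divr_gt0// mulr_gt0// exprn_gt0.
pose K' := `|K| + 1.
have K'0 : 0 < K' by rewrite ltr_wpDl.
have e1 : 0 < b / 2 / (16 * K') by rewrite !divr_gt0// mulr_gt0.
(* A point that nearly attains the infimum: there [Re (f z0)] is a small fraction of [Re (W z0)]. *)
have [z0 z01 z0P] : exists2 z0, cmod z0 < 1 & Re (f z0) <= b / 2 / (16 * K') * Re (W z0).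
  have [_ [z0 /= z01 <-] h] := @inf_adherent _ E _ e1 Einf.
  exists z0 => //; rewrite cReB cReM /= mul0r subr0 lerBlDl -mulrDl.
  by rewrite -ler_pdivrMr ?W0// ltW.
have zz0 : 0 < cmod (zeta - z0) by rewrite cmod_gt0 zz.
pose N := `|1 - c| + cmod (f z0) + 1.
have N0 : 0 < N by rewrite ltr_wpDl// addr_ge0// cmod_ge0.
exists (Num.min (cmod (zeta - z0)) (b / 2 / N)).
  by rewrite lt_min zz0 divr_gt0// divr_gt0.
move=> z z1 zK; rewrite lt_min => /andP[zd1 zd2].
have [z1' h0] : cmod (zeta - z) = cmod (z - zeta) /\ 0 < 1 - cmod z.
  by split; [rewrite cmodB|rewrite subr_gt0].
set u := zeta - z in z1' *; have u0 : u != 0 by exact: zz.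
pose x := cmod (f z + (f z0)^*).
have x0 : 0 <= x := cmod_ge0 _.
have xu : x * cmod u <= b / 2.
  (* Comparison of [z] with [z0]: in the Stolz region [cmod u] is at most [K' * (1 - cmod z)], and
     the near-extremality of [z0] makes the resulting bound on [x * cmod u] small instead of merely
     finite. *)
  have HP := halfplane_schwarz_pick fh fRe z1 z01; rewrite -/x in HP.
  have fx : Re (f z) <= x.
    have E1 : Re (f z + (f z0)^*) = Re (f z) + Re (f z0).
      by rewrite cReD; congr (_ + _); case: (f z0).
    by apply: le_trans (Re_le _); rewrite E1; have := fRe z0 z01; lra.
  have f00 := fRe z0 z01.
  have q0 := p0 z z1; have q00 := p0 z0 z01.
  have D1 : cmod (1 - z0^* * z) <= 2 * cmod (zeta - z0).
    have -> : 1 - z0^* * z = (1 - zeta^* * z0)^* + z0^* * (zeta - z).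
      by rewrite rmorphB rmorph1 rmorphM /= conjCK; ring.
    apply: le_trans (cmodD _ _) _; rewrite cmod_conj cmod_one_conj// cmodM cmod_conj.
    have : cmod z0 * cmod (zeta - z) <= cmod (zeta - z).
      by rewrite ler_piMl ?cmod_ge0// ltW.
    by move: zd1; rewrite -z1'; lra.
  have h1 : Re (f z0) * cmod (zeta - z0) ^+ 2 <= b / 2 / (16 * K') * (1 - cmod z0 ^+ 2).
    have := ler_wpM2r (sqr_ge0 (cmod (zeta - z0))) z0P.
    by rewrite ReW// -[leRHS]mulrA divfK// gt_eqF// exprn_gt0.
  have h2 : cmod (1 - z0^* * z) ^+ 2 <= 4 * cmod (zeta - z0) ^+ 2.
    have -> : 4 * cmod (zeta - z0) ^+ 2 = (2 * cmod (zeta - z0)) ^+ 2 by ring.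
    by apply: lerXn2r => //; rewrite nnegrE ?cmod_ge0// mulr_ge0 ?cmod_ge0.
  have h3 : x * (1 - cmod z ^+ 2) <= b / K' / 2.
    have [x00|x00] := eqVneq x 0.
      by rewrite x00 mul0r !divr_ge0// ltW.
    have xp : 0 < x by rewrite lt_def x00.
    rewrite -(ler_pM2l (mulr_gt0 xp q00)).
    have -> : x * (1 - cmod z0 ^+ 2) * (x * (1 - cmod z ^+ 2)) =
      x ^+ 2 * ((1 - cmod z0 ^+ 2) * (1 - cmod z ^+ 2)) by ring.
    apply: le_trans HP _.
    apply: le_trans (ler_wpM2r _ h2) _; first by rewrite !mulr_ge0// fRe.
    have h4 : Re (f z) * (Re (f z0) * cmod (zeta - z0) ^+ 2) <=
        x * (b / 2 / (16 * K') * (1 - cmod z0 ^+ 2)).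
      by apply: ler_pM => //; [exact: fRe|rewrite mulr_ge0 ?sqr_ge0].
    have -> : x * (1 - cmod z0 ^+ 2) * (b / K' / 2) =
      16 * (x * (b / 2 / (16 * K') * (1 - cmod z0 ^+ 2))).
      by field; rewrite gt_eqF.
    by move: h4; lra.
  have h5 : cmod u <= K' * (1 - cmod z).
    rewrite z1' (le_trans (ltW zK))// ler_wpM2r ?(ltW h0)// /K'.
    by have := ler_norm K; lra.
  have h6 : 1 - cmod z <= 1 - cmod z ^+ 2.
    by rewrite lerD2l lerN2 expr2 ler_piMl ?cmod_ge0// ltW.
  apply: le_trans (ler_wpM2l x0 h5) _.
  have h7 : x * (1 - cmod z) <= x * (1 - cmod z ^+ 2) := ler_wpM2l x0 h6.
  have h8 := ler_wpM2l (ltW K'0) (le_trans h7 h3).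
  rewrite mulrCA (le_trans h8)// le_eqVlt; apply/orP; left; apply/eqP.
  by field; rewrite gt_eqF.
(* [dl] equals [u * (1 + P z) - 2 * c * zeta], and [1 + P = 2 * omega / (omega - F)]; hence the
   difference quotient is [2 * omega / (2 * c * zeta + dl)], and only [dl --> 0] remains to be
   used. *)
have [dl dlE] : exists dl, dl = (1 - rc c) * u + u * f z by eexists.
have db : cmod dl < b.
  have fz : cmod (f z) <= x + cmod (f z0).
    rewrite -(cmod_conj (f z0)) -[X in cmod X](addrK (f z0)^*).
    exact: cmod_leB.
  have hu := cmod_ge0 u.
  have h1 : cmod dl <= cmod u * `|1 - c| + cmod u * cmod (f z).
    rewrite dlE; apply: le_trans (cmodD _ _) _.
    by rewrite !cmodM -rc1 -rcB cmod_rc mulrC.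
  have h2 : cmod u * cmod (f z) <= x * cmod u + cmod u * cmod (f z0).
    by have := ler_wpM2l hu fz; rewrite mulrDr (mulrC (cmod u) x).
  have h3 : cmod u * N < b / 2 by rewrite z1' -ltr_pdivlMr.
  have h4 : cmod u * N = cmod u * `|1 - c| + cmod u * cmod (f z0) + cmod u.
    by rewrite /N; ring.
  by move: h1 h2 h3 xu; rewrite h4; lra.
have zeta0 : zeta != 0 by rewrite -cmod_eq0 zeta1 oner_neq0.
have rc0 : rc c != 0 by rewrite rc_eq0 gt_eqF.
have [dc de] : cmod dl < c /\ cmod dl < e * c ^+ 2 / 2.
  by move: db; rewrite lt_min => /andP.
have den : c <= cmod (2 * rc c * zeta + dl).
  have := cmod_subl (2 * rc c * zeta) (- dl); rewrite opprK cmodN !cmodM zeta1 cmod_rc_ge0 ?(ltW c0)//.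
  rewrite -(rc_nat R 2) cmod_rc_ge0//; lra.
have den0 : 2 * rc c * zeta + dl != 0.
  by rewrite -cmod_gt0 (lt_le_trans c0).
have zc : zeta^* = zeta^-1.
  by apply: (mulfI zeta0); rewrite cmod_unit_conj// divff.
have FE : (F z - omega) / (z - zeta) = 2 * omega / (2 * rc c * zeta + dl).
  have oFz := oF z z1.
  have E1 : (2 * rc c * zeta + dl) * (omega - F z) = 2 * omega * u.
    rewrite dlE /f /P /W -/u.
    have -> : zeta + z = 2 * zeta - u by rewrite /u; ring.
    clearbody u; field; rewrite u0 oFz//.
  have -> : (F z - omega) / (z - zeta) = (omega - F z) / u.
    by rewrite /u -(opprB omega) -(opprB zeta) invrN mulrNN.
  by apply/eqP; rewrite eqr_div// mulrC E1.
rewrite FE zc.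
have -> : 2 * omega / (2 * rc c * zeta + dl) - omega / zeta / rc c =
  - (omega * dl) / (rc c * zeta * (2 * rc c * zeta + dl)).
  by field; rewrite rc0 zeta0 den0.
rewrite cmod_div cmodN !cmodM o1 zeta1 mul1r mulr1 cmod_rc_ge0 ?(ltW c0)//.
rewrite ltr_pdivrMr ?mulr_gt0 ?(lt_le_trans c0)//.
apply: lt_le_trans (_ : e * c ^+ 2 / 2 <= _) => //.
rewrite expr2; have := ler_wpM2l (ltW c0) den.
move=> /(ler_wpM2l (ltW e0)); have : 0 < e * (c * c) by rewrite !mulr_gt0.
by lra.
Qed.

End Boundary.

End JuliaCaratheodory.

(** * Radial limits, and limit theorems for circle means *)

Section RadialLimits.
Variable R : realType.
Local Notation C := (cplx R).
Local Notation Re := (@complex.Re R).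
Local Notation Im := (@complex.Im R).
Local Notation rc := (@rc R).
Local Notation mu := (@lebesgue_measure R).
Local Notation D := (`[0, 2 * pi]%classic).
Implicit Types (rho r : R) (z w a : C) (f g : C -> C).

Lemma cauchy_estimate f z d rho M : 0 < rho -> 0 < M ->
  (forall w, cmod (w - z) < rho -> exists k, hasD f w k) ->
  (forall w, cmod (w - z) < rho -> cmod (f w) <= M) -> hasD f z d ->
  cmod d <= M / rho.
Proof.
move=> r0 M0 fD fM fd.
pose g v := rc M^-1 * f (rc rho * v + z).
have aux v : cmod v < 1 -> cmod (rc rho * v + z - z) < rho.
  by move=> v1; rewrite addrK cmodM cmod_rc_ge0 ?(ltW r0)// gtr_pMr.
have lin v : hasD (fun v => rc rho * v + z) v (rc rho * 1 + 0).
  exact: hasD_add (hasD_cmul (rc rho) (hasD_id v)) (hasD_cst z v).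
have gD v k : hasD f (rc rho * v + z) k -> hasD g v (rc M^-1 * (k * (rc rho * 1 + 0))).
  move=> fk; exact: hasD_cmul (hasD_comp (lin v) fk).
have gh : hol 1 g.
  by move=> v v1; have [k fk] := fD _ (aux v v1); eexists; exact: gD fk.
have g1 v : cmod v < 1 -> cmod (g v) <= 1.
  move=> v1; rewrite cmodM cmod_rc_ge0 ?invr_ge0 ?(ltW M0)// mulrC ler_pdivrMr// mul1r.
  exact: fM (aux v v1).
have z0 : cmod (0 : C) < 1 by rewrite cmod0.
have fd' : hasD f (rc rho * 0 + z) d by rewrite mulr0 add0r.
have := schwarz_pick_derive gh g1 z0 (gD 0 d fd').
rewrite cmod0 expr0n subr0 mul1r mulr1 addr0 !cmodM !cmod_rc_ge0 ?invr_ge0 ?(ltW M0) ?(ltW r0)// => h.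
rewrite ler_pdivlMr// -(ler_pM2l (_ : 0 < M^-1)) ?invr_gt0// mulVf ?gt_eqF//.
by apply: le_trans h _; rewrite gerBl sqr_ge0.
Qed.

Definition radial_limit (g : C -> C) (zeta l : C) := forall e : R, 0 < e ->
  exists2 d : R, 0 < d & forall r, 0 <= r -> r < 1 -> 1 - r < d ->
    cmod (g (rc r * zeta) - l) < e.

Section Derivative.
Variables (F F' : C -> C) (zeta omega l : C).
Hypothesis FD : forall z, cmod z < 1 -> hasD F z (F' z).
Hypothesis zeta1 : cmod zeta = 1.
Hypothesis Fl : forall K e : R, 0 < e ->
    exists2 d : R, 0 < d & forall z, cmod z < 1 ->
      cmod (z - zeta) < K * (1 - cmod z) -> cmod (z - zeta) < d ->
      cmod ((F z - omega) / (z - zeta) - l) < e.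

Let near_zeta (K e : R) : 0 < e ->
  exists2 d : R, 0 < d & forall z, cmod z < 1 ->
      cmod (z - zeta) < K * (1 - cmod z) -> cmod (z - zeta) < d ->
      cmod (F z - omega - l * (z - zeta)) <= e * cmod (z - zeta).
Proof.
move=> e0; have [d d0 dP] := Fl K e0; exists d => // z z1 zK zd.
have nz : z - zeta != 0.
  by rewrite subr_eq0; apply: contraTneq z1 => ->; rewrite zeta1 ltxx.
have -> : F z - omega - l * (z - zeta) =
   ((F z - omega) / (z - zeta) - l) * (z - zeta) by rewrite mulrBl divfK.
by rewrite cmodM ler_wpM2r ?cmod_ge0// ltW// dP.
Qed.

Let rad_dist r : 0 <= r -> r < 1 -> cmod (rc r * zeta) = r /\
  cmod (rc r * zeta - zeta) = 1 - r.
Proof.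
move=> r0 r1; rewrite cmodM zeta1 mulr1 cmod_rc_ge0//; split=> //.
have -> : rc r * zeta - zeta = - (rc (1 - r) * zeta) by rewrite rcB rc1; ring.
by rewrite cmodN cmodM zeta1 mulr1 cmod_rc_ge0// subr_ge0 ltW.
Qed.

Lemma angular_radial_limit : radial_limit F zeta omega.
Proof.
move=> e e0; have [d d0 dP] := near_zeta 2 ltr01.
have c0 : 0 < cmod l + 1 by rewrite ltr_wpDl ?cmod_ge0.
exists (Num.min d (e / (cmod l + 1))); first by rewrite lt_min d0 divr_gt0.
move=> r r0 r1; rewrite lt_min => /andP[rd re].
have [h1 h2] := rad_dist r0 r1.
have h := dP (rc r * zeta); rewrite h1 h2 in h.
have {h} := h r1 ltac:(lra) rd.
set w := F _ - omega => h.
have : cmod w <= cmod (w - l * (rc r * zeta - zeta)) + cmod (l * (rc r * zeta - zeta)).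
  by have := cmodD (w - l * (rc r * zeta - zeta)) (l * (rc r * zeta - zeta)); rewrite subrK.
rewrite (cmodM l) h2; rewrite ltr_pdivlMr// in re; move: h re; lra.
Qed.

(** Cauchy's estimate for [F - omega - l * (z - zeta)] on the disc of radius [(1 - r) / 2] about
    [r * zeta]. That disc lies in the Stolz region of aperture 4, and the error becomes
    [3 / 4 * e]. *)
Lemma angular_radial_derivative : radial_limit F' zeta l.
Proof.
move=> e e0; have e4 : 0 < e / 4 by rewrite divr_gt0.
have [d d0 dP] := near_zeta 4 e4.
exists (d / 2); first by rewrite divr_gt0.
move=> r r0 r1 rd; have [h1 h2] := rad_dist r0 r1.
have r10 : 0 < 1 - r by rewrite subr_gt0.
pose G w := F w - omega - l * (w - zeta).
have z1 : cmod (rc r * zeta) < 1 by rewrite h1.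
have GD w k : hasD F w k -> hasD G w (k - 0 - l * (1 - 0)).
  move=> Fk.
  exact: hasD_sub (hasD_sub Fk (hasD_cst _ _)) (hasD_cmul l (hasD_sub (hasD_id w) (hasD_cst zeta w))).
have aux w : cmod (w - rc r * zeta) < (1 - r) / 2 ->
    [/\ cmod w < 1, (1 - r) / 2 < 1 - cmod w & cmod (w - zeta) < 3 / 2 * (1 - r)].
  move=> wr; have a1 : cmod w < (1 - r) / 2 + r.
    have := cmodD (w - rc r * zeta) (rc r * zeta); rewrite subrK h1; lra.
  have a2 : cmod (w - zeta) < 3 / 2 * (1 - r).
    have := cmod_trian (rc r * zeta) w zeta; rewrite h2; lra.
  by split => //; lra.
have := @cauchy_estimate G (rc r * zeta) (F' (rc r * zeta) - 0 - l * (1 - 0))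
  ((1 - r) / 2) (e / 4 * (3 / 2 * (1 - r))).
rewrite !subr0 mulr1 => H.
have {H} : cmod (F' (rc r * zeta) - l) <= e / 4 * (3 / 2 * (1 - r)) / ((1 - r) / 2).
  apply: H; first by rewrite divr_gt0.
  - by rewrite !mulr_gt0.
  - by move=> w /aux[w1 _ _]; eexists; exact: GD (FD w1).
  - move=> w wr; have [w1 w2 w3] := aux w wr.
    apply: le_trans (dP w w1 _ _) _; [lra|lra|].
    by apply: ler_wpM2l; exact: ltW.
  - have := GD _ _ (FD z1); rewrite !subr0 mulr1; exact.
have -> : e / 4 * (3 / 2 * (1 - r)) / ((1 - r) / 2) = 3 / 4 * e.
  by field; rewrite gt_eqF.
move=> h; apply: le_lt_trans h _; lra.
Qed.

End Derivative.

Let mD : measurable (D : set (measurableTypeR R)).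
Proof. exact: measurable_itv. Qed.

Let icts (u : R -> R) : continuous u -> mu.-integrable D (EFin \o u).
Proof. by move=> uc; exact: ctsR_integrable (ctsRT uc). Qed.

Let tmeanE (u : R -> R) : continuous u ->
  (\int[mu]_(t in D) (u t)%:E = (2 * pi * tmean u)%:E)%E.
Proof.
move=> uc; rewrite /tmean mulrA mulfV ?gt_eqF ?pi2_gt0// mul1r /rint /Rintegral fineK//.
exact: (integrable_fin_num _ (icts uc)).
Qed.

(** By Fatou's lemma the lower limit is integrable, hence finite almost everywhere; the conclusion
    spells this out as a bound that holds at arbitrarily large indices. *)
Lemma tmean_fatou (u : nat -> R -> R) M : (forall m, continuous (u m)) ->
  (forall m t, 0 <= u m t) -> (forall m, tmean (u m) <= M) ->
  {ae mu, forall t, D t ->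
    exists L, forall N, exists2 m, (N <= m)%N & u m t <= L}.
Proof.
move=> uc u0 uM; pose f m t := (u m t)%:E.
have mf m := measurable_int mu (icts (uc m)).
have f0 m t : D t -> (0 <= f m t)%E by move=> _; rewrite lee_fin.
have limE (v : nat -> \bar R) : limn_einf v = ereal_sup (range (einfs v)).
  by rewrite limn_einf_lim; apply/cvg_lim => //; exact: cvg_einfs_sup.
have F := @fatou _ _ _ mu D mD f mf f0.
have fin : (\int[mu]_(t in D) limn_einf (f ^~ t) < +oo)%E.
  apply: (@le_lt_trans _ _ (2 * pi * M)%:E); last by rewrite ltry.
  apply: le_trans F _; rewrite limE; apply: ge_ereal_sup => _ [n _ <-].
  apply: (@le_trans _ _ (\int[mu]_(x in D) f n x)%E).
    by apply: ereal_inf_lbound; exists n => /=.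
  by rewrite tmeanE// lee_fin ler_pM2l ?pi2_gt0.
have nn t : D t -> (0 <= limn_einf (f ^~ t))%E.
  move=> Dt; rewrite limE; apply: (@le_trans _ _ (einfs (f ^~ t) 0%N)).
    by apply: le_ereal_inf_tmp => _ [m _ <-]; exact: f0.
  by apply: ereal_sup_ubound; exists 0%N.
have int : mu.-integrable D (fun t => limn_einf (f ^~ t)).
  apply/integrableP; split.
    apply: (measurable_realfun.emeasurable_fun_cvg (fun n t => einfs (f ^~ t) n)) => [n|t Dt].
      exact: (measurable_realfun.measurable_fun_einfs mf n).
    by rewrite limE; exact: cvg_einfs_sup.
  have -> : (\int[mu]_(t in D) `|limn_einf (f ^~ t)| =
      \int[mu]_(t in D) limn_einf (f ^~ t))%E.
    by apply: eq_integral => t; rewrite inE => Dt; rewrite gee0_abs// nn.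
  exact: fin.
apply: (@filterS _ _ (ae_filter_ringOfSetsType mu) _ _ _ (integrable_ae mD int)) => t fn Dt.
have := fn Dt; move: (limE (f ^~ t)) (nn t Dt); case: (limn_einf _) => // l lE l0 _.
exists (l + 1) => N; apply: contrapT => H.
have : ((l + 1)%:E <= einfs (f ^~ t) N)%E.
  apply: le_ereal_inf_tmp => _ [m /= Nm <-]; rewrite lee_fin.
  by have [h|/ltW//] := leP (u m t) (l + 1); case: H; exists m.
have : (einfs (f ^~ t) N <= l%:E)%E by rewrite lE; apply: ereal_sup_ubound; exists N.
move=> h1 h2; have := le_trans h2 h1; rewrite lee_fin; lra.
Qed.

Lemma tmean_bounded_cvg (u : nat -> R -> R) M : (forall m, continuous (u m)) ->
  (forall m t, `|u m t| <= M) ->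
  {ae mu, forall t, D t -> (fun m => u m t) @ \oo --> (0 : R)} ->
  (fun m => tmean (u m)) @ \oo --> (0 : R).
Proof.
move=> uc uM u0.
have [_ _] : [/\ mu.-integrable D (fun=> 0%E),
   [sequence (\int[mu]_(x in D) `|(u n x)%:E - 0|)%E]_n @ \oo --> (0%E : \bar R) &
   [sequence (\int[mu]_(x in D) (u n x)%:E)%E]_n @ \oo --> (\int[mu]_(x in D) (0%E : \bar R))%E].
  apply: (@dominated_convergence _ _ _ mu D mD (fun n x => (u n x)%:E) (fun=> 0%E)
    (fun=> M%:E)).
  - by move=> n; exact: (measurable_int mu (icts (uc n))).
  - exact: measurable_cst.
  - apply: (@filterS _ _ (ae_filter_ringOfSetsType mu) _ _ _ u0) => t ut Dt; apply: cvg_EFin; last exact: ut.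
    by apply: nearW.
  - exact: (ctsR_integrable (@ctsR_cst R 0 (2 * pi) M)).
  - by apply: aeW => t n _; rewrite /= lee_fin.
rewrite integral0; under eq_fun do rewrite tmeanE//.
move=> /fine_cvg h.
have -> : (fun m => tmean (u m)) = (fun m => (2 * pi)^-1 * (2 * pi * tmean (u m))).
  by apply/funext => m; rewrite mulKf// gt_eqF// pi2_gt0.
rewrite -[0](mulr0 (2 * pi)^-1); apply: cvgMr; exact: h.
Qed.

(* On the circle [conj (expi t) = (expi t)^-1], so a bounded function with
   [g (expi t) * expi t ^- n] real has Taylor coefficients symmetric about [n]. *)
Lemma coef_eq0_of_real_boundary g M n : hol 1 g ->
  (forall z, cmod z < 1 -> cmod (g z) <= M) ->
  {ae mu, forall t, D t -> forall e : R, 0 < e -> exists2 d : R, 0 < d &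
     forall r, 0 <= r -> r < 1 -> 1 - r < d ->
       `|Im (g (rc r * expi t) * (expi t)^* ^+ n)| < e} ->
  forall r k, 0 < r -> r < 1 -> (2 * n < k)%N -> coef g r k = 0.
Proof.
move=> gh gM gae r0 k r00 r01 nk.
pose E t : C := expi t; pose X r t := g (circ 0 r t) * (E t)^* ^+ n.
have EE t : E t * (E t)^* = 1 by apply: cmod_unit_conj; exact: cmod_expi.
have cE : continuous E := @cont_expi R.
have cE' : continuous (fun t => (E t)^*).
  by move=> t; apply: (@continuous_comp _ _ _ E (fun z => z^*) t (cE t)); exact: cont_conj.
have cg r : 0 <= r -> r < 1 -> continuous (fun t => g (circ 0 r t)).
  by move=> a b; exact: cont_hol_circ gh a b.
have cX r : 0 <= r -> r < 1 -> continuous (X r).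
  by move=> a b t; apply: cvgM; [exact: cg|exact: cont_expC].
have cI r : 0 <= r -> r < 1 -> continuous (fun t => Im (X r t)).
  move=> a b t.
  by apply: (@continuous_comp _ _ _ (X r) Im t (cX r a b t)); exact: cont_Im.
have cA r : 0 <= r -> r < 1 -> continuous (fun t => `|Im (X r t)|).
  by move=> a b t; apply: cvg_norm; exact: cI.
(* [coef g r k * r ^+ k] is the mean of [X * conj E ^ (k - n)], while the mean of
   [conj X * conj E ^ (k - n)] is the conjugate of that of [g * E ^ (k - 2n)], which vanishes as
   [k > 2n]. Only [X - conj X], that is [Im X], is left. *)
have bound r : 0 < r -> r < 1 ->
    cmod (coef g r k) * r ^+ k <= 2 * tmean (fun t => `|Im (X r t)|).
  move=> a b; have a' := ltW a.
  pose h t := g (circ 0 r t) * E t ^+ (k - 2 * n).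
  have hc : continuous h by move=> t; apply: cvgM; [exact: cg|exact: cont_expC].
  have h0 : cmean h = 0.
    have [j kj] : exists j, (k - 2 * n = j.+1)%N.
      by exists (k - 2 * n).-1; rewrite prednK// subn_gt0.
    pose q z := g z * z ^+ j.+1.
    have qh : hol 1 q := hol_mul gh (hol_exp j.+1 (@hol_id R 1)).
    have qm : cmean (fun t => q (circ 0 r t)) = q 0.
      apply: mean_value a _ => w; rewrite subr0 => wr; apply: qh.
      exact: le_lt_trans b.
    have cq := cont_hol_circ qh a' b.
    have -> : h = (fun t => rc (r ^- j.+1) * q (circ 0 r t)).
      apply/funext => t; rewrite /h /q kj /circ add0r exprMn mulrCA; congr (_ * _).
      rewrite rcV rcX mulKf// expf_neq0// rc_eq0 gt_eqF//.
    by rewrite cmeanZ// qm /q expr0n !mulr0.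
  have coefE : coef g r k * rc (r ^+ k) = cmean (fun t => X r t * (E t)^* ^+ (k - n)).
    rewrite mulrC -cmeanZ; last exact: cont_coef gh a b.
    apply: cmean_eq => t; rewrite /X -mulrA -exprD subnKC; last by rewrite (leq_trans _ (ltnW nk))// leq_pmull.
    rewrite mulrCA; congr (_ * _).
    have -> : (E t)^* = (E t)^-1.
      by apply: (mulfI (expi_neq0 t)); rewrite EE divff// expi_neq0.
    by rewrite rcX -exprMn /circ add0r invfM mulrA divff ?mul1r// rc_eq0 gt_eqF.
  have conjE : cmean (fun t => (X r t)^* * (E t)^* ^+ (k - n)) = 0.
    rewrite -[RHS](conjC0 C) -h0 -cmean_conj//; apply: cmean_eq => t.
    rewrite /X /h !conjM !rmorphXn /= conjCK -mulrA; congr (_ * _).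
      have -> : (k - n = n + (k - 2 * n))%N.
      by rewrite mul2n -addnn subnDA subnKC// leq_subRL ?addnn -?mul2n ?(ltnW nk)// (leq_trans _ (ltnW nk))// leq_pmull.
    by rewrite exprD mulrA -exprMn EE expr1n mul1r.
  have cEk : continuous (fun t => (E t)^* ^+ (k - n)) := @cont_expC R _ (k - n)%N cE'.
  have cXc : continuous (fun t => (X r t)^*).
    move=> t; apply: (@continuous_comp _ _ _ (X r) (fun z => z^*) t (cX r a' b t)).
    exact: cont_conj.
  have cX1 : continuous (fun t => X r t * (E t)^* ^+ (k - n)).
    by move=> t; apply: cvgM; [exact: cX|exact: cEk].
  have cX2 : continuous (fun t => (X r t)^* * (E t)^* ^+ (k - n)).
    by move=> t; apply: cvgM; [exact: cXc|exact: cEk].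
  have -> : cmod (coef g r k) * r ^+ k = cmod (coef g r k * rc (r ^+ k)).
    by rewrite cmodM cmod_rc_ge0// exprn_ge0.
  have cB := cmeanB cX1 cX2; rewrite conjE subr0 in cB.
  rewrite coefE -cB.
  have cX3 : continuous (fun t => X r t * (E t)^* ^+ (k - n) - (X r t)^* * (E t)^* ^+ (k - n)).
    by move=> t; apply: cvgB; [exact: cX1|exact: cX2].
  apply: le_trans (cmean_le cX3) _; rewrite -tmeanZ; last exact: cA.
  apply: tmean_le.
  - move=> t; apply: (@continuous_comp _ _ _ _ (@cmod R) t (cX3 t)); exact: cont_cmod.
  - move=> t; apply: cvgM; [exact: cvg_cst|exact: cA].
  move=> t; rewrite -mulrBl cmodM cmodX cmod_conj cmod_expi expr1n mulr1.
  apply: le_trans (cmod_le_ReIm _) _; rewrite cReB cImB.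
  case: (X r t) => x y; rewrite conj_pair /= subrr normr0 add0r opprK.
  by have := ler_normD y y; lra.
(* [m.+2] keeps the radii positive: they increase from [1/2] to 1. *)
pose rm m : R := 1 - m.+2%:R^-1.
have rm0 m : 0 < rm m by rewrite subr_gt0 invf_lt1// ltr1n.
have rm1 m : rm m < 1 by rewrite gtrBl invr_gt0.
have rm_le m : rm 0%N <= rm m.
  have h : (2 : R) <= m.+2%:R by rewrite ler_nat.
  rewrite /rm; apply: lerB; first exact: lexx.
  by rewrite lef_pV2 // posrE ltr0n.
have M0 : 0 <= M by apply: le_trans (gM 0 _); rewrite ?cmod_ge0// cmod0.
have T0 : (fun m => tmean (fun t => `|Im (X (rm m) t)|)) @ \oo --> (0 : R).
  apply: (@tmean_bounded_cvg _ M).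
  - by move=> m; apply: cA; [exact: ltW|].
  - move=> m t; rewrite normr_id; apply: le_trans (normIm_le _) _.
    rewrite cmodM cmodX cmod_conj cmod_expi expr1n mulr1 gM// cmod_circ0//; exact: ltW.
  - apply: (@filterS _ _ (ae_filter_ringOfSetsType mu) _ _ _ gae) => t gt Dt; apply/cvgrPdist_lt => e e0.
    have [d d0 dP] := gt Dt e e0.
    have [N _ NP] : \forall m \near \oo, (m.+2%:R^-1 : R) < d.
      have := @near_infty_natSinv_lt R (PosNum d0); case=> N _ NP.
      exists N => // m /= Nm; apply: le_lt_trans (NP m Nm).
      by rewrite lef_pV2 ?posrE// ler_nat.
    exists N => // m /= Nm; rewrite sub0r normrN normr_id /X /circ add0r.
    by apply: dP; [exact: ltW|exact: rm1|rewrite /rm opprB addrCA subrr addr0; exact: NP].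
apply/eqP; rewrite -cmod_eq0 eq_le cmod_ge0 andbT.
have P0 : 0 < (rm 0%N) ^+ k by rewrite exprn_gt0.
rewrite -(pmulr_lle0 _ P0); apply/ler_addgt0Pl => e e0; rewrite addr0.
have e2 : 0 < e / 2 by rewrite divr_gt0.
have /cvgrPdist_lt/(_ _ e2)[N _ NP] := T0.
have h : `|tmean (fun t => `|Im (X (rm N) t)|)| < e / 2.
  by have := NP N (leqnn N); rewrite /= sub0r normrN.
have E1 : coef g r0 k = coef g (rm N) k.
  have [s s1 s2] := @between R (Num.max r0 (rm N)) 1 ltac:(by rewrite gt_max r01 rm1).
  move: s1; rewrite gt_max => /andP[s1 s1'].
  by rewrite (coef_radius k gh r00 s1 s2) (coef_radius k gh (rm0 N) s1' s2).
rewrite E1; have := bound (rm N) (rm0 N) (rm1 N).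
have : cmod (coef g (rm N) k) * rm 0 ^+ k <= cmod (coef g (rm N) k) * rm N ^+ k.
  apply: ler_wpM2l; first exact: cmod_ge0.
  have rmN : rm 0%N <= rm N := rm_le N.
  by apply: lerXn2r rmN; rewrite nnegrE; exact: ltW (rm0 _).
have := ler_norm (tmean (fun t => `|Im (X (rm N) t)|)); lra.
Qed.

End RadialLimits.

(** * Partial Blaschke products *)

Section Counting.

Lemma count_iotaS (Q : pred nat) N :
  count Q (iota 0 N.+1) = (count Q (iota 0 N) + Q N)%N.
Proof. by rewrite -addn1 iotaD count_cat /= addn0 add0n. Qed.

Lemma count_iota_le (Q : pred nat) M N : (M <= N)%N ->
  (count Q (iota 0 M) <= count Q (iota 0 N))%N.
Proof. by move=> /subnKC <-; rewrite iotaD count_cat leq_addr. Qed.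

(** Multiplicities are cardinalities of index sets, whereas partial products see prefixes of [nat];
    this relates the two. *)
Lemma count_card (Q : pred nat) m : ([set j | Q j] #= `I_m)%card ->
  (exists N, count Q (iota 0 N) = m) /\ forall N, (count Q (iota 0 N) <= m)%N.
Proof.
move=> Am; have Afin : finite_set [set j | Q j] by apply/finite_setP; exists m.
have sz := card_fset_set Am.
set s := finmap.enum_fset _ in sz.
have sQ j : (j \in s) = Q j by rewrite /s (in_fset_set Afin) mem_setE.
have us : uniq s by exact: finmap.fset_uniq.
pose N0 := (\max_(i <- s) i).+1.
have sN j : Q j -> (j < N0)%N by rewrite -sQ => /leq_bigmax_seq; exact.
have cN0 : count Q (iota 0 N0) = m.
  rewrite -sz -size_filter; apply: perm_size; apply: uniq_perm => //.
    by rewrite filter_uniq// iota_uniq.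
  move=> j; rewrite mem_filter mem_iota sQ add0n leq0n /=.
  by case Qj: (Q j) => //=; exact: sN.
split; first by exists N0.
move=> N; rewrite -sz -size_filter; apply: uniq_leq_size.
  by rewrite filter_uniq// iota_uniq.
by move=> j; rewrite mem_filter sQ => /andP[].
Qed.

Lemma bounded_count_card (Q : pred nat) B :
  (forall N, (count Q (iota 0 N) <= B)%N) -> exists m, ([set j | Q j] #= `I_m)%card.
Proof.
move=> cB; apply/finite_setP.
pose T v := `[< exists N, count Q (iota 0 N) = v >].
have T0 : exists v, T v by exists 0%N; apply/asboolP; exists 0%N.
have TB v : T v -> (v <= B)%N by move=> /asboolP[N <-].
case: (ex_maxnP T0 TB) => v /asboolP[N0 N0v] vmax.
apply/finite_seqP; exists [seq j <- iota 0 N0 | Q j].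
apply/seteqP; split => j /=; last by rewrite mem_filter => /andP[].
move=> Qj; rewrite mem_filter Qj mem_iota /= add0n ltnNge; apply/negP => N0j.
have : (count Q (iota 0 j.+1) <= v)%N by apply: vmax; apply/asboolP; exists j.+1.
rewrite count_iotaS Qj addn1 -N0v ltnNge => /negP; apply.
exact: count_iota_le.
Qed.

End Counting.

Section PartialBlaschke.
Variable R : realType.
Local Notation C := (cplx R).
Local Notation Re := (@complex.Re R).
Local Notation Im := (@complex.Im R).
Local Notation rc := (@rc R).
Implicit Types (rho r : R) (z w a : C) (f g : C -> C).

(** The Weierstrass product inequality. *)
Lemma prod_ge_1B (I : Type) (r : seq I) (P : pred I) (x : I -> R) :
  (forall i, P i -> 0 <= x i <= 1) ->
  1 - \sum_(i <- r | P i) (1 - x i) <= \prod_(i <- r | P i) x i <= 1.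
Proof.
move=> x01; suff : 1 - \sum_(i <- r | P i) (1 - x i) <= \prod_(i <- r | P i) x i /\
    0 <= \prod_(i <- r | P i) x i <= 1 by move=> [-> /andP[_ ->]].
elim: r => [|i r [IH1 /andP[IH2 IH3]]]; first by rewrite !big_nil subr0 lexx ler01.
rewrite !big_cons; case: ifP => Pi; last by rewrite IH1 IH2 IH3.
have /andP[h0 h1] := x01 i Pi; split; last by rewrite mulr_ge0// mulr_ile1.
set p := \prod_(_ <- _ | _) _ in IH1 IH2 IH3 *.
have : (1 - x i) * (1 - p) >= 0 by rewrite mulr_ge0// subr_ge0.
by move: IH1; lra.
Qed.

(** Locally uniform convergence of Blaschke products in quantitative form; [4] is the product of two
    factors from [1 - x^2 <= 2 * (1 - x)]. *)
Lemma mob_defect a z : cmod a < 1 -> cmod z < 1 ->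
  1 - cmod (mob a z) <= 4 * (1 - cmod a) / (1 - cmod z).
Proof.
move=> a1 z1; have m0 := cmod_ge0 (mob a z); have m1 := cmod_mob_lt1 a1 z1.
have z0 := cmod_ge0 z; have a0 := cmod_ge0 a.
have zz : 0 < 1 - cmod z by rewrite subr_gt0.
apply: (@le_trans _ _ (1 - cmod (mob a z) ^+ 2)).
  by rewrite lerD2l lerN2 expr2 ler_piMl// ltW.
rewrite one_sub_mob// ?(ltW z1)//.
have d : 1 - cmod z <= cmod (1 - a^* * z).
  have := cmod_subl 1 (a^* * z); rewrite cmod1 cmodM cmod_conj.
  have : cmod a * cmod z <= cmod z by rewrite ler_piMl// ltW.
  lra.
have d0 := lt_le_trans zz d.
rewrite ler_pdivrMr ?exprn_gt0// mulrAC ler_pdivlMr//.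
have h1 : 1 - cmod a ^+ 2 <= 2 * (1 - cmod a) by nra.
have h2 : 1 - cmod z ^+ 2 <= 2 * (1 - cmod z) by nra.
have h3 : (1 - cmod z) ^+ 2 <= cmod (1 - a^* * z) ^+ 2.
  by apply: lerXn2r d; rewrite nnegrE ltW.
have h4 : (1 - cmod a ^+ 2) * (1 - cmod z ^+ 2) <= 2 * (1 - cmod a) * (2 * (1 - cmod z)).
  by apply: ler_pM h1 h2; rewrite subr_ge0 expr_le1// ltW.
have h5 := ler_wpM2l (ltW zz) h4.
have h6 : 4 * (1 - cmod a) * (1 - cmod z) ^+ 2 <= 4 * (1 - cmod a) * cmod (1 - a^* * z) ^+ 2.
  by apply: ler_wpM2l h3; lra.
move: h5 h6; lra.
Qed.

Lemma mob_eq0 a z : cmod a < 1 -> cmod z <= 1 -> (mob a z == 0) = (z == a).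
Proof.
by move=> a1 z1; rewrite mulf_eq0 invr_eq0 (negPf (mob_den a1 z1)) orbF subr_eq0 eq_sym.
Qed.

Lemma mob_lower a z : cmod a < 1 -> cmod z < 1 -> cmod (z - a) / 2 <= cmod (mob a z).
Proof.
move=> a1 z1; rewrite /mob cmod_div cmodB.
have d0 := mob_den_gt0 a1 (ltW z1); rewrite ler_pdivlMr// mulrAC ler_pdivrMr//.
apply: ler_wpM2l; first exact: cmod_ge0.
apply: le_trans (cmod_leB _ _) _; rewrite cmod1 cmodM cmod_conj.
have := mulr_ile1 (cmod_ge0 a) (cmod_ge0 z) (ltW a1) (ltW z1); lra.
Qed.

Lemma mob_upper a z : cmod a < 1 -> cmod z < 1 ->
  cmod (mob a z) <= cmod (z - a) / (1 - cmod a).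
Proof.
move=> a1 z1; rewrite /mob cmod_div cmodB.
have d0 := mob_den_gt0 a1 (ltW z1); apply: ler_wpM2l; first exact: cmod_ge0.
rewrite lef_pV2 ?posrE ?subr_gt0//.
have := cmod_subl 1 (a^* * z); rewrite cmod1 cmodM cmod_conj.
have : cmod a * cmod z <= cmod a by rewrite ler_piMr ?cmod_ge0// ltW.
lra.
Qed.

Lemma peel_zero_hol f a : hol 1 f -> cmod a < 1 -> f a = 0 ->
  exists2 g, hol 1 g & forall w, cmod w < 1 -> f w = mob a w * g w.
Proof.
move=> fh a1 fa; have mh : hol 1 (mob a) := hol_mob a1.
have m1 w : cmod w < 1 -> cmod (mob a w) < 1 by move=> w1; exact: cmod_mob_lt1.
have h0 : hol 1 (fun w => f (mob a w)) by exact: hol_comp mh fh m1.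
have h00 : f (mob a 0) = 0 by rewrite mob0.
have [g gh gE] := hol_factor0 ltr01 h0 h00.
exists (fun w => g (mob a w)); first exact: hol_comp mh gh m1.
by move=> w w1; rewrite -gE ?m1// mobK// ltW.
Qed.

(** Pigeonhole on the points [d / (k + 2)]. It serves to step off a finite set of zeros and to
    choose radii different from finitely many moduli. *)
Lemma avoid_seq (s : seq C) z0 (d : R) : 0 < d ->
  exists2 x : R, 0 < x & x < d /\ z0 + rc x \notin s.
Proof.
move=> d0; pose x k : R := d / k.+2%:R.
have x0 k : 0 < x k by rewrite divr_gt0.
have xd k : x k < d by rewrite ltr_pdivrMr// ltr_pMr// ltr1n.
have xi : injective x.
  move=> i j; rewrite /x => /(mulfI (lt0r_neq0 d0))/invr_inj/eqP.
  by rewrite eqr_nat => /eqP[].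
have [[k kP]|H] := pselect (exists k, z0 + rc (x k) \notin s); first by exists (x k).
pose t : seq C := [seq z0 + rc (x k) | k <- iota 0 (size s).+1].
have : (size t <= size s)%N.
  apply: uniq_leq_size.
    rewrite map_inj_uniq ?iota_uniq// => i j /addrI/(congr1 Re) /=; exact: xi.
  move=> _ /mapP[k _ ->]; apply: contrapT => /negP h; case: H; by exists k.
by rewrite size_map size_iota ltnn.
Qed.

(** Continuity carries an inequality across finitely many exceptional points; these will be the
    zeros of [bprod N], where one cannot divide by it. *)
Lemma le_off_finite (s : seq C) (u v : C -> R) z0 : cmod z0 < 1 ->
  {for z0, continuous u} -> {for z0, continuous v} ->
  (forall z, cmod z < 1 -> z \notin s -> u z <= v z) -> u z0 <= v z0.
Proof.
move=> z1 uc vc uv; rewrite leNgt; apply/negP => vu.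
have e0 : 0 < (u z0 - v z0) / 2 by rewrite divr_gt0// subr_gt0.
have /cvgCRP/(_ _ e0)[d1 d10 h1] := uc; have /cvgCRP/(_ _ e0)[d2 d20 h2] := vc.
have dd : 0 < Num.min (1 - cmod z0) (Num.min d1 d2) by rewrite !lt_min subr_gt0 z1 d10.
have [x x0 [xd xs]] := avoid_seq s z0 dd.
move: xd; rewrite !lt_min => /and3P[xd xd1 xd2].
have xz : cmod (z0 + rc x - z0) = x by rewrite addrAC subrr add0r cmod_rc_ge0// ltW.
have w1 : cmod (z0 + rc x) < 1.
  by apply: le_lt_trans (cmodD _ _) _; rewrite cmod_rc_ge0 ?(ltW x0)//; lra.
have := uv _ w1 xs.
have := h1 (z0 + rc x); rewrite xz ltr_norml => /(_ xd1)/andP[a1 a2].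
have := h2 (z0 + rc x); rewrite xz ltr_norml => /(_ xd2)/andP[b1 b2].
lra.
Qed.

Section Data.
Variables (P : pred nat) (c : nat -> C).

Definition Blaschke_bounded := (forall j, P j -> cmod (c j) < 1) /\
  exists S, forall N, \sum_(0 <= j < N | P j) (1 - cmod (c j)) <= S.

Definition bprod N z : C := \prod_(0 <= j < N | P j) mob (c j) z.

(** The modulus [|B|] of the full Blaschke product: the moduli of the partial products decrease in
    the disk, so the infimum is their limit. *)
Definition beta z : R := inf (range (fun N => cmod (bprod N z))).

(** The remainder of the Blaschke sum after the first [N] indices; it controls the relative error of
    [bprod N] against [beta]. *)
Definition defect N : R :=
  sup (range (fun M => \sum_(0 <= j < M | P j) (1 - cmod (c j)))) -
  \sum_(0 <= j < N | P j) (1 - cmod (c j)).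

Definition zeros N : seq C := [seq c j | j <- iota 0 N & P j].

Lemma bprod0 z : bprod 0 z = 1. Proof. by rewrite /bprod big_geq. Qed.

Lemma bprodS N z : bprod N.+1 z = bprod N z * (if P N then mob (c N) z else 1).
Proof. by rewrite /bprod big_mkcond big_nat_recr//= -big_mkcond. Qed.

Section InDisk.
Hypothesis c1 : forall j, P j -> cmod (c j) < 1.

Lemma bprod_le1 N z : cmod z < 1 -> cmod (bprod N z) <= 1.
Proof.
move=> z1; rewrite /bprod cmod_prod.
have [|_ //] := andP (@prod_ge_1B _ (index_iota 0 N) P (fun j => cmod (mob (c j) z)) _).
by move=> j Pj; rewrite cmod_ge0 mob_le1// ?(ltW z1)// c1.
Qed.

Lemma hol_bprod N : hol 1 (bprod N).
Proof.
elim: N => [|N IH].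
  by apply: hol_eq (hol_cst 1) => w _; rewrite bprod0.
case PN: (P N).
  by apply: hol_eq (hol_mul IH (hol_mob (c1 PN))) => w _; rewrite bprodS PN.
by apply: hol_eq IH => w _; rewrite bprodS PN mulr1.
Qed.

End InDisk.

Hypothesis Bb : Blaschke_bounded.

Lemma defect_le N M : (N <= M)%N ->
  \sum_(N <= j < M | P j) (1 - cmod (c j)) <= defect N.
Proof.
move=> NM; have [c1 [S SP]] := Bb.
have : \sum_(0 <= j < M | P j) (1 - cmod (c j)) <=
    sup (range (fun M => \sum_(0 <= j < M | P j) (1 - cmod (c j)))).
  apply: sup_upper_bound; last by exists M.
  by split; [eexists; exists 0%N|exists S => _ [L _ <-]].
by rewrite /defect (big_cat_nat (leq0n N) NM)/=; lra.
Qed.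

Lemma defect_ge0 N : 0 <= defect N.
Proof. by have := defect_le (leqnn N); rewrite big_geq. Qed.

Lemma defect_mono N M : (N <= M)%N -> defect M <= defect N.
Proof.
move=> NM; rewrite /defect lerD2l lerN2 (big_cat_nat (leq0n N) NM)/= lerDl.
by apply: sumr_ge0 => j Pj; rewrite subr_ge0 ltW// Bb.1.
Qed.

Lemma defect_small (e : R) : 0 < e -> exists N, defect N < e.
Proof.
move=> e0; have [c1 [S SP]] := Bb.
have hs : has_sup (range (fun M => \sum_(0 <= j < M | P j) (1 - cmod (c j)))).
  by split; [eexists; exists 0%N|exists S => _ [L _ <-]].
have [_ [N _ <-] h] := sup_adherent e0 hs.
by exists N; rewrite /defect; lra.
Qed.

Lemma bprod_tail N M z : cmod z < 1 -> (N <= M)%N ->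
  cmod (bprod N z) * (1 - 4 * defect N / (1 - cmod z)) <= cmod (bprod M z).
Proof.
move=> z1 NM; rewrite /bprod (big_cat_nat (leq0n N) NM)/= cmodM.
apply: ler_wpM2l; first exact: cmod_ge0.
rewrite cmod_prod.
have := @prod_ge_1B _ (index_iota N M) P (fun j => cmod (mob (c j) z)).
case/(_ _)/andP => [j Pj|h _].
  by rewrite cmod_ge0 mob_le1// ?(ltW z1)// Bb.1.
apply: le_trans h; rewrite lerD2l lerN2.
apply: (@le_trans _ _ (\sum_(N <= j < M | P j) 4 / (1 - cmod z) * (1 - cmod (c j)))).
  apply: ler_sum => j Pj; apply: le_trans (mob_defect (Bb.1 _ Pj) z1) _.
  by rewrite mulrAC.
rewrite -mulr_sumr [leRHS]mulrAC; apply: ler_wpM2l (defect_le NM).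
by rewrite divr_ge0// subr_ge0 ltW.
Qed.

Lemma bprod_anti N M z : cmod z < 1 -> (N <= M)%N -> cmod (bprod M z) <= cmod (bprod N z).
Proof.
move=> z1 NM; rewrite /bprod (big_cat_nat (leq0n N) NM)/= cmodM ler_piMr ?cmod_ge0// cmod_prod.
have := @prod_ge_1B _ (index_iota N M) P (fun j => cmod (mob (c j) z)).
case/(_ _)/andP => // j Pj.
by rewrite cmod_ge0 mob_le1// ?(ltW z1)// Bb.1.
Qed.

Let beta_inf z : has_inf (range (fun N => cmod (bprod N z))).
Proof.
by split; [eexists; exists 0%N|exists 0 => _ [N _ <-]; exact: cmod_ge0].
Qed.

Lemma beta_ge0 z : 0 <= beta z.
Proof. by apply: lb_le_inf (beta_inf z).1 _ => _ [N _ <-]; exact: cmod_ge0. Qed.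

Lemma beta_le N z : beta z <= cmod (bprod N z).
Proof. by apply: ge_inf; [exact: (beta_inf z).2|exists N]. Qed.

Lemma beta_ge N z : cmod z < 1 ->
  cmod (bprod N z) * (1 - 4 * defect N / (1 - cmod z)) <= beta z.
Proof.
move=> z1; apply: lb_le_inf (beta_inf z).1 _ => _ [M _ <-].
have [NM|/ltnW MN] := leqP N M; first exact: bprod_tail.
apply: le_trans (bprod_anti z1 MN); rewrite ler_piMr ?cmod_ge0// gerBl.
by rewrite divr_ge0 ?mulr_ge0 ?defect_ge0// subr_ge0 ltW.
Qed.

Lemma bprod_eq0 N z : cmod z < 1 -> (bprod N z == 0) = (z \in zeros N).
Proof.
move=> z1; elim: N => [|N IH]; first by rewrite bprod0 oner_eq0.
rewrite bprodS mulf_eq0 IH /zeros -addn1 iotaD filter_cat map_cat mem_cat /= add0n.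
congr orb; case: ifP => PN; last by rewrite oner_eq0.
by rewrite mob_eq0 ?Bb.1 ?(ltW z1)// inE.
Qed.

Lemma beta_gt0_exists : exists2 z, cmod z < 1 & 0 < beta z.
Proof.
(* [16] makes [4 * defect N / (1 - |z|)] less than [1/2] on [|z| < 1/2]. *)
have [N hN] := defect_small (divr_gt0 ltr01 (ltr0n R 16)).
have [x x0 [x1 xN]] := avoid_seq (zeros N) 0 (divr_gt0 ltr01 (ltr0n R 2)).
rewrite add0r in xN.
have w1 : cmod (rc x) < 1 by rewrite cmod_rc_ge0 ?(ltW x0)//; lra.
exists (rc x) => //; apply: lt_le_trans (beta_ge N w1).
rewrite mulr_gt0 ?cmod_gt0 ?bprod_eq0//.
rewrite cmod_rc_ge0 ?(ltW x0)// subr_gt0 ltr_pdivrMr; lra.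
Qed.

Lemma cont_bprod N z : cmod z < 1 -> {for z, continuous (fun w => cmod (bprod N w))}.
Proof. by move=> z1; apply: contC_cmod; exact: hol_cont (hol_bprod Bb.1 N) z1. Qed.

Lemma cont_beta z : cmod z < 1 -> {for z, continuous beta}.
Proof.
move=> z1; apply/cvgCRP => e e0.
have [s s1 s2] := between z1.
have ss : 0 < 1 - s by rewrite subr_gt0.
have [N hN] := defect_small (mulr_gt0 ss (divr_gt0 e0 (ltr0n _ 12))).
have hN' : 4 * defect N / (1 - s) < e / 3 by rewrite ltr_pdivrMr//; lra.
have close w : cmod w <= s -> cmod (bprod N w) - e / 3 <= beta w.
  move=> ws; have w1 : cmod w < 1 := le_lt_trans ws s2.
  apply: le_trans (beta_ge N w1); rewrite mulrBr mulr1 lerD2l lerN2.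
  apply: (@le_trans _ _ (4 * defect N / (1 - cmod w))).
    rewrite ler_piMl ?(bprod_le1 Bb.1)// divr_ge0 ?mulr_ge0 ?defect_ge0// subr_ge0; exact: ltW.
  apply: le_trans (ltW hN'); apply: ler_wpM2l; first by rewrite mulr_ge0// defect_ge0.
  by rewrite lef_pV2 ?posrE ?subr_gt0// lerD2l lerN2.
have e3 : 0 < e / 3 by rewrite divr_gt0.
have /cvgCRP/(_ _ e3)[d d0 dP] := @cont_bprod N z z1.
exists (Num.min d (s - cmod z)); first by rewrite lt_min d0 subr_gt0.
move=> w; rewrite lt_min => /andP[wd ws].
have ws' : cmod w <= s by have := cmodD (w - z) z; rewrite subrK; lra.
have := dP w wd; have := close w ws'; have := close z (ltW s1).
have := beta_le N w; have := beta_le N z.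
rewrite !ltr_norml => h1 h2 h3 h4 /andP[h5 h6]; apply/andP; split; lra.
Qed.

Definition vanishes (G : C -> C) a m := exists K d : R, 0 < d /\
  forall w, cmod w < 1 -> cmod (w - a) < d -> cmod (G w) <= K * cmod (w - a) ^+ m.

Lemma bprod_lower N a : cmod a < 1 -> exists k d : R, [/\ 0 < k, 0 < d &
  forall w, cmod w < 1 -> cmod (w - a) < d ->
    k * cmod (w - a) ^+ count (fun j => P j && (c j == a)) (iota 0 N) <= cmod (bprod N w)].
Proof.
move=> a1; elim: N => [|N [k [d [k0 d0 IH]]]].
  by exists 1, 1; split => // w _ _; rewrite bprod0 cmod1 expr0 mulr1.
have [h|] := boolP (P N && (c N == a)).
  have /andP[PN /eqP cN] := h.
  exists (k / 2), d; split => //; first by rewrite divr_gt0.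
  move=> w w1 wd; rewrite count_iotaS h addn1 bprodS PN cmodM exprSr cN.
  have := ler_pM _ _ (IH w w1 wd) (mob_lower a1 w1).
  rewrite mulr_ge0 ?exprn_ge0 ?cmod_ge0 ?(ltW k0)// divr_ge0 ?cmod_ge0// => /(_ isT isT).
  by lra.
move=> h.
have [k1 [d1 [k10 d10 h1]]] : exists k1 d1 : R, [/\ 0 < k1, 0 < d1 &
    forall w, cmod w < 1 -> cmod (w - a) < d1 ->
      k1 <= cmod (if P N then mob (c N) w else 1)].
  case PN: (P N); last by exists 1, 1; split => // w _ _; rewrite cmod1.
  rewrite PN /= in h; have ca : 0 < cmod (a - c N) / 4.
    by rewrite divr_gt0// cmod_gt0 subr_eq0 eq_sym.
  exists (cmod (a - c N) / 4), (cmod (a - c N) / 2); split => //.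
    by rewrite divr_gt0// cmod_gt0 subr_eq0 eq_sym.
  move=> w w1 wa; apply: le_trans (mob_lower (Bb.1 _ PN) w1).
  have := cmod_trian w a (c N); rewrite (cmodB a w); lra.
exists (k * k1), (Num.min d d1); split; [by rewrite mulr_gt0|by rewrite lt_min d0|].
move=> w w1; rewrite lt_min => /andP[wd wd1].
rewrite count_iotaS (negPf h) addn0 bprodS cmodM mulrAC.
apply: ler_pM; [|exact: ltW|exact: IH|exact: h1].
by rewrite mulr_ge0 ?exprn_ge0 ?cmod_ge0 ?(ltW k0).
Qed.

(** Induction on [N]: near [a = c N] the order of vanishing of [G] exceeds the multiplicity of [a]
    in [bprod N], which [bprod_lower] bounds from below; the quotient [H] therefore vanishes at [a]
    and one more factor can be removed. *)
Lemma divide_bprod (G : C -> C) N : hol 1 G ->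
  (forall a M, cmod a < 1 -> vanishes G a (count (fun j => P j && (c j == a)) (iota 0 M))) ->
  exists2 H, hol 1 H & forall z, cmod z < 1 -> G z = bprod N z * H z.
Proof.
move=> Gh Gv; elim: N => [|N [H Hh HE]].
  by exists G => // z _; rewrite bprod0 mul1r.
case PN: (P N); last first.
  by exists H => // z z1; rewrite bprodS PN mulr1 HE.
set a := c N; have a1 : cmod a < 1 := Bb.1 _ PN.
suff Ha : H a = 0.
  have [g gh gE] := peel_zero_hol Hh a1 Ha; exists g => // z z1.
  by rewrite bprodS PN HE// gE// mulrA.
have [k [d [k0 d0 kd]]] := bprod_lower N a1.
(* Taken at [N.+1] the count includes the index [N] itself, one more than in [bprod N]; this extra
   factor [cmod (w - a)] yields [H a = 0]. *)
have [K [d' [d'0 Kd]]] := Gv a N.+1 a1.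
rewrite count_iotaS -/a PN eqxx addn1 in Kd.
set m := count _ _ in kd Kd.
apply/eqP; rewrite -cmod_eq0 eq_le cmod_ge0 andbT; apply/ler_addgt0Pl => e e0.
rewrite addr0.
have /cvgCCP/(_ _ (divr_gt0 e0 (ltr0n _ 2)))[d2 d20 hd2] := hol_cont Hh a1.
have K1 : 0 < `|K| / k + 1 by rewrite ltr_wpDl// divr_ge0// ltW.
have D0 : 0 < Num.min (Num.min (1 - cmod a) d) (Num.min (Num.min d' d2) (e / 2 / (`|K| / k + 1))).
  by rewrite !lt_min subr_gt0 a1 d0 d'0 d20 !divr_gt0.
have [x x0 [xD _]] := avoid_seq [::] a D0.
move: xD; rewrite !lt_min => /andP[/andP[x1 xd] /andP[/andP[xd' xd2] xe]].
have w1 : cmod (a + rc x) < 1.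
  by apply: le_lt_trans (cmodD _ _) _; rewrite cmod_rc_ge0 ?(ltW x0)//; lra.
have xz : cmod (a + rc x - a) = x by rewrite addrAC subrr add0r cmod_rc_ge0// ltW.
have := kd _ w1; have := Kd _ w1; have := hd2 (a + rc x); rewrite xz.
move=> /(_ xd2) h1 /(_ xd') h2 /(_ xd) h3.
rewrite HE// cmodM in h2.
have xm : 0 < x ^+ m by rewrite exprn_gt0.
have h4 : k * x ^+ m * cmod (H (a + rc x)) <= `|K| * x * x ^+ m.
  apply: le_trans (ler_wpM2r (cmod_ge0 _) h3) _.
  apply: le_trans h2 _; rewrite exprS mulrA; apply: ler_wpM2r; first exact: ltW.
  by apply: ler_wpM2r; [exact: ltW|exact: ler_norm].
have h5 : cmod (H (a + rc x)) <= `|K| / k * x.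
  rewrite -(ler_pM2l (mulr_gt0 k0 xm)) (le_trans h4)// le_eqVlt; apply/orP; left.
  by apply/eqP; field; rewrite gt_eqF.
have h6 : `|K| / k * x < e / 2.
  rewrite ltr_pdivlMr// in xe; move: xe; rewrite mulrDr mulr1 => xe.
  by rewrite mulrC; move: xe x0; lra.
have := cmod_subl (H a) (H (a + rc x)); rewrite cmodB; lra.
Qed.

End Data.

Lemma Blaschke_sequence_bounded (s : point_seq R) : Blaschke_sequence s ->
  Blaschke_bounded (has_index s) (seq_point s).
Proof.
move=> [s1 sum]; split; first exact: s1.
have p0 j : (0 <= j)%N -> has_index s j -> (0 <= (1 - cmod (seq_point s j))%:E)%E.
  by move=> _ /s1 h; rewrite lee_fin subr_ge0 ltW.
exists (fine (\sum_(0 <= j <oo | has_index s j) (1 - cmod (seq_point s j))%:E)%E) => N.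
rewrite -lee_fin fineK; last first.
  by rewrite ge0_fin_numE//; apply: nneseries_ge0 => j _; exact: p0.
rewrite -sumEFin; exact: nneseries_lim_ge p0.
Qed.

(** Each occurrence of [a] contributes [1 - |a|] to the Blaschke sum, so a point of the disk occurs
    only finitely often. *)
Lemma Blaschke_multiplicity (s : point_seq R) (a : C) : Blaschke_sequence s -> cmod a < 1 ->
  (forall N, count (fun j => has_index s j && (seq_point s j == a)) (iota 0 N) = 0%N) \/
  exists2 m, occurs_with_multiplicity s a m &
    forall N, (count (fun j => has_index s j && (seq_point s j == a)) (iota 0 N) <= m)%N.
Proof.
move=> sB a1; have [s1 [S SP]] := Blaschke_sequence_bounded sB.
set Q := fun j => _.
have cS N : (count Q (iota 0 N))%:R * (1 - cmod a) <= S.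
  apply: le_trans (SP N); elim: N => [|N IH]; first by rewrite big_geq// mul0r.
  rewrite count_iotaS natrD mulrDl big_mkcond big_nat_recr//= -big_mkcond /= lerD// /Q.
  case hN: (has_index s N) => /=; last by rewrite mul0r.
  have [->|_] := eqVneq (seq_point s N) a; first by rewrite mul1r.
  by rewrite mul0r subr_ge0 ltW// s1.
have [B cB] : exists B, forall N, (count Q (iota 0 N) <= B)%N.
  have aa : 0 < 1 - cmod a by rewrite subr_gt0.
  have [B hB] : exists B : nat, S / (1 - cmod a) <= B%:R.
    exists (Num.truncn (Num.max 0 (S / (1 - cmod a)))).+1.
    apply: le_trans (ltW (truncnS_gt _)); by rewrite le_max lexx orbT.
  exists B => N; rewrite -(ler_nat R); apply: le_trans hB.
  by rewrite ler_pdivlMr.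
have [m mQ] := bounded_count_card cB.
have [[N1 N1m] le_m] := count_card mQ.
case: m mQ N1m le_m => [|m] mQ N1m le_m.
  by left => N; apply/eqP; rewrite -leqn0; exact: le_m.
right; exists m.+1 => //; split => //.
move: mQ; congr (_ #= _)%card; apply/seteqP; split => j /=.
  by move=> /andP[-> /eqP].
by move=> [h e]; rewrite /Q h e eqxx.
Qed.

Lemma occurs_count (s : point_seq R) (a : C) m : occurs_with_multiplicity s a m ->
  exists N, count (fun j => has_index s j && (seq_point s j == a)) (iota 0 N) = m.
Proof.
move=> [m0 mQ]; apply: (proj1 (@count_card _ m _)).
move: mQ; congr (_ #= _)%card; apply/seteqP; split => j /=.
  by move=> [-> /eqP].
by move=> /andP[-> /eqP].
Qed.

End PartialBlaschke.

(** * SK-metrics and maximal functions *)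

Section Pseudometrics.
Variable R : realType.
Local Notation C := (cplx R).
Local Notation Re := (@complex.Re R).
Local Notation Im := (@complex.Im R).
Local Notation rc := (@rc R).
Implicit Types (rho r : R) (z w a : C) (f g : C -> C) (lam : C -> R).

Lemma limf_einf_ge (T : filteredType R) (F : set_system R) (f : R -> \bar R) (a : \bar R) :
  (\forall x \near F, (a <= f x)%E) -> (a <= limf_einf f F)%E.
Proof.
move=> fa; rewrite limf_einfE.
apply: (@le_trans _ _ (ereal_inf (f @` [set x | (a <= f x)%E]))).
  by apply: le_ereal_inf_tmp => _ [x /= ax <-].
by apply: ereal_sup_ubound; exists [set x | (a <= f x)%E].
Qed.

Lemma limf_einf_le (F : set_system R) (FF : ProperFilter F) (f : R -> \bar R) (a : \bar R) :
  (\forall x \near F, (f x <= a)%E) -> (limf_einf f F <= a)%E.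
Proof.
move=> fa; rewrite limf_einfE; apply: ge_ereal_sup => _ [V FV <-].
have [x [Vx fx]] := filter_ex (filterI FV fa).
by apply: le_trans fx; apply: ereal_inf_lbound; exists x.
Qed.

Lemma limf_esup_lty (F : set_system C) (f : C -> R) (K : R) :
  (\forall x \near F, f x <= K) -> (limf_esup (fun w => (f w)%:E) F < +oo)%E.
Proof.
move=> fK; apply: (@le_lt_trans _ _ K%:E); last by rewrite ltry.
rewrite limf_esupE; apply: (@le_trans _ _ (ereal_sup ((fun w => (f w)%:E) @` [set x | f x <= K]))).
  by apply: ereal_inf_lbound; exists [set x | f x <= K].
by apply: ge_ereal_sup => _ [x /= fx <-]; rewrite lee_fin.
Qed.

Lemma limf_esup_bound (F : set_system C) (FF : Filter F) (f : C -> R) :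
  (limf_esup (fun w => (f w)%:E) F < +oo)%E -> exists K, \forall x \near F, f x <= K.
Proof.
rewrite limf_esupE => /ereal_inf_lt[_ [V FV <-]] sV.
have [K hK] : exists K : R, (ereal_sup [set (f w)%:E | w in V] <= K%:E)%E.
  move: sV; case: (ereal_sup _) => [K|//|] _; first by exists K.
  by exists 0; rewrite leNye.
exists K; apply: filterS FV => x Vx; rewrite -lee_fin; apply: le_trans hK.
by apply: ereal_sup_ubound; exists x.
Qed.

Lemma open_unit_disk : open (@unit_disk R).
Proof.
move=> z z1; apply/nbhsCP; exists (1 - cmod z); first by rewrite subr_gt0.
by move=> w wz; have := cmodD (w - z) z; rewrite subrK /unit_disk /=; lra.
Qed.

Lemma within_disk lam : (forall z, cmod z < 1 -> {for z, continuous lam}) ->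
  {within @unit_disk R, continuous lam}.
Proof.
move=> lc; rewrite continuous_open_subspace; last exact: open_unit_disk.
by move=> z; rewrite inE => z1; exact: lc.
Qed.

Lemma within_disk_cont lam z : {within @unit_disk R, continuous lam} -> cmod z < 1 ->
  {for z, continuous lam}.
Proof.
rewrite continuous_open_subspace; last exact: open_unit_disk.
by move=> lc z1; apply: lc; rewrite inE.
Qed.

Lemma cont_ln_comp (u : R -> R) : continuous u -> (forall t, 0 < u t) ->
  continuous (fun t => ln (u t)).
Proof.
by move=> uc u0 t; apply: (@continuous_comp _ _ _ u (@ln R) t (uc t)); exact: continuous_ln.
Qed.

Lemma cont_comp_RR (h : R -> C) lam : continuous h ->
  (forall t, {for h t, continuous lam}) -> continuous (fun t => lam (h t)).
Proof. by move=> hc fc t; exact: (@continuous_comp _ _ _ h lam t (hc t) (fc t)). Qed.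

Lemma cont_comp_circ lam z r : 0 <= r ->
  (forall w, cmod (w - z) = r -> {for w, continuous lam}) ->
  continuous (fun t => lam (circ z r t)).
Proof.
move=> r0 lc; apply: (cont_comp_RR (@cont_circ R z r)) => t.
by apply: lc; exact: cmod_circ.
Qed.

Lemma mean_ln_hol_at rho f z r : 0 < r -> r < rho ->
  (forall w, cmod (w - z) < rho -> exists k, hasD f w k) ->
  (forall w, cmod (w - z) < rho -> f w != 0) ->
  tmean (fun t => ln (cmod (f (circ z r t)))) = ln (cmod (f z)).
Proof.
move=> r0 rr fD f0; pose g v := f (v + z).
have sub v : v + z - z = v by rewrite addrK.
have gh : hol rho g.
  move=> v vr; have [|k fk] := fD (v + z); first by rewrite sub.
  have D0 : hasD (fun v => v + z) v (1 + 0) := hasD_add (hasD_id v) (hasD_cst z v).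
  eexists; exact: hasD_comp D0 fk.
have g0 v : cmod v < rho -> g v != 0 by move=> vr; apply: f0; rewrite sub.
have := mean_ln_hol gh r0 rr g0; rewrite /g add0r => <-.
by apply: tmean_eq => t; rewrite /circ add0r addrC.
Qed.

Lemma contR_cst (k : R) z : {for z, continuous (fun _ : C => k)}.
Proof. by apply/cvgCRP => e e0; exists 1 => // w _; rewrite subrr normr0. Qed.

Lemma contR_M (u v : C -> R) z : {for z, continuous u} -> {for z, continuous v} ->
  {for z, continuous (fun w : C => u w * v w)}.
Proof. by move=> uc vc; exact: (cvgM uc vc). Qed.

Lemma contR_B (u v : C -> R) z : {for z, continuous u} -> {for z, continuous v} ->
  {for z, continuous (fun w : C => u w - v w)}.
Proof. by move=> uc vc; exact: (cvgB uc vc). Qed.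

Lemma contR_V (u : C -> R) z : u z != 0 -> {for z, continuous u} ->
  {for z, continuous (fun w : C => (u w)^-1)}.
Proof. by move=> u0 uc; exact: (cvgV u0 uc). Qed.

Lemma contR_X (u : C -> R) n z : {for z, continuous u} ->
  {for z, continuous (fun w : C => u w ^+ n)}.
Proof.
move=> uc; elim: n => [|n IH].
  have -> : (fun w : C => u w ^+ 0) = (fun _ : C => 1) by apply/funext => w; rewrite expr0.
  exact: contR_cst.
have -> : (fun w : C => u w ^+ n.+1) = (fun w : C => u w * u w ^+ n).
  by apply/funext => w; rewrite exprS.
exact: contR_M uc IH.
Qed.

Lemma cont_1Bsqr z : {for z, continuous (fun w : C => 1 - cmod w ^+ 2)}.
Proof. exact: (contR_B (@contR_cst 1 z) (contR_X (@cont_cmod R z))). Qed.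

Section LowerBound.
Variables (P : pred nat) (c : nat -> C).
Hypothesis Bb : Blaschke_bounded P c.
Local Notation beta := (beta P c).
Local Notation bprod := (bprod P c).
Local Notation defect := (defect P c).

Lemma ln_1B_ge (x : R) : 0 <= x -> x <= 1 / 2 -> - (2 * x) <= ln (1 - x).
Proof.
move=> x0 x1; have h : 0 < 1 - x by lra.
have := @le_ln1Dx R ((1 - x)^-1 - 1).
have -> : 1 + ((1 - x)^-1 - 1) = (1 - x)^-1 by ring.
rewrite lnV ?posrE// => H.
have h2 : (1 - x)^-1 <= 1 + 2 * x by rewrite -[_^-1]mul1r ler_pdivrMr//; nra.
have h3 : -1 < (1 - x)^-1 - 1 by rewrite ltrBrDl subrr invr_gt0.
by have := H h3; lra.
Qed.

(** [ln |bprod N|] has the mean value property near [z]. On the circle it exceeds [ln beta] by at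
    most [e] when [N] is large, and at the centre it is at least [ln (beta z)]. *)
Lemma beta_submean z r : 0 < r -> cmod z + r < 1 ->
  (exists2 rho, r < rho & forall w, cmod (w - z) < rho -> cmod w < 1 /\ 0 < beta w) ->
  ln (beta z) <= tmean (fun t => ln (beta (circ z r t))).
Proof.
move=> r0 zr [rho rr rP].
have z1 : cmod z < 1 by have := cmod_ge0 z; lra.
have rho0 : 0 < rho := lt_trans r0 rr.
have bz : 0 < beta z by apply: (rP z _).2; rewrite subrr cmod0.
have cp t : cmod (circ z r t - z) = r by apply: cmod_circ; exact: ltW.
have cr t : cmod (circ z r t - z) < rho by rewrite cp.
have c1 t : cmod (circ z r t) < 1 := (rP _ (cr t)).1.
have cle t : cmod (circ z r t) <= cmod z + r.
  by have := cmodD (circ z r t - z) z; rewrite subrK cp addrC.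
have b0 t : 0 < beta (circ z r t) := (rP _ (cr t)).2.
have bc : continuous (fun t => ln (beta (circ z r t))).
  apply: cont_ln_comp b0; apply: cont_comp_circ (ltW r0) _ => w wr.
  by apply: (cont_beta Bb); apply: (rP w _).1; rewrite wr.
have bp0 N w : cmod (w - z) < rho -> 0 < cmod (bprod N w).
  by move=> /rP[_ h]; exact: lt_le_trans h (beta_le P c N w).
apply/ler_addgt0Pl => e e0.
have ss : 0 < 1 - (cmod z + r) by rewrite subr_gt0.
have m0 : 0 < Num.min (1 / 2) (e / 2) by rewrite lt_min !divr_gt0.
have [N hN] := defect_small Bb (mulr_gt0 (divr_gt0 ss (ltr0n _ 4)) m0).
set x := 4 * defect N / (1 - (cmod z + r)).
have x0 : 0 <= x by rewrite divr_ge0 ?mulr_ge0 ?(defect_ge0 Bb) ?ltW.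
have : x < Num.min (1 / 2) (e / 2) by rewrite ltr_pdivrMr//; move: hN; lra.
rewrite lt_min => /andP[x1 x2].
have lx : - e <= ln (1 - x) by have := ln_1B_ge x0 (ltW x1); lra.
have key t : ln (cmod (bprod N (circ z r t))) - e <= ln (beta (circ z r t)).
  have h1 : cmod (bprod N (circ z r t)) * (1 - x) <= beta (circ z r t).
    apply: le_trans (beta_ge Bb N (c1 t)); apply: ler_wpM2l; first exact: cmod_ge0.
    rewrite lerD2l lerN2; apply: ler_wpM2l; first by rewrite mulr_ge0// defect_ge0.
    by rewrite lef_pV2 ?posrE ?subr_gt0// lerD2l lerN2.
  have p0 := bp0 N _ (cr t).
  have h2 : 0 < 1 - x by lra.
  have := h1; rewrite -ler_ln ?posrE ?mulr_gt0// lnM ?posrE//; lra.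
have pc : continuous (fun t => ln (cmod (bprod N (circ z r t)))).
  apply: cont_ln_comp (fun t => bp0 N _ (cr t)).
  apply: (@cont_comp_circ (fun w => cmod (bprod N w)) z r (ltW r0)) => w wr.
  apply: (cont_bprod Bb).
  by apply: (rP w _).1; rewrite wr.
have ce : continuous (fun _ : R => e) by move=> t; exact: cvg_cst.
have pce : continuous (fun t => ln (cmod (bprod N (circ z r t))) - e).
  by move=> t; apply: cvgB; [exact: pc|exact: ce].
have := tmean_le pce bc key; rewrite (tmeanB pc ce) tmean_cst (@mean_ln_hol_at rho)//.
- have : ln (beta z) <= ln (cmod (bprod N z)).
    by rewrite ler_ln ?posrE ?(beta_le P c)// bp0// subrr cmod0.
  by lra.
- by move=> w /rP[w1 _]; exact: hol_bprod Bb.1 _ _ w1.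
- by move=> w /(bp0 N); rewrite cmod_gt0.
Qed.

End LowerBound.

(* Jensen's formula for [ln |1 - conj z w|] turns the mean of [- ln (1 - |w|^2)]
   into that of [- ln (1 - |mob z w|^2) >= |mob z w|^2]. *)
Lemma hyperbolic_submean z r : 0 < r -> cmod z + r < 1 ->
  r ^+ 2 / (1 - cmod z ^+ 2) ^+ 2 - ln (1 - cmod z ^+ 2) <=
  tmean (fun t => - ln (1 - cmod (circ z r t) ^+ 2)).
Proof.
move=> r0 zr; have z1 : cmod z < 1 by have := cmod_ge0 z; lra.
set d := 1 - cmod z ^+ 2; have d0 : 0 < d by rewrite subr_gt0 cmod_sqr_lt1.
have [rho rr rz] := @between R r (1 - cmod z) ltac:(by move: zr; lra).
have cp t : cmod (circ z r t - z) = r by apply: cmod_circ; exact: ltW.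
have disk w : cmod (w - z) < rho -> cmod w < 1.
  by have := cmodD (w - z) z; rewrite subrK; lra.
have c1 t : cmod (circ z r t) < 1 by apply: disk; rewrite cp.
pose q w := 1 / (1 - z^* * w).
have q0 w : cmod w < 1 -> 1 - z^* * w != 0 by move=> w1; exact: mob_den (ltW w1).
have pD w : exists k, hasD (fun w => 1 - z^* * w) w k.
  by eexists; exact: hasD_sub (hasD_cst 1 w) (hasD_cmul z^* (hasD_id w)).
have qD w : cmod w < 1 -> exists k, hasD q w k.
  move=> w1; have [k pk] := pD w; eexists; exact: hasD_div (hasD_cst 1 w) pk (q0 w w1).
have qz : q z = rc d^-1.
  by rewrite /q [z^* * z]mulrC mul_conj -rc1 -rcB -rcV -rcM mul1r.
have contq w : cmod w < 1 -> {for w, continuous q}.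
  by move=> /qD[k qk]; exact: hasD_cvg qk.
have qcC : continuous (fun t => q (circ z r t)).
  apply: (cont_comp_RC (@cont_circ R z r)) => t; exact: contq (c1 t).
have Reqc : continuous (fun t => Re (q (circ z r t))).
  by apply: (cont_comp_RR qcC) => t; exact: cont_Re.
have mq : tmean (fun t => Re (q (circ z r t))) = d^-1.
  rewrite -Re_cmean (mean_value r0) ?qz// => w wr; apply: qD; apply: disk.
  exact: le_lt_trans wr rr.
have mp : tmean (fun t => ln (cmod (1 - z^* * circ z r t))) = ln d.
  rewrite (@mean_ln_hol_at rho (fun w => 1 - z^* * w))//.
    by rewrite [z^* * z]mulrC mul_conj -rc1 -rcB cmod_rc_ge0// ltW.
  by move=> w /disk; exact: q0.
have lnc : continuous (fun t => ln (cmod (1 - z^* * circ z r t))).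
  apply: cont_ln_comp => [|t]; last by rewrite cmod_gt0 q0.
  apply: (@cont_comp_circ (fun w => cmod (1 - z^* * w)) z r (ltW r0)) => w wr.
  apply: contC_cmod; have [k pk] := pD w; exact: hasD_cvg pk.
have lnc2 : continuous (fun t => - ln (1 - cmod (circ z r t) ^+ 2)).
  move=> t; apply: cvgN; move: t; apply: cont_ln_comp => [|t].
    apply: (@cont_comp_circ (fun w => 1 - cmod w ^+ 2) z r (ltW r0)) => w wr.
    exact: cont_1Bsqr.
  by rewrite subr_gt0 cmod_sqr_lt1.
have key t : ln d - 2 * ln (cmod (1 - z^* * circ z r t)) +
    r ^+ 2 * (2 * d^-1 * Re (q (circ z r t)) - d^-1 ^+ 2) <=
    - ln (1 - cmod (circ z r t) ^+ 2).
  set w := circ z r t; have w1 : cmod w < 1 := c1 t.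
  have D0 : 0 < cmod (1 - z^* * w) by rewrite cmod_gt0 q0.
  have W0 : 0 < 1 - cmod w ^+ 2 by rewrite subr_gt0 cmod_sqr_lt1.
  have M := one_sub_mob z1 (ltW w1); rewrite -/d in M.
  have V0 : 0 < 1 - cmod (mob z w) ^+ 2 by rewrite M divr_gt0 ?mulr_gt0 ?exprn_gt0.
  have E1 : ln (1 - cmod (mob z w) ^+ 2) = ln d + ln (1 - cmod w ^+ 2) -
      2 * ln (cmod (1 - z^* * w)).
    rewrite M ln_div ?posrE ?mulr_gt0 ?exprn_gt0// lnM ?posrE// lnXn//.
    by rewrite mulr_natl.
  have E2 : ln (1 - cmod (mob z w) ^+ 2) <= - cmod (mob z w) ^+ 2.
    have := @le_ln1Dx R (- cmod (mob z w) ^+ 2).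
    by apply; rewrite ltrNl opprK; move: V0; lra.
  have E3 : cmod (mob z w) ^+ 2 = r ^+ 2 * cmod (q w) ^+ 2.
    rewrite /mob /q !cmod_div cmod1 !expr_div_n expr1n cmodB cp mul1r//.
  (* Minorizing [|q|^2] by an expression affine in [Re q] keeps the mean computable; equality holds
     at the centre, where [q z = 1 / d]. *)
  have E4 : 2 * d^-1 * Re (q w) - d^-1 ^+ 2 <= cmod (q w) ^+ 2.
    rewrite cmod_sqr; have := sqr_ge0 (Im (q w)).
    have := sqr_ge0 (Re (q w) - d^-1); rewrite sqrrB; lra.
  have := ler_wpM2l (sqr_ge0 r) E4; move: E1 E2; rewrite E3; lra.
have cA : continuous (fun t => ln d - 2 * ln (cmod (1 - z^* * circ z r t))).
  move=> t; apply: cvgB; first exact: cvg_cst.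
  by apply: cvgM; [exact: cvg_cst|exact: lnc].
have cB1 : continuous (fun t => 2 * d^-1 * Re (q (circ z r t)) - d^-1 ^+ 2).
  move=> t; apply: cvgB; last exact: cvg_cst.
  by apply: cvgM; [exact: cvg_cst|exact: Reqc].
have cB : continuous (fun t => r ^+ 2 * (2 * d^-1 * Re (q (circ z r t)) - d^-1 ^+ 2)).
  by move=> t; apply: cvgM; [exact: cvg_cst|exact: cB1].
have cAB : continuous (fun t => ln d - 2 * ln (cmod (1 - z^* * circ z r t)) +
    r ^+ 2 * (2 * d^-1 * Re (q (circ z r t)) - d^-1 ^+ 2)).
  by move=> t; apply: cvgD; [exact: cA|exact: cB].
have cc (k : R) : continuous (fun _ : R => k) by move=> t; exact: cvg_cst.
have cL : continuous (fun t => 2 * ln (cmod (1 - z^* * circ z r t))).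
  by move=> t; apply: cvgM; [exact: cvg_cst|exact: lnc].
have cR : continuous (fun t => 2 * d^-1 * Re (q (circ z r t))).
  by move=> t; apply: cvgM; [exact: cvg_cst|exact: Reqc].
have := tmean_le cAB lnc2 key.
rewrite (tmeanD cA cB) (tmeanB (cc _) cL) tmean_cst (tmeanZ _ lnc) mp.
rewrite (tmeanZ _ cB1) (tmeanB cR (cc _)) (tmeanZ _ Reqc) tmean_cst mq.
move=> h; apply: le_trans h; rewrite le_eqVlt; apply/orP; left; apply/eqP.
by field; rewrite gt_eqF.
Qed.

Lemma bprod_upper P (c : nat -> C) N a w : Blaschke_bounded P c -> cmod a < 1 -> cmod w < 1 ->
  cmod (bprod P c N w) <=
  (cmod (w - a) / (1 - cmod a)) ^+ count (fun j => P j && (c j == a)) (iota 0 N).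
Proof.
move=> Bb a1 w1; have q0 : 0 <= cmod (w - a) / (1 - cmod a).
  by rewrite divr_ge0 ?cmod_ge0// subr_ge0 ltW.
elim: N => [|N IH]; first by rewrite bprod0 cmod1.
rewrite bprodS cmodM count_iotaS; case PN: (P N); rewrite ?andTb; last first.
  by rewrite addn0 cmod1 mulr1.
have b1 : cmod (mob (c N) w) <= 1 by rewrite mob_le1 ?Bb.1 ?ltW.
have [e|_] := eqVneq (c N) a.
  rewrite addn1 exprSr; apply: ler_pM => //; rewrite ?cmod_ge0// e; exact: mob_upper.
by rewrite addn0; apply: le_trans IH; rewrite ler_piMr ?cmod_ge0.
Qed.

(** The Poincare density of curvature -4 multiplied by [|B|]: the competitor behind (1). *)
Definition pseudohyp (s : point_seq R) : C -> R :=
  fun z => beta (has_index s) (seq_point s) z / (1 - cmod z ^+ 2).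

Lemma cont_pseudohyp s z : Blaschke_sequence s -> cmod z < 1 ->
  {for z, continuous (pseudohyp s)}.
Proof.
move=> sB z1; have Bb := Blaschke_sequence_bounded sB.
have d0 : 1 - cmod z ^+ 2 != 0 by rewrite gt_eqF// subr_gt0 cmod_sqr_lt1.
exact: (contR_M (cont_beta Bb z1) (contR_V d0 (@cont_1Bsqr z))).
Qed.

(** [ln |B|] is submean and [- ln (1 - |z|^2)] has lower Laplacian at least [4 / (1 - |z|^2)^2].
    Dividing by the squared density bounds the curvature by [-4 / |B|^2], and [|B| <= 1]. *)
Lemma pseudohyp_curvature s z : Blaschke_sequence s -> cmod z < 1 -> 0 < pseudohyp s z ->
  (curvature (pseudohyp s) z <= (- 4)%:E)%E.
Proof.
move=> sB z1 lz; have Bb := Blaschke_sequence_bounded sB.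
set b := beta (has_index s) (seq_point s).
have d0 : 0 < 1 - cmod z ^+ 2 by rewrite subr_gt0 cmod_sqr_lt1.
have bz : 0 < b z by move: lz; rewrite /pseudohyp pmulr_lgt0// invr_gt0.
have /cvgCRP/(_ _ bz)[e e0 eP] := cont_beta Bb z1.
have [rho rho0 [rho1 rhoP]] : exists2 rho : R, 0 < rho & rho < 1 - cmod z /\
    forall w, cmod (w - z) < rho -> cmod w < 1 /\ 0 < b w.
  have m0 : 0 < Num.min e (1 - cmod z) by rewrite lt_min e0 subr_gt0.
  have [rho h1] := between m0; rewrite lt_min => /andP[h2 h3].
  exists rho => //; split => // w wr; split.
    by have := cmodD (w - z) z; rewrite subrK; lra.
  have := eP w (lt_trans wr h2); rewrite ltr_norml => /andP[]; rewrite -/b; lra.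
have L : ((4 / (1 - cmod z ^+ 2) ^+ 2)%:E <= lower_laplacian (fun w => ln (pseudohyp s w)) z)%E.
  apply: (@limf_einf_ge R); near=> r.
  have r0 : 0 < r by near: r; exact: nbhs_right_gt.
  have rr : r < rho by near: r; exact: nbhs_right_lt.
  have zr : cmod z + r < 1 by lra.
  have cp t : cmod (circ z r t - z) = r by apply: cmod_circ; exact: ltW.
  have cr t : cmod (circ z r t - z) < rho by rewrite cp.
  have c1 t := (rhoP _ (cr t)).1; have b0 t := (rhoP _ (cr t)).2.
  have bc : continuous (fun t => ln (b (circ z r t))).
    apply: cont_ln_comp b0; apply: cont_comp_circ (ltW r0) _ => w wr.
    by apply: (cont_beta Bb); apply: (rhoP w _).1; rewrite wr.
  have lc : continuous (fun t => - ln (1 - cmod (circ z r t) ^+ 2)).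
    move=> t; apply: cvgN; move: t; apply: cont_ln_comp => [|t].
      apply: (@cont_comp_circ (fun w => 1 - cmod w ^+ 2) z r (ltW r0)) => w wr.
      exact: cont_1Bsqr.
    by rewrite subr_gt0 cmod_sqr_lt1.
  have lnE w : cmod w < 1 -> 0 < b w ->
      ln (pseudohyp s w) = ln (b w) + - ln (1 - cmod w ^+ 2).
    by move=> w1 bw; rewrite ln_div// posrE// subr_gt0 cmod_sqr_lt1.
  have E : circle_mean (fun w => ln (pseudohyp s w)) z r =
      tmean (fun t => ln (b (circ z r t))) + tmean (fun t => - ln (1 - cmod (circ z r t) ^+ 2)).
    by rewrite circle_meanE -(tmeanD bc lc); apply: tmean_eq => t; exact: (lnE _ (c1 t) (b0 t)).
  rewrite lee_fin E lnE//.
  have H1 := beta_submean Bb r0 zr (ex_intro2 _ _ rho rr rhoP); rewrite -/b in H1.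
  have H2 := hyperbolic_submean r0 zr.
  have r2 : 0 < 4 / r ^+ 2 by rewrite divr_gt0// exprn_gt0.
  have -> : 4 / (1 - cmod z ^+ 2) ^+ 2 =
      4 / r ^+ 2 * (r ^+ 2 / (1 - cmod z ^+ 2) ^+ 2) by field; rewrite !gt_eqF.
  by rewrite ler_pM2l//; lra.
rewrite /curvature /pseudohyp -/b.
have b1 : b z <= 1.
  by have := beta_le (has_index s) (seq_point s) 0%N z; rewrite bprod0 cmod1.
have l2 : 0 < ((b z / (1 - cmod z ^+ 2)) ^+ 2)^-1.
  by rewrite invr_gt0 exprn_gt0// divr_gt0.
apply: (@le_trans _ _ ((- (4 / (1 - cmod z ^+ 2) ^+ 2))%:E *
   (((b z / (1 - cmod z ^+ 2)) ^+ 2)^-1)%:E)%E).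
  by apply: lee_wpmul2r; [rewrite lee_fin ltW|rewrite EFinN leeN2].
rewrite -EFinM lee_fin.
have -> : - (4 / (1 - cmod z ^+ 2) ^+ 2) * ((b z / (1 - cmod z ^+ 2)) ^+ 2)^-1 =
   - 4 / b z ^+ 2 by field; rewrite !gt_eqF.
rewrite ler_pdivrMr ?exprn_gt0// mulNr lerN2 ler_piMr// expr_le1// ltW//.
Unshelve. all: by end_near.
Qed.

Lemma pseudohyp_in_SK_family s : Blaschke_sequence s -> SK_family s (pseudohyp s).
Proof.
move=> sB; have Bb := Blaschke_sequence_bounded sB.
split; first split; first split.
- by apply: within_disk => z z1; exact: cont_pseudohyp.
- move=> z z1; rewrite /pseudohyp divr_ge0 ?beta_ge0// subr_ge0 expr_le1 ?cmod_ge0//; exact: ltW.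
- have [z z1 bz] := beta_gt0_exists Bb.
  by exists z => //; rewrite gt_eqF// divr_gt0 ?subr_gt0 ?cmod_sqr_lt1.
- by move=> z z1 lz; exact: pseudohyp_curvature.
move=> a m am; have [N Nm] := occurs_count am.
have a1 : cmod a < 1.
  move: am => [m0 _]; move: m0; rewrite -Nm -has_count => /hasP[j _ /andP[hj /eqP <-]].
  exact: Bb.1.
have [s0 s1 s2] := between a1.
apply: (@limf_esup_lty _ _ ((1 - cmod a) ^- m / (1 - s0 ^+ 2))).
apply/nbhsCP; exists (s0 - cmod a); first by rewrite subr_gt0.
move=> w wa wna; have ws : cmod w <= s0.
  by have := cmodD (w - a) a; rewrite subrK; lra.
have w1 : cmod w < 1 := le_lt_trans ws s2.
have wa0 : 0 < cmod (w - a) ^+ m by rewrite exprn_gt0// cmod_gt0 subr_eq0.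
rewrite ler_pdivrMr// /pseudohyp.
have ss : 0 < 1 - s0 ^+ 2.
  by rewrite subr_gt0 sqr_lt1// (le_trans _ ws)// cmod_ge0.
have h1 := le_trans (beta_le _ _ N w) (bprod_upper N Bb a1 w1).
rewrite Nm expr_div_n in h1.
have h2 : (1 - cmod w ^+ 2)^-1 <= (1 - s0 ^+ 2)^-1.
  have hw : 0 < 1 - cmod w ^+ 2 by rewrite subr_gt0 cmod_sqr_lt1.
  rewrite lef_pV2 ?posrE// lerD2l lerN2.
  have s00 : 0 <= s0 := le_trans (cmod_ge0 w) ws.
  by apply: lerXn2r => //; rewrite nnegrE ?cmod_ge0.
rewrite [leRHS]mulrAC [X in _ <= X / _]mulrC.
apply: ler_pM => //; first exact: beta_ge0.
by rewrite invr_ge0 subr_ge0 expr_le1 ?cmod_ge0// ltW.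
Qed.

(* [E = (lam / |w|^(m - 1/k))^k] has no interior maximum, and letting
   [k --> oo] turns the resulting bound into one of exact order [m]. *)
Lemma SK_family_bound s lam a m M rho : SK_family s lam -> occurs_with_multiplicity s a m ->
  0 < rho -> cmod a + rho < 1 -> 0 < M ->
  (forall w, cmod (w - a) <= rho -> lam w <= M) ->
  forall w, cmod (w - a) <= rho -> lam w <= M * (cmod (w - a) / rho) ^+ m.
Proof.
move=> [[[lc l0 _] lk] lm] am rho0 arho M0 lM.
have lnX (x : R) n : 0 < x -> ln (x ^+ n) = n%:R * ln x.
  by move=> x0; rewrite lnXn// mulr_natl.
have disk v : cmod v <= rho -> cmod (a + v) < 1.
  by move=> vr; have := cmodD a v; lra.
have lcont v : cmod v <= rho -> {for a + v, continuous lam}.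
  by move=> /disk; exact: within_disk_cont.
have l0' v : cmod v <= rho -> 0 <= lam (a + v) by move=> /disk/l0.
have [B /nbhsCP[e e0 eB]] := limf_esup_bound _ (lm a m am).
have m0 : (0 < m)%N := am.1.
(* Since [lam / |v|^m] is bounded near the centre, the additional factor [cmod v] makes [E k]
   continuous there with value 0. *)
pose E k v := lam (a + v) ^+ k * cmod v / cmod v ^+ (k * m).
have Ec k v : (0 < k)%N -> cmod v <= rho -> {for v, continuous (E k)}.
  move=> k0 vr.
  have addc : {for v, continuous (fun v : C => a + v)}.
    exact: hasD_cvg (hasD_add (hasD_cst a v) (hasD_id v)).
  have lc' : {for v, continuous (fun v : C => lam (a + v))}.
    exact: (@continuous_comp _ _ _ (fun v => a + v) lam v addc (lcont v vr)).
  have [v0|v0] := eqVneq v 0; last first.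
    have vm : cmod v ^+ (k * m) != 0 by rewrite expf_neq0// cmod_eq0.
    have cc := @cont_cmod R v.
    exact: (contR_M (contR_M (contR_X lc') cc) (contR_V vm (contR_X cc))).
  rewrite v0; apply/cvgCRP => d d0.
  have BB : 0 < `|B| ^+ k + 1 by rewrite ltr_wpDl// exprn_ge0.
  exists (Num.min (Num.min e rho) (d / (`|B| ^+ k + 1))).
    by rewrite !lt_min e0 rho0 divr_gt0.
  move=> w; rewrite subr0 !lt_min => /andP[/andP[we wr] wd].
  have -> : E k 0 = 0 by rewrite /E cmod0 mulr0 mul0r.
  rewrite subr0; have [->|w0] := eqVneq w 0; first by rewrite /E cmod0 mulr0 mul0r normr0.
  have cw : 0 < cmod w by rewrite cmod_gt0.
  have := eB (a + w); rewrite addrAC subrr add0r => /(_ we) h.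
  have {h} h : lam (a + w) / cmod w ^+ m <= B.
    by apply: h; rewrite -subr_eq0 addrAC subrr add0r.
  have q0 : 0 <= lam (a + w) / cmod w ^+ m.
    by rewrite divr_ge0 ?exprn_ge0 ?cmod_ge0 ?l0' ?ltW.
  have -> : E k w = (lam (a + w) / cmod w ^+ m) ^+ k * cmod w.
    by rewrite /E expr_div_n -exprM mulnC mulrAC.
  rewrite ger0_norm ?mulr_ge0 ?exprn_ge0 ?cmod_ge0//.
  have hk : (lam (a + w) / cmod w ^+ m) ^+ k <= `|B| ^+ k.
    by apply: lerXn2r; rewrite ?nnegrE// (le_trans h)// ler_norm.
  apply: le_lt_trans (ler_wpM2r (ltW cw) hk) _.
  by rewrite ltr_pdivlMr// in wd; move: wd; rewrite mulrDr mulr1 mulrC; lra.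
have bound k v : (0 < k)%N -> cmod v <= rho -> E k v <= M ^+ k * rho / rho ^+ (k * m).
  move=> k0 vr; have [p pr pmax] := disc_max (ltW rho0) (fun w wr => Ec k w k0 wr).
  have Rk : 0 < M ^+ k * rho / rho ^+ (k * m).
    by rewrite !mulr_gt0 ?invr_gt0 ?exprn_gt0.
  apply: le_trans (pmax v vr) _; have [Ep|Ep] := leP (E k p) 0.
    exact: le_trans Ep (ltW Rk).
  have cp : 0 < cmod p.
    rewrite lt_def cmod_ge0 andbT; apply: contraTneq Ep => p0.
    by rewrite /E p0 mulr0 mul0r ltxx.
  have lp : 0 < lam (a + p).
    rewrite lt_def l0'// andbT; apply: contraTneq Ep => p0.
    by rewrite /E p0 expr0n eqn0Ngt k0 /= !mul0r ltxx.
  move: pr; rewrite le_eqVlt => /orP[/eqP pr|pr].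
    rewrite /E pr; apply: ler_wpM2r; first by rewrite invr_ge0 exprn_ge0// ltW.
    apply: ler_wpM2r; first exact: ltW.
    apply: lerXn2r; rewrite ?nnegrE ?(ltW lp) ?(ltW M0)//; apply: lM.
    by rewrite addrAC subrr add0r pr.
  (* At an interior maximum [p != 0] of [E k], [ln lam] lies below its value at [p] plus [m - 1/k]
     times the harmonic function [ln |v| - ln |p|]. Its circle means do not exceed the central
     value, so the lower Laplacian is at most 0, against curvature at most -4. *)
  exfalso.
  have /cvgCRP/(_ _ lp)[d d0 dP] := lcont p (ltW pr).
  have ap1 : cmod (a + p) < 1 := disk p (ltW pr).
  have near_pos u : cmod u < d -> 0 < lam (a + p + u).
    move=> ud; have := dP (a + p + u); rewrite addrAC subrr add0r => /(_ ud).
    by rewrite ltr_norml => /andP[]; lra.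
  have : (curvature lam (a + p) <= (- 4)%:E)%E := lk _ ap1 lp.
  apply/negP; rewrite -ltNge; apply: (@lt_le_trans _ _ 0%E).
    by rewrite lte_fin; lra.
  rewrite /curvature; apply: mule_ge0; last by rewrite lee_fin invr_ge0 sqr_ge0.
  rewrite oppe_ge0; apply: limf_einf_le; near=> r.
  have r0 : 0 < r by near: r; exact: nbhs_right_gt.
  have : r < Num.min (Num.min d (cmod p)) (rho - cmod p).
    by near: r; apply: nbhs_right_lt; rewrite !lt_min d0 cp subr_gt0.
  rewrite !lt_min => /andP[/andP[rd rp] rrho].
  rewrite lee_fin pmulr_rle0; last by rewrite divr_gt0// exprn_gt0.
  rewrite subr_le0 circle_meanE -/(circ (a + p) r).
  pose u t : C := rc r * expi t.
  have ur t : cmod (u t) = r by rewrite cmodM cmod_expi mulr1 cmod_rc_ge0// ltW.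
  have upr t : cmod (p + u t) <= rho by have := cmodD p (u t); rewrite ur; lra.
  have up0 t : 0 < cmod (p + u t).
    have := cmod_subl p (- u t); rewrite opprK cmodN ur; lra.
  have lu t : 0 < lam (a + p + u t) by apply: near_pos; rewrite ur.
  pose q : R := m%:R - k%:R^-1.
  have kR : 0 < k%:R :> R by rewrite ltr0n.
  have key t : ln (lam (a + p + u t)) <=
      ln (lam (a + p)) + q * (ln (cmod (circ p r t)) - ln (cmod p)).
    have := pmax (p + u t) (upr t); rewrite -ler_ln ?posrE//; last first.
      by rewrite /E !mulr_gt0 ?invr_gt0 ?exprn_gt0// addrA.
    rewrite /E !addrA !ln_div ?posrE ?mulr_gt0 ?exprn_gt0// !lnM ?posrE ?exprn_gt0//.
    rewrite (lnX _ _ (lu t)) (lnX _ _ lp) !(lnX _ _ (up0 t)) !(lnX _ _ cp) natrM => h.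
    rewrite -(ler_pM2l kR); move: h; rewrite /q /circ -/(u t).
    have -> : k%:R * (ln (lam (a + p)) +
        (m%:R - k%:R^-1) * (ln (cmod (p + u t)) - ln (cmod p))) =
      k%:R * ln (lam (a + p)) + (k%:R * m%:R - 1) * (ln (cmod (p + u t)) - ln (cmod p)).
      by field; rewrite gt_eqF.
    by move=> h; lra.
  have cl : continuous (fun t => ln (lam (a + p + u t))).
    apply: cont_ln_comp lu; apply: (@cont_comp_circ lam (a + p) r (ltW r0)) => w wr.
    apply: within_disk_cont lc _; have := cmod_trian (a + p) w 0.
    rewrite !subr0 wr; have := cmodD a p; lra.
  have pc : continuous (fun t => ln (cmod (circ p r t))).
    apply: cont_ln_comp up0; apply: (@cont_comp_circ (@cmod R) p r (ltW r0)) => w _.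
    exact: cont_cmod.
  have cc (x : R) : continuous (fun _ : R => x) by move=> t; exact: cvg_cst.
  have c1 : continuous (fun t => ln (cmod (circ p r t)) - ln (cmod p)).
    by move=> t; apply: cvgB; [exact: pc|exact: cvg_cst].
  have c2 : continuous (fun t => q * (ln (cmod (circ p r t)) - ln (cmod p))).
    by move=> t; apply: cvgM; [exact: cvg_cst|exact: c1].
  have c3 : continuous (fun t => ln (lam (a + p)) + q * (ln (cmod (circ p r t)) - ln (cmod p))).
    by move=> t; apply: cvgD; [exact: cvg_cst|exact: c2].
  have := tmean_le cl c3 key.
  rewrite (tmeanD (cc _) c2) tmean_cst (tmeanZ _ c1) (tmeanB pc (cc _)) tmean_cst.
  rewrite (@mean_ln_hol_at (cmod p) (fun w => w))//.
  - by rewrite subrr mulr0 addr0.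
  - by move=> w _; eexists; exact: hasD_id.
  - move=> w; apply: contraTneq => ->; rewrite sub0r cmodN ltxx//.
move=> w wr; have [v vw] : exists v, w = a + v by exists (w - a); rewrite addrC subrK.
rewrite vw addrAC subrr add0r in wr *.
(* At the centre the claim is [lam a <= 0]: continuity together with [lam = O(|v|^m)] and
   [m > 0]. *)
have [->|v0] := eqVneq v 0.
  rewrite cmod0 mul0r expr0n eqn0Ngt m0 mulr0 addr0.
  have [_ /nbhsCP[e' e'0 _]] := (True, (nbhsCP a setT).2 (ex_intro2 _ _ 1 ltr01 (fun _ _ => I))).
  have z0 : cmod (0 : C) <= rho by rewrite cmod0 ltW.
  have := lcont 0 z0; rewrite addr0 => /cvgCRP ac.
  apply/ler_addgt0Pl => d d0; rewrite addr0.
  have [d1 d10 hd1] := ac (d / 2) (divr_gt0 d0 (ltr0n _ 2)).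
  have B1 : 0 < `|B| + 1 by rewrite ltr_wpDl.
  have D0 : 0 < Num.min (Num.min e 1) (Num.min d1 (d / 2 / (`|B| + 1))).
    by rewrite !lt_min e0 ltr01 d10 !divr_gt0.
  have [x x0 [xD _]] := avoid_seq [::] a D0.
  move: xD; rewrite !lt_min => /andP[/andP[xe x1] /andP[xd1 xd]].
  have cx : cmod (rc x) = x by rewrite cmod_rc_ge0// ltW.
  have := eB (a + rc x); rewrite addrAC subrr add0r cx => /(_ xe) h.
  have {h} h : lam (a + rc x) / x ^+ m <= B.
    by apply: h; rewrite -subr_eq0 addrAC subrr add0r rc_eq0 gt_eqF.
  have := hd1 (a + rc x); rewrite addrAC subrr add0r cx => /(_ xd1).
  rewrite ltr_norml => /andP[h1 _].
  rewrite ler_pdivrMr ?exprn_gt0// in h.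
  have h2 : x ^+ m <= x by rewrite -{2}(expr1 x) ler_wiXn2l// ltW.
  have h3 : B * x ^+ m <= `|B| * x.
    by apply: le_trans (ler_wpM2r _ (ler_norm B)) _; rewrite ?exprn_ge0 ?(ltW x0)// ler_wpM2l.
  rewrite ltr_pdivlMr// in xd; move: xd; rewrite mulrDr mulr1; lra.
have cv : 0 < cmod v by rewrite cmod_gt0.
have q0 : 0 < M * (cmod v / rho) ^+ m by rewrite mulr_gt0// exprn_gt0// divr_gt0.
rewrite -[leRHS]mul1r -ler_pdivrMr//.
(* The [k]-th power of the ratio of the two sides is at most [rho / cmod v] for every [k], so the
   ratio is at most 1. *)
apply: (@pow_bounded_le1 R _ (rho / cmod v)).
  by rewrite divr_ge0 ?(ltW q0)// l0'.
case=> [|k]; first by rewrite expr0 ler_pdivlMr// mul1r.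
have := bound k.+1 v isT wr; rewrite /E.
rewrite expr_div_n exprMn -exprM mulnC expr_div_n.
move: (lam _ ^+ _) (M ^+ _) (exprn_gt0 k.+1 M0) (m * k.+1)%N => X Y Y0 n h.
have a0 : 0 < cmod v ^+ n by rewrite exprn_gt0.
have b0 : 0 < rho ^+ n by rewrite exprn_gt0.
rewrite ler_pdivrMr// in h.
rewrite ler_pdivrMr ?mulr_gt0 ?invr_gt0//.
rewrite -(ler_pM2r cv) (le_trans h)// le_eqVlt; apply/orP; left; apply/eqP.
by field; rewrite !gt_eqF.
Unshelve. all: by end_near.
Qed.

End Pseudometrics.

(** * Consequences of maximality for the function and its derivative *)

Section MaximalFunctions.
Variable R : realType.
Local Notation C := (cplx R).
Local Notation Re := (@complex.Re R).
Local Notation Im := (@complex.Im R).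
Local Notation rc := (@rc R).
Implicit Types (rho r : R) (z w a : C).

(* What is used of a maximal function with critical set [c]: its hyperbolic
   derivative dominates the Blaschke product of [c], and its derivative
   vanishes on [c] with multiplicities. *)
Record extremal (P : pred nat) (c : nat -> C) (F F' : C -> C) : Prop := Extremal {
  ext_lt1 : forall z, cmod z < 1 -> cmod (F z) < 1;
  ext_hasD : forall z, cmod z < 1 -> hasD F z (F' z);
  ext_lower : forall z, cmod z < 1 ->
    beta P c z * (1 - cmod (F z) ^+ 2) <= (1 - cmod z ^+ 2) * cmod (F' z);
  ext_vanishes : forall a M, cmod a < 1 ->
    vanishes F' a (count (fun j => P j && (c j == a)) (iota 0 M)) }.

Lemma ext_hol P c F F' : extremal P c F F' -> hol 1 F.
Proof. by move=> E z z1; exists (F' z); exact: ext_hasD E z z1. Qed.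

Lemma ext_hol_derive P c F F' : extremal P c F F' -> hol 1 F'.
Proof. by move=> E; apply: hol_derive ltr01 (ext_hol E) (ext_hasD E). Qed.

Lemma one_sub_sqr_gt0 z : cmod z < 1 -> 0 < 1 - cmod z ^+ 2.
Proof. by move=> z1; rewrite subr_gt0 cmod_sqr_lt1. Qed.

Lemma ext_upper P c F F' z : extremal P c F F' -> cmod z < 1 ->
  (1 - cmod z ^+ 2) * cmod (F' z) <= 1 - cmod (F z) ^+ 2.
Proof.
move=> E z1; apply: schwarz_pick_derive (ext_hol E) _ z1 (ext_hasD E z1).
by move=> v /(ext_lt1 E)/ltW.
Qed.

(** The lower bound is maximality against [pseudohyp s]. For the zeros, [SK_family_bound] holds for
    all competitors with the same constants, hence for their supremum. A count over a prefix may
    fall short of the multiplicity [m], but since [|w - a| < 1] order [m] implies every smaller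
    order. *)
Lemma maximal_extremal (s : point_seq R) F : Blaschke_sequence s -> maximal_function s F ->
  extremal (has_index s) (seq_point s) F (F^`()%classic).
Proof.
move=> sB [Fan F1 Fmax].
have FD z : cmod z < 1 -> hasD F z (F^`()%classic z) by move=> /Fan/derivable_hasD.
have Fh : hol 1 F by move=> z /FD; exists (F^`()%classic z).
set F' := F^`()%classic in FD Fmax *.
have lamF lam z : SK_family s lam -> cmod z < 1 ->
    lam z <= cmod (F' z) / (1 - cmod (F z) ^+ 2).
  by move=> sl z1; rewrite -lee_fin -Fmax//; apply: ereal_sup_ubound; exists lam.
have up z : cmod z < 1 -> (1 - cmod z ^+ 2) * cmod (F' z) <= 1 - cmod (F z) ^+ 2.
  move=> z1; apply: schwarz_pick_derive Fh _ z1 (FD z z1).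
  by move=> v /F1/ltW.
split => //.
  move=> z z1; have := lamF _ z (pseudohyp_in_SK_family sB) z1.
  rewrite /pseudohyp ler_pdivrMr ?one_sub_sqr_gt0// mulrAC ler_pdivlMr.
    by rewrite [leRHS]mulrC.
  exact: one_sub_sqr_gt0 (F1 z z1).
move=> a N a1; set m' := count _ _.
pose rho := (1 - cmod a) / 2.
have a0 := cmod_ge0 a.
have rho0 : 0 < rho by rewrite divr_gt0// subr_gt0.
have rho1 : rho < 1 by rewrite /rho; lra.
have ar : cmod a + rho < 1 by rewrite /rho; lra.
have disk w : cmod (w - a) <= rho -> cmod w <= cmod a + rho.
  by move=> wr; have := cmodD (w - a) a; rewrite subrK; lra.
have disk1 w : cmod (w - a) <= rho -> cmod w < 1 by move=> /disk/le_lt_trans; apply.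
(* Schwarz-Pick for [F] bounds the maximal density by [1 / (1 - |w|^2)], hence by [M] on the disc of
   radius [rho] about [a]. *)
pose M := (1 - (cmod a + rho) ^+ 2)^-1.
have ar0 : 0 <= cmod a + rho by rewrite addr_ge0// ltW.
have arS : 0 < 1 - (cmod a + rho) ^+ 2 by rewrite subr_gt0 sqr_lt1.
have M0 : 0 < M by rewrite invr_gt0.
have FM w : cmod (w - a) <= rho -> cmod (F' w) / (1 - cmod (F w) ^+ 2) <= M.
  move=> wr; have w1 := disk1 w wr; have f0 := one_sub_sqr_gt0 (F1 w w1).
  rewrite ler_pdivrMr// /M mulrC ler_pdivlMr// mulrC.
  apply: le_trans (up w w1); apply: ler_wpM2r; first exact: cmod_ge0.
  rewrite lerD2l lerN2; apply: lerXn2r (disk w wr); rewrite nnegrE ?cmod_ge0//.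
case: (Blaschke_multiplicity sB a1) => [c0|[m am cm]].
  exists M, rho; split => // w w1 wr; rewrite /m' c0 expr0 mulr1.
  have := FM w (ltW wr); rewrite ler_pdivrMr ?(one_sub_sqr_gt0 (F1 w w1))// => h.
  by apply: le_trans h _; rewrite ler_piMr ?(ltW M0)// gerBl sqr_ge0.
exists (M / rho ^+ m), rho; split => // w w1 wr.
(* The bound is independent of [lam], so it passes to the supremum, which is the density of [F]. *)
have key : cmod (F' w) / (1 - cmod (F w) ^+ 2) <= M * (cmod (w - a) / rho) ^+ m.
  rewrite -lee_fin -Fmax//; apply: ge_ereal_sup => _ [lam sl <-]; rewrite lee_fin.
  apply: (SK_family_bound sl am rho0 ar M0 _ (ltW wr)) => v vr.
  exact: le_trans (lamF lam v sl (disk1 v vr)) (FM v vr).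
have f0 := one_sub_sqr_gt0 (F1 w w1).
rewrite ler_pdivrMr// in key.
have p0 : 0 <= M * (cmod (w - a) / rho) ^+ m.
  by rewrite mulr_ge0 ?(ltW M0)// exprn_ge0// divr_ge0 ?cmod_ge0 ?ltW.
apply: (@le_trans _ _ (M * (cmod (w - a) / rho) ^+ m)).
  by apply: le_trans key _; rewrite ler_piMr// gerBl sqr_ge0.
rewrite expr_div_n mulrCA [leLHS]mulrC; apply: ler_wpM2l.
  by rewrite divr_ge0 ?exprn_ge0 ?ltW.
by apply: ler_wiXn2l; [exact: cmod_ge0|exact: ltW (lt_trans wr rho1)|exact: cm].
Qed.

Section Extremal.
Variables (P : pred nat) (c : nat -> C) (F F' : C -> C).
Hypothesis Bb : Blaschke_bounded P c.
Hypothesis EF : extremal P c F F'.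
Local Notation beta := (beta P c).
Local Notation bprod := (bprod P c).
Local Notation defect := (defect P c).

Lemma quotient_exists N : exists2 H, hol 1 H &
  forall z, cmod z < 1 -> F' z = bprod N z * H z.
Proof.
by apply: (divide_bprod Bb N (ext_hol_derive EF)) => a M a1; exact: (ext_vanishes EF).
Qed.

(** (1) divided by [|bprod N|]: legitimate off the zeros of [bprod N], and extended to them by
    continuity. *)
Lemma quotient_lower N H z : hol 1 H ->
  (forall z, cmod z < 1 -> F' z = bprod N z * H z) -> cmod z < 1 ->
  (1 - cmod (F z) ^+ 2) * (1 - 4 * defect N / (1 - cmod z)) <=
  (1 - cmod z ^+ 2) * cmod (H z).
Proof.
move=> Hh HE z1.
have cF w : cmod w < 1 -> {for w, continuous F} := hol_cont (ext_hol EF).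
apply: (@le_off_finite R (zeros P c N)
  (fun w => (1 - cmod (F w) ^+ 2) * (1 - 4 * defect N / (1 - cmod w)))
  (fun w => (1 - cmod w ^+ 2) * cmod (H w))) => //.
- have n0 : 1 - cmod z != 0 by rewrite subr_eq0 gt_eqF.
  have c1 := contR_B (@contR_cst R 1 z) (@cont_cmod R z).
  have c2 := contR_M (@contR_cst R (4 * defect N) z) (contR_V n0 c1).
  have c3 := contR_X (n := 2) (contC_cmod (cF z z1)).
  exact: (contR_M (contR_B (@contR_cst R 1 z) c3) (contR_B (@contR_cst R 1 z) c2)).
- exact: (contR_M (@cont_1Bsqr R z) (contC_cmod (hol_cont Hh z1))).
move=> w w1; rewrite -(bprod_eq0 Bb)// => b0.
have b0' : 0 < cmod (bprod N w) by rewrite cmod_gt0.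
have := ext_lower EF w1; rewrite HE// cmodM => h.
have F0 : 0 <= 1 - cmod (F w) ^+ 2 by rewrite ltW// one_sub_sqr_gt0// (ext_lt1 EF).
have := ler_wpM2r F0 (beta_ge Bb N w1) => h2.
rewrite -(ler_pM2l b0'); move: (le_trans h2 h); lra.
Qed.

(** Schwarz-Pick against the origin. This positive lower bound supplies the nonnegativity for
    Fatou's lemma and, for finite critical sets, bounds [1 / H]. *)
Lemma ext_ratio_lower z : cmod z < 1 ->
  (1 - cmod (F 0)) / (1 + cmod (F 0)) <= (1 - cmod (F z) ^+ 2) / (1 - cmod z ^+ 2).
Proof.
move=> z1; have z0 : cmod (0 : C) < 1 by rewrite cmod0.
have := schwarz_pick_sqr (ext_hol EF) (fun v v1 => ltW (ext_lt1 EF v1)) z1 z0.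
rewrite cmod0 conjC0 mul0r subr0 cmod1 expr0n subr0 expr1n !mul1r => h.
have f0 := cmod_ge0 (F 0); have f1 := ext_lt1 EF z0.
have fz := ext_lt1 EF z1.
have h2 : 1 - cmod (F 0) <= cmod (1 - (F 0)^* * F z).
  have := cmod_subl 1 ((F 0)^* * F z); rewrite cmod1 cmodM cmod_conj.
  have : cmod (F 0) * cmod (F z) <= cmod (F 0) by rewrite ler_piMr// ltW.
  lra.
have h3 : (1 - cmod (F 0)) ^+ 2 <= cmod (1 - (F 0)^* * F z) ^+ 2.
  by apply: lerXn2r h2; rewrite nnegrE ?cmod_ge0// subr_ge0 ltW.
have zz := one_sub_sqr_gt0 z1.
rewrite ler_pdivrMr ?ltr_wpDr// mulrAC ler_pdivlMr//.
have h4 := le_trans (ler_wpM2r (ltW zz) h3) h.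
have f10 : 0 < 1 - cmod (F 0) by rewrite subr_gt0.
rewrite -(ler_pM2l f10); move: h4; lra.
Qed.

End Extremal.
End MaximalFunctions.

(** * Angular derivatives almost everywhere *)

Section AngularDerivatives.
Variable R : realType.
Local Notation C := (cplx R).
Local Notation Re := (@complex.Re R).
Local Notation Im := (@complex.Im R).
Local Notation rc := (@rc R).
Local Notation mu := (@lebesgue_measure R).
Implicit Types (rho r : R) (z w a : C).
Variables (P : pred nat) (c : nat -> C) (F F' : C -> C).
Hypothesis Bb : Blaschke_bounded P c.
Hypothesis EF : extremal P c F F'.
Local Notation beta := (beta P c).
Local Notation bprod := (bprod P c).
Local Notation defect := (defect P c).

Let A z := (1 - cmod (F z) ^+ 2) / (1 - cmod z ^+ 2).

Let A0 z : cmod z < 1 -> 0 < A z.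
Proof.
by move=> z1; rewrite divr_gt0 ?one_sub_sqr_gt0// (ext_lt1 EF).
Qed.

Let cont_A z : cmod z < 1 -> {for z, continuous A}.
Proof.
move=> z1; have n0 : 1 - cmod z ^+ 2 != 0 by rewrite gt_eqF// one_sub_sqr_gt0.
have cF := hol_cont (ext_hol EF) z1.
have c3 := contR_X (n := 2) (contC_cmod cF).
exact: (contR_M (contR_B (@contR_cst R 1 z) c3) (contR_V n0 (@cont_1Bsqr R z))).
Qed.

Lemma cont_ln_ratio r : 0 < r -> r < 1 -> continuous (fun t => ln (A (circ 0 r t))).
Proof.
move=> r0 r1.
have c1 w : cmod (w - 0) = r -> cmod w < 1 by rewrite subr0 => ->.
apply: cont_ln_comp => [|t]; last by apply: A0; rewrite cmod_circ0// ltW.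
by apply: (@cont_comp_circ R A 0 r (ltW r0)) => w /c1; exact: cont_A.
Qed.

(** Compares the quotients of [F'] by two partial products; thus the values at the origin of all
    later quotients are controlled by a fixed one. *)
Lemma quotient_tail N M H K z : (N <= M)%N -> hol 1 H -> hol 1 K ->
  (forall z, cmod z < 1 -> F' z = bprod N z * H z) ->
  (forall z, cmod z < 1 -> F' z = bprod M z * K z) -> cmod z < 1 ->
  (1 - 4 * defect N / (1 - cmod z)) * cmod (K z) <= cmod (H z).
Proof.
move=> NM Hh Kh HE KE z1.
apply: (@le_off_finite R (zeros P c N)
  (fun w => (1 - 4 * defect N / (1 - cmod w)) * cmod (K w)) (fun w => cmod (H w))) => //.
- have n0 : 1 - cmod z != 0 by rewrite subr_eq0 gt_eqF.
  have c1 := contR_B (@contR_cst R 1 z) (@cont_cmod R z).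
  have c2 := contR_M (@contR_cst R (4 * defect N) z) (contR_V n0 c1).
  exact: (contR_M (contR_B (@contR_cst R 1 z) c2) (contC_cmod (hol_cont Kh z1))).
- exact: (contC_cmod (hol_cont Hh z1)).
move=> w w1; rewrite -(bprod_eq0 Bb)// => b0.
have b0' : 0 < cmod (bprod N w) by rewrite cmod_gt0.
have E : cmod (bprod N w) * cmod (H w) = cmod (bprod M w) * cmod (K w).
  by rewrite -!cmodM -HE// -KE.
rewrite -(ler_pM2l b0') E mulrA; apply: ler_wpM2r; first exact: cmod_ge0.
by have := bprod_tail Bb w1 NM.
Qed.

(** On [|w| < s] the ratio [A] is at most [2 * |H|] for a quotient [H] with large [N], and [A > 0]
    makes [H] zero-free there. So the mean of [ln A] is at most [ln 2 + ln |H 0|], where [N] depends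
    on the radius but [|H 0| <= 2 * |H0 0|] with [H0] fixed. *)
Lemma mean_ln_ratio_bounded : exists M, forall r, 0 < r -> r < 1 ->
  tmean (fun t => ln (A (circ 0 r t))) <= M.
Proof.
have [N0 hN0] := defect_small Bb (divr_gt0 ltr01 (ltr0n R 8)).
have [H0 H0h H0E] := quotient_exists Bb EF N0.
exists (ln (2 * (2 * cmod (H0 0)))) => r r0 r1.
have [s rs s1] := between r1.
have ss : 0 < 1 - s by rewrite subr_gt0.
have [N1 hN1] := defect_small Bb (divr_gt0 ss (ltr0n R 8)).
have [N N0N N1N] : exists2 N, (N0 <= N)%N & (N1 <= N)%N.
  by exists (maxn N0 N1); rewrite ?leq_maxl ?leq_maxr.
have [H Hh HE] := quotient_exists Bb EF N.
have dN : defect N < (1 - s) / 8 := le_lt_trans (defect_mono Bb N1N) hN1.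
have AH w : cmod w < s -> A w <= 2 * cmod (H w).
  move=> ws; have w1 : cmod w < 1 := lt_trans ws s1.
  have := quotient_lower Bb EF Hh HE w1.
  have F0 : 0 < 1 - cmod (F w) ^+ 2 by rewrite one_sub_sqr_gt0// (ext_lt1 EF).
  have h : 1 / 2 <= 1 - 4 * defect N / (1 - cmod w).
    have w0 : 0 < 1 - cmod w by rewrite subr_gt0.
    have : 4 * defect N / (1 - cmod w) <= 1 / 2 by rewrite ler_pdivrMr//; lra.
    by lra.
  have h2 := ler_wpM2l (ltW F0) h.
  rewrite /A ler_pdivrMr ?one_sub_sqr_gt0//; lra.
have Hn0 w : cmod w < s -> H w != 0.
  move=> ws; rewrite -cmod_gt0 -(pmulr_rgt0 _ (ltr0n R 2)).
  exact: lt_le_trans (A0 (lt_trans ws s1)) (AH w ws).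
have s0 : 0 < s := lt_trans r0 rs.
have Hs : hol s H := hol_sub_radius (ltW s1) Hh.
have mH := mean_ln_hol Hs r0 rs Hn0.
have cr t : cmod (circ 0 r t) = r by rewrite cmod_circ0// ltW.
have Hn0' w : cmod w = r -> H w != 0 by move=> wr; apply: Hn0; rewrite wr.
have cH : continuous (fun t => ln (cmod (H (circ 0 r t)))).
  exact: cont_ln_hol Hs (ltW r0) rs Hn0'.
have c2 : continuous (fun _ : R => ln (2 : R)) by move=> t; exact: cvg_cst.
have c2H : continuous (fun t => ln 2 + ln (cmod (H (circ 0 r t)))).
  by move=> t; apply: cvgD; [exact: c2|exact: cH].
have key t : ln (A (circ 0 r t)) <= ln 2 + ln (cmod (H (circ 0 r t))).
  have ws : cmod (circ 0 r t) < s by rewrite cr.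
  have h0 : 0 < cmod (H (circ 0 r t)) by rewrite cmod_gt0 Hn0.
  have Ac : 0 < A (circ 0 r t) by apply: A0; rewrite cr.
  rewrite -lnM ?posrE//; rewrite ler_ln ?posrE//.
    exact: AH.
  exact: mulr_gt0.
have := tmean_le (cont_ln_ratio r0 r1) c2H key.
rewrite (tmeanD c2 cH) tmean_cst mH => h; apply: le_trans h _.
have z0 : cmod (0 : C) < 1 by rewrite cmod0.
have H00 : 0 < cmod (H 0) by rewrite cmod_gt0 Hn0// cmod0.
have := quotient_tail N0N H0h Hh H0E HE z0; rewrite cmod0 subr0 divr1 => h.
have h2 : cmod (H 0) <= 2 * cmod (H0 0).
  have : 1 / 2 * cmod (H 0) <= (1 - 4 * defect N0) * cmod (H 0).
    by apply: ler_wpM2r; [exact: ltW|lra].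
  by move: h; lra.
have h3 : 0 < 2 * cmod (H0 0) := lt_le_trans H00 h2.
rewrite -lnM ?posrE// ler_ln ?posrE; [|exact: mulr_gt0|exact: mulr_gt0].
by rewrite ler_pM2l.
Qed.

Definition angular_limit (zeta omega : C) (d : R) :=
  forall K e : R, 0 < e ->
    exists2 d' : R, 0 < d' & forall z, cmod z < 1 ->
      cmod (z - zeta) < K * (1 - cmod z) -> cmod (z - zeta) < d' ->
      cmod ((F z - omega) / (z - zeta) - omega * zeta^* / rc d) < e.

Theorem ae_angular_limit :
  {ae mu, forall t, `[0, 2 * pi]%classic t -> exists (omega : C) (d : R),
    [/\ cmod omega = 1, 0 < d & angular_limit (expi t) omega d]}.
Proof.
have [M hM] := mean_ln_ratio_bounded.
pose k0 := (1 - cmod (F 0)) / (1 + cmod (F 0)).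
have z0 : cmod (0 : C) < 1 by rewrite cmod0.
have k00 : 0 < k0.
  by rewrite divr_gt0 ?subr_gt0 ?(ext_lt1 EF)// ltr_wpDr// cmod_ge0.
pose rm m : R := 1 - m.+2%:R^-1.
have rm0 m : 0 < rm m by rewrite subr_gt0 invf_lt1// ltr1n.
have rm1 m : rm m < 1 by rewrite gtrBl invr_gt0.
(* Subtracting the logarithm of the lower bound [k0] makes the integrands nonnegative, as Fatou's
   lemma demands. *)
pose u m t := ln (A (circ 0 (rm m) t)) - ln k0.
have c1 m t : cmod (circ 0 (rm m) t) < 1 by rewrite cmod_circ0// ltW.
have ck : continuous (fun _ : R => ln k0) by move=> t; exact: cvg_cst.
have uc m : continuous (u m).
  by move=> t; apply: cvgB; [exact: cont_ln_ratio|exact: ck].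
have u0 m t : 0 <= u m t.
  have h := ext_ratio_lower EF (c1 m t); have Ac := A0 (c1 m t).
  by rewrite subr_ge0 ler_ln ?posrE.
have uM m : tmean (u m) <= M - ln k0.
  by rewrite (tmeanB (cont_ln_ratio (rm0 m) (rm1 m)) ck) tmean_cst lerD2r hM.
have fat := tmean_fatou uc u0 uM.
apply: (@filterS _ _ (ae_filter_ringOfSetsType mu) _ _ _ fat) => t ut Dt.
have [L hL] := ut Dt.
(* A finite lower limit gives radii tending to 1 along which the quotient stays bounded, exactly the
   hypothesis of [julia_caratheodory]. *)
have /choice[f fP] : forall N, exists m, (N <= m)%N /\ u m t <= L.
  by move=> N; have [m Nm um] := hL N; exists m.
have rk01 k : 0 < rm (f k) /\ rm (f k) < 1 by split.
have rk1 (e : R) : 0 < e -> exists k, 1 - rm (f k) < e.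
  move=> e0; have [k ke] : exists k : nat, e^-1 < k%:R.
    by exists (Num.truncn e^-1).+1; exact: truncnS_gt.
  exists k; rewrite /rm opprB addrCA subrr addr0.
  rewrite -[e]invrK ltf_pV2 ?posrE ?invr_gt0//; apply: lt_le_trans ke _.
  by rewrite ler_nat (leq_trans (fP k).1)// -addn2 leq_addr.
have Fk k : 1 - cmod (F (rc (rm (f k)) * expi t)) ^+ 2 <=
    (k0 * expR L) * (1 - rm (f k) ^+ 2).
  have := (fP k).2; rewrite /u lerBlDr => h.
  have r2 : 0 < 1 - rm (f k) ^+ 2 by rewrite subr_gt0 sqr_lt1// ltW.
  have E : cmod (circ 0 (rm (f k)) t) = rm (f k) by rewrite cmod_circ0// ltW.
  have : A (circ 0 (rm (f k)) t) <= k0 * expR L.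
    have e0 : 0 < expR L := expR_gt0 L.
    have Ac := A0 (c1 (f k) t).
    rewrite -ler_ln ?posrE//; last exact: mulr_gt0.
    by rewrite [leRHS]lnM ?posrE// expRK addrC.
  by rewrite /A E ler_pdivrMr// /circ add0r.
have [omega [k [u1 k1 J]]] := julia_caratheodory (ext_hol EF) (ext_lt1 EF)
  (cmod_expi t) rk01 rk1 Fk.
by exists omega, k; split.
Qed.

Lemma angular_limit_finite (zeta omega : C) (d : R) : cmod omega = 1 ->
  angular_limit zeta omega d -> finite_angular_derivative F zeta.
Proof.
move=> o1 J; exists omega, (omega * zeta^* / rc d); split => // K K1.
apply/cvgCP => e e0; have [d' d'0 dP] := J K e e0.
apply/nbhsCP; exists d' => // w wd [w1 wK].
exact: dP.
Qed.

Corollary ae_finite_angular_derivative : ae_unit_circle (finite_angular_derivative F).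
Proof.
apply: (@filterS _ _ (ae_filter_ringOfSetsType mu) _ _ _ ae_angular_limit) => t H Dt.
have [omega [k [u1 k1 J]]] := H Dt; exact: angular_limit_finite J.
Qed.

End AngularDerivatives.

(** * Recognition of Blaschke products *)

Section ZeroFreeFactor.
Variable R : realType.
Local Notation C := (cplx R).
Local Notation Re := (@complex.Re R).
Local Notation Im := (@complex.Im R).
Local Notation rc := (@rc R).
Implicit Types (rho r : R) (z w a : C) (f g : C -> C).

Lemma schwarz_pick_radius G r z k : 0 < r -> hol r G ->
  (forall w, cmod w < r -> cmod (G w) <= 1) -> cmod z < r -> hasD G z k ->
  (r ^+ 2 - cmod z ^+ 2) * cmod k <= r * (1 - cmod (G z) ^+ 2).
Proof.
move=> r0 Gh G1 zr Gk; pose g w := G (rc r * w).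
have Gh' : hol (r * 1) G by rewrite mulr1.
have gh : hol 1 g := hol_scale r0 Gh'.
have rr : rc r != 0 by rewrite rc_eq0 gt_eqF.
pose w := z / rc r; have wz : rc r * w = z by rewrite mulrC divfK.
have cw : cmod w = cmod z / r by rewrite cmod_div cmod_rc_ge0// ltW.
have w1 : cmod w < 1 by rewrite cw ltr_pdivrMr// mul1r.
have g1 v : cmod v < 1 -> cmod (g v) <= 1.
  by move=> v1; apply: G1; rewrite cmodM cmod_rc_ge0 ?(ltW r0)// gtr_pMr.
have gD : hasD g w (k * (rc r * 1)).
  apply: (hasD_comp (hasD_cmul (rc r) (hasD_id w))); by rewrite wz.
have := schwarz_pick_derive gh g1 w1 gD.
rewrite /g wz cw mulr1 cmodM cmod_rc_ge0 ?(ltW r0)// => /(ler_wpM2l (ltW r0)) h.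
apply: le_trans h; rewrite le_eqVlt; apply/orP; left; apply/eqP.
by field; rewrite gt_eqF.
Qed.

(* With [S = Q^2] zero-free, [F = (B Q) Q] and both factors obey Schwarz-Pick. *)
Lemma zero_free_derive B S F r z k : 0 < r -> hol r B -> hol r S ->
  (forall w, cmod w < r -> cmod (B w) <= 1) -> (forall w, cmod w < r -> cmod (S w) <= 1) ->
  (forall w, cmod w < r -> S w != 0) -> (forall w, cmod w < r -> F w = B w * S w) ->
  cmod z < r -> hasD F z k ->
  ((r ^+ 2 - cmod z ^+ 2) * cmod k * (1 + cmod (S z))) ^+ 2 <=
  4 * r ^+ 2 * cmod (S z) * (1 - cmod (F z) ^+ 2) ^+ 2.
Proof.
move=> r0 Bh Sh B1 S1 S0 FE zr Fk.
have [Q Qh QE] := hol_sqrt r0 Sh S0.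
have Q1 w : cmod w < r -> cmod (Q w) <= 1.
  by move=> wr; rewrite -(@expr_le1 _ 2)// ?cmod_ge0// -cmodX -QE// S1.
pose P w := B w * Q w.
have Ph : hol r P := hol_mul Bh Qh.
have P1 w : cmod w < r -> cmod (P w) <= 1.
  by move=> wr; rewrite cmodM mulr_ile1 ?cmod_ge0 ?B1 ?Q1.
have PQ : cmod (P z) <= cmod (Q z) by rewrite cmodM ler_piMl ?cmod_ge0 ?B1.
have [kP hP] := Ph z zr; have [kQ hQ] := Qh z zr.
have kE : k = kP * Q z + P z * kQ.
  have D := hasD_mul hP hQ; apply: hasD_uniq Fk _.
  apply: (@hasD_near _ _ _ _ _ (r - cmod z)) D; first by rewrite subr_gt0.
  move=> w wz; have wr : cmod w < r.
    by have := cmodD (w - z) z; rewrite subrK; lra.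
  by rewrite FE// QE// expr2 mulrA.
have a1 := schwarz_pick_radius r0 Ph P1 zr hP.
have a2 := schwarz_pick_radius r0 Qh Q1 zr hQ.
rewrite FE// cmodM QE// cmodX.
have -> : cmod (B z) * cmod (Q z) ^+ 2 = cmod (P z) * cmod (Q z).
  by rewrite cmodM expr2 mulrA.
have d0 : 0 < r ^+ 2 - cmod z ^+ 2.
  by rewrite subr_gt0 -subr_gt0 subr_sqr mulr_gt0 ?subr_gt0// ltr_wpDr ?cmod_ge0.
have a3 : cmod k <= cmod kP * cmod (Q z) + cmod (P z) * cmod kQ.
  by rewrite kE; apply: le_trans (cmodD _ _) _; rewrite !cmodM.
move: PQ (cmod_ge0 (P z)) (cmod_ge0 (Q z)) (Q1 z zr) (cmod_ge0 k) d0 a1 a2 a3.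
move: (cmod (P z)) (cmod (Q z)) (cmod k) (cmod kP) (cmod kQ) (r ^+ 2 - cmod z ^+ 2).
move=> p q x xP xQ d pq p0 q0 q1 x0 d0 a1 a2 a3.
have b1 : d * x <= r * ((p + q) * (1 - p * q)).
  have h := ler_wpM2l (ltW d0) a3.
  have h1 := ler_wpM2r q0 a1; have h2 := ler_wpM2l p0 a2.
  by move: h h1 h2; lra.
have pq1 : p * q <= 1 by rewrite mulr_ile1// (le_trans pq).
have b2 : (p + q) * (1 + q ^+ 2) <= 2 * q * (1 + p * q).
  have : 0 <= (q - p) * (1 - q ^+ 2).
    by rewrite mulr_ge0 ?subr_ge0// expr_le1.
  by lra.
have b3 : d * x * (1 + q ^+ 2) <= 2 * r * q * (1 - (p * q) ^+ 2).
  have h1 : d * x * (1 + q ^+ 2) <= r * ((p + q) * (1 - p * q)) * (1 + q ^+ 2).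
    by apply: ler_wpM2r b1; rewrite addr_ge0 ?sqr_ge0.
  have c0 : 0 <= r * (1 - p * q) by rewrite mulr_ge0 ?subr_ge0// ltW.
  have h2 := ler_wpM2l c0 b2; move: h1 h2; lra.
have -> : 4 * r ^+ 2 * q ^+ 2 * (1 - (p * q) ^+ 2) ^+ 2 =
  (2 * r * q * (1 - (p * q) ^+ 2)) ^+ 2 by ring.
apply: lerXn2r b3; rewrite nnegrE.
  by rewrite !mulr_ge0 ?addr_ge0 ?sqr_ge0// ltW.
by rewrite !mulr_ge0 ?subr_ge0 ?expr_le1 ?mulr_ge0// ltW.
Qed.

(** Jensen's formula for one factor: the mean is [ln |a|] if the zero lies outside the circle and
    [ln r] if it lies inside. *)
Lemma mean_ln_mob a r : cmod a < 1 -> 0 < r -> r < 1 -> cmod a != r ->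
  continuous (fun t => ln (cmod (mob a (circ 0 r t)))) /\
  tmean (fun t => ln (cmod (mob a (circ 0 r t)))) = ln (Num.max r (cmod a)).
Proof.
move=> a1 r0 r1 ar; have mh := hol_mob a1.
have nz w : cmod w = r -> mob a w != 0.
  move=> wr; have w1 : cmod w <= 1 by rewrite wr ltW.
  by rewrite mob_eq0//; apply/eqP => e; rewrite -e wr eqxx in ar.
split; first exact: cont_ln_hol mh (ltW r0) r1 nz.
have [lt|gt|e] := ltgtP r (cmod a); last by rewrite e eqxx in ar.
  rewrite (mean_ln_hol (hol_sub_radius (ltW a1) mh) r0 lt) ?mob0// => w wa.
  have w1 := lt_trans wa a1.
  by rewrite mob_eq0// ?(ltW w1)//; apply: contraTneq wa => ->; rewrite ltxx.
(* The zero inside is reflected in the circle: on [|w| = r], [a - w = - w * conj (h w)]. The radius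
   [s = 2 * r - |a|] exceeds [r], and [|a| * s < r^2] because [(r - |a|)^2 > 0], so [h] has no zero
   in [|w| < s]. *)
pose h w := 1 - rc (r ^- 2) * a^* * w; pose q w := 1 - a^* * w.
have hh rho : hol rho h.
  exact: hol_sub (hol_cst 1) (hol_mul (hol_cst (rc (r ^- 2) * a^*)) (@hol_id R rho)).
have qh rho : hol rho q.
  exact: hol_sub (hol_cst 1) (hol_mul (hol_cst a^*) (@hol_id R rho)).
have r20 : 0 < r ^+ 2 by rewrite exprn_gt0.
pose s := 2 * r - cmod a; have rs : r < s by rewrite /s; lra.
have h0 w : cmod w < s -> h w != 0.
  move=> ws; rewrite subr_eq0; apply: contraTneq (ltr01 : (0 : R) < 1) => e.
  have : cmod (rc (r ^- 2) * a^* * w) = 1 by rewrite -e cmod1.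
  rewrite !cmodM cmod_conj cmod_rc_ge0 ?invr_ge0 ?(ltW r20)// => e1.
  have : cmod a * cmod w = r ^+ 2.
    by rewrite -[RHS]mulr1 -e1 !mulrA mulfV ?mul1r// gt_eqF.
  have : cmod a * cmod w <= cmod a * s by rewrite ler_wpM2l ?cmod_ge0// ltW.
  have : 0 < (r - cmod a) ^+ 2 by rewrite exprn_gt0// subr_gt0.
  by rewrite /s; lra.
have q0 w : cmod w < 1 -> q w != 0 by move=> w1; exact: mob_den (ltW w1).
have mH := mean_ln_hol (hh s) r0 rs h0.
have mQ := mean_ln_hol (qh 1) r0 r1 q0.
have cr t : cmod (circ 0 r t) = r by rewrite cmod_circ0// ltW.
have cH : continuous (fun t => ln (cmod (h (circ 0 r t)))).
  have h0' w : cmod w = r -> h w != 0 by move=> wr; apply: h0; rewrite wr.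
  exact: cont_ln_hol (hh s) (ltW r0) rs h0'.
have cQ : continuous (fun t => ln (cmod (q (circ 0 r t)))).
  have q0' w : cmod w = r -> q w != 0 by move=> wr; apply: q0; rewrite wr.
  exact: cont_ln_hol (qh 1) (ltW r0) r1 q0'.
have c1 : continuous (fun _ : R => ln r) by move=> t; exact: cvg_cst.
have cR : continuous (fun t => ln r + ln (cmod (h (circ 0 r t)))).
  by move=> t; apply: cvgD; [exact: c1|exact: cH].
have E t : ln (cmod (mob a (circ 0 r t))) =
    ln r + ln (cmod (h (circ 0 r t))) - ln (cmod (q (circ 0 r t))).
  set w := circ 0 r t.
  have Q0 : 0 < cmod (q w) by rewrite cmod_gt0 q0// cr.
  have H0 : 0 < cmod (h w) by rewrite cmod_gt0 h0// cr.
  rewrite -lnM ?posrE// -ln_div ?posrE ?mulr_gt0// /mob cmod_div; congr (ln (_ / _)).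
  have ww : w * w^* = rc (r ^+ 2) by rewrite mul_conj cr.
  have -> : a - w = - (w * (h w)^*).
    rewrite /h rmorphB rmorph1 !rmorphM /= conjCK conj_rc mulrBr mulr1 opprB.
    rewrite [w * _]mulrC -!mulrA [w^* * w]mulrC ww [a * _]mulrC mulrA -rcM.
    by rewrite mulVf ?gt_eqF// mul1r.
  by rewrite cmodN cmodM cmod_conj cr.
rewrite (tmean_eq E) (tmeanB cR cQ) (tmeanD c1 cH) tmean_cst mH mQ.
by rewrite /h /q !mulr0 subr0 cmod1 ln1 addr0 subr0.
Qed.

Section Means.
Variables (P : pred nat) (c : nat -> C).
Hypothesis Bb : Blaschke_bounded P c.
Local Notation beta := (beta P c).
Local Notation bprod := (bprod P c).
Local Notation defect := (defect P c).

Lemma mean_ln_bprod r N : 0 < r -> r < 1 ->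
  (forall j, P j -> (j < N)%N -> cmod (c j) != r) ->
  [/\ forall t, bprod N (circ 0 r t) != 0,
      continuous (fun t => ln (cmod (bprod N (circ 0 r t)))) &
      tmean (fun t => ln (cmod (bprod N (circ 0 r t)))) =
        \sum_(0 <= j < N | P j) ln (Num.max r (cmod (c j)))].
Proof.
move=> r0 r1; elim: N => [|N IH] cr.
  have E t : ln (cmod (bprod 0 (circ 0 r t))) = 0 by rewrite bprod0 cmod1 ln1.
  split; [by move=> t; rewrite bprod0 oner_neq0| |].
    by under eq_fun do rewrite E; move=> t; exact: cvg_cst.
  by rewrite (tmean_eq E) tmean_cst big_geq.
have [n0 bc bm] := IH (fun j Pj jN => cr j Pj (ltn_trans jN (ltnSn N))).
rewrite big_mkcond big_nat_recr//= -big_mkcond /=.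
case PN: (P N); last first.
  have E t : bprod N.+1 (circ 0 r t) = bprod N (circ 0 r t) by rewrite bprodS PN mulr1.
  split; first by move=> t; rewrite E.
    by under eq_fun do rewrite E; exact: bc.
  by rewrite addr0 -bm; apply: tmean_eq => t; rewrite E.
have [mc mm] := mean_ln_mob (Bb.1 _ PN) r0 r1 (cr N PN (ltnSn N)).
have m0 t : mob (c N) (circ 0 r t) != 0.
  have e : cmod (circ 0 r t) = r by rewrite cmod_circ0// ltW.
  have w1 : cmod (circ 0 r t) <= 1 by rewrite e ltW.
  rewrite mob_eq0 ?Bb.1//; apply/eqP => e'.
  by have := cr N PN (ltnSn N); rewrite -e' e eqxx.
have E t : ln (cmod (bprod N.+1 (circ 0 r t))) =
    ln (cmod (bprod N (circ 0 r t))) + ln (cmod (mob (c N) (circ 0 r t))).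
  by rewrite bprodS PN cmodM lnM ?posrE ?cmod_gt0.
split; first by move=> t; rewrite bprodS PN mulf_neq0.
  by under eq_fun do rewrite E; move=> t; apply: cvgD; [exact: bc|exact: mc].
by rewrite (tmean_eq E) (tmeanD bc mc) bm mm.
Qed.

(** Makes quantitative, uniformly in [N >= M], that the mean of [ln |bprod N|] over [|z| = r] tends
    to 0: each of the first [M] terms is at least [ln r >= - 2 * (1 - r)], and the others cost at
    most twice the tail of the Blaschke sum. *)
Lemma sum_ln_max_ge r M N : (M <= N)%N -> 1 / 2 <= r -> r < 1 -> defect M <= 1 / 2 ->
  - (2 * M%:R * (1 - r) + 2 * defect M) <=
  \sum_(0 <= j < N | P j) ln (Num.max r (cmod (c j))).
Proof.
move=> MN r0 r1 dM; have rp : 0 < r by lra.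
rewrite (big_cat_nat (leq0n M) MN)/=.
have h1 : - (2 * M%:R * (1 - r)) <= \sum_(0 <= j < M | P j) ln (Num.max r (cmod (c j))).
  have t1 j : - (2 * (1 - r)) <= ln (Num.max r (cmod (c j))).
    have := @ln_1B_ge R (1 - r) ltac:(lra) ltac:(lra); rewrite opprB addrCA subrr addr0 => h.
    apply: le_trans h _; rewrite ler_ln ?posrE// ?lt_max ?rp// le_max lexx//.
  elim: {MN dM} M => [|M IH]; first by rewrite big_geq// mulr0 mul0r oppr0.
  rewrite big_mkcond big_nat_recr//= -big_mkcond /=.
  have : - (2 * (1 - r)) <= if P M then ln (Num.max r (cmod (c M))) else 0.
    by case: ifP => // _; lra.
  by rewrite -natr1; move: IH; lra.
have h2 : - (2 * defect M) <= \sum_(M <= j < N | P j) ln (Num.max r (cmod (c j))).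
  apply: (@le_trans _ _ (\sum_(M <= j < N | P j) - (2 * (1 - cmod (c j))))).
    rewrite sumrN lerN2 -mulr_sumr ler_wpM2l//; exact: defect_le.
  rewrite big_nat_cond [leRHS]big_nat_cond; apply: ler_sum => j /andP[/andP[Mj jN] Pj].
  have cj1 := Bb.1 j Pj.
  have cj : 1 - cmod (c j) <= 1 / 2.
    apply: le_trans dM; apply: le_trans (defect_le Bb (leqW Mj)).
    rewrite big_mkcond big_nat_recr//= -big_mkcond /= Pj lerDr.
    by apply: sumr_ge0 => i Pi; rewrite subr_ge0 ltW// Bb.1.
  have := @ln_1B_ge R (1 - cmod (c j)) ltac:(lra) cj; rewrite opprB addrCA subrr addr0 => h.
  by apply: le_trans h _; rewrite ler_ln ?posrE ?lt_max ?rp ?le_max ?lexx ?orbT//; lra.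
by rewrite opprD lerD.
Qed.

(** The unimodular [u] is chosen so that [1 + u * S] equals [1 + |S 0|] at the origin;
    [ln |1 + u * S|] is harmonic and lies below [ln (1 + |S|)]. *)
Lemma mean_ln_1D S r : hol 1 S -> (forall w, cmod w < 1 -> cmod (S w) < 1) -> S 0 != 0 ->
  0 < r -> r < 1 ->
  continuous (fun t => ln (1 + cmod (S (circ 0 r t)))) /\
  ln (1 + cmod (S 0)) <= tmean (fun t => ln (1 + cmod (S (circ 0 r t)))).
Proof.
move=> Sh S1 S00 r0 r1.
have c1 w : cmod w = r -> cmod w < 1 by move=> ->.
have p0 w : 0 < 1 + cmod (S w) by rewrite ltr_wpDr ?cmod_ge0.
have sc : continuous (fun t => ln (1 + cmod (S (circ 0 r t)))).
  apply: cont_ln_comp => [|t]; last exact: p0.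
  have cc : continuous (fun t => cmod (S (circ 0 r t))).
    by apply: (cont_comp_RR (cont_hol_circ Sh (ltW r0) r1)) => t; exact: cont_cmod.
  by move=> t; apply: cvgD; [exact: cvg_cst|exact: cc].
split=> //; pose u := (S 0)^* / rc (cmod (S 0)); pose f w := 1 + u * S w.
have s0 : 0 < cmod (S 0) by rewrite cmod_gt0.
have u1 : cmod u = 1.
  by rewrite cmod_div cmod_conj cmod_rc_ge0 ?cmod_ge0// divff// gt_eqF.
have fh : hol 1 f := hol_add (hol_cst 1) (hol_mul (hol_cst u) Sh).
have f0 w : cmod w < 1 -> f w != 0.
  move=> w1; rewrite -cmod_gt0; have := cmod_subl 1 (- (u * S w)).
  by rewrite opprK cmod1 cmodN cmodM u1 mul1r; have := S1 w w1; lra.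
have f00 : f 0 = rc (1 + cmod (S 0)).
  rewrite /f /u rcD rc1; congr (1 + _); rewrite mulrAC [_^* * _]mulrC mul_conj expr2 rcM.
  by rewrite mulfK// rc_eq0 gt_eqF.
have := mean_ln_hol fh r0 r1 f0; rewrite f00 cmod_rc_ge0 ?(ltW (p0 0))// => <-.
have fc : continuous (fun t => ln (cmod (f (circ 0 r t)))).
  by apply: cont_ln_hol fh (ltW r0) r1 _ => w /c1; exact: f0.
apply: tmean_le fc sc _ => t.
have w1 : cmod (circ 0 r t) < 1 by rewrite cmod_circ0// ltW.
rewrite ler_ln ?posrE ?p0 ?cmod_gt0 ?f0//.
by apply: le_trans (cmodD _ _) _; rewrite cmod1 cmodM u1 mul1r.
Qed.

Variables (F F' : C -> C).
Hypothesis F1 : forall z, cmod z < 1 -> cmod (F z) < 1.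
Hypothesis FD : forall z, cmod z < 1 -> hasD F z (F' z).
Hypothesis Flow : forall z, cmod z < 1 ->
    beta z * (1 - cmod (F z) ^+ 2) <= (1 - cmod z ^+ 2) * cmod (F' z).

(** [Flow] bounds [F'] from below and [zero_free_derive] from above; the factor [1 - |F|^2] cancels.
    The squared form avoids the square root of [|S z|]. *)
Lemma zero_free_pointwise N B S r z : hol 1 B -> hol 1 S ->
  (forall w, cmod w < 1 -> cmod (B w) <= 1) -> (forall w, cmod w < 1 -> cmod (S w) <= 1) ->
  (forall w, cmod w < 1 -> F w = B w * S w) ->
  0 < r -> r < 1 -> (forall w, cmod w < r -> S w != 0) -> cmod z < r ->
  4 * defect N / (1 - cmod z) <= 1 ->
  (cmod (bprod N z) * (1 - 4 * defect N / (1 - cmod z)) * (1 + cmod (S z)) *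
    (r ^+ 2 - cmod z ^+ 2)) ^+ 2 <=
  4 * r ^+ 2 * (1 - cmod z ^+ 2) ^+ 2 * cmod (S z).
Proof.
move=> Bh Sh B1 S1 FE r0 r1 S0 zr dN.
have lt1 w : cmod w < r -> cmod w < 1 by move=> /lt_trans; apply.
have z1 := lt1 z zr.
have KD := zero_free_derive r0 (hol_sub_radius (ltW r1) Bh) (hol_sub_radius (ltW r1) Sh)
  (fun w wr => B1 w (lt1 w wr)) (fun w wr => S1 w (lt1 w wr)) S0
  (fun w wr => FE w (lt1 w wr)) zr (FD z1).
have bg := beta_ge Bb N z1; have fl := Flow z1.
have d0 : 0 < r ^+ 2 - cmod z ^+ 2.
  by rewrite subr_gt0 -subr_gt0 subr_sqr mulr_gt0 ?subr_gt0// ltr_wpDr ?cmod_ge0.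
have f0 : 0 < 1 - cmod (F z) ^+ 2 by rewrite one_sub_sqr_gt0// F1.
have e0 : 0 < 1 - cmod z ^+ 2 by rewrite one_sub_sqr_gt0.
have b0 : 0 <= cmod (bprod N z) * (1 - 4 * defect N / (1 - cmod z)).
  by rewrite mulr_ge0 ?cmod_ge0// subr_ge0.
move: (cmod (bprod N z) * _) b0 bg KD d0 f0 e0 fl (cmod_ge0 (F' z)) (cmod_ge0 (S z)).
move=> b b0 bg; move: (beta z) bg (r ^+ 2 - cmod z ^+ 2) (1 - cmod (F z) ^+ 2)
  (1 - cmod z ^+ 2) (cmod (F' z)) (cmod (S z)).
move=> be bg d f e x s KD d0 f0 e0 fl x0 s0.
have f20 : 0 < f ^+ 2 by rewrite exprn_gt0.
rewrite -(ler_pM2r f20).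
have h1 : b * f <= e * x by apply: le_trans fl; apply: ler_wpM2r bg; exact: ltW.
have h2 : (b * f * (1 + s) * d) ^+ 2 <= (e * x * (1 + s) * d) ^+ 2.
  apply: lerXn2r; rewrite ?nnegrE.
  - by rewrite !mulr_ge0 ?addr_ge0// ltW.
  - by rewrite !mulr_ge0 ?addr_ge0// ltW.
  - have sd : 0 <= (1 + s) * d by rewrite mulr_ge0 ?addr_ge0// ltW.
    by have := ler_wpM2r sd h1; rewrite !mulrA.
have h3 : e ^+ 2 * (d * x * (1 + s)) ^+ 2 <= e ^+ 2 * (4 * r ^+ 2 * s * f ^+ 2).
  by apply: ler_wpM2l KD; exact: sqr_ge0.
have -> : (b * (1 + s) * d) ^+ 2 * f ^+ 2 = (b * f * (1 + s) * d) ^+ 2 by ring.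
apply: le_trans h2 _; have -> : (e * x * (1 + s) * d) ^+ 2 = e ^+ 2 * (d * x * (1 + s)) ^+ 2 by ring.
apply: le_trans h3 _; rewrite le_eqVlt; apply/orP; left; apply/eqP; ring.
Qed.

Lemma between_avoid (x y : R) N : x < y -> exists r : R, [/\ x < r, r < y &
  forall j, (j < N)%N -> cmod (c j) != r].
Proof.
move=> xy; have yx : 0 < y - x by rewrite subr_gt0.
have [t t0 [tx tn]] := avoid_seq [seq rc (cmod (c j)) | j <- iota 0 N] (rc x) yx.
exists (x + t); split; [by rewrite ltrDl|by rewrite -ltrBrDl|].
move=> j jN; apply: contraNneq tn => e; apply/mapP; exists j.
  by rewrite mem_iota.
by rewrite e rcD.
Qed.

Lemma ln_mul3 (x y u : R) : 0 < x -> 0 < y -> 0 < u ->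
  ln (x * y * u) = ln x + ln y + ln u.
Proof. by move=> x0 y0 u0; rewrite !lnM ?posrE ?mulr_gt0. Qed.

Lemma ln_mul4 (x y u v : R) : 0 < x -> 0 < y -> 0 < u -> 0 < v ->
  ln (x * y * u * v) = ln x + ln y + ln u + ln v.
Proof. by move=> x0 y0 u0 v0; rewrite !lnM ?posrE ?mulr_gt0. Qed.

(* Averaging the pointwise bound over circles [|z| = r --> 1], the mean of the
   logarithm of the Blaschke product of [c] tends to zero. *)
Theorem zero_free_factor_large (e : R) : 0 < e -> exists r, [/\ 0 < r, r < 1 &
  forall B S, hol 1 B -> hol 1 S ->
  (forall w, cmod w < 1 -> cmod (B w) <= 1) -> (forall w, cmod w < 1 -> cmod (S w) <= 1) ->
  (forall w, cmod w < 1 -> F w = B w * S w) ->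
  (forall w, cmod w < r -> S w != 0) -> 1 - e <= cmod (S 0)].
Proof.
(* The logarithmic errors below add up to [14 * d]: 8 from the partial product, 4 from [eps], 2 from
   [r3]. Then [(1 - |S 0|)^2 <= 14 * d * (1 + |S 0|)^2 <= 56 * d], which is at most [e ^+ 2]. *)
move=> e0; pose d := Num.min (1 / 4) (e ^+ 2 / 64).
have d0 : 0 < d by rewrite lt_min !divr_gt0 ?exprn_gt0.
have [d4 de] : d <= 1 / 4 /\ d <= e ^+ 2 / 64 by rewrite !ge_min !lexx orbT.
(* The choices depend on each other in this order: [M] makes the tail small, the radii are so close
   to 1 that the first [M] factors cost little, [N >= M] depends on these radii, and [rho] avoids
   the moduli of the first [N] points. *)
have [M dM] := defect_small Bb d0.
have M1 : 0 < M%:R + 1 :> R by rewrite ltr_wpDl.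
pose r1 : R := 1 - d / (M%:R + 1).
have q1 : d / (M%:R + 1) <= 1 / 4.
  by rewrite ler_pdivrMr//; have := ler0n R M; nra.
have q0 : 0 < d / (M%:R + 1) by rewrite divr_gt0.
have r11 : r1 < 1 by rewrite /r1; lra.
have r1h : 1 / 2 <= r1 by rewrite /r1; lra.
have M1r : M%:R * (1 - r1) <= d.
  rewrite /r1 opprB addrCA subrr addr0 mulrCA ler_piMr ?(ltW d0)//.
  by rewrite ler_pdivrMr// mul1r lerDl.
have [r2 r12 r21] := between r11.
have s2 : 0 < 1 - r2 by rewrite subr_gt0.
have [N1 dN1] := defect_small Bb (mulr_gt0 s2 (divr_gt0 d0 (ltr0n R 4))).
pose N := maxn M N1.
have MN : (M <= N)%N by rewrite leq_maxl.
have dN : 4 * defect N / (1 - r2) < d.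
  rewrite ltr_pdivrMr//; have := defect_mono Bb (leq_maxr M N1); rewrite -/N.
  by move: dN1; lra.
have [rho [r1rho rhor2 avoid]] := between_avoid N r12.
have rho0 : 0 < rho by lra.
have rho1 : rho < 1 := lt_trans rhor2 r21.
have rho2 : 0 < 1 - rho ^+ 2 by rewrite subr_gt0 sqr_lt1// ltW.
(* The first entry puts [r3] above [rho]. The second makes [r3 * (1 - rho ^+ 2) / (r3 ^+ 2 - rho ^+
   2)] at most [1 + d]: the disc free of zeros must reach much closer to the boundary than the
   circle of averaging. *)
pose r3 := Num.max ((1 + rho) / 2) (1 - d * (1 - rho ^+ 2) / 4).
have r3h1 : (1 + rho) / 2 <= r3 by rewrite le_max lexx.
have r3h2 : 1 - d * (1 - rho ^+ 2) / 4 <= r3 by rewrite le_max lexx orbT.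
have r31 : r3 < 1.
  rewrite gt_max; apply/andP; split; first by lra.
  by rewrite gtrBl divr_gt0// mulr_gt0.
exists r3; split => //; first by lra.
move=> B S Bh Sh B1 S1 FE S0.
have r30 : 0 < r3 by lra.
have rr3 : rho < r3 by lra.
have S00 : S 0 != 0 by apply: S0; rewrite cmod0.
have z0 : cmod (0 : C) < 1 by rewrite cmod0.
have [s1|s1] := leP 1 (cmod (S 0)); first by apply: le_trans s1; lra.
have Slt w : cmod w < 1 -> cmod (S w) < 1.
  move=> w1; have := schwarz_pick_sqr Sh S1 w1 z0.
  rewrite cmod0 conjC0 mul0r subr0 cmod1 expr0n subr0 expr1n !mul1r => h.
  rewrite -sqr_lt1 ?cmod_ge0// -subr_gt0.
  have p0 : 0 < 1 - cmod (S 0) ^+ 2 by rewrite one_sub_sqr_gt0.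
  rewrite -(pmulr_rgt0 _ p0); apply: lt_le_trans h.
  rewrite mulr_gt0 ?one_sub_sqr_gt0// exprn_gt0//.
  have := cmod_subl 1 ((S 0)^* * S w); rewrite cmod1 cmodM cmod_conj.
  have : cmod (S 0) * cmod (S w) <= cmod (S 0) by rewrite ler_piMr ?cmod_ge0 ?S1.
  by lra.
have [bn bc bm] := mean_ln_bprod rho0 rho1 (fun j _ jN => avoid j jN).
have [sc sm] := mean_ln_1D Sh Slt S00 rho0 rho1.
have Shr : hol r3 S := hol_sub_radius (ltW r31) Sh.
have lm := mean_ln_hol Shr rho0 rr3 S0.
have S0' w : cmod w = rho -> S w != 0 by move=> wr; apply: S0; rewrite wr.
have lc : continuous (fun t => ln (cmod (S (circ 0 rho t)))).
  exact: cont_ln_hol Shr (ltW rho0) rr3 S0'.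
have cr t : cmod (circ 0 rho t) = rho by rewrite cmod_circ0// ltW.
have ep : 4 * defect N / (1 - rho) < d.
  apply: le_lt_trans dN; apply: ler_wpM2l; first by rewrite mulr_ge0 ?(defect_ge0 Bb).
  by rewrite lef_pV2 ?posrE ?subr_gt0// lerD2l lerN2 ltW.
set eps := 4 * defect N / (1 - rho) in ep.
have ep0 : 0 <= eps by rewrite divr_ge0 ?mulr_ge0 ?(defect_ge0 Bb)// subr_ge0 ltW.
have ep1 : 0 < 1 - eps by lra.
have D0 : 0 < r3 ^+ 2 - rho ^+ 2.
  by rewrite subr_gt0; apply: ltrXn2r; rewrite // ?nnegrE ltW.
pose K := ln 2 + ln r3 + ln (1 - rho ^+ 2) - ln (1 - eps) - ln (r3 ^+ 2 - rho ^+ 2).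
have key t : 2 * (ln (cmod (bprod N (circ 0 rho t))) + ln (1 + cmod (S (circ 0 rho t)))) <=
    2 * K + ln (cmod (S (circ 0 rho t))).
  have zr : cmod (circ 0 rho t) < r3 by rewrite cr.
  have zd : 4 * defect N / (1 - cmod (circ 0 rho t)) <= 1 by rewrite cr -/eps; lra.
  have := zero_free_pointwise Bh Sh B1 S1 FE r30 r31 S0 zr zd; rewrite cr -/eps.
  have b0 : 0 < cmod (bprod N (circ 0 rho t)) by rewrite cmod_gt0.
  have t0 : 0 < cmod (S (circ 0 rho t)) by rewrite cmod_gt0 S0.
  move: (cmod (bprod N _)) (cmod (S (circ 0 rho t))) b0 t0 => b x b0 x0.
  have x1 : 0 < 1 + x by lra.
  rewrite -ler_ln ?posrE ?exprn_gt0 ?mulr_gt0 ?exprn_gt0//.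
  have -> : (4 : R) * r3 ^+ 2 * (1 - rho ^+ 2) ^+ 2 * x = (2 * r3 * (1 - rho ^+ 2)) ^+ 2 * x by ring.
  have y0 : 0 < 2 * r3 * (1 - rho ^+ 2) by rewrite !mulr_gt0.
  rewrite [in X in _ <= X -> _]lnM ?posrE ?exprn_gt0// !lnXn ?mulr_gt0//.
  rewrite (ln_mul3 (ltr0n R 2) r30 rho2) (ln_mul4 b0 ep1 x1 D0) !mulr2n /K.
  by clear - Flow Bb FD F1; lra.
have cc (x : R) : continuous (fun _ : R => x) by move=> t; exact: cvg_cst.
have c1 : continuous (fun t => ln (cmod (bprod N (circ 0 rho t))) +
    ln (1 + cmod (S (circ 0 rho t)))).
  by move=> t; apply: cvgD; [exact: bc|exact: sc].
have c2 : continuous (fun t => 2 * (ln (cmod (bprod N (circ 0 rho t))) +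
    ln (1 + cmod (S (circ 0 rho t))))).
  by move=> t; apply: cvgM; [exact: cvg_cst|exact: c1].
have c3 : continuous (fun t => 2 * K + ln (cmod (S (circ 0 rho t)))).
  by move=> t; apply: cvgD; [exact: cvg_cst|exact: lc].
have := tmean_le c2 c3 key.
rewrite (tmeanZ _ c1) (tmeanD bc sc) bm (tmeanD (cc _) lc) tmean_cst lm => main.
have rhoh : 1 / 2 <= rho by lra.
have dMh : defect M <= 1 / 2 by lra.
have sl := sum_ln_max_ge MN rhoh rho1 dMh.
have M2 : M%:R * (1 - rho) <= d.
  by apply: le_trans M1r; rewrite ler_wpM2l//; lra.
have le := ln_1B_ge ep0 (ltac:(lra) : eps <= 1 / 2).
have kap : ln r3 + ln (1 - rho ^+ 2) - ln (r3 ^+ 2 - rho ^+ 2) <= d.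
  have k0 : 0 < r3 * (1 - rho ^+ 2) / (r3 ^+ 2 - rho ^+ 2) by rewrite divr_gt0// mulr_gt0.
  have -> : ln r3 + ln (1 - rho ^+ 2) - ln (r3 ^+ 2 - rho ^+ 2) =
    ln (1 + (r3 * (1 - rho ^+ 2) / (r3 ^+ 2 - rho ^+ 2) - 1)).
    have -> (x : R) : 1 + (x - 1) = x by ring.
    by rewrite ln_div ?posrE ?mulr_gt0// lnM ?posrE.
  apply: le_trans (le_ln1Dx _) _; first by rewrite ltrBrDl subrr.
  have -> : r3 * (1 - rho ^+ 2) / (r3 ^+ 2 - rho ^+ 2) - 1 =
    (1 - r3) * (r3 + rho ^+ 2) / (r3 ^+ 2 - rho ^+ 2) by field; rewrite gt_eqF.
  rewrite ler_pdivrMr//.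
  have h1 : (1 - r3) * (r3 + rho ^+ 2) <= (1 - r3) * 2 by apply: ler_wpM2l; move: r31 rho2 (sqr_ge0 rho); clear - Flow Bb FD F1; lra.
  have h2 : (1 - rho ^+ 2) / 2 <= r3 ^+ 2 - rho ^+ 2.
    have := sqr_ge0 (r3 - 1); have := ler_wpM2r (ltW rho2) d4.
    by move: r3h2 rho2; clear - Flow Bb FD F1; lra.
  have h3 := ler_wpM2l (ltW d0) h2; move: h1 h3 r3h2; clear - Flow Bb FD F1; lra.
have s00 : 0 < cmod (S 0) by rewrite cmod_gt0.
have s10 : 0 < 1 + cmod (S 0) by lra.
have main2 : 2 * ln (1 + cmod (S 0)) <= 2 * ln 2 + ln (cmod (S 0)) + 14 * d.
  by move: main sm sl M2 le kap dM ep; rewrite /K; clear - Flow Bb FD F1; lra.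
have main3 : 4 * cmod (S 0) >= (1 + cmod (S 0)) ^+ 2 * expR (- (14 * d)).
  rewrite -ler_ln ?posrE ?mulr_gt0 ?exprn_gt0 ?expR_gt0//.
  rewrite [ln (_ ^+ 2 * _)]lnM ?posrE ?exprn_gt0 ?expR_gt0// expRK lnXn// mulr2n.
  have -> : (4 : R) * cmod (S 0) = 2 ^+ 2 * cmod (S 0) by ring.
  rewrite [ln (2 ^+ 2 * _)]lnM ?posrE// lnXn// mulr2n.
  by move: main2; lra.
have main4 : (1 + cmod (S 0)) ^+ 2 * (1 - 14 * d) <= 4 * cmod (S 0).
  apply: le_trans main3; apply: ler_wpM2l; first exact: sqr_ge0.
  by have := expR_ge1Dx (- (14 * d)).
have main5 : (1 - cmod (S 0)) ^+ 2 <= e ^+ 2.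
  have : (1 + cmod (S 0)) ^+ 2 <= 4.
    have -> : (4 : R) = 2 ^+ 2 by ring.
    by apply: lerXn2r; rewrite ?nnegrE; move: s1 s00; clear - Flow Bb FD F1; lra.
  by move=> h; have := ler_wpM2r (ltW d0) h; move: main4 de (sqr_ge0 e); clear - Flow Bb FD F1; lra.
rewrite lerBlDr -lerBlDl -(@ler_pXn2r _ 2)// ?nnegrE ?subr_ge0; exact: ltW.
Qed.

End Means.
End ZeroFreeFactor.

(** * Factorization by removing zeros one at a time *)

Section Recognition.
Variable R : realType.
Local Notation C := (cplx R).
Local Notation Re := (@complex.Re R).
Local Notation Im := (@complex.Im R).
Local Notation rc := (@rc R).
Implicit Types (rho r : R) (z w a b : C) (f g S : C -> C) (p : option C * (C -> C)).

Definition schur S := [/\ hol 1 S, forall w, cmod w < 1 -> cmod (S w) <= 1 &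
  exists2 z, cmod z < 1 & S z != 0].

(* One step of the factorization: among the zeros of [S], remove one that is
   nearly of least modulus. *)
Definition peels S p := schur p.2 /\
  match p.1 with
  | Some a => [/\ cmod a < 1, S a = 0,
      forall b, cmod b < 1 -> S b = 0 -> 1 - cmod b <= 2 * (1 - cmod a) &
      forall z, cmod z < 1 -> S z = mob a z * p.2 z]
  | None => (forall z, cmod z < 1 -> S z != 0) /\ p.2 = S
  end.

Lemma peels_exists S : schur S -> exists p, peels S p.
Proof.
move=> Sg; have [Sh S1 [z0 z01 Sz0]] := Sg.
pose E := [set 1 - cmod b | b in [set b | cmod b < 1 /\ S b = 0]].
have [E0|E0] := pselect (E !=set0); last first.
  exists (None, S); split=> //; split => // z z1; apply/eqP => Sz.
  by apply: E0; exists (1 - cmod z), z.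
have Es : has_sup E.
  by split => //; exists 1 => _ [b /= _ <-]; rewrite gerBl cmod_ge0.
have sE : 0 < sup E.
  have [x [b /= [b1 Sb] bx]] := E0.
  apply: (@lt_le_trans _ _ (1 - cmod b)); first by rewrite subr_gt0.
  by apply: sup_upper_bound => //; exists b.
(* The supremum of [1 - |b|] over the zeros is positive, so some zero reaches half of it; hence the
   factor 2 in [peels]. *)
have [_ [a /= [a1 Sa] <-] ha] := sup_adherent (divr_gt0 sE (ltr0n R 2)) Es.
have [g [gh g1 gE]] := peel_zero Sh S1 a1 Sa.
exists (Some a, g); split.
  split => //; exists z0 => //; apply: contraNneq Sz0 => /= g0.
  by rewrite gE// g0 mulr0.
split => // b b1 Sb.
have : 1 - cmod b <= sup E by apply: sup_upper_bound => //; exists b.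
by move: ha; lra.
Qed.

(** Schwarz-Pick against the origin: if [|S 0|] is close to 1, then [S] is nearly constant on
    compact sets, and constant if [|S 0| = 1]. *)
Lemma schur_variation S z : hol 1 S -> (forall w, cmod w < 1 -> cmod (S w) <= 1) ->
  cmod z < 1 -> cmod (S 0 - S z) * (1 - cmod z) <= 2 * (1 - cmod (S 0)).
Proof.
move=> Sh S1 z1; have z0 : cmod (0 : C) < 1 by rewrite cmod0.
have := schwarz_pick Sh S1 z1 z0.
rewrite conjC0 mul0r subr0 cmod1 mulr1 sub0r cmodN => h.
have h2 : cmod (1 - (S 0)^* * S z) <= 1 - cmod (S 0) ^+ 2 + cmod (S 0 - S z).
  have -> : 1 - (S 0)^* * S z = rc (1 - cmod (S 0) ^+ 2) + (S 0)^* * (S 0 - S z).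
    by rewrite rcB rc1 -mul_conj; ring.
  apply: le_trans (cmodD _ _) _.
  have s0 : 0 <= 1 - cmod (S 0) ^+ 2 by rewrite subr_ge0 expr_le1 ?cmod_ge0 ?S1.
  by rewrite cmod_rc_ge0// lerD2l cmodM cmod_conj ler_piMl ?cmod_ge0 ?S1.
have h3 := le_trans h (ler_wpM2l (cmod_ge0 z) h2).
have s0 : 1 - cmod (S 0) ^+ 2 <= 2 * (1 - cmod (S 0)).
  by have := sqr_ge0 (1 - cmod (S 0)); lra.
have s1 : 0 <= 1 - cmod (S 0) ^+ 2 by rewrite subr_ge0 expr_le1 ?cmod_ge0 ?S1.
have : cmod z * (1 - cmod (S 0) ^+ 2) <= 1 - cmod (S 0) ^+ 2 by rewrite ler_piMl// ltW.
by move: h3; lra.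
Qed.

Definition bunit a : C := if a == 0 then -1 else a^* / rc (cmod a).

Lemma cmod_bunit a : cmod (bunit a) = 1.
Proof.
rewrite /bunit; have [_|a0] := eqVneq a 0; first by rewrite cmodN cmod1.
by rewrite cmod_div cmod_conj cmod_rc_ge0 ?cmod_ge0// divff// cmod_eq0.
Qed.

Lemma Blaschke_factorE a z : Blaschke_factor a z = bunit a * mob a z.
Proof.
rewrite /Blaschke_factor /bunit /mob normC_cmod; case: ifP => // /eqP ->.
by rewrite conjC0 mul0r subr0 divr1 sub0r mulN1r opprK.
Qed.

(** Converse to the Weierstrass inequality: a product bounded away from 0 bounds the sum of the
    defects, which yields the Blaschke condition. *)
Lemma prod_ge_inv_1Dsum (I : Type) (s : seq I) (P : pred I) (x : I -> R) :
  (forall i, P i -> 0 <= x i <= 1) ->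
  (\prod_(i <- s | P i) x i) * (1 + \sum_(i <- s | P i) (1 - x i)) <= 1.
Proof.
move=> x01; elim: s => [|i s IH]; first by rewrite !big_nil addr0 mulr1.
rewrite !big_cons; case: ifP => // Pi.
have /andP[x0 x1] := x01 i Pi.
have [p0 s0] : 0 <= \prod_(j <- s | P j) x j /\ 0 <= \sum_(j <- s | P j) (1 - x j).
  split; [apply: prodr_ge0|apply: sumr_ge0] => j Pj; have /andP[a b] := x01 j Pj => //.
  by rewrite subr_ge0.
move: (\prod_(j <- s | P j) x j) (\sum_(j <- s | P j) (1 - x j)) p0 s0 IH.
move=> p t p0 t0 IH.
have h1 : x i * (1 + (1 - x i + t)) <= 1 + t.
  have : 0 <= (1 - x i) * (1 + t - x i) by rewrite mulr_ge0; lra.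
  by lra.
have := ler_wpM2l p0 h1; lra.
Qed.

Lemma nneseries_lty (P : pred nat) (x : nat -> R) (B : R) :
  (forall j, P j -> 0 <= x j) -> (forall N, \sum_(0 <= j < N | P j) x j <= B) ->
  (\sum_(0 <= j <oo | P j) (x j)%:E < +oo)%E.
Proof.
move=> x0 xB; apply: (@le_lt_trans _ _ B%:E); last by rewrite ltry.
apply: lime_le; first by apply: is_cvg_nneseries => j _ Pj; rewrite lee_fin x0.
by apply: nearW => N; rewrite sumEFin lee_fin.
Qed.

Definition finite_form (F : C -> C) := exists (l : seq C) (eta : C),
  [/\ cmod eta = 1, forall a, a \in l -> cmod a < 1 &
      forall z, cmod z < 1 -> F z = eta * \prod_(a <- l) mob a z].

(** That the [a j] are zeros of [F] is recorded for [not_infinite_form], where they become roots of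
    a polynomial. *)
Definition infinite_form (F : C -> C) := exists (a : nat -> C) (eta : C),
  [/\ cmod eta = 1, Blaschke_bounded xpredT a, forall j, F (a j) = 0 &
      forall z, cmod z < 1 ->
        (fun k => eta * \prod_(0 <= j < k) Blaschke_factor (a j) z) @ \oo --> F z].

Section Peeling.
Variable F : C -> C.
Hypothesis Fs : schur F.
Hypothesis large : forall e : R, 0 < e -> exists r, [/\ 0 < r, r < 1 &
  forall B S, hol 1 B -> hol 1 S ->
  (forall w, cmod w < 1 -> cmod (B w) <= 1) -> (forall w, cmod w < 1 -> cmod (S w) <= 1) ->
  (forall w, cmod w < 1 -> F w = B w * S w) ->
  (forall w, cmod w < r -> S w != 0) -> 1 - e <= cmod (S 0)].

(** Iterated removal gives [F = bprod k * St k]. If the zeros run out, [St k] is zero-free on the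
    whole disk, so [large] gives [|St k 0| = 1] and [St k] is constant. Otherwise the greedy choice
    clears every smaller disc of zeros after finitely many steps, and [large] makes [|St k 0|] tend
    to 1. *)
Theorem schur_recognition : finite_form F \/ infinite_form F.
Proof.
have [f fP] : exists f : (C -> C) -> option C * (C -> C), forall S, schur S -> peels S (f S).
  have /choice[f fP] : forall S, exists p, schur S -> peels S p.
    move=> S; have [/peels_exists[p Sp]|nS] := pselect (schur S); first by exists p.
    by exists (None, S).
  by exists f.
pose St k := iter k (fun S => (f S).2) F.
have StS k : St k.+1 = (f (St k)).2 by [].
have Sg k : schur (St k).
  by elim: k => [|k IH] //; rewrite StS; exact: (fP _ IH).1.
have Sp k : peels (St k) (f (St k)) := fP _ (Sg k).
pose Q k := isSome (f (St k)).1; pose a k := odflt 0 (f (St k)).1.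
have PQ k : Q k -> [/\ cmod (a k) < 1, St k (a k) = 0,
    forall b, cmod b < 1 -> St k b = 0 -> 1 - cmod b <= 2 * (1 - cmod (a k)) &
    forall z, cmod z < 1 -> St k z = mob (a k) z * St k.+1 z].
  by rewrite StS /Q /a; have [_] := Sp k; case: (f (St k)).1.
have NQ k : ~~ Q k -> (forall z, cmod z < 1 -> St k z != 0) /\ St k.+1 = St k.
  by rewrite StS /Q; have [_] := Sp k; case: (f (St k)).1.
have a1 k : Q k -> cmod (a k) < 1 by move=> /PQ[].
have S1 k z : cmod z < 1 -> cmod (St k z) <= 1 by have [_ h _] := Sg k; exact: h.
have Sh k : hol 1 (St k) by have [] := Sg k.
have FE k z : cmod z < 1 -> F z = bprod Q a k z * St k z.
  move=> z1; elim: k => [|k IH]; first by rewrite bprod0 mul1r.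
  rewrite bprodS IH; case Qk: (Q k).
    by have [_ _ _ ->] := PQ k Qk; rewrite // mulrA.
  by have [_ ->] := NQ k (negbT Qk); rewrite mulr1.
have B1 k : forall w, cmod w < 1 -> cmod (bprod Q a k w) <= 1 := bprod_le1 a1 k.
have Bh k : hol 1 (bprod Q a k) := hol_bprod a1 k.
have Slarge k e : 0 < e -> (forall r : R, r < 1 -> forall z, cmod z < r -> St k z != 0) ->
    1 - e <= cmod (St k 0).
  move=> e0 zf; have [r [r0 r1 rP]] := large e0.
  exact: rP (Bh k) (Sh k) (B1 k) (S1 k) (FE k) (zf r r1).
have [[k0 Qk0]|allQ] := pselect (exists k, ~~ Q k); last first.
- right.
  have {}allQ k : Q k by apply: contrapT => /negP h; apply: allQ; exists k.
  have Scons j k z : (j <= k)%N -> cmod z < 1 -> St k z = 0 -> St j z = 0.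
    move=> /subnKC <- z1; elim: (k - j)%N => [|n IH]; first by rewrite addn0.
    rewrite addnS => h; apply: IH; have [_ _ _ ->] := PQ _ (allQ (j + n)%N) => //.
    by rewrite h mulr0.
  (* If zeros persisted in [|z| < r], every removed zero would satisfy [1 - |a k| >= (1 - r) / 2];
     each factor at [z0] would have squared modulus at most [1 - d] for a fixed [d > 0], and [F z0]
     would vanish. *)
  have zfree r : r < 1 -> exists k0, forall k, (k0 <= k)%N ->
      forall z, cmod z < r -> St k z != 0.
    move=> r1; apply: contrapT => H.
    have H1 k : exists2 z, cmod z < r & St k z = 0.
      apply: contrapT => H2; apply: H; exists k => j kj z zr; apply/eqP => Sz.
      by apply: H2; exists z => //; apply: Scons kj (lt_trans zr r1) Sz.
    have H2 k : 1 - r <= 2 * (1 - cmod (a k)).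
      have [z zr Sz] := H1 k; have [_ _ h _] := PQ k (allQ k).
      by have := h z (lt_trans zr r1) Sz; lra.
    have [_ _ [z0 z01 Fz0]] := Fs.
    pose d := (1 - r) / 2 * (1 - cmod z0 ^+ 2) / 4.
    have zz := one_sub_sqr_gt0 z01.
    have r0 : 0 < 1 - r by rewrite subr_gt0.
    have d0 : 0 < d by rewrite divr_gt0// mulr_gt0// divr_gt0.
    have md k : cmod (mob (a k) z0) ^+ 2 <= 1 - d.
      have ak := a1 k (allQ k); have := one_sub_mob ak (ltW z01).
      have D0 : 0 < cmod (1 - (a k)^* * z0) := mob_den_gt0 ak (ltW z01).
      have D2 : cmod (1 - (a k)^* * z0) <= 2.
        apply: le_trans (cmod_leB _ _) _; rewrite cmod1 cmodM cmod_conj.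
        have := mulr_ile1 (cmod_ge0 (a k)) (cmod_ge0 z0) (ltW ak) (ltW z01); lra.
      have D4 : cmod (1 - (a k)^* * z0) ^+ 2 <= 4.
        have -> : (4 : R) = 2 ^+ 2 by ring.
        by apply: lerXn2r D2; rewrite // nnegrE ltW.
      have h1 : (1 - r) / 2 <= 1 - cmod (a k) ^+ 2.
        have := H2 k; have := cmod_ge0 (a k).
        have : cmod (a k) ^+ 2 <= cmod (a k) by rewrite expr2 ler_piMl ?cmod_ge0// ltW.
        by lra.
      have h2 := ler_wpM2r (ltW zz) h1.
      have h3 : d <= (1 - cmod (a k) ^+ 2) * (1 - cmod z0 ^+ 2) / cmod (1 - (a k)^* * z0) ^+ 2.
        rewrite ler_pdivlMr ?exprn_gt0//; apply: le_trans h2; rewrite /d.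
        have X0 : 0 <= (1 - r) / 2 * (1 - cmod z0 ^+ 2).
          by rewrite mulr_ge0 ?divr_ge0 ?(ltW r0) ?(ltW zz).
        by have := ler_wpM2l X0 D4; lra.
      by move: h3; lra.
    have d1 : 0 <= 1 - d by apply: le_trans (md 0%N); exact: sqr_ge0.
    have fb k : cmod (F z0) ^+ 2 <= (1 - d) ^+ k.
      have : cmod (bprod Q a k z0) ^+ 2 <= (1 - d) ^+ k.
        elim: k => [|k IH]; first by rewrite bprod0 cmod1 expr1n.
        rewrite bprodS allQ cmodM exprMn [leRHS]exprSr.
        by apply: ler_pM; rewrite ?sqr_ge0.
      apply: le_trans; rewrite (FE k)// cmodM exprMn ler_piMr ?sqr_ge0//.
      by rewrite expr_le1 ?cmod_ge0 ?S1.
    have F0 : 0 < cmod (F z0) ^+ 2 by rewrite exprn_gt0// cmod_gt0.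
    have [N hN] := @geometric_small R 1 (1 - d) _ ler01 d1 ltac:(lra) F0.
    by have := hN N (leqnn N); rewrite mul1r ltNge fb.
  have s_lim e : 0 < e -> exists k0, forall k, (k0 <= k)%N -> 1 - e <= cmod (St k 0).
    move=> e0; have [r [r0 r1 rP]] := large e0; have [k0 k0P] := zfree r r1.
    exists k0 => k kk; exact: rP (Bh k) (Sh k) (B1 k) (S1 k) (FE k) (k0P k kk).
  (* From [k1] on, [|St 0| >= 1/2] keeps the products of the [|a j|] above [1/2]; this gives the
     Blaschke condition and shows that later zeros are not the origin. *)
  have [k1 k1P] := s_lim (1 / 2) (divr_gt0 ltr01 (ltr0n R 2)).
  have s1 : 1 / 2 <= cmod (St k1 0) by have := k1P k1 (leqnn _); lra.
  have z0 : cmod (0 : C) < 1 by rewrite cmod0.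
  have Smod k : cmod (St k 0) = cmod (a k) * cmod (St k.+1 0).
    by have [_ _ _ ->] := PQ k (allQ k); rewrite // mob0 cmodM.
  have tail n : cmod (St k1 0) = \prod_(k1 <= j < k1 + n) cmod (a j) * cmod (St (k1 + n)%N 0).
    elim: n => [|n IH]; first by rewrite addn0 big_geq// mul1r.
    by rewrite IH addnS big_nat_recr ?leq_addr//= -mulrA -Smod.
  have a01 j : xpredT j -> 0 <= cmod (a j) <= 1.
    by move=> _; rewrite cmod_ge0 ltW// a1.
  have tail2 n : 1 / 2 <= \prod_(k1 <= j < k1 + n) cmod (a j).
    apply: le_trans s1 _; rewrite (tail n) ler_piMr ?S1//.
    by apply: prodr_ge0 => j _; exact: cmod_ge0.
  have tail3 n : \sum_(k1 <= j < k1 + n) (1 - cmod (a j)) <= 1.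
    have := prod_ge_inv_1Dsum (index_iota k1 (k1 + n)) a01.
    have s0 : 0 <= \sum_(k1 <= j < k1 + n) (1 - cmod (a j)).
      by apply: sumr_ge0 => j _; rewrite subr_ge0 ltW// a1.
    have := ler_wpM2r (ltac:(lra) : 0 <= 1 + \sum_(k1 <= j < k1 + n) (1 - cmod (a j))) (tail2 n).
    by lra.
  have Ba : Blaschke_bounded xpredT a.
    split; first by move=> j _; exact: a1.
    exists (k1%:R + 1) => N.
    have hd : \sum_(0 <= j < k1) (1 - cmod (a j)) <= k1%:R.
      elim: k1 {k1P s1 tail tail2 tail3} => [|n IH]; first by rewrite big_geq.
      by rewrite big_nat_recr//= -natr1 lerD// gerBl cmod_ge0.
    apply: (@le_trans _ _ (\sum_(0 <= j < k1 + N) (1 - cmod (a j)))).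
      rewrite addnC [leRHS](big_cat_nat (leq0n N) (leq_addr k1 N))/= lerDl.
      by apply: sumr_ge0 => j _; rewrite subr_ge0 ltW// a1.
    by rewrite (big_cat_nat (leq0n k1) (leq_addr N k1))/= lerD.
  have an0 k : (k1 <= k)%N -> a k != 0.
    move=> kk; rewrite -cmod_eq0 gt_eqF// lt_def cmod_ge0 andbT.
    apply/eqP => e; have := tail2 (k - k1).+1.
    rewrite addnS subnKC// big_nat_recr//= e mulr0; lra.
  pose V k := \prod_(0 <= j < k) bunit (a j).
  have V1 k : cmod (V k) = 1.
    by rewrite /V cmod_prod big1// => j _; exact: cmod_bunit.
  have VS k : V k.+1 = V k * bunit (a k) by rewrite /V big_nat_recr.
  have V0 k : V k != 0 by rewrite -cmod_eq0 V1 oner_neq0.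
  have sk0 : rc (cmod (St k1 0)) != 0 by rewrite rc_eq0 gt_eqF//; lra.
  (* [V k] collects the unimodular constants that turn [mob] into [Blaschke_factor]. Since
     [mob (a k) 0 = a k], each later step changes the phase of [St k 0] by [bunit (a k)]; fixing
     [eta] at [k1] gives [St k 0 = eta * |St k 0| * V k] from then on. *)
  pose eta := St k1 0 / (rc (cmod (St k1 0)) * V k1).
  have eta1 : cmod eta = 1.
    rewrite /eta cmod_div cmodM V1 mulr1 cmod_rc_ge0 ?cmod_ge0// divff//.
    by rewrite gt_eqF//; lra.
  have phase k : (k1 <= k)%N -> St k 0 = eta * rc (cmod (St k 0)) * V k.
    move=> /subnKC <-; elim: (k - k1)%N => [|n IH].
      by rewrite addn0 /eta; field; rewrite sk0 V0.
    rewrite addnS; set m := (k1 + n)%N in IH *.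
    have am : a m != 0 by apply: an0; rewrite /m leq_addr.
    have rm : rc (cmod (a m)) != 0 by rewrite rc_eq0 cmod_eq0.
    apply: (mulfI am); have [_ _ _ /(_ 0 z0)] := PQ m (allQ m); rewrite mob0 => <-.
    rewrite IH Smod rcM VS /bunit (negPf am).
    have -> : a m * (eta * rc (cmod (St m.+1 0)) * (V m * ((a m)^* / rc (cmod (a m))))) =
      eta * rc (cmod (St m.+1 0)) * V m * (a m * (a m)^*) / rc (cmod (a m)) by ring.
    rewrite mul_conj expr2 rcM; by field.
  exists a, eta; split => //.
    by move=> j; rewrite (FE j) ?a1//; have [_ -> _ _] := PQ j (allQ j); rewrite mulr0.
  move=> z z1; apply/cvgCP => e e0.
  have zz : 0 < 1 - cmod z by rewrite subr_gt0.
  pose L := 1 + 2 / (1 - cmod z).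
  have L0 : 0 < L by rewrite ltr_wpDr// divr_ge0// ltW.
  have eL : 0 < e / L / 2 by rewrite !divr_gt0.
  have [k2 k2P] := s_lim _ eL.
  exists (maxn k1 k2) => // k /=; rewrite geq_max => /andP[k1k k2k].
  have E1 : \prod_(0 <= j < k) Blaschke_factor (a j) z = V k * bprod Q a k z.
    have -> : bprod Q a k z = \prod_(0 <= j < k) mob (a j) z.
      by apply: eq_bigl => j; exact: allQ.
    by rewrite /V -big_split /=; apply: eq_bigr => j _; exact: Blaschke_factorE.
  have E2 : eta * \prod_(0 <= j < k) Blaschke_factor (a j) z - F z =
      bprod Q a k z * (eta * V k - St k z) by rewrite E1 (FE k z z1); ring.
  rewrite E2 cmodM; apply: le_lt_trans (_ : cmod (eta * V k - St k z) < _).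
    by rewrite ler_piMl ?cmod_ge0 ?B1.
  have h1 : cmod (eta * V k - St k 0) = 1 - cmod (St k 0).
    have -> : eta * V k - St k 0 = eta * V k * rc (1 - cmod (St k 0)).
      by rewrite {1}(phase k k1k) rcB rc1; ring.
    by rewrite (cmodM (eta * V k)) (cmodM eta) eta1 V1 !mul1r cmod_rc_ge0// subr_ge0 S1.
  have h2 := schur_variation (Sh k) (S1 k) z1.
  have h3 : cmod (St k 0 - St k z) <= 2 * (1 - cmod (St k 0)) / (1 - cmod z).
    by rewrite ler_pdivlMr.
  have h4 := cmod_trian (St k 0) (eta * V k) (St k z).
  have h5 := k2P k k2k.
  have h6 : (1 - cmod (St k 0)) * L <= e / 2.
    have -> : e / 2 = e / L / 2 * L by field; rewrite gt_eqF.
    by apply: ler_wpM2r; [exact: ltW|lra].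
  move: h1 h3 h4 h6; rewrite /L; lra.
left; have [zf _] := NQ k0 Qk0.
have s1 : cmod (St k0 0) = 1.
  apply/eqP; rewrite eq_le S1 ?cmod0//=; apply/ler_addgt0Pl => e e0.
  have := Slarge k0 e e0 (fun r hr z hz => zf z (lt_trans hz hr)); lra.
exists (zeros Q a k0), (St k0 0); split => //.
  by move=> b /mapP[j]; rewrite mem_filter => /andP[Qj _] ->; exact: a1.
move=> z z1; rewrite (FE k0 z z1) mulrC; congr (_ * _).
  have := schur_variation (Sh k0) (S1 k0) z1; rewrite s1 subrr mulr0.
  rewrite pmulr_lle0 ?subr_gt0// => h.
  apply/esym/eqP; rewrite -subr_eq0 -cmod_eq0 eq_le h cmod_ge0//.
by rewrite /bprod /zeros big_map big_filter /index_iota subn0.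
Qed.

End Peeling.

Lemma finite_form_Blaschke (F : C -> C) (l : seq C) (eta : C) m : size l = m ->
  cmod eta = 1 -> (forall a, a \in l -> cmod a < 1) ->
  (forall z, cmod z < 1 -> F z = eta * \prod_(a <- l) mob a z) ->
  finite_Blaschke_product m F.
Proof.
move=> <- e1 l1 FE; exists (eta * \prod_(a <- l) (bunit a)^-1), (in_tuple l); split.
- rewrite cmodM e1 mul1r cmod_prod big1// => a _.
  by rewrite cmodV cmod_bunit invr1.
- by move=> i; apply: l1; exact: mem_tnth.
move=> z z1; rewrite FE// -mulrA; congr (_ * _).
rewrite -(big_tnth _ _ l xpredT (fun a => Blaschke_factor a z)) -big_split /=.
apply: eq_bigr => a _; rewrite Blaschke_factorE mulrA mulVf ?mul1r//.
by rewrite -cmod_eq0 cmod_bunit oner_neq0.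
Qed.

Lemma FinSeq_Blaschke_sequence (c : seq C) :
  (forall a, a \in c -> cmod a < 1) -> Blaschke_sequence (FinSeq c).
Proof.
move=> c1; have dd j : (j < size c)%N -> unit_disk (nth 0 c j).
  by move=> jc; apply: c1; exact: mem_nth.
split => //.
apply: (@nneseries_lty _ _ (size c)%:R) => [j jc|N].
  by rewrite subr_ge0 ltW//; exact: dd.
apply: (@le_trans _ _ (\sum_(0 <= j < N | (j < size c)%N) 1)).
  by apply: ler_sum => j _; rewrite gerBl cmod_ge0.
have -> : \sum_(0 <= j < N | (j < size c)%N) (1 : R) = (minn N (size c))%:R.
  elim: N => [|N IH]; first by rewrite big_geq// min0n.
  rewrite big_mkcond big_nat_recr//= -big_mkcond /= IH.
  case: ltnP => h; first by rewrite natr1 !(minn_idPl _) ?(ltnW h).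
  by rewrite addr0 !(minn_idPr _) ?(leqW h).
by rewrite ler_nat geq_minr.
Qed.

Lemma finite_Blaschke_product_Blaschke (F : C -> C) m :
  finite_Blaschke_product m F -> Blaschke_product F.
Proof.
move=> [eta [a [e1 a1 FE]]]; exists eta, (FinSeq a); split => //.
  by apply: FinSeq_Blaschke_sequence => b /tnthP[i ->]; exact: a1.
move=> z z1; apply/cvgCP => e e0; exists m => // k /= mk.
suff -> : eta * \prod_(0 <= j < k | (j < size a)%N) Blaschke_factor (nth 0 a j) z = F z.
  by rewrite subrr cmod0.
rewrite (FE z z1); congr (_ * _).
rewrite (big_cat_nat (leq0n m) mk)/= [X in _ * X]big_nat_cond [X in _ * X]big_pred0 ?mulr1.
  rewrite big_nat_cond (eq_bigl (fun j => (0 <= j < m)%N && true)); last first.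
    by move=> j; rewrite size_tuple; case: ltnP.
  rewrite -big_nat_cond big_mkord; apply: eq_bigr => i _.
  by rewrite (tnth_nth 0).
by move=> j; rewrite size_tuple; apply/negbTE/negP => /andP[/andP[mj _]]; rewrite ltnNge mj.
Qed.

Lemma infinite_form_Blaschke (F : C -> C) : infinite_form F -> Blaschke_product F.
Proof.
move=> [a [eta [e1 [a1 [S SP]] _ FE]]]; exists eta, (InfSeq a); split => //.
split; first by move=> j _; exact: a1.
apply: (@nneseries_lty _ _ S) => [j _|N]; first by rewrite subr_ge0 ltW// a1.
exact: SP.
Qed.

Section Dominated.
Variables (P : pred nat) (c : nat -> C) (F F' : C -> C).
Hypothesis Bb : Blaschke_bounded P c.
Hypothesis F1 : forall z, cmod z < 1 -> cmod (F z) < 1.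
Hypothesis FD : forall z, cmod z < 1 -> hasD F z (F' z).
Hypothesis Flow : forall z, cmod z < 1 ->
    beta P c z * (1 - cmod (F z) ^+ 2) <= (1 - cmod z ^+ 2) * cmod (F' z).

Theorem dominated_recognition : finite_form F \/ infinite_form F.
Proof.
apply: schur_recognition; last first.
  by move=> e e0; exact: (zero_free_factor_large Bb F1 FD Flow e0).
split; [by move=> z /FD; exists (F' z)|by move=> w /F1/ltW|].
apply: contrapT => F0.
have Fz z : cmod z < 1 -> F z = 0.
  by move=> z1; apply: contrapT => /eqP h; apply: F0; exists z.
have [z z1 bz] := beta_gt0_exists Bb.
have F'z : F' z = 0.
  apply: hasD_uniq (FD z1) _.
  apply: (@hasD_near _ (fun=> 0) _ _ _ (1 - cmod z)); first by rewrite subr_gt0.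
    move=> w wz; rewrite Fz//; have := cmodD (w - z) z; rewrite subrK; lra.
  exact: hasD_cst.
have := Flow z1; rewrite F'z cmod0 mulr0 Fz// cmod0 expr0n subr0 mulr1.
by rewrite leNgt bz.
Qed.

Corollary dominated_Blaschke : Blaschke_product F.
Proof.
have [[l [eta [e1 l1 FE]]]|] := dominated_recognition; last exact: infinite_form_Blaschke.
apply: finite_Blaschke_product_Blaschke.
exact: (finite_form_Blaschke (erefl (size l)) e1 l1 FE).
Qed.

End Dominated.

(** Schwarz-Pick for the inverse [S] of [T] gives [1 - |T w|^2 <= (1 - |w|^2) * |T' w|], so the
    lower bound on [F'] passes to the derivative of [T \o F]. *)
Theorem dominated_indestructible P c (F F' : C -> C) : Blaschke_bounded P c ->
  (forall z, cmod z < 1 -> cmod (F z) < 1) -> (forall z, cmod z < 1 -> hasD F z (F' z)) ->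
  (forall z, cmod z < 1 ->
    beta P c z * (1 - cmod (F z) ^+ 2) <= (1 - cmod z ^+ 2) * cmod (F' z)) ->
  indestructible_Blaschke_product F.
Proof.
move=> Bb F1 FD Flow; split; first exact: dominated_Blaschke Bb F1 FD Flow.
move=> T [S [Tan San T1 S1 ST]].
pose T' := T^`()%classic.
have TD z : cmod z < 1 -> hasD T z (T' z) by move=> /Tan/derivable_hasD.
have TFD z : cmod z < 1 -> hasD (T \o F) z (T' (F z) * F' z).
  by move=> z1; apply: hasD_comp (FD z z1) (TD _ (F1 z z1)).
apply: (@dominated_Blaschke P c (T \o F) (fun z => T' (F z) * F' z)) => //.
  by move=> z /F1/T1.
move=> z z1 /=; set w := F z; have w1 : cmod w < 1 := F1 z z1.
have Tw1 : cmod (T w) < 1 := T1 w w1.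
have SD : hasD S (T w) (S^`()%classic (T w)) by apply: derivable_hasD; exact: San.
have Shol : hol 1 S.
  by move=> v v1; exists (S^`()%classic v); apply: derivable_hasD; exact: San.
have SP := schwarz_pick_derive Shol (fun v v1 => ltW (S1 v v1)) Tw1 SD.
have [STw _] := ST w w1; rewrite STw in SP.
have inv : S^`()%classic (T w) * T' w = 1.
  have D1 : hasD (fun v => S (T v)) w (S^`()%classic (T w) * T' w) := hasD_comp (TD w w1) SD.
  apply: hasD_uniq D1 _.
  apply: (@hasD_near _ (fun v => v) _ _ _ (1 - cmod w)); first by rewrite subr_gt0.
    move=> v vw; have v1 : cmod v < 1 by have := cmodD (v - w) w; rewrite subrK; lra.
    by have [-> _] := ST v v1.
  exact: hasD_id.
have inv2 : cmod (S^`()%classic (T w)) * cmod (T' w) = 1 by rewrite -cmodM inv cmod1.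
have h1 : 1 - cmod (T w) ^+ 2 <= (1 - cmod w ^+ 2) * cmod (T' w).
  by have := ler_wpM2r (cmod_ge0 (T' w)) SP; rewrite -mulrA inv2 mulr1.
have h2 := ler_wpM2l (beta_ge0 P c z) h1.
have h3 := ler_wpM2r (cmod_ge0 (T' w)) (Flow z z1).
apply: le_trans h2 _; rewrite mulrA; apply: le_trans h3 _.
by rewrite (cmodM (T' w)) [cmod (T' w) * _]mulrC mulrA.
Qed.

End Recognition.

(** * Finite critical sets *)

Section FiniteCriticalSet.
Variable R : realType.
Local Notation C := (cplx R).
Local Notation Re := (@complex.Re R).
Local Notation Im := (@complex.Im R).
Local Notation rc := (@rc R).
Local Notation mu := (@lebesgue_measure R).
Implicit Types (rho r : R) (z w a b zeta : C) (f g : C -> C) (l : seq C).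

Lemma radial_limitP g zeta (x : C) :
  radial_limit g zeta x <-> g (rc r * zeta) @[r --> 1^'-] --> x.
Proof.
split=> [H|/cvgCP H e e0].
  apply/cvgCP => e e0; have [d d0 dP] := H e e0; near=> r; apply: dP.
  - by apply: ltW; near: r; apply: nbhs_left_gt.
  - by near: r; exact: nbhs_left_lt.
  - rewrite ltrBlDr addrC -ltrBlDr; near: r; apply: nbhs_left_gt.
    by rewrite gtrBl.
have /nbhs_ballP[d /= d0 dP] := H e e0; exists d => // r r0 r1 rd.
apply: dP; last exact: r1.
by rewrite /ball /= ger0_norm// subr_ge0 ltW.
Unshelve. all: by end_near.
Qed.

Lemma radial_continuous f zeta : {for zeta, continuous f} -> radial_limit f zeta (f zeta).
Proof.
move=> /cvgCCP fc e e0; have [d d0 dP] := fc e e0.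
have z1 : 0 < cmod zeta + 1 by rewrite ltr_wpDl ?cmod_ge0.
exists (d / (cmod zeta + 1)); first by rewrite divr_gt0.
move=> r r0 r1 rd; apply: dP.
have -> : rc r * zeta - zeta = - (rc (1 - r) * zeta) by rewrite rcB rc1; ring.
rewrite cmodN cmodM cmod_rc_ge0 ?subr_ge0 ?(ltW r1)//.
rewrite ltr_pdivlMr// in rd; apply: le_lt_trans rd; rewrite ler_wpM2l ?subr_ge0 ?(ltW r1)//.
by rewrite lerDl.
Qed.

Lemma radial_mul f g zeta (x y : C) : radial_limit f zeta x -> radial_limit g zeta y ->
  radial_limit (fun z => f z * g z) zeta (x * y).
Proof. by move=> /radial_limitP fx /radial_limitP gy; apply/radial_limitP; exact: cvgM fx gy. Qed.

Lemma radial_inv f zeta (x : C) : x != 0 -> radial_limit f zeta x ->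
  radial_limit (fun z => (f z)^-1) zeta x^-1.
Proof. by move=> x0 /radial_limitP fx; apply/radial_limitP; exact: cvgV x0 fx. Qed.

Lemma radial_quotient f g h zeta (x y : C) : cmod zeta = 1 ->
  (forall z, cmod z < 1 -> f z = g z * h z) -> y != 0 ->
  radial_limit f zeta x -> radial_limit g zeta y -> radial_limit h zeta (x / y).
Proof.
move=> z1 E y0 fx gy; have D := radial_mul fx (radial_inv y0 gy).
move=> e e0; have [d d0 dP] := D e e0.
have y2 : 0 < cmod y by rewrite cmod_gt0.
have [d' d'0 d'P] := gy (cmod y) y2.
exists (Num.min d d'); first by rewrite lt_min d0.
move=> r r0 r1; rewrite lt_min => /andP[rd rd'].
have w1 : cmod (rc r * zeta) < 1 by rewrite cmodM z1 mulr1 cmod_rc_ge0.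
have g0 : g (rc r * zeta) != 0.
  have := d'P r r0 r1 rd'; apply: contraTneq => ->.
  by rewrite sub0r cmodN ltxx.
by have := dP r r0 r1 rd; rewrite E// mulrAC divff// mul1r.
Qed.

Lemma radial_uniq f zeta (x y : C) : radial_limit f zeta x -> radial_limit f zeta y -> x = y.
Proof. by move=> /radial_limitP fx /radial_limitP fy; exact: (cvg_unique _ fx fy). Qed.

Lemma radial_eq f g zeta (x : C) : cmod zeta = 1 -> (forall z, cmod z < 1 -> f z = g z) ->
  radial_limit f zeta x -> radial_limit g zeta x.
Proof.
move=> z1 E fx e e0; have [d d0 dP] := fx e e0; exists d => // r r0 r1 rd.
by rewrite -E ?dP// cmodM z1 mulr1 cmod_rc_ge0.
Qed.

Lemma radial_real g zeta (x : C) n : cmod zeta = 1 -> radial_limit g zeta x ->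
  Im (x * zeta^* ^+ n) = 0 -> forall e : R, 0 < e -> exists2 d : R, 0 < d &
     forall r, 0 <= r -> r < 1 -> 1 - r < d -> `|Im (g (rc r * zeta) * zeta^* ^+ n)| < e.
Proof.
move=> z1 gx Ix e e0; have [d d0 dP] := gx e e0; exists d => // r r0 r1 rd.
have -> : Im (g (rc r * zeta) * zeta^* ^+ n) = Im ((g (rc r * zeta) - x) * zeta^* ^+ n).
  by rewrite mulrBl cImB Ix subr0.
apply: le_lt_trans (normIm_le _) _.
by rewrite cmodM cmodX cmod_conj z1 expr1n mulr1 dP.
Qed.

(** All Taylor coefficients beyond [2 * n] vanish, so [g] is a polynomial; for [n = 0] it is
    constant, which is the form used to settle the degree. *)
Lemma real_boundary_taylor g M n : hol 1 g ->
  (forall z, cmod z < 1 -> cmod (g z) <= M) ->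
  {ae mu, forall t, `[0, 2 * pi]%classic t -> exists2 x,
     radial_limit g (expi t) x & Im (x * (expi t)^* ^+ n) = 0} ->
  forall z, cmod z < 1 -> g z = \sum_(0 <= k < (2 * n).+1) coef g (1 / 2) k * z ^+ k.
Proof.
move=> gh gM gae z z1; have h0 : 0 < 1 / 2 :> R by rewrite divr_gt0.
have h1 : 1 / 2 < 1 :> R by lra.
have c0 k : (2 * n < k)%N -> coef g (1 / 2) k = 0.
  apply: (coef_eq0_of_real_boundary gh gM) => //.
  apply: (@filterS _ _ (ae_filter_ringOfSetsType mu) _ _ _ gae) => t H Dt.
  by have [x gx xr] := H Dt; exact: radial_real (cmod_expi t) gx xr.
rewrite (taylor gh h0 h1 z1); apply/eqP; rewrite -subr_eq0 -cmod_eq0 eq_le cmod_ge0 andbT.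
apply/ler_addgt0Pl => e e0; rewrite addr0.
have [N NP] := psumP (coef_growth gh h0 h1) z1 e0.
have := NP (maxn N (2 * n).+1) (leq_maxl _ _).
have T0 : \sum_((2 * n).+1 <= k < maxn N (2 * n).+1) coef g (1 / 2) k * z ^+ k = 0.
  rewrite big_nat_cond; apply: big1 => k /andP[/andP[nk _] _].
  by rewrite c0 ?mul0r.
by rewrite (big_cat_nat (leq0n _) (leq_maxr N (2 * n).+1))/= T0 addr0 => /ltW.
Qed.

Lemma real_boundary_eq0 g M : hol 1 g ->
  (forall z, cmod z < 1 -> cmod (g z) <= M) ->
  {ae mu, forall t, `[0, 2 * pi]%classic t -> exists2 x,
     radial_limit g (expi t) x & Im x = 0} -> g 0 = 0 ->
  forall z, cmod z < 1 -> g z = 0.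
Proof.
move=> gh gM gae g0 z z1; have z0 : cmod (0 : C) < 1 by rewrite cmod0.
have gae' : {ae mu, forall t, `[0, 2 * pi]%classic t -> exists2 x,
     radial_limit g (expi t) x & Im (x * (expi t)^* ^+ 0) = 0}.
  apply: (@filterS _ _ (ae_filter_ringOfSetsType mu) _ _ _ gae) => t H Dt.
  by have [x gx xr] := H Dt; exists x => //; rewrite expr0 mulr1.
have E := real_boundary_taylor gh gM gae'; rewrite muln0 in E.
by move: (E z z1) (E 0 z0); rewrite !big_nat1 !expr0 => -> <-.
Qed.

(** [denp c] is the polynomial [q] of the overview, and [bp c] is [d / q] up to the sign
    [(-1)^n]. *)
Definition denp l z : C := \prod_(a <- l) (1 - a^* * z).

Definition bp l z : C := \prod_(a <- l) mob a z.

Section List.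
Variable l : seq C.
Hypothesis l1 : forall a, a \in l -> cmod a < 1.

Lemma hol_denp rho : hol rho (denp l).
Proof.
rewrite /denp; elim: l => [|a s IH].
  by apply: hol_eq (hol_cst 1) => w _; rewrite big_nil.
apply: hol_eq (hol_mul (hol_sub (hol_cst 1) (hol_mul (hol_cst a^*) (@hol_id R rho))) IH).
by move=> w _; rewrite big_cons.
Qed.

Lemma denp_neq0 z : cmod z <= 1 -> denp l z != 0.
Proof.
move=> z1; rewrite /denp prodf_seq_neq0; apply/allP => a /l1 a1.
by apply/implyP => _; exact: mob_den.
Qed.

Lemma denp_le z : cmod z < 1 -> cmod (denp l z) <= 2 ^+ size l.
Proof.
move=> z1; rewrite /denp; elim: l l1 => [|a s IH] sl; first by rewrite big_nil cmod1.
rewrite big_cons cmodM exprS; apply: ler_pM; rewrite ?cmod_ge0//.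
  apply: le_trans (cmod_leB _ _) _; rewrite cmod1 cmodM cmod_conj.
  have a1 : cmod a < 1 by apply: sl; rewrite mem_head.
  have := mulr_ile1 (cmod_ge0 a) (cmod_ge0 z) (ltW a1) (ltW z1); lra.
by apply: IH => b bs; apply: sl; rewrite inE bs orbT.
Qed.

Lemma denp_ge : exists2 k : R, 0 < k & forall z, cmod z < 1 -> k <= cmod (denp l z).
Proof.
rewrite /denp; elim: l l1 => [|a s IH] sl.
  by exists 1 => // z _; rewrite big_nil cmod1.
have [|k k0 kP] := IH; first by move=> b bs; apply: sl; rewrite inE bs orbT.
have a1 : cmod a < 1 by apply: sl; rewrite mem_head.
exists ((1 - cmod a) * k); first by rewrite mulr_gt0// subr_gt0.
move=> z z1; rewrite big_cons cmodM; apply: ler_pM.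
- by rewrite subr_ge0 ltW.
- exact: ltW.
- have := cmod_subl 1 (a^* * z); rewrite cmod1 cmodM cmod_conj.
  have : cmod a * cmod z <= cmod a by rewrite ler_piMr ?cmod_ge0// ltW.
  by lra.
- exact: kP.
Qed.

Lemma cont_bp zeta : cmod zeta <= 1 -> {for zeta, continuous (bp l)}.
Proof.
move=> z1; rewrite /bp; elim: l l1 => [|a s IH] sl.
  have -> : (fun z => \prod_(b <- [::]) mob b z) = (fun=> 1) :> (C -> C).
    by apply/funext => z; rewrite big_nil.
  exact: contC_cst.
have -> : (fun z => \prod_(b <- a :: s) mob b z) =
    (fun z => mob a z * \prod_(b <- s) mob b z) :> (C -> C).
  by apply/funext => z; rewrite big_cons.
apply: contC_M; first by apply: hasD_cvg; apply: hasD_mob z1; apply: sl; rewrite mem_head.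
by apply: IH => b bs; apply: sl; rewrite inE bs orbT.
Qed.

Lemma bp_neq0 zeta : cmod zeta = 1 -> bp l zeta != 0.
Proof.
move=> z1; rewrite /bp prodf_seq_neq0; apply/allP => a /l1 a1; apply/implyP => _.
by rewrite mob_eq0 ?z1//; apply: contraTneq a1 => <-; rewrite z1 ltxx.
Qed.

(* On the unit circle [a - z = - z * conj (1 - conj a * z)]. *)
Lemma bp_denp zeta : cmod zeta = 1 -> exists2 x : R, x != 0 &
  bp l zeta * denp l zeta ^+ 2 = (- zeta) ^+ size l * rc x.
Proof.
move=> z1; rewrite /bp /denp; elim: l l1 => [|a s IH] sl.
  by exists 1; rewrite ?oner_neq0// !big_nil expr1n expr0 rc1.
have [|x x0 E] := IH; first by move=> b bs; apply: sl; rewrite inE bs orbT.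
have a1 : cmod a < 1 by apply: sl; rewrite mem_head.
have d0 : 1 - a^* * zeta != 0 by apply: mob_den; rewrite ?z1.
exists (cmod (1 - a^* * zeta) ^+ 2 * x).
  by rewrite mulf_neq0// expf_neq0// cmod_eq0.
rewrite !big_cons exprMn mulrACA E -[size (a :: s)]/(size s).+1 [(- zeta) ^+ _.+1]exprS rcM -mul_conj.
have -> : mob a zeta * (1 - a^* * zeta) ^+ 2 = - zeta * ((1 - a^* * zeta) * (1 - a^* * zeta)^*).
  have E1 : - zeta * (1 - a^* * zeta)^* = a - zeta.
    rewrite rmorphB rmorph1 rmorphM /= conjCK mulrBr mulr1 mulrCA mulNr cmod_unit_conj//.
    by rewrite mulrN1 opprK addrC.
  by rewrite [RHS]mulrCA E1 /mob expr2 mulrA divfK// mulrC.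
by ring.
Qed.

(** The Weierstrass inequality with [one_sub_mob] for each factor. Combined with Schwarz-Pick it
    bounds [F'] once [F] is known to be a finite product. *)
Lemma bp_defect z : cmod z < 1 ->
  1 - cmod (bp l z) ^+ 2 <= (1 - cmod z ^+ 2) * \sum_(a <- l) (1 - cmod a) ^- 2.
Proof.
move=> z1; rewrite /bp cmod_prod -prodrXl.
have := @prod_ge_1B R _ l (mem l) (fun a => cmod (mob a z) ^+ 2).
rewrite -!big_seq => /(_ _)/andP[a al|h _].
  by rewrite sqr_ge0 expr_le1 ?cmod_ge0// mob_le1 ?l1 ?ltW.
rewrite lerBlDr -lerBlDl; apply: le_trans h; rewrite lerD2l lerN2 mulr_sumr.
rewrite big_seq [leRHS]big_seq; apply: ler_sum => a /l1 a1.
rewrite one_sub_mob// ?(ltW z1)//.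
have zz := one_sub_sqr_gt0 z1; have aa : 0 < 1 - cmod a by rewrite subr_gt0.
rewrite [(1 - cmod a ^+ 2) * _]mulrC -mulrA; apply: ler_wpM2l; first exact: ltW.
have d0 := mob_den_gt0 a1 (ltW z1).
rewrite ler_pdivrMr ?exprn_gt0//.
have d1 : 1 - cmod a <= cmod (1 - a^* * z).
  have := cmod_subl 1 (a^* * z); rewrite cmod1 cmodM cmod_conj.
  have : cmod a * cmod z <= cmod a by rewrite ler_piMr ?cmod_ge0// ltW.
  by lra.
have d2 : (1 - cmod a) ^+ 2 <= cmod (1 - a^* * z) ^+ 2.
  by apply: lerXn2r d1; rewrite nnegrE ?cmod_ge0 ?ltW.
apply: (@le_trans _ _ 1); first by rewrite gerBl sqr_ge0.
by rewrite mulrC ler_pdivlMr ?exprn_gt0// mul1r.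
Qed.

End List.

Section Degree.
Variables (c : seq C) (F F' : C -> C).
Hypothesis c1 : forall a, a \in c -> cmod a < 1.
Local Notation P := (fun j => (j < size c)%N).
Hypothesis EF : extremal P (nth 0 c) F F'.
Local Notation n := (size c).

Let Bb : Blaschke_bounded P (nth 0 c) :=
  Blaschke_sequence_bounded (FinSeq_Blaschke_sequence c1).

Let defect0 : defect P (nth 0 c) n = 0.
Proof.
apply/eqP; rewrite eq_le (defect_ge0 Bb) andbT /defect subr_le0.
apply: ge_sup; first by exists 0, 0%N => //; rewrite big_geq.
move=> _ [M _ <-]; have [nM|/ltnW Mn] := leqP n M.
  rewrite (big_cat_nat (leq0n n) nM)/= [X in _ + X]big_nat_cond [X in _ + X]big_pred0 ?addr0//.
  by move=> j; apply/negbTE/negP => /andP[/andP[h _] h']; rewrite ltnNge h in h'.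
rewrite [leRHS](big_cat_nat (leq0n M) Mn)/= lerDl; apply: sumr_ge0 => j jn.
by rewrite subr_ge0 ltW// Bb.1.
Qed.

Let bprodE z : bprod P (nth 0 c) n z = bp c z.
Proof.
rewrite /bprod /bp [RHS](big_nth 0) big_nat_cond; apply/esym.
rewrite big_nat_cond; apply: eq_bigl => j.
by case: (j < n)%N; rewrite ?andbF.
Qed.

(** For a finite critical set the tail of the Blaschke sum is zero, and (1) divided by [|B|] carries
    no error term. *)
Lemma critical_quotient : exists2 H, hol 1 H & forall z, cmod z < 1 -> F' z = bp c z * H z /\
  1 - cmod (F z) ^+ 2 <= (1 - cmod z ^+ 2) * cmod (H z).
Proof.
have [H Hh HE] := quotient_exists Bb EF n; exists H => // z z1.
split; first by rewrite -bprodE HE.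
by have := quotient_lower Bb EF Hh HE z1; rewrite defect0 mulr0 mul0r subr0 mulr1.
Qed.

Let k0 := (1 - cmod (F 0)) / (1 + cmod (F 0)).

Let k00 : 0 < k0.
Proof.
have z0 : cmod (0 : C) < 1 by rewrite cmod0.
by rewrite divr_gt0 ?subr_gt0 ?(ext_lt1 EF)// ltr_wpDr// cmod_ge0.
Qed.

Variable H : C -> C.
Hypothesis Hh : hol 1 H.
Hypothesis HP : forall z, cmod z < 1 -> F' z = bp c z * H z /\
  1 - cmod (F z) ^+ 2 <= (1 - cmod z ^+ 2) * cmod (H z).

Let H_ge z : cmod z < 1 -> k0 <= cmod (H z).
Proof.
move=> z1; apply: le_trans (ext_ratio_lower EF z1) _.
by rewrite ler_pdivrMr ?one_sub_sqr_gt0// mulrC; have [_] := HP z1.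
Qed.

Let H_neq0 z : cmod z < 1 -> H z != 0.
Proof. by move=> z1; rewrite -cmod_gt0; exact: lt_le_trans k00 (H_ge z1). Qed.

(** The angular derivative is also the radial limit of [F'], and [bp c] is continuous and nonzero on
    the circle; so the quotient [H] has a radial limit. *)
Let boundary : {ae mu, forall t, `[0, 2 * pi]%classic t -> exists (omega : C) (d : R),
  [/\ cmod omega = 1, d != 0, radial_limit F (expi t) omega &
    radial_limit H (expi t) (omega * (expi t)^* / rc d / bp c (expi t))]}.
Proof.
apply: (@filterS _ _ (ae_filter_ringOfSetsType mu) _ _ _ (ae_angular_limit Bb EF)) => t E Dt.
have [omega [d [w1 d0 J]]] := E Dt; exists omega, d.
have t1 : cmod (expi t : C) = 1 := cmod_expi t.
split => //; first by rewrite gt_eqF.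
  exact: angular_radial_limit t1 J.
have FL := angular_radial_derivative (fun w h => ext_hasD EF h) t1 J.
apply: (@radial_quotient F' (bp c) H _ _ _ t1 _ (bp_neq0 c1 t1) FL); first by move=> z /HP[].
by apply: radial_continuous; apply: cont_bp; rewrite ?t1.
Qed.

(* At a boundary point where [F] has angular derivative [d > 0], [W zeta * conj zeta ^ (n+1)]
   is real, so [W] is a polynomial whose roots include the zeros of [F]. *)
Let W z := F z * denp c z ^+ 2 / H z.

Let W_hol : hol 1 W.
Proof.
have h : hol 1 (denp c) := @hol_denp c 1.
exact: (@hol_div R 1 _ H (hol_mul (ext_hol EF) (hol_exp 2 h)) Hh (@H_neq0)).
Qed.

Let W_bound z : cmod z < 1 -> cmod (W z) <= (2 ^+ n) ^+ 2 / k0.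
Proof.
move=> z1; rewrite /W cmod_div cmodM cmodX.
have h1 : cmod (F z) * cmod (denp c z) ^+ 2 <= (2 ^+ n) ^+ 2.
  rewrite -[leRHS]mul1r; apply: ler_pM; rewrite ?cmod_ge0 ?sqr_ge0//.
    by rewrite ltW// (ext_lt1 EF).
  by apply: lerXn2r (denp_le c1 z1); rewrite nnegrE ?cmod_ge0 ?exprn_ge0.
apply: ler_pM => //; first by rewrite mulr_ge0 ?sqr_ge0 ?cmod_ge0.
  by rewrite invr_ge0 cmod_ge0.
by rewrite lef_pV2 ?posrE ?cmod_gt0 ?H_neq0 ?H_ge.
Qed.

Let W_boundary : {ae mu, forall t, `[0, 2 * pi]%classic t -> exists2 x,
     radial_limit W (expi t) x & Im (x * (expi t)^* ^+ n.+1) = 0}.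
Proof.
apply: (@filterS _ _ (ae_filter_ringOfSetsType mu) _ _ _ boundary) => t E Dt.
have [omega [d [w1 d0 Fl Hl]]] := E Dt; set zeta := expi t in Fl Hl *.
have t1 : cmod zeta = 1 := cmod_expi t.
have zz := cmod_unit_conj t1.
have z0 : zeta^* != 0 by rewrite conjC_eq0 -cmod_eq0 t1 oner_neq0.
have om0 : omega != 0 by rewrite -cmod_eq0 w1 oner_neq0.
have dd : rc d != 0 by rewrite rc_eq0.
have b0 := bp_neq0 c1 t1.
have Hl0 : omega * zeta^* / rc d / bp c zeta != 0.
  by rewrite !mulf_neq0 ?invr_eq0.
have ql : radial_limit (denp c) zeta (denp c zeta).
  by apply: radial_continuous; apply: hol_cont (@hol_denp c 2) _; rewrite t1 ltr1n.
have Wl := radial_mul (radial_mul Fl (radial_mul ql ql)) (radial_inv Hl0 Hl).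
exists (omega * (denp c zeta * denp c zeta) / (omega * zeta^* / rc d / bp c zeta)) => //.
have [x x0 bE] := bp_denp c1 t1.
have -> : omega * (denp c zeta * denp c zeta) / (omega * zeta^* / rc d / bp c zeta) *
    zeta^* ^+ n.+1 = (bp c zeta * denp c zeta ^+ 2) * rc d * zeta^* ^+ n.
  by rewrite exprS; field; rewrite om0 z0 dd b0.
rewrite bE exprNn -!mulrA [zeta ^+ n * _]mulrC -!mulrA [_ * zeta ^+ n]mulrC -exprMn zz expr1n mulr1.
by rewrite -rcM; case: (n) => [|k]; rewrite -signr_odd; case: odd;
  rewrite ?expr0 ?expr1 ?mul1r ?mulN1r ?cImN ?Im_rc ?oppr0.
Qed.

(** [W] is a nonzero polynomial that vanishes at every [a j]. Its finitely many roots in the disk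
    stay at a distance [d > 0] from the circle, so the Blaschke sum would exceed [N * d] for all
    [N]. *)
Lemma not_infinite_form : ~ infinite_form F.
Proof.
move=> [a [eta [e1 [a1 [S SP]] Fa FE]]].
have WT := real_boundary_taylor W_hol W_bound W_boundary.
pose p : {poly C} := \poly_(k < (2 * n.+1).+1) coef W (1 / 2) k.
have Wp z : cmod z < 1 -> W z = p.[z].
  by move=> z1; rewrite WT// horner_poly big_mkord.
have aa j : cmod (a j) < 1 by exact: a1.
have pa j : root p (a j).
  by rewrite /root -Wp// /W Fa !mul0r.
have p0 : p != 0.
  apply/eqP => p0; have F0 z : cmod z < 1 -> F z = 0.
    move=> z1; have := Wp z z1; rewrite p0 horner0 /W => /eqP.
    rewrite !mulf_eq0 invr_eq0 (negPf (H_neq0 z1)) orbF orbb.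
    by rewrite (negPf (denp_neq0 c1 (ltW z1))) orbF => /eqP.
  have z0 : cmod (0 : C) < 1 by rewrite cmod0.
  have [z z1 bz] := beta_gt0_exists Bb.
  have F'z : F' z = 0.
    apply: hasD_uniq (ext_hasD EF z1) _.
    apply: (@hasD_near _ (fun=> 0) _ _ _ (1 - cmod z)); first by rewrite subr_gt0.
      move=> w wz; rewrite F0//; have := cmodD (w - z) z; rewrite subrK; lra.
    exact: hasD_cst.
  have := ext_lower EF z1; rewrite F'z cmod0 mulr0 F0// cmod0 expr0n subr0 mulr1.
  by rewrite leNgt bz.
have [rs pE] := closed_field_poly_normal p.
have ars j : a j \in rs.
  by have := pa j; rewrite pE rootZ ?lead_coef_eq0// root_prod_XsubC.
have [d d0 dP] : exists2 d : R, 0 < d & forall b, b \in rs -> cmod b < 1 -> d <= 1 - cmod b.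
  clear pE ars; elim: rs => [|b s [d d0 dP]]; first by exists 1.
  have [b1|b1] := ltP (cmod b) 1.
    exists (Num.min d (1 - cmod b)); first by rewrite lt_min d0 subr_gt0.
    move=> x; rewrite inE => /orP[/eqP -> _|xs x1]; first by rewrite ge_min lexx orbT.
    by rewrite ge_min dP.
  exists d => // x; rewrite inE => /orP[/eqP -> h|xs x1]; last exact: dP.
  by rewrite ltNge b1 in h.
have [N hN] : exists N : nat, S / d < N%:R.
  by exists (Num.truncn (S / d)).+1; exact: truncnS_gt.
have := SP N; apply/negP; rewrite -ltNge; rewrite ltr_pdivrMr// in hN.
apply: lt_le_trans hN _; elim: N => [|N IH]; first by rewrite big_geq// mul0r.
by rewrite big_nat_recr//= -natr1 mulrDl mul1r lerD// dP.
Qed.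

Variables (l : seq C) (eta : C).
Hypothesis eta1 : cmod eta = 1.
Hypothesis l1 : forall a, a \in l -> cmod a < 1.
Hypothesis FE : forall z, cmod z < 1 -> F z = eta * bp l z.

(** Near the circle [|bp c| >= 1/2] and [F'] is bounded, hence so is [H]; the maximum principle
    covers the rest of the disk. *)
Let H_bounded : exists M, forall z, cmod z < 1 -> cmod (H z) <= M.
Proof.
pose A := \sum_(a <- l) (1 - cmod a) ^- 2; pose B := \sum_(a <- c) 4 / (1 - cmod a).
have B0 : 0 <= B.
  rewrite /B big_seq; apply: sumr_ge0 => a /c1 a1.
  by rewrite divr_ge0// subr_ge0 ltW.
have A0 : 0 <= A.
  rewrite /A big_seq; apply: sumr_ge0 => a /l1 a1.
  by rewrite invr_ge0 sqr_ge0.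
have F'A z : cmod z < 1 -> cmod (F' z) <= A.
  move=> z1; rewrite -(ler_pM2l (one_sub_sqr_gt0 z1)).
  apply: le_trans (ext_upper EF z1) _; rewrite FE// cmodM eta1 mul1r.
  exact: bp_defect.
have bB z : cmod z < 1 -> 1 - (1 - cmod z) * B <= cmod (bp c z).
  move=> z1; rewrite /bp cmod_prod.
  have := @prod_ge_1B R _ c (mem c) (fun a => cmod (mob a z)).
  rewrite -!big_seq => /(_ _)/andP[a ac|h _].
    by rewrite cmod_ge0 mob_le1 ?c1 ?ltW.
  apply: le_trans h; rewrite lerD2l lerN2 /B mulr_sumr.
  rewrite big_seq [leRHS]big_seq; apply: ler_sum => a /c1 a1.
  have -> : cmod (mob a z) = cmod (mob z a).
    rewrite /mob !cmod_div cmodB; congr (_ / _).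
    by rewrite -(cmod_conj (1 - z^* * a)) rmorphB rmorph1 rmorphM /= conjCK mulrC.
  by apply: le_trans (mob_defect z1 a1) _; rewrite mulrA [_ * 4]mulrC.
pose r0 := 1 - (2 * B + 2)^-1.
have B2 : 0 < 2 * B + 2 by lra.
have r01 : r0 < 1 by rewrite gtrBl invr_gt0.
have r00 : 0 <= r0 by rewrite subr_ge0 invf_le1//; lra.
have big z : r0 <= cmod z -> cmod z < 1 -> cmod (H z) <= 2 * A.
  move=> rz z1; have h1 : (1 - cmod z) * B <= 1 / 2.
    have h : 1 - cmod z <= (2 * B + 2)^-1 by move: rz; rewrite /r0; lra.
    apply: le_trans (ler_wpM2r B0 h) _.
    by rewrite mulrC ler_pdivrMr//; lra.
  have h2 : 1 / 2 <= cmod (bp c z) by have := bB z z1; lra.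
  have [E _] := HP z1; have := F'A z z1; rewrite E cmodM => h3.
  have := ler_wpM2r (cmod_ge0 (H z)) h2; lra.
exists (2 * A) => z z1; have [rz|rz] := leP r0 (cmod z); first exact: big.
have [s s1 s2] := between r01.
apply: (max_principle Hh s2 (lt_trans rz s1)); first by rewrite mulr_ge0.
by move=> w ws; apply: big; rewrite ws ?ltW.
Qed.

(* On the boundary [K zeta] is a real multiple of [zeta ^ (size l - n - 1)]; since [K]
   and [1 / K] are bounded and zero-free, the exponent can be neither positive nor
   negative. *)
Let K z := denp l z ^+ 2 * H z / (eta * denp c z ^+ 2).

Let eta0 : eta != 0.
Proof. by rewrite -cmod_eq0 eta1 oner_neq0. Qed.

Let K_den z : cmod z < 1 -> eta * denp c z ^+ 2 != 0.
Proof. by move=> z1; rewrite mulf_neq0 ?eta0// expf_neq0// denp_neq0// ltW. Qed.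

Let K_neq0 z : cmod z < 1 -> K z != 0.
Proof.
move=> z1; have d0 := denp_neq0 l1 (ltW z1).
by rewrite !mulf_neq0 ?invr_eq0 ?H_neq0 ?K_den// expf_neq0.
Qed.

Let K_hol : hol 1 K.
Proof.
have hc : hol 1 (denp c) := @hol_denp c 1; have hl : hol 1 (denp l) := @hol_denp l 1.
exact: (@hol_div R 1 _ _ (hol_mul (hol_exp 2 hl) Hh)
  (hol_mul (hol_cst eta) (hol_exp 2 hc)) (@K_den)).
Qed.

Let K_boundary : {ae mu, forall t, `[0, 2 * pi]%classic t -> exists x : R,
  x != 0 /\ radial_limit K (expi t) (expi t ^+ size l * (expi t)^* ^+ n.+1 * rc x)}.
Proof.
apply: (@filterS _ _ (ae_filter_ringOfSetsType mu) _ _ _ boundary) => t E Dt.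
have [omega [d [w1 d0 Fl Hl]]] := E Dt; set zeta := expi t in Fl Hl *.
have t1 : cmod zeta = 1 := cmod_expi t.
have zz := cmod_unit_conj t1.
have z0 : zeta != 0 by rewrite -cmod_eq0 t1 oner_neq0.
have dd : rc d != 0 by rewrite rc_eq0.
have b0 := bp_neq0 c1 t1.
have dl s : radial_limit (denp s) zeta (denp s zeta).
  by apply: radial_continuous; apply: hol_cont (@hol_denp s 2) _; rewrite t1 ltr1n.
have oE : omega = eta * bp l zeta.
  apply: radial_uniq Fl _.
  apply: (@radial_eq (fun z : C => eta * bp l z) F _ _ t1); first by move=> z /FE.
  apply: radial_continuous; apply: contC_M; first exact: contC_cst.
  by apply: cont_bp; rewrite ?t1.
have q0 : denp c zeta != 0 by apply: denp_neq0; rewrite ?t1.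
have D0 : eta * (denp c zeta * denp c zeta) != 0 by rewrite !mulf_neq0 ?eta0.
have el : radial_limit (fun=> eta) zeta eta.
  exact: radial_continuous (@contC_cst R eta zeta).
have Kl := radial_mul (radial_mul (radial_mul (dl l) (dl l)) Hl)
  (radial_inv D0 (radial_mul el (radial_mul (dl c) (dl c)))).
have [x x0 xE] := bp_denp l1 t1; have [y y0 yE] := bp_denp c1 t1.
exists ((-1) ^+ size l * (-1) ^+ n * x / (d * y)).
split; first by rewrite !mulf_neq0 ?invr_eq0 ?signr_eq0 ?mulf_neq0.
have LE : denp l zeta * denp l zeta * (omega * zeta^* / rc d / bp c zeta) /
    (eta * (denp c zeta * denp c zeta)) =
    zeta ^+ size l * zeta^* ^+ n.+1 * rc ((-1) ^+ size l * (-1) ^+ n * x / (d * y)).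
  transitivity ((bp l zeta * denp l zeta ^+ 2) * zeta^* / rc d /
     (bp c zeta * denp c zeta ^+ 2)).
    by rewrite oE; field; rewrite eta0 q0 b0 dd.
  have yy : rc y != 0 by rewrite rc_eq0.
  have cz : zeta^* = zeta^-1 by apply: (mulfI z0); rewrite zz divff.
  rewrite xE yE cz !(exprNn zeta) !rcM rcV rcM !rcX rcN rc1 exprVn exprS.
  have s0 : (-1) ^+ n != 0 :> C by rewrite signr_eq0.
  have s2 : ((-1) ^+ n)^-1 = (-1) ^+ n :> C by rewrite -exprVn invrN1.
  have zn : zeta ^+ n != 0 by rewrite expf_neq0.
  rewrite !invfM s2; field; rewrite z0 zn dd yy//.
by rewrite -LE; apply: (@radial_eq _ K _ _ t1 _ Kl) => z z1; rewrite /K !expr2.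
Qed.

(** If the exponent [size l - n - 1] is a positive [q], then [z^q / K], and if it is [- q < 0], then
    [z^q * K], is bounded, has real boundary values and vanishes at the origin. It is then
    identically zero, although [K] has no zero. In both cases [q] is written [p.+1]. *)
Lemma finite_form_degree : size l = n.+1.
Proof.
have h1 : cmod (rc (1 / 2)) < 1 by rewrite cmod_rc_ge0 ?divr_ge0//; lra.
have h0 : rc (1 / 2) != 0 by rewrite rc_eq0 gt_eqF// divr_gt0.
have [M HM] := H_bounded.
have [kl kl0 klP] := denp_ge l1; have [kc kc0 kcP] := denp_ge c1.
have [|pos] := ltnP n.+1 (size l).
  move=> /subnKC; set p := (size l - n.+2)%N => pE.
  pose g z := z ^+ p.+1 / K z.
  have gh : hol 1 g := hol_div (hol_exp p.+1 (@hol_id R 1)) K_hol (@K_neq0).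
  have gM z : cmod z < 1 -> cmod (g z) <= (2 ^+ n) ^+ 2 / (kl ^+ 2 * k0).
    move=> z1; rewrite /g /K !cmod_div !(cmodX, cmodM) eta1 mul1r invf_div.
    have g1 : cmod z ^+ p.+1 <= 1 by rewrite expr_le1 ?cmod_ge0// ltW.
    rewrite -[leRHS]mul1r; apply: ler_pM => //; first by rewrite exprn_ge0 ?cmod_ge0.
      by rewrite divr_ge0 ?mulr_ge0 ?sqr_ge0 ?cmod_ge0.
    have a1 : cmod (denp c z) ^+ 2 <= (2 ^+ n) ^+ 2.
      by apply: lerXn2r (denp_le c1 z1); rewrite nnegrE ?cmod_ge0 ?exprn_ge0.
    have a2 : kl ^+ 2 * k0 <= cmod (denp l z) ^+ 2 * cmod (H z).
      apply: ler_pM; rewrite ?sqr_ge0 ?(ltW k00) ?H_ge//.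
      by apply: lerXn2r (klP z z1); rewrite nnegrE ?cmod_ge0 ?ltW.
    have a3 : 0 < kl ^+ 2 * k0 by rewrite mulr_gt0 ?exprn_gt0.
    apply: ler_pM => //; first by rewrite sqr_ge0.
      by rewrite invr_ge0 mulr_ge0 ?sqr_ge0 ?cmod_ge0.
    by rewrite lef_pV2 ?posrE//; exact: lt_le_trans a2.
  have gae : {ae mu, forall t, `[0, 2 * pi]%classic t -> exists2 x,
     radial_limit g (expi t) x & Im x = 0}.
    apply: (@filterS _ _ (ae_filter_ringOfSetsType mu) _ _ _ K_boundary) => t E Dt.
    have [x [x0 Kl]] := E Dt; set zeta := expi t in Kl *.
    have t1 : cmod zeta = 1 := cmod_expi t.
    have zz := cmod_unit_conj t1.
    have z0 : zeta != 0 by rewrite -cmod_eq0 t1 oner_neq0.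
    have cz : zeta^* = zeta^-1 by apply: (mulfI z0); rewrite zz divff.
    have xx : rc x != 0 by rewrite rc_eq0.
    have L0 : zeta ^+ size l * zeta^* ^+ n.+1 * rc x != 0.
      by rewrite !mulf_neq0 ?expf_neq0// conjC_eq0.
    have zl : radial_limit (fun z => z ^+ p.+1) zeta (zeta ^+ p.+1).
      by apply: radial_continuous; apply: hol_cont (hol_exp p.+1 (@hol_id R 2)) _; rewrite t1 ltr1n.
    exists (rc x^-1) => //; have := radial_mul zl (radial_inv L0 Kl).
    suff -> : zeta ^+ p.+1 / (zeta ^+ size l * zeta^* ^+ n.+1 * rc x) = rc x^-1 by [].
    rewrite -pE addSnnS exprD cz exprVn rcV.
    have zn : zeta ^+ n.+1 != 0 by rewrite expf_neq0.
    have zp : zeta ^+ p.+1 != 0 by rewrite expf_neq0.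
    by field; rewrite zn zp xx.
  have g0 : g 0 = 0 by rewrite /g expr0n mul0r.
  have /eqP := real_boundary_eq0 gh gM gae g0 h1.
  by rewrite mulf_eq0 invr_eq0 (negPf (K_neq0 h1)) expf_eq0 (negPf h0) andbF.
move: pos; rewrite leq_eqVlt => /orP[/eqP //|].
move=> /subnKC; set p := (n.+1 - (size l).+1)%N => pE.
pose g z := z ^+ p.+1 * K z.
have gh : hol 1 g := hol_mul (hol_exp p.+1 (@hol_id R 1)) K_hol.
have gM z : cmod z < 1 -> cmod (g z) <= (2 ^+ size l) ^+ 2 * M / kc ^+ 2.
  move=> z1; rewrite /g /K cmodM cmod_div !(cmodX, cmodM) eta1 mul1r.
  have g1 : cmod z ^+ p.+1 <= 1 by rewrite expr_le1 ?cmod_ge0// ltW.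
  rewrite -[leRHS]mul1r; apply: ler_pM => //; first by rewrite exprn_ge0 ?cmod_ge0.
    by rewrite divr_ge0 ?mulr_ge0 ?sqr_ge0 ?cmod_ge0.
  have a1 : cmod (denp l z) ^+ 2 * cmod (H z) <= (2 ^+ size l) ^+ 2 * M.
    apply: ler_pM; rewrite ?sqr_ge0 ?cmod_ge0 ?HM//.
    by apply: lerXn2r (denp_le l1 z1); rewrite nnegrE ?cmod_ge0 ?exprn_ge0.
  have a2 : kc ^+ 2 <= cmod (denp c z) ^+ 2.
    by apply: lerXn2r (kcP z z1); rewrite nnegrE ?cmod_ge0 ?ltW.
  have a3 : 0 < kc ^+ 2 by rewrite exprn_gt0.
  apply: ler_pM => //; first by rewrite mulr_ge0 ?sqr_ge0 ?cmod_ge0.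
    by rewrite invr_ge0 sqr_ge0.
  by rewrite lef_pV2 ?posrE//; exact: lt_le_trans a2.
have gae : {ae mu, forall t, `[0, 2 * pi]%classic t -> exists2 x,
   radial_limit g (expi t) x & Im x = 0}.
  apply: (@filterS _ _ (ae_filter_ringOfSetsType mu) _ _ _ K_boundary) => t E Dt.
  have [x [x0 Kl]] := E Dt; set zeta := expi t in Kl *.
  have t1 : cmod zeta = 1 := cmod_expi t.
  have zz := cmod_unit_conj t1.
  have zl : radial_limit (fun z => z ^+ p.+1) zeta (zeta ^+ p.+1).
    by apply: radial_continuous; apply: hol_cont (hol_exp p.+1 (@hol_id R 2)) _; rewrite t1 ltr1n.
  exists (rc x) => //; have := radial_mul zl Kl.
  suff -> : zeta ^+ p.+1 * (zeta ^+ size l * zeta^* ^+ n.+1 * rc x) = rc x by [].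
  rewrite -pE addSnnS !mulrA -exprD [(p.+1 + _)%N]addnC -exprMn zz expr1n mul1r.
  by [].
have g0 : g 0 = 0 by rewrite /g expr0n mul0r.
have /eqP := real_boundary_eq0 gh gM gae g0 h1.
by rewrite mulf_eq0 (negPf (K_neq0 h1)) expf_eq0 (negPf h0) andbF.
Qed.

End Degree.

Theorem extremal_finite_Blaschke (c : seq C) (F F' : C -> C) :
  (forall a, a \in c -> cmod a < 1) ->
  extremal (fun j => (j < size c)%N) (nth 0 c) F F' ->
  finite_Blaschke_product (size c).+1 F.
Proof.
move=> c1 EF; have Bb := Blaschke_sequence_bounded (FinSeq_Blaschke_sequence c1).
have [H Hh HP] := critical_quotient c1 EF.
have FD z : cmod z < 1 -> hasD F z (F' z) by move=> h; exact (ext_hasD EF h).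
have [|] := dominated_recognition Bb (fun z => @ext_lt1 _ _ _ _ _ EF z) FD
    (fun z => @ext_lower _ _ _ _ _ EF z); last first.
  by move=> /(not_infinite_form c1 EF Hh HP).
move=> [l [eta [e1 l1 FE]]].
have sl := finite_form_degree c1 EF Hh HP e1 l1 FE.
exact: (finite_form_Blaschke sl e1 l1 FE).
Qed.

End FiniteCriticalSet.

Theorem theorem4p3 (R : realType) :
  (forall (n : nat) (c : n.-tuple (cplx R)) (F : cplx R -> cplx R),
     (forall i, unit_disk (tnth c i)) ->
     maximal_function (FinSeq c) F ->
     finite_Blaschke_product n.+1 F)
  /\
  (forall (s : point_seq R) (F : cplx R -> cplx R),
     Blaschke_sequence s ->
     maximal_function s F ->
     indestructible_Blaschke_product F /\
     ae_unit_circle (finite_angular_derivative F)).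
Proof.
split=> [n c F c1 mF|s F sB mF].
  have cc a : a \in (c : seq (cplx R)) -> cmod a < 1 by move=> /tnthP[i ->]; exact: c1.
  have EF := maximal_extremal (FinSeq_Blaschke_sequence cc) mF.
  have := extremal_finite_Blaschke cc EF.
  by rewrite size_tuple.
have EF := maximal_extremal sB mF; have Bb := Blaschke_sequence_bounded sB.
split; last exact: ae_finite_angular_derivative Bb EF.
apply: (dominated_indestructible Bb (fun z => @ext_lt1 _ _ _ _ _ EF z) _
  (fun z => @ext_lower _ _ _ _ _ EF z)).
by move=> z h; exact (ext_hasD EF h).
Qed.
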